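(* In the setting of the context (Neimark--Sacker bifurcation of an autonomous system, with $\omega^\star\notin\{\frac13,\frac14\}$, and with normal form coefficients and the $M=3$ Fourier $\phi$-mode approximation as defined there), as $\varepsilon\to0$, $$\beta_R(\lambda^\star)=-\dot\alpha_R(\lambda^\star)\frac{\lambda^F(\varepsilon)-\lambda^\star}{\varepsilon^2}+O(\varepsilon^2),$$ $$\beta_I(\lambda^\star)=\frac{\omega^F(\varepsilon)-\omega^\star}{\varepsilon^2}-\dot\alpha_I(\lambda^\star)\frac{\lambda^F(\varepsilon)-\lambda^\star}{\varepsilon^2}+O(\varepsilon^2),$$ $$\kappa(\lambda^\star)=\frac{\eta^F(\varepsilon)}{\varepsilon}+O(\varepsilon^2),$$ together with, for $m=0,2$, $$\widehat{\boldsymbol a}_m(\theta,\lambda^\star)=\tfrac1\varepsilon\widehat{\boldsymbol a}_m^F(\theta,\varepsilon)+O(\varepsilon^2),\quad\widetilde{\boldsymbol a}_m(\theta,\lambda^\star)=\tfrac1\varepsilon\widetilde{\boldsymbol a}_m^F(\theta,\varepsilon)+O(\varepsilon^2),\quad\mathring a_m(\theta,\lambda^\star)=\tfrac1\varepsilon\mathring a_m^F(\theta,\varepsilon)+O(\varepsilon^2),$$ for $m=2$, $$\widehat{\boldsymbol b}_m(\theta,\lambda^\star)=\tfrac1\varepsilon\widehat{\boldsymbol b}_m^F(\theta,\varepsilon)+O(\varepsilon^2),\quad\widetilde{\boldsymbol b}_m(\theta,\lambda^\star)=\tfrac1\varepsilon\widetilde{\boldsymbol b}_m^F(\theta,\varepsilon)+O(\varepsilon^2),\quad\mathring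 b_m(\theta,\lambda^\star)=\tfrac1\varepsilon\mathring b_m^F(\theta,\varepsilon)+O(\varepsilon^2),$$ and for $m=1,3$, $$\widehat{\boldsymbol a}_m(\theta,\lambda^\star)=\tfrac1{\varepsilon^2}\widehat{\boldsymbol a}_m^F(\theta,\varepsilon)+O(\varepsilon^2),\quad\widehat{\boldsymbol b}_m(\theta,\lambda^\star)=\tfrac1{\varepsilon^2}\widehat{\boldsymbol b}_m^F(\theta,\varepsilon)+O(\varepsilon^2).$$
   Context: Setting (autonomous Neimark--Sacker bifurcation). $\mathbb S^1=\mathbb R/2\pi\mathbb Z$; $\boldsymbol F:\mathbb R^n\times\mathbb R\to\mathbb R^n$ is smooth; the system is $\frac{d\boldsymbol x}{dt}=\boldsymbol F(\boldsymbol x,\lambda)$; $\mathsf J(\boldsymbol x,\lambda)$ is the Jacobian matrix of $\boldsymbol F$ with respect to $\boldsymbol x$. Assume: (1) At $\lambda=\lambda^\star$ the system has a periodic orbit of period $2\pi T^\star$; rescaled to $\boldsymbol v^\star:\mathbb S^1\to\mathbb R^n$ it satisfies $T^\star\boldsymbol F(\boldsymbol v^\star(\theta),\lambda^\star)-\frac{d}{d\theta}\boldsymbol v^\star(\theta)=\boldsymbol 0$. (2) There are $\mathsf E^\star\in\mathbb R^{n\times n}$ and $\mathsf P^\star:\mathbb S^1\to\mathbb R^{n\times n}$ with $\mathsf P^\star(\theta)$ non-singular for all $\theta$ (so all Floquet vectors are taken $2\pi$-periodic) such that $T^\star\mathsf J(\boldsymbol v^\star(\theta),\lambda^\star)\mathsf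 P^\star(\theta)-\dot{\mathsf P}^\star(\theta)=\mathsf P^\star(\theta)\mathsf E^\star$, $\mathsf E^\star=\mathrm{diag}(\widehat{\mathsf E}^\star,\widetilde{\mathsf E}^\star,0)$, $\widehat{\mathsf E}^\star=\begin{pmatrix}0&-\omega^\star\\ \omega^\star&0\end{pmatrix}$, $\omega^\star>0$, and $\widetilde{\mathsf E}^\star\in\mathbb R^{(n-3)\times(n-3)}$ with no eigenvalues on the imaginary axis. The imaginary parts of the eigenvalues of $\mathsf E^\star$ (Floquet exponents) are taken in $(-\frac12,\frac12)$, so that $0<\omega^\star<\frac12$. Consequently, for $\lambda$ near $\lambda^\star$ there are smooth continuations $T^\star(\lambda)$, $\boldsymbol v^\star(\theta;\lambda)$, $\mathsf P(\theta;\lambda)$ (non-singular, $2\pi$-periodic in $\theta$), $\mathsf E(\lambda)$ with $T^\star(\lambda)\boldsymbol F(\boldsymbol v^\star(\theta;\lambda),\lambda)=\frac{d}{d\theta}\boldsymbol v^\star(\theta;\lambda)$, $T^\star(\lambda)\mathsf J(\boldsymbol v^\star(\theta;\lambda),\lambda)\mathsf P(\theta;\lambda)-\dot{\mathsf P}(\theta;\lambda)=\mathsf P(\theta;\lambda)\mathsf E(\lambda)$ (here $\dot{\mathsf P}=\partial\mathsf P/\partial\theta$), $\mathsf E(\lambda)=\mathrm{diag}(\widehat{\mathsf E}(\lambda),\widetilde{\mathsf E}(\lambda),0)$, $\widehat{\mathsf E}(\lambda)=\begin{pmatrix}\alpha_R(\lambda)&-\alpha_I(\lambda)\\ \alpha_I(\lambda)&\alpha_R(\lambda)\end{pmatrix}$.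 The last column of $\mathsf P(\theta;\lambda)$ is $\frac{d}{d\theta}\boldsymbol v^\star(\theta;\lambda)$. (3) Transversality: $\dot\alpha_R(\lambda^\star)\ne0$ (dot on $\alpha_R,\alpha_I$ denotes $d/d\lambda$). (4) No strong resonance: $\omega^\star\notin\{\frac13,\frac14\}$. Notation. $\boldsymbol a^\star(\phi)=(\cos\phi,\sin\phi,0,\dots,0)^T$, $\dot{\boldsymbol a}^\star(\phi)=(-\sin\phi,\cos\phi,0,\dots,0)^T\in\mathbb R^n$; $\boldsymbol e_n$ is the $n$-th unit vector of $\mathbb R^n$; $\widehat{\boldsymbol e}_1=(1,0)^T$, $\widehat{\boldsymbol e}_2=(0,1)^T$. $\langle w_1,w_2\rangle=\frac1{2\pi}\int_0^{2\pi}w_1(\theta)\cdot w_2(\theta)\,d\theta$; $\langle\langle w_1,w_2\rangle\rangle=\frac1{(2\pi)^2}\int_0^{2\pi}\int_0^{2\pi}w_1\cdot w_2\,d\theta\,d\phi$. For $\boldsymbol z:\mathbb S^1\times\mathbb S^1\to\mathbb R^n$, a function of $(\theta,\phi)$, $\boldsymbol\gamma_1(\boldsymbol z)=(\langle\langle\boldsymbol z,\boldsymbol a^\star(\phi)\rangle\rangle,\langle\langle\boldsymbol z,\dot{\boldsymbol a}^\star(\phi)\rangle\rangle)^T$, $\gamma_2(\boldsymbol z)=\langle\langle\boldsymbol z,\boldsymbol e_n\rangle\rangle$ (so $\boldsymbol\gamma_1$ depends only on the first two components of $\boldsymbol z$ and $\gamma_2$ only on the last), and for $\lambda,\eta\in\mathbb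 R$ $$\boldsymbol G(\boldsymbol z,\lambda,\eta,\theta;\varepsilon)=\tfrac1\varepsilon\mathsf P(\theta;\lambda)^{-1}\Big\{T^\star(\lambda)\boldsymbol F\big(\boldsymbol v^\star(\theta;\lambda)+\varepsilon\mathsf P(\theta;\lambda)\boldsymbol z,\lambda\big)-T^\star(\lambda)\boldsymbol F\big(\boldsymbol v^\star(\theta;\lambda),\lambda\big)-\varepsilon[1+\varepsilon\eta]\dot{\mathsf P}(\theta;\lambda)\boldsymbol z\Big\},$$ with expansion $\boldsymbol G=\mathsf E(\lambda)\boldsymbol z+\varepsilon\eta\boldsymbol G_1(\boldsymbol z;\lambda,\theta)+\sum_{p\ge2}\varepsilon^{p-1}\boldsymbol G_p(\boldsymbol z;\lambda,\theta)$, the components of $\boldsymbol G_p$ being homogeneous polynomials of degree $p$ in the components of $\boldsymbol z$ with coefficients depending on $\lambda$ and $\theta$. Write $\boldsymbol z=(\widehat{\boldsymbol z},\widetilde{\boldsymbol z},\mathring z)\in\mathbb R^2\times\mathbb R^{n-3}\times\mathbb R$ and correspondingly $\boldsymbol G=(\widehat{\boldsymbol G},\widetilde{\boldsymbol G},\mathring G)$. $M=3$ Fourier $\phi$-mode approximation. $\mathsf S_{\infty,3}$ truncates double Fourier series to $\phi$-modes $0,\dots,3$ (all $\theta$-modes kept). For $|\varepsilon|$ sufficiently small, $\lambda^F(\varepsilon),\omega^F(\varepsilon),\eta^F(\varepsilon)$ and $\boldsymbol z^F(\theta,\phi;\varepsilon)=\boldsymbol a^\star(\phi)+\boldsymbol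 a_0^F(\theta,\varepsilon)+\sum_{m=1}^3\{\boldsymbol a_m^F(\theta,\varepsilon)\cos m\phi+\boldsymbol b_m^F(\theta,\varepsilon)\sin m\phi\}$ is the locally unique solution near $(\lambda^\star,\omega^\star,0,\boldsymbol a^\star)$, with $\boldsymbol z_3$ having only $\phi$-modes $0,\dots,3$, of $\mathsf S_{\infty,3}\boldsymbol G(\boldsymbol z_3,\lambda,\eta,\theta;\varepsilon)-\eta\boldsymbol e_n-[(1+\varepsilon\eta)\partial_\theta+\omega\partial_\phi]\boldsymbol z_3=\boldsymbol 0$, $\boldsymbol\gamma_1(\boldsymbol z_3)=\widehat{\boldsymbol e}_1$, $\gamma_2(\boldsymbol z_3)=0$. Write $\boldsymbol a_m^F=(\widehat{\boldsymbol a}_m^F,\widetilde{\boldsymbol a}_m^F,\mathring a_m^F)$, $\boldsymbol b_m^F=(\widehat{\boldsymbol b}_m^F,\widetilde{\boldsymbol b}_m^F,\mathring b_m^F)$ for the splitting in $\mathbb R^2\times\mathbb R^{n-3}\times\mathbb R$. Normal form. Consider near-identity transformations $(\widehat{\boldsymbol y},\widetilde{\boldsymbol y},\mathring y)\mapsto(\widehat{\boldsymbol z},\widetilde{\boldsymbol z},\mathring z)$, with $\widehat{\boldsymbol y}=(\hat y_1,\hat y_2)$ and all coefficients $\widehat{\boldsymbol a}_m,\widehat{\boldsymbol b}_m,\widetilde{\boldsymbol a}_m,\widetilde{\boldsymbol b}_m,\mathring a_m,\mathring b_m$ depending on $(\theta,\lambda)\in\mathbb S^1\times\mathbb R$, $$\widehat{\boldsymbol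 z}=\widehat{\boldsymbol y}+\tfrac1\varepsilon\widehat{\boldsymbol h}(\varepsilon\widehat{\boldsymbol y};\theta,\lambda)=\widehat{\boldsymbol y}+\varepsilon\{[\hat y_1^2+\hat y_2^2]\widehat{\boldsymbol a}_0+[\hat y_1^2-\hat y_2^2]\widehat{\boldsymbol a}_2+2\hat y_1\hat y_2\widehat{\boldsymbol b}_2\}$$ $$+\varepsilon^2\{\hat y_1[\hat y_1^2+\hat y_2^2]\widehat{\boldsymbol a}_1+\hat y_2[\hat y_1^2+\hat y_2^2]\widehat{\boldsymbol b}_1+\hat y_1[\hat y_1^2-3\hat y_2^2]\widehat{\boldsymbol a}_3+\hat y_2[3\hat y_1^2-\hat y_2^2]\widehat{\boldsymbol b}_3\},$$ $$\widetilde{\boldsymbol z}=\widetilde{\boldsymbol y}+\tfrac1\varepsilon\widetilde{\boldsymbol h}(\varepsilon\widehat{\boldsymbol y};\theta,\lambda)=\widetilde{\boldsymbol y}+\varepsilon\{[\hat y_1^2+\hat y_2^2]\widetilde{\boldsymbol a}_0+[\hat y_1^2-\hat y_2^2]\widetilde{\boldsymbol a}_2+2\hat y_1\hat y_2\widetilde{\boldsymbol b}_2\},$$ $$\mathring z=\mathring y+\tfrac1\varepsilon\mathring h(\varepsilon\widehat{\boldsymbol y};\theta,\lambda)=\mathring y+\varepsilon\{[\hat y_1^2+\hat y_2^2]\mathring a_0+[\hat y_1^2-\hat y_2^2]\mathring a_2+2\hat y_1\hat y_2\mathring b_2\},$$ together with $\eta=\zeta+\varepsilon\kappa(\lambda)$,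 subject to $\langle\widehat{\boldsymbol a}_1,\widehat{\boldsymbol e}_1\rangle+\langle\widehat{\boldsymbol b}_1,\widehat{\boldsymbol e}_2\rangle=0=\langle\widehat{\boldsymbol a}_1,\widehat{\boldsymbol e}_2\rangle-\langle\widehat{\boldsymbol b}_1,\widehat{\boldsymbol e}_1\rangle$ and $\langle\mathring a_0,1\rangle=0$. With $\mathcal D=(1+\varepsilon^2\kappa(\lambda)+\varepsilon\zeta)\partial_\theta+\omega\partial_\phi$, under these transformations the equations $\boldsymbol G-\eta\boldsymbol e_n-[(1+\varepsilon\eta)\partial_\theta+\omega\partial_\phi]\boldsymbol z=\boldsymbol 0$, $\boldsymbol\gamma_1(\boldsymbol z)=\widehat{\boldsymbol e}_1$, $\gamma_2(\boldsymbol z)=0$ become $$\widehat{\boldsymbol G}^\dagger-\mathcal D\widehat{\boldsymbol y}=\boldsymbol 0,\quad\widetilde{\boldsymbol G}^\dagger-\mathcal D\widetilde{\boldsymbol y}=\boldsymbol 0,\quad\mathring G^\dagger-[\zeta+\varepsilon\kappa(\lambda)]-\mathcal D\mathring y=0,\quad\boldsymbol\gamma_1(\widehat{\boldsymbol y})=\widehat{\boldsymbol e}_1,\quad\gamma_2(\mathring y)=0,$$ where the mappings $\widehat{\boldsymbol G}^\dagger,\widetilde{\boldsymbol G}^\dagger,\mathring G^\dagger$ of $(\widehat{\boldsymbol y},\widetilde{\boldsymbol y},\mathring y,\lambda,\zeta,\theta;\varepsilon)$, with values in $\mathbb R^2$, $\mathbb R^{n-3}$, $\mathbb R$ respectively,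 are expanded in the form $$\widehat{\boldsymbol G}^\dagger=\widehat{\mathsf E}(\lambda)\widehat{\boldsymbol y}+\sum_{p\ge2}\varepsilon^{p-1}\widehat{\boldsymbol G}_p^\dagger(\widehat{\boldsymbol y},\widetilde{\boldsymbol y},\mathring y;\lambda,\theta)+\zeta\sum_{p\ge1}\varepsilon^p\widehat{\boldsymbol K}_p^\dagger(\widehat{\boldsymbol y},\widetilde{\boldsymbol y},\mathring y;\lambda,\theta),$$ $$\widetilde{\boldsymbol G}^\dagger=\widetilde{\mathsf E}(\lambda)\widetilde{\boldsymbol y}+\sum_{p\ge2}\varepsilon^{p-1}\widetilde{\boldsymbol G}_p^\dagger(\widehat{\boldsymbol y},\widetilde{\boldsymbol y},\mathring y;\lambda,\theta)+\zeta\sum_{p\ge1}\varepsilon^p\widetilde{\boldsymbol K}_p^\dagger(\widehat{\boldsymbol y},\widetilde{\boldsymbol y},\mathring y;\lambda,\theta),$$ $$\mathring G^\dagger=\sum_{p\ge2}\varepsilon^{p-1}\mathring G_p^\dagger(\widehat{\boldsymbol y},\widetilde{\boldsymbol y},\mathring y;\lambda,\theta)+\zeta\sum_{p\ge1}\varepsilon^p\mathring K_p^\dagger(\widehat{\boldsymbol y},\widetilde{\boldsymbol y},\mathring y;\lambda,\theta),$$ the components of $\widehat{\boldsymbol G}_p^\dagger,\widetilde{\boldsymbol G}_p^\dagger,\mathring G_p^\dagger$ and of $\widehat{\boldsymbol K}_p^\dagger,\widetilde{\boldsymbol K}_p^\dagger,\mathring K_p^\dagger$ being homogeneous polynomials of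 degree $p$ in the components of $\widehat{\boldsymbol y},\widetilde{\boldsymbol y},\mathring y$, with coefficients depending on $\lambda$ and $\theta$. The polynomials $\widehat{\boldsymbol h},\widetilde{\boldsymbol h},\mathring h$ and $\kappa(\lambda)$ are chosen so that: the quadratic terms in $\widehat{\boldsymbol y}$ of $\widetilde{\boldsymbol G}_2^\dagger$ vanish; the quadratic terms in $\widehat{\boldsymbol y}$ of $\mathring G_2^\dagger$ take the form $\kappa(\lambda)[\hat y_1^2+\hat y_2^2]$; the quadratic terms in $\widehat{\boldsymbol y}$ of $\widehat{\boldsymbol G}_2^\dagger$ vanish; and the cubic terms in $\widehat{\boldsymbol y}$ of $\widehat{\boldsymbol G}_3^\dagger$ take the form $[\hat y_1^2+\hat y_2^2]\begin{pmatrix}\beta_R(\lambda)&-\beta_I(\lambda)\\ \beta_I(\lambda)&\beta_R(\lambda)\end{pmatrix}\widehat{\boldsymbol y}$. The numbers $\beta_R(\lambda),\beta_I(\lambda)$ are the Lyapunov coefficients.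
   Formalization: The expansion of G† in homogeneous polynomials of degree p is required only where ŷ₁²+ŷ₂²=1, so ε²κG₁(y) counts as the cubic term ε²κ|ŷ|²G₁(y); for all y, as stated, it is inconsistent unless κ=0. *)

(* Defs.v *)
From HB Require Import structures.
From mathcomp Require Import all_boot all_order all_algebra.
From mathcomp Require Import all_classical all_reals all_analysis.
From mathcomp Require Import complex.
Set Implicit Arguments.
Unset Strict Implicit.
Unset Printing Implicit Defensive.
Import Order.TTheory GRing.Theory Num.Theory.
Import numFieldNormedType.Exports.
Local Open Scope classical_set_scope.
Local Open Scope ring_scope.

(* For open A and finite-dimensional V this is C^m on A: all iterated
   directional derivatives up to order m exist and are continuous on A. *)
Fixpoint class_C (R : realType) (V W : normedModType R) (m : nat)
    (A : set V) (f : V -> W) : Prop :=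
  (forall x, A x -> {for x, continuous f}) /\
  match m with
  | 0%N => True
  | m'.+1 => forall u : V,
      (forall x, A x -> derivable f x u) /\ class_C m' A (fun x => 'D_u f x)
  end.

Definition smooth_on (R : realType) (V W : normedModType R) (A : set V)
  (f : V -> W) : Prop := forall m, class_C m A f.

(* Functions on the circle are 2 pi-periodic functions on R. *)
Definition periodic (R : realType) (W : Type) (f : R -> W) : Prop :=
  forall t, f (t + pi *+ 2) = f t.

Definition per_derivable (R : realType) (W : normedModType R) (f : R -> W) :
  Prop := periodic f /\ forall t, derivable f t 1.

Definition avg (R : realType) (f : R -> R) : R :=
  (pi *+ 2)^-1 * (\int[@lebesgue_measure R]_(t in `[0, pi *+ 2]) f t)%R.

Definition dotv (R : realType) (n : nat) (u w : 'cV[R]_n) : R :=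
  \sum_i u i 0 * w i 0.

Definition inner1 (R : realType) (n : nat) (w1 w2 : R -> 'cV[R]_n) : R :=
  avg (fun t => dotv (w1 t) (w2 t)).

Definition inner2 (R : realType) (n : nat) (w1 w2 : R -> R -> 'cV[R]_n) : R :=
  avg (fun p => avg (fun t => dotv (w1 t p) (w2 t p))).

Definition avgv (R : realType) (n : nat) (w : R -> 'cV[R]_n) : 'cV[R]_n :=
  \col_i avg (fun t => w t i 0).

(* The space R^n, n >= 3, is 'cV_(2 + k + 1) with k = n - 3, split into blocks
   of sizes 2, k and 1. *)
Section Blocks.
Variables (R : realType) (k : nat).

Definition zhat (y : 'cV[R]_(2 + k + 1)) : 'cV[R]_2 := usubmx (usubmx y).
Definition ztil (y : 'cV[R]_(2 + k + 1)) : 'cV[R]_k := dsubmx (usubmx y).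
Definition zring (y : 'cV[R]_(2 + k + 1)) : R := dsubmx y 0 0.
Definition vec3 (a : 'cV[R]_2) (b : 'cV[R]_k) (c : R) : 'cV[R]_(2 + k + 1) :=
  col_mx (col_mx a b) (const_mx c).

Definition cv2 (x y : R) : 'cV[R]_2 := \col_i (if i == 0 then x else y).
Definition ehat1 : 'cV[R]_2 := cv2 1 0.
Definition ehat2 : 'cV[R]_2 := cv2 0 1.
Definition e_n : 'cV[R]_(2 + k + 1) := vec3 0 0 1.
Definition astar (p : R) : 'cV[R]_(2 + k + 1) := vec3 (cv2 (cos p) (sin p)) 0 0.
Definition dastar (p : R) : 'cV[R]_(2 + k + 1) :=
  vec3 (cv2 (- sin p) (cos p)) 0 0.

(* The matrix with rows (x, -y) and (y, x). *)
Definition rotmx (x y : R) : 'M[R]_2 :=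
  \matrix_(i, j) (if i == j then x else if i == 0 then - y else y).

Definition gamma1 (z : R -> R -> 'cV[R]_(2 + k + 1)) : 'cV[R]_2 :=
  cv2 (inner2 z (fun _ => astar)) (inner2 z (fun _ => dastar)).
Definition gamma2 (z : R -> R -> 'cV[R]_(2 + k + 1)) : R :=
  inner2 z (fun _ _ => e_n).

End Blocks.

Definition jac (R : realType) (n m : nat) (f : 'cV[R]_n -> 'cV[R]_m)
  (x : 'cV[R]_n) : 'M[R]_(m, n) :=
  \matrix_(i, j) ('D_(delta_mx j 0) f x) i 0.

(* ns_T, ns_v, ns_P, ns_aR, ns_aI, ns_Et are the smooth continuations in
   lambda; the data of the bifurcating orbit are their values at ns_lam. *)
Record ns_data (R : realType) (k : nat) := NSData {
  ns_F : 'cV[R]_(2 + k + 1) -> R -> 'cV[R]_(2 + k + 1);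
  ns_lam : R;
  ns_om : R;
  ns_T : R -> R;
  ns_v : R -> R -> 'cV[R]_(2 + k + 1);
  ns_P : R -> R -> 'M[R]_(2 + k + 1);
  ns_aR : R -> R;
  ns_aI : R -> R;
  ns_Et : R -> 'M[R]_k }.

Section Setting.
Variables (R : realType) (k : nat) (D : ns_data R k).

Let n := (2 + k + 1)%N.

Definition ns_J (x : 'cV[R]_n) (l : R) : 'M[R]_n := jac (ns_F D ^~ l) x.

Definition ns_dv (t l : R) : 'cV[R]_n := derive1 (ns_v D ^~ l) t.
Definition ns_dP (t l : R) : 'M[R]_n := derive1 (ns_P D ^~ l) t.

Definition ns_E (l : R) : 'M[R]_n :=
  block_mx (block_mx (rotmx (ns_aR D l) (ns_aI D l)) 0 0 (ns_Et D l)) 0 0 0.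

Record continuation (r : R) : Prop := Continuation {
  ct_T : smooth_on [set l : R | `|l - ns_lam D| < r] (ns_T D);
  ct_v : smooth_on [set p : R * R | `|p.2 - ns_lam D| < r]
    (fun p => ns_v D p.1 p.2);
  ct_P : smooth_on [set p : R * R | `|p.2 - ns_lam D| < r]
    (fun p => ns_P D p.1 p.2);
  ct_aR : smooth_on [set l : R | `|l - ns_lam D| < r] (ns_aR D);
  ct_aI : smooth_on [set l : R | `|l - ns_lam D| < r] (ns_aI D);
  ct_Et : smooth_on [set l : R | `|l - ns_lam D| < r] (ns_Et D);
  ct_v_per : forall l, `|l - ns_lam D| < r -> periodic (ns_v D ^~ l);
  ct_P_per : forall l, `|l - ns_lam D| < r -> periodic (ns_P D ^~ l);
  ct_orbit : forall t l, `|l - ns_lam D| < r ->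
    ns_T D l *: ns_F D (ns_v D t l) l = ns_dv t l;
  ct_floquet : forall t l, `|l - ns_lam D| < r ->
    ns_T D l *: (ns_J (ns_v D t l) l *m ns_P D t l) - ns_dP t l =
    ns_P D t l *m ns_E l;
  ct_unit : forall t l, `|l - ns_lam D| < r -> ns_P D t l \in unitmx;
  ct_last : forall t l, `|l - ns_lam D| < r -> rsubmx (ns_P D t l) = ns_dv t l
}.

Record ns_setting : Prop := NSSetting {
  nss_smooth : smooth_on setT (fun p : 'cV[R]_n * R => ns_F D p.1 p.2);
  nss_cont : exists2 r : R, 0 < r & continuation r;
  nss_T : 0 < ns_T D (ns_lam D);
  nss_aR : ns_aR D (ns_lam D) = 0;
  nss_aI : ns_aI D (ns_lam D) = ns_om D;
  nss_om : 0 < ns_om D < 1 / 2;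
  nss_hyp : forall w : R,
    ~~ eigenvalue (map_mx (real_complex R) (ns_Et D (ns_lam D))) (Complex 0 w);
  nss_strip : forall c : R[i],
    eigenvalue (map_mx (real_complex R) (ns_E (ns_lam D))) c ->
    - (1 / 2) < complex.Im c < 1 / 2;
  nss_transversal : derive1 (ns_aR D) (ns_lam D) != 0;
  nss_res3 : ns_om D != 1 / 3;
  nss_res4 : ns_om D != 1 / 4 }.

Definition ns_G (z : 'cV[R]_n) (l eta t e : R) : 'cV[R]_n :=
  e^-1 *: (invmx (ns_P D t l) *m
    (ns_T D l *: ns_F D (ns_v D t l + e *: (ns_P D t l *m z)) l
     - ns_T D l *: ns_F D (ns_v D t l) l
     - (e * (1 + e * eta)) *: (ns_dP t l *m z))).

Definition phi_poly (M : nat) (a b : nat -> R -> 'cV[R]_n) (t p : R) :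
  'cV[R]_n :=
  a 0%N t + \sum_(1 <= m < M.+1)
    (cos (m%:R * p) *: a m t + sin (m%:R * p) *: b m t).

(* phi-modes 0, ..., M only. *)
Definition phi_band (M : nat) (z : R -> R -> 'cV[R]_n) : Prop :=
  exists a b : nat -> R -> 'cV[R]_n,
    [/\ forall m, per_derivable (a m), forall m, per_derivable (b m)
      & forall t p, z t p = phi_poly M a b t p].

(* S_{oo,M}: keeping all theta-modes, the truncation acts on the Fourier
   series in phi for each fixed theta. *)
Definition phi_trunc (M : nat) (w : R -> R -> 'cV[R]_n) : R -> R -> 'cV[R]_n :=
  phi_poly M
    (fun m t => (if m == 0%N then 1 else 2) *:
                avgv (fun p => cos (m%:R * p) *: w t p))
    (fun m t => 2 *: avgv (fun p => sin (m%:R * p) *: w t p)).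

Record fourier_sol (M : nat) (e l om eta : R) (z : R -> R -> 'cV[R]_n) : Prop :=
  FourierSol {
  fs_band : phi_band M z;
  fs_eq : forall t p,
    phi_trunc M (fun t p => ns_G (z t p) l eta t e) t p - eta *: e_n R k
    - ((1 + e * eta) *: derive1 (z ^~ p) t + om *: derive1 (z t) p) = 0;
  fs_gamma1 : gamma1 z = ehat1 R;
  fs_gamma2 : gamma2 z = 0 }.

Definition near_base (r l om eta : R) (z : R -> R -> 'cV[R]_n) : Prop :=
  [/\ `|l - ns_lam D| < r, `|om - ns_om D| < r, `|eta| < r
    & forall t p, `|z t p - astar k p| < r].

(* In each sufficiently small neighbourhood of (lambda^*, omega^*, 0, a^* ) the
   branch is, for small e, the only solution. The value e = 0 is excluded since
   ns_G carries a factor 1/e. *)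
Definition local_branch (M : nat) (lF omF etaF : R -> R)
    (zF : R -> R -> R -> 'cV[R]_n) : Prop :=
  exists2 r0 : R, 0 < r0 & forall r, 0 < r <= r0 ->
    \forall e \near 0^',
      [/\ near_base r (lF e) (omF e) (etaF e) (zF e),
          fourier_sol M e (lF e) (omF e) (etaF e) (zF e)
        & forall l om eta z, near_base r l om eta z ->
            fourier_sol M e l om eta z ->
            [/\ l = lF e, om = omF e, eta = etaF e
              & forall t p, z t p = zF e t p]].

End Setting.

(* Coefficients are functions of theta and lambda; only the indices m that occur
   in nf_map are relevant. *)
Record nf_data (R : realType) (k : nat) := NFData {
  nf_ahat : nat -> R -> R -> 'cV[R]_2;
  nf_bhat : nat -> R -> R -> 'cV[R]_2;
  nf_atil : nat -> R -> R -> 'cV[R]_k;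
  nf_btil : nat -> R -> R -> 'cV[R]_k;
  nf_aring : nat -> R -> R -> R;
  nf_bring : nat -> R -> R -> R;
  nf_kappa : R -> R;
  nf_betaR : R -> R;
  nf_betaI : R -> R }.

(* Homogeneous polynomial maps of degree p, as sums over multi-indices. *)
Definition homog_poly (R : realType) (n m p : nat)
    (f : 'cV[R]_n -> 'cV[R]_m) : Prop :=
  exists c : {ffun 'I_n -> 'I_p.+1} -> 'cV[R]_m, forall y,
    f y = \sum_(a : {ffun 'I_n -> 'I_p.+1} | (\sum_i a i == p)%N)
            (\prod_i y i 0 ^+ a i) *: c a.

Section NormalForm.
Variables (R : realType) (k : nat) (D : ns_data R k) (nf : nf_data R k).

Let n := (2 + k + 1)%N.

Definition quad_part (W : lmodType R) (a b : nat -> R -> R -> W) (t l : R)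
    (y : 'cV[R]_2) : W :=
  let y1 := y 0 0 in let y2 := y 1 0 in
  (y1 ^+ 2 + y2 ^+ 2) *: a 0%N t l + (y1 ^+ 2 - y2 ^+ 2) *: a 2%N t l
  + (2 * y1 * y2) *: b 2%N t l.

Definition cubic_part (W : lmodType R) (a b : nat -> R -> R -> W) (t l : R)
    (y : 'cV[R]_2) : W :=
  let y1 := y 0 0 in let y2 := y 1 0 in
  (y1 * (y1 ^+ 2 + y2 ^+ 2)) *: a 1%N t l
  + (y2 * (y1 ^+ 2 + y2 ^+ 2)) *: b 1%N t l
  + (y1 * (y1 ^+ 2 - 3 * y2 ^+ 2)) *: a 3%N t l
  + (y2 * (3 * y1 ^+ 2 - y2 ^+ 2)) *: b 3%N t l.

Definition nf_map (e l t : R) (y : 'cV[R]_n) : 'cV[R]_n :=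
  vec3
    (zhat y + e *: quad_part (nf_ahat nf) (nf_bhat nf) t l (zhat y)
     + e ^+ 2 *: cubic_part (nf_ahat nf) (nf_bhat nf) t l (zhat y))
    (ztil y + e *: quad_part (nf_atil nf) (nf_btil nf) t l (zhat y))
    (zring y + e * quad_part (W := R^o) (nf_aring nf) (nf_bring nf) t l (zhat y)).

(* With z = Y(y; theta) = nf_map and eta = zeta + e kappa, the chain rule gives
   [(1 + e eta) d_theta + omega d_phi] z = DY Dy + (1 + e eta) d_theta Y, where
   Dy is the same operator applied to y. Solving the equation for Dy leaves
   G^dagger - eta e_n - Dy = 0 with the G^dagger below. *)
Definition nf_Gdag (y : 'cV[R]_n) (l zeta t e : R) : 'cV[R]_n :=
  let eta := zeta + e * nf_kappa nf l in
  invmx (jac (nf_map e l t) y) *m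
    (ns_G D (nf_map e l t y) l eta t e - eta *: e_n R k
     - (1 + e * eta) *: derive1 (fun s => nf_map e l s y) t)
  + eta *: e_n R k.

(* The expansion is asymptotic, F being only smooth. Substituting
   eta = zeta + e kappa produces terms such as kappa e^2 (linear in y), whose
   degree is two less than the degree p that goes with e^(p-1). They are
   homogeneous of degree p only modulo |hat y|^2 = 1, the amplitude fixed by
   gamma_1: kappa e^2 (linear in y) counts as kappa |hat y|^2 e^2 (linear in y),
   a contribution of degree 3. Hence the expansion is imposed where
   |hat y|^2 = 1, which still determines the homogeneous polynomials Gp and Kp
   everywhere. *)
Definition nf_expansion (l : R) (Gp Kp : nat -> R -> 'cV[R]_n -> 'cV[R]_n) :
  Prop :=
  [/\ forall p t, homog_poly p (Gp p t),
      forall p t, homog_poly p (Kp p t)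
    & forall N y zeta t, zhat y 0 0 ^+ 2 + zhat y 1 0 ^+ 2 = 1 ->
        (fun e : R => nf_Gdag y l zeta t e
           - (ns_E D l *m y
              + \sum_(2 <= p < N.+1) e ^+ p.-1 *: Gp p t y
              + zeta *: \sum_(1 <= p < N.+1) e ^+ p *: Kp p t y))
        =O_ (0^') (fun e : R => e ^+ N)].

Definition only_hat (x : 'cV[R]_2) : 'cV[R]_n := vec3 x 0 0.

Record normal_form_at (l : R) : Prop := NormalFormAt {
  nfa_ahat : forall m, per_derivable (nf_ahat nf m ^~ l);
  nfa_bhat : forall m, per_derivable (nf_bhat nf m ^~ l);
  nfa_atil : forall m, per_derivable (nf_atil nf m ^~ l);
  nfa_btil : forall m, per_derivable (nf_btil nf m ^~ l);
  nfa_aring : forall m, per_derivable (nf_aring nf m ^~ l);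
  nfa_bring : forall m, per_derivable (nf_bring nf m ^~ l);
  nfa_norm1 : inner1 (nf_ahat nf 1 ^~ l) (fun _ => ehat1 R)
              + inner1 (nf_bhat nf 1 ^~ l) (fun _ => ehat2 R) = 0;
  nfa_norm2 : inner1 (nf_ahat nf 1 ^~ l) (fun _ => ehat2 R)
              - inner1 (nf_bhat nf 1 ^~ l) (fun _ => ehat1 R) = 0;
  nfa_norm3 : avg (nf_aring nf 0 ^~ l) = 0;
  nfa_conditions : exists Gp Kp : nat -> R -> 'cV[R]_n -> 'cV[R]_n,
    nf_expansion l Gp Kp /\
    forall t x,
      [/\ ztil (Gp 2%N t (only_hat x)) = 0,
          zring (Gp 2%N t (only_hat x)) =
            nf_kappa nf l * (x 0 0 ^+ 2 + x 1 0 ^+ 2),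
          zhat (Gp 2%N t (only_hat x)) = 0
        & zhat (Gp 3%N t (only_hat x)) =
            (x 0 0 ^+ 2 + x 1 0 ^+ 2) *:
              (rotmx (nf_betaR nf l) (nf_betaI nf l) *m x)] }.

End NormalForm.

(* f(theta, e) = O(e^2) as e -> 0, uniformly in theta. *)
Definition unif_O2 (R : realType) (W : normedModType R) (f : R -> R -> W) :
  Prop :=
  exists C : R, \forall e \near 0^', forall t, `|f t e| <= C * e ^+ 2.

(* Main.v *)
(** Write z = a* + w for the Fourier branch and expand G(z) = E z - eps eta B z
    + eps q2(z,z) + eps^2 q3(z,z,z) + ... with coefficients bounded in theta and
    Lipschitz in lambda.  The phi-modes of w then satisfy linear systems in theta
    with constant coefficients, which are uniformly solvable: no strong resonance
    excludes a multiplier 1 in the hat block, except in mode 1 and in the ring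
    block of mode 0, where the secular terms are exactly the unknowns
    alpha_R(lambda), alpha_I(lambda) - omega and eta, and the phase and mean
    conditions fix the kernel.  A bootstrap gives first w, eta = O(eps).  Under
    phi -> phi + pi odd and even modes separate, and odd modes see only the odd
    part of the nonlinearity, so odd modes, lambda - lambda* and omega - omega*
    are O(eps^2).  The normal form coefficients satisfy the same systems with the
    forcing evaluated at a* (even modes, order eps) and at a* + eps z2 (odd modes,
    order eps^2); subtracting, the errors are O(eps^3) for even modes and eta, and
    O(eps^4) for the hat block of odd modes, alpha_R(lambda) and
    alpha_I(lambda) - omega.  Transversality converts these into the claims. *)
From Pilot Require Import Defs.
From mathcomp Require Import all_boot all_order all_algebra.
From mathcomp Require Import all_classical all_reals all_analysis.
From mathcomp Require Import complex ring lra.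
Set Implicit Arguments.
Unset Strict Implicit.
Unset Printing Implicit Defensive.
Import Order.TTheory GRing.Theory Num.Theory.
Import numFieldNormedType.Exports.
(* [periodic] must denote the one of [Defs], not the one of [trigo]. *)
Import Pilot.Defs.
Local Open Scope classical_set_scope.
Local Open Scope ring_scope.

(** * Averages over the circle *)

(** Only sup-norm estimates are used, uniform in theta, for periodic solutions of linear equations
    with E frozen at lambda*; Fourier series occur in phi alone. Two obstacles shape the argument.
    The branch is known a priori to be small but without a rate, so terms linear in it with small
    coefficients are not yet errors of a definite order: a supremum must be absorbed before orders
    can be counted. The expansion of G keeps the quartic terms because odd modes need an error
    O(eps^4): these terms are even in z and reach the odd modes only through an even-mode factor of
    order eps. On the normal form side it is enough to insert y = a*(phi) and zeta = 0, since the
    image of the circle a* carries every coefficient in question, in modes 0 and 2 at order eps and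
    in modes 1 and 3 at order eps^2. The cubic part of the transformation has no tilde or ring
    component, so odd modes are compared after projection to the hat block. *)

Section Avg.
Variable R : realType.
Implicit Types f g : R -> R.
Notation mu := (@lebesgue_measure R).

Lemma integrable_cont f a b : continuous f ->
  mu.-integrable `[a, b] (EFin \o f).
Proof.
move=> cf; apply: continuous_compact_integrable; first exact: segment_compact.
exact: continuous_subspaceT.
Qed.

Lemma pi2_gt0 : 0 < pi *+ 2 :> R.
Proof. by rewrite pmulrn_lgt0// pi_gt0. Qed.

Lemma avgD f g : continuous f -> continuous g ->
  avg (fun t => f t + g t) = avg f + avg g.
Proof.
move=> cf cg; rewrite /avg RintegralD ?mulrDr//; exact: integrable_cont.
Qed.

Lemma avgZ c f : continuous f -> avg (fun t => c * f t) = c * avg f.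
Proof.
move=> cf; rewrite /avg RintegralZl//; [exact: mulrCA|exact: integrable_cont].
Qed.

Lemma avgN f : continuous f -> avg (fun t => - f t) = - avg f.
Proof.
by move=> cf; rewrite -mulN1r -avgZ//; congr avg; apply/funext => t; rewrite mulN1r.
Qed.

Lemma avgB f g : continuous f -> continuous g ->
  avg (fun t => f t - g t) = avg f - avg g.
Proof. by move=> cf cg; rewrite avgD// ?avgN// => t; apply/continuousN/cg. Qed.

Lemma avg_cst c : avg (fun=> c : R) = c.
Proof.
rewrite /avg Rintegral_cst//= lebesgue_measure_itv/= lte_fin pi2_gt0.
by rewrite oppr0 adde0 /= mulrCA mulVf ?mulr1// gt_eqF// pi2_gt0.
Qed.

Lemma avg_sum (I : Type) (r : seq I) (F : I -> R -> R) :
  (forall i, continuous (F i)) ->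
  avg (fun t => \sum_(i <- r) F i t) = \sum_(i <- r) avg (F i).
Proof.
move=> cF; elim: r => [|i r IH].
  by rewrite big_nil -[RHS](avg_cst 0); congr avg; apply/funext => t; rewrite big_nil.
rewrite big_cons -IH -avgD//; first by congr avg; apply/funext => t; rewrite big_cons.
elim: r {IH} => [|j r IH] t.
  apply: (@cvg_trans _ ((fun=> 0 : R) @ nbhs t)); last by rewrite /continuous_at big_nil; exact: cvg_cst.
  by apply: near_eq_cvg; near=> s; rewrite big_nil.
rewrite /continuous_at big_cons.
apply: (@cvg_trans _ ((fun s => F j s + \sum_(j <- r) F j s) @ nbhs t)).
  by apply: near_eq_cvg; near=> s; rewrite big_cons.
by apply: cvgD; [exact: cF|exact: IH].
Unshelve. all: by end_near. Qed.

Lemma avg_bound f (B : R) : continuous f -> (forall t, `|f t| <= B) -> `|avg f| <= B.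
Proof.
move=> cf fB; rewrite /avg normrM ger0_norm; last by rewrite invr_ge0 ltW// pi2_gt0.
rewrite ler_pdivrMl; last exact: pi2_gt0.
apply: (le_trans (le_normr_Rintegral _ _)) => //; first exact: integrable_cont.
have -> : pi *+ 2 * B = (\int[mu]_(t in `[0, pi *+ 2]) (fun=> B) t)%R.
  rewrite Rintegral_cst//= lebesgue_measure_itv/= lte_fin pi2_gt0.
  by rewrite oppr0 adde0 /= mulrC.
apply: le_Rintegral => //; last by exact: integrable_cont (fun t => @cvg_cst _ _ _ _ _).
apply: integrable_cont => t; apply: cvg_norm; exact: cf.
Qed.

Lemma Rintegral_shift f (a b c : R) : a <= b -> continuous f ->
  (\int[mu]_(t in `[a + c, b + c]) f t)%R =
  (\int[mu]_(t in `[a, b]) f (t + c)%R)%R.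
Proof.
move=> ab cf; rewrite /Rintegral; congr fine.
have dsh (x : R) : is_derive x 1 (fun t : R => t + c) 1 by exact: is_derive_shift.
have D1 : derive1 (fun t : R => t + c) = cst 1.
  by apply/funext => x; rewrite derive1E derive_val.
have csh : continuous (fun t : R => t + c).
  by move=> x; apply: cvgD; [exact: cvg_id|exact: cvg_cst].
rewrite (@integration_by_substitution_increasing _ (fun t => t + c) f)//.
- apply: eq_integral => x _; congr EFin.
  by rewrite D1 [LHS]mulr1.
- by move=> x y _ _ xy; rewrite ltrD2r.
- by rewrite D1 => x _; exact: cst_continuous.
- by rewrite D1; exact: is_cvg_cst.
- by rewrite D1; exact: is_cvg_cst.
- split; [by move=> x _; exact: ex_derive|..].
  + by apply: cvg_at_right_filter; exact: csh.
  + by apply: cvg_at_left_filter; exact: csh.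
- exact: continuous_subspaceT.
Qed.

Lemma Rintegral_cat f (a b c : R) : a <= b -> b <= c -> continuous f ->
  (\int[mu]_(t in `[a, c]) f t)%R =
  (\int[mu]_(t in `[a, b]) f t)%R + (\int[mu]_(t in `[b, c]) f t)%R.
Proof.
move=> ab bc cf; have := @Rintegral_itvB _ f (BLeft a) (BRight c) b.
rewrite !bnd_simp => /(_ (integrable_cont _ _ cf) ab bc).
rewrite Rintegral_itv_obnd_cbnd; last first.
  apply: integrableS (integrable_cont b c cf) => //.
  by move=> x /=; rewrite !in_itv/= => /andP[/ltW -> ->].
by move=> <-; rewrite addrC subrK.
Qed.

(** The period is cut at pi and the shift exchanges the two halves. This invariance is what
    separates odd from even modes. *)
Lemma avg_shift_pi f : continuous f -> periodic f ->
  avg (fun t => f (t + pi)) = avg f.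
Proof.
move=> cf pf; rewrite /avg; congr (_ * _).
have p0 := pi_ge0 R.
have p2 : pi <= pi *+ 2 :> R by rewrite mulr2n lerDl.
have csh : continuous (fun t : R => f (t + pi)).
  move=> t; apply: (@continuous_comp _ _ _ (fun t : R => t + pi) f); last exact: cf.
  by apply: cvgD; [exact: cvg_id|exact: cvg_cst].
rewrite (@Rintegral_cat _ 0 pi (pi *+ 2))// [RHS](@Rintegral_cat _ 0 pi (pi *+ 2))//.
rewrite addrC; congr (_ + _).
  rewrite -[LHS](_ : (\int[mu]_(t in `[0, pi]) f (t + pi + pi))%R = _); last first.
    by rewrite -(@Rintegral_shift (fun t => f (t + pi)))// add0r -mulr2n.
  by apply: eq_Rintegral => t _; rewrite -addrA -mulr2n pf.
by rewrite -Rintegral_shift// add0r -mulr2n.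
Qed.

(** Fundamental theorem of calculus over one period. The averages of cosines and sines of nonzero
    frequency follow from it. *)
Lemma avg_deriv (F f : R -> R) : (forall t : R, is_derive t 1 F (f t)) -> continuous f ->
  periodic F -> avg f = 0.
Proof.
move=> dF cf pF; rewrite /avg /Rintegral.
have cF : continuous F.
  by move=> t; apply/differentiable_continuous/derivable1_diffP/ex_derive.
rewrite (@continuous_FTC2 _ f F)//=.
- by rewrite -[X in F X]add0r pF subrr mulr0.
- exact: pi2_gt0.
- exact: continuous_subspaceT.
- split; [by move=> x _; exact: ex_derive|..].
  + by apply: cvg_at_right_filter; exact: cF.
  + by apply: cvg_at_left_filter; exact: cF.
- by move=> x _; rewrite derive1E derive_val.
Qed.

Lemma cont_cosM (k : R) : continuous (fun t => cos (k * t) : R).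
Proof.
move=> t; apply: (@continuous_comp _ _ _ (fun t => k * t) cos); last exact: continuous_cos.
by apply: cvgM; [exact: cvg_cst|exact: cvg_id].
Qed.

Lemma cont_sinM (k : R) : continuous (fun t => sin (k * t) : R).
Proof.
move=> t; apply: (@continuous_comp _ _ _ (fun t => k * t) sin); last exact: continuous_sin.
by apply: cvgM; [exact: cvg_cst|exact: cvg_id].
Qed.

Lemma is_derive_sinM (k t : R) : is_derive t 1 (fun t => sin (k * t)) (k * cos (k * t)).
Proof.
have d1 : is_derive t 1 (fun t => k * t) k.
  have := is_deriveZ k (is_derive_id t (1 : R)).
  by rewrite /= [_ *: _]mulr1.
by have := @is_derive1_comp _ sin (fun t => k * t) t _ _ (is_derive_sin _) d1; rewrite mulrC.
Qed.

Lemma is_derive_cosM (k t : R) : is_derive t 1 (fun t => cos (k * t)) (- k * sin (k * t)).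
Proof.
have d1 : is_derive t 1 (fun t => k * t) k.
  have := is_deriveZ k (is_derive_id t (1 : R)).
  by rewrite /= [_ *: _]mulr1.
have := @is_derive1_comp _ cos (fun t => k * t) t _ _ (is_derive_cos _) d1.
by rewrite !mulNr mulrC.
Qed.

Lemma cosM_periodic (k : nat) : periodic (fun t : R => cos (k%:R * t)).
Proof.
move=> t; rewrite mulrDr; elim: k (k%:R * t) => [|k IH] x; first by rewrite mul0r addr0.
by rewrite -natr1 mulrDl mul1r addrA cosD2pi.
Qed.
Lemma sinM_periodic (k : nat) : periodic (fun t : R => sin (k%:R * t)).
Proof.
move=> t; rewrite mulrDr; elim: k (k%:R * t) => [|k IH] x; first by rewrite mul0r addr0.
by rewrite -natr1 mulrDl mul1r addrA sinD2pi.
Qed.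

Lemma avg_sinM (k : nat) : avg (fun t : R => sin (k%:R * t)) = 0.
Proof.
case: (posnP k) => [->|k0].
  by rewrite -[RHS](avg_cst 0); congr avg; apply/funext => t; rewrite mul0r sin0.
have k0' : k%:R != 0 :> R by rewrite pnatr_eq0 -lt0n.
apply: (@avg_deriv (fun t => - k%:R^-1 * cos (k%:R * t))).
- move=> t; have := is_deriveZ (- k%:R^-1) (is_derive_cosM k%:R t).
  by rewrite /= [_ *: _]mulrA mulrNN mulVf ?mul1r.
- exact: cont_sinM.
- by move=> t; rewrite cosM_periodic.
Qed.

Lemma avg_cosM (k : nat) : avg (fun t : R => cos (k%:R * t)) = (k == 0%N)%:R.
Proof.
case: (posnP k) => [->|k0].
  by rewrite -[RHS](avg_cst 1); congr avg; apply/funext => t; rewrite mul0r cos0.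
have k0' : k%:R != 0 :> R by rewrite pnatr_eq0 -lt0n.
rewrite (_ : false%:R = 0)//; apply: (@avg_deriv (fun t => k%:R^-1 * sin (k%:R * t))).
- move=> t; have := is_deriveZ (k%:R^-1) (is_derive_sinM k%:R t).
  by rewrite /= [_ *: _]mulrA mulVf ?mul1r.
- exact: cont_cosM.
- by move=> t; rewrite sinM_periodic.
Qed.

End Avg.

(** * Trigonometric polynomials in the angle phi *)

Section Trig.
Variable R : realType.
Implicit Types f g : R -> R.

Lemma contD f g : continuous f -> continuous g -> continuous (fun t => f t + g t).
Proof. by move=> cf cg t; apply: cvgD; [exact: cf|exact: cg]. Qed.

Lemma contM f g : continuous f -> continuous g -> continuous (fun t => f t * g t).
Proof. by move=> cf cg t; apply: cvgM; [exact: cf|exact: cg]. Qed.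

Lemma contN f : continuous f -> continuous (fun t => - f t).
Proof. by move=> cf t; apply: cvgN; exact: cf. Qed.

Lemma cont_cst (c : R) : continuous (fun _ : R => c).
Proof. by move=> t; exact: cvg_cst. Qed.

Lemma cont_sum (I : Type) (r : seq I) (F : I -> R -> R) :
  (forall i, continuous (F i)) -> continuous (fun t => \sum_(i <- r) F i t).
Proof.
move=> cF; elim: r => [|i r IH].
  rewrite (_ : (fun t => _) = fun=> 0); first exact: cont_cst.
  by apply/funext => t; rewrite big_nil.
rewrite (_ : (fun t => _) = fun t => F i t + \sum_(i <- r) F i t).
  exact: contD.
by apply/funext => t; rewrite big_cons.
Qed.

Lemma cont_shift f c : continuous f -> continuous (fun t => f (t + c)).
Proof.
move=> cf t; apply: (@continuous_comp _ _ _ (fun t : R => t + c) f); last exact: cf.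
by apply: cvgD; [exact: cvg_id|exact: cvg_cst].
Qed.

Lemma avg_cc (m k : nat) : avg (fun p : R => cos (m%:R * p) * cos (k%:R * p)) =
  ((m == k)%:R + ((m + k)%N == 0%N)%:R) / 2.
Proof.
(* Product-to-sum formulas. The symmetry allows m <= k, so that the truncated difference k - m is
   the true one. *)
wlog mk : m k / (m <= k)%N => [H|].
  case: (leqP m k) => [/H//|/ltnW/H]; rewrite eq_sym addnC => <-.
  by congr avg; apply/funext => p; rewrite mulrC.
have -> : (fun p : R => cos (m%:R * p) * cos (k%:R * p)) =
   (fun p => 2^-1 * (cos ((k - m)%:R * p) + cos ((m + k)%:R * p))).
  apply/funext => p; rewrite natrB// natrD mulrBl mulrDl cosB cosD; by field.
rewrite avgZ ?avgD ?avg_cosM; try exact: cont_cosM; last first.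
  by apply: contD; exact: cont_cosM.
by rewrite mulrC subn_eq0 (eqn_leq m k) mk.
Qed.

Lemma avg_ss (m k : nat) : avg (fun p : R => sin (m%:R * p) * sin (k%:R * p)) =
  ((m == k)%:R - ((m + k)%N == 0%N)%:R) / 2.
Proof.
wlog mk : m k / (m <= k)%N => [H|].
  case: (leqP m k) => [/H//|/ltnW/H]; rewrite eq_sym addnC => <-.
  by congr avg; apply/funext => p; rewrite mulrC.
have -> : (fun p : R => sin (m%:R * p) * sin (k%:R * p)) =
   (fun p => 2^-1 * (cos ((k - m)%:R * p) - cos ((m + k)%:R * p))).
  apply/funext => p; rewrite natrB// natrD mulrBl mulrDl cosB cosD; by field.
rewrite avgZ ?avgB ?avg_cosM; try exact: cont_cosM; last first.
  by apply: contD; [|apply: contN]; exact: cont_cosM.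
by rewrite mulrC subn_eq0 (eqn_leq m k) mk.
Qed.

Lemma avg_cs (m k : nat) : avg (fun p : R => cos (m%:R * p) * sin (k%:R * p)) = 0.
Proof.
case: (leqP m k) => mk.
  have -> : (fun p : R => cos (m%:R * p) * sin (k%:R * p)) =
     (fun p => 2^-1 * (sin ((k - m)%:R * p) + sin ((m + k)%:R * p))).
    apply/funext => p; rewrite natrB// natrD mulrBl mulrDl sinB sinD; by field.
  rewrite avgZ ?avgD ?avg_sinM; try exact: cont_sinM; last first.
    by apply: contD; exact: cont_sinM.
  by rewrite addr0 mulr0.
have -> : (fun p : R => cos (m%:R * p) * sin (k%:R * p)) =
   (fun p => 2^-1 * (sin ((m + k)%:R * p) - sin ((m - k)%:R * p))).
  apply/funext => p; rewrite natrB ?(ltnW mk)// natrD mulrBl mulrDl sinB sinD; by field.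
rewrite avgZ ?avgB ?avg_sinM; try exact: cont_sinM; last first.
  by apply: contD; [|apply: contN]; exact: cont_sinM.
by rewrite subrr mulr0.
Qed.

(** One component of [phi_poly 3] at fixed theta. The value b 0 and all indices above 3 do not
    enter. *)
Definition trig (a b : nat -> R) (p : R) : R :=
  a 0%N + \sum_(1 <= m < 4) (cos (m%:R * p) * a m + sin (m%:R * p) * b m).

(** Not normalized: for m > 0 the Fourier coefficient is twice this average. *)
Definition pc (m : nat) f : R := avg (fun p => cos (m%:R * p) * f p).
Definition ps (m : nat) f : R := avg (fun p => sin (m%:R * p) * f p).

Lemma cont_trig a b : continuous (trig a b).
Proof.
apply: contD; first exact: cont_cst.
apply: cont_sum => i; apply: contD; apply: contM; try exact: cont_cst.
  exact: cont_cosM.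
exact: cont_sinM.
Qed.

Lemma trigE a b : trig a b = fun p => \sum_(0 <= m < 4)
   (a m * cos (m%:R * p) + b m * sin (m%:R * p)).
Proof.
apply/funext => p; rewrite /trig [RHS]big_ltn// mul0r cos0 sin0 mulr1 mulr0 addr0.
by congr (_ + _); apply: eq_bigr => i _; rewrite mulrC [X in _ + X]mulrC.
Qed.

Lemma pc_trig (m : nat) a b : (m < 4)%N ->
  pc m (trig a b) = (if m == 0%N then 1 else 2^-1) * a m.
Proof.
move=> m4; rewrite /pc trigE.
have -> : (fun p : R => cos (m%:R * p) * (\sum_(0 <= k < 4)
     (a k * cos (k%:R * p) + b k * sin (k%:R * p)))) =
   (fun p => \sum_(0 <= k < 4)
     (a k * (cos (m%:R * p) * cos (k%:R * p)) + b k * (cos (m%:R * p) * sin (k%:R * p)))).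
  apply/funext => p; rewrite mulr_sumr; apply: eq_bigr => k _.
  by rewrite mulrDr !(mulrCA (cos _)).
have c1 k : continuous (fun p : R => cos (m%:R * p) * cos (k%:R * p)).
  by apply: contM; exact: cont_cosM.
have c2 k : continuous (fun p : R => cos (m%:R * p) * sin (k%:R * p)).
  by apply: contM; [exact: cont_cosM|exact: cont_sinM].
have c3 (c : R) f : continuous f -> continuous (fun p => c * f p).
  by move=> cf; apply: contM => //; exact: cont_cst.
rewrite avg_sum => [|k]; last by apply: contD; apply: c3.
transitivity (\sum_(0 <= k < 4) a k * (((m == k)%:R + ((m + k)%N == 0%N)%:R) / 2)).
  apply: eq_bigr => k _; rewrite avgD; [|exact: c3|exact: c3].
  by rewrite !avgZ// avg_cc avg_cs mulr0 addr0.
rewrite /index_iota /= !big_cons big_nil.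
case: m m4 {c1 c2} => [|[|[|[|//]]]] _ /=; by field.
Qed.

Lemma ps_trig (m : nat) a b : (0 < m < 4)%N ->
  ps m (trig a b) = 2^-1 * b m.
Proof.
move=> m4; rewrite /ps trigE.
have -> : (fun p : R => sin (m%:R * p) * (\sum_(0 <= k < 4)
     (a k * cos (k%:R * p) + b k * sin (k%:R * p)))) =
   (fun p => \sum_(0 <= k < 4)
     (a k * (cos (k%:R * p) * sin (m%:R * p)) + b k * (sin (m%:R * p) * sin (k%:R * p)))).
  apply/funext => p; rewrite mulr_sumr; apply: eq_bigr => k _.
  by rewrite mulrDr !(mulrCA (sin (m%:R * p))) [in X in X + _](mulrC (sin (m%:R * p))).
have c1 k : continuous (fun p : R => cos (k%:R * p) * sin (m%:R * p)).
  by apply: contM; [exact: cont_cosM|exact: cont_sinM].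
have c2 k : continuous (fun p : R => sin (m%:R * p) * sin (k%:R * p)).
  by apply: contM; exact: cont_sinM.
have c3 (c : R) f : continuous f -> continuous (fun p => c * f p).
  by move=> cf; apply: contM => //; exact: cont_cst.
rewrite avg_sum => [|k]; last by apply: contD; apply: c3.
transitivity (\sum_(0 <= k < 4) b k * (((m == k)%:R - ((m + k)%N == 0%N)%:R) / 2)).
  apply: eq_bigr => k _; rewrite avgD; [|exact: c3|exact: c3].
  by rewrite !avgZ// avg_ss avg_cs mulr0 add0r.
rewrite /index_iota /= !big_cons big_nil.
case: m m4 {c1 c2} => [|[|[|[|//]]]] _ //=; by field.
Qed.

Lemma trig_inj a b a' b' : trig a b =1 trig a' b' ->
  (forall m, (m < 4)%N -> a m = a' m) /\ (forall m, (0 < m < 4)%N -> b m = b' m).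
Proof.
move=> /funext E; split=> m m4.
  have := pc_trig a b m4; rewrite E pc_trig// => /mulfI -> //.
  by case: (m == 0%N); rewrite ?oner_eq0 ?invr_eq0 ?pnatr_eq0.
by have := ps_trig a b m4; rewrite E ps_trig// => /mulfI ->.
Qed.

Section pcps.
Variable m : nat.

Lemma pcD f g : continuous f -> continuous g ->
  pc m (fun p => f p + g p) = pc m f + pc m g.
Proof.
move=> cf cg; rewrite /pc -avgD; try (apply: contM => //; exact: cont_cosM).
by congr avg; apply/funext => p; rewrite mulrDr.
Qed.

Lemma psD f g : continuous f -> continuous g ->
  ps m (fun p => f p + g p) = ps m f + ps m g.
Proof.
move=> cf cg; rewrite /ps -avgD; try (apply: contM => //; exact: cont_sinM).
by congr avg; apply/funext => p; rewrite mulrDr.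
Qed.

Lemma pcZ c f : continuous f -> pc m (fun p => c * f p) = c * pc m f.
Proof.
move=> cf; rewrite /pc -avgZ; last by apply: contM => //; exact: cont_cosM.
by congr avg; apply/funext => p; rewrite mulrCA.
Qed.

Lemma psZ c f : continuous f -> ps m (fun p => c * f p) = c * ps m f.
Proof.
move=> cf; rewrite /ps -avgZ; last by apply: contM => //; exact: cont_sinM.
by congr avg; apply/funext => p; rewrite mulrCA.
Qed.

Lemma pc_bound f (B : R) : continuous f -> (forall p, `|f p| <= B) -> `|pc m f| <= B.
Proof.
move=> cf fB; apply: avg_bound => [|p]; first by apply: contM => //; exact: cont_cosM.
rewrite normrM (le_trans _ (fB p))// ler_piMl//.
by rewrite ler_norml cos_geN1 cos_le1.
Qed.

Lemma ps_bound f (B : R) : continuous f -> (forall p, `|f p| <= B) -> `|ps m f| <= B.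
Proof.
move=> cf fB; apply: avg_bound => [|p]; first by apply: contM => //; exact: cont_sinM.
rewrite normrM (le_trans _ (fB p))// ler_piMl//.
by rewrite ler_norml sin_geN1 sin_le1.
Qed.

Lemma cosM_pi (p : R) : cos (m%:R * (p + pi)) = (-1) ^+ m * cos (m%:R * p).
Proof.
rewrite mulrDr; elim: m (m%:R * p) => [|n IH] x.
  by rewrite mul0r addr0 expr0 mul1r.
by rewrite -natr1 mulrDl mul1r addrA cosDpi IH exprS mulN1r mulNr.
Qed.

Lemma sinM_pi (p : R) : sin (m%:R * (p + pi)) = (-1) ^+ m * sin (m%:R * p).
Proof.
rewrite mulrDr; elim: m (m%:R * p) => [|n IH] x.
  by rewrite mul0r addr0 expr0 mul1r.
by rewrite -natr1 mulrDl mul1r addrA sinDpi IH exprS mulN1r mulNr.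
Qed.

(* The part of f seen by the modes of the parity of m. *)
Definition par f (p : R) : R := 2^-1 * (f p + (-1) ^+ m * f (p + pi)).

(** The shift by pi multiplies cos (m phi) by (-1)^m and leaves averages unchanged, so both halves
    of [par] contribute equally. *)
Lemma pc_par f : continuous f -> periodic f -> pc m f = pc m (par f).
Proof.
move=> cf pf.
have cs : continuous (fun p => f (p + pi)) by exact: cont_shift.
have cm : continuous (fun p => (-1) ^+ m * f (p + pi)).
  by apply: contM => //; exact: cont_cst.
rewrite /par pcZ ?pcD//; last exact: contD.
suff -> : pc m (fun p => (-1) ^+ m * f (p + pi)) = pc m f by field.
rewrite {2}/pc -avg_shift_pi; last 2 first.
- by apply: contM => //; exact: cont_cosM.
- by move=> p; rewrite cosM_periodic pf.
by congr avg; apply/funext => p; rewrite cosM_pi mulrCA mulrA.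
Qed.

Lemma ps_par f : continuous f -> periodic f -> ps m f = ps m (par f).
Proof.
move=> cf pf.
have cs : continuous (fun p => f (p + pi)) by exact: cont_shift.
have cm : continuous (fun p => (-1) ^+ m * f (p + pi)).
  by apply: contM => //; exact: cont_cst.
rewrite /par psZ ?psD//; last exact: contD.
suff -> : ps m (fun p => (-1) ^+ m * f (p + pi)) = ps m f by field.
rewrite {2}/ps -avg_shift_pi; last 2 first.
- by apply: contM => //; exact: cont_sinM.
- by move=> p; rewrite sinM_periodic pf.
by congr avg; apply/funext => p; rewrite sinM_pi mulrCA mulrA.
Qed.

End pcps.

End Trig.

(** * Periodic linear differential equations *)

Section ODE.
Variable R : realType.
Implicit Types f g : R -> R.

Lemma is_derive_cont f df : (forall t : R, is_derive t 1 f (df t)) -> continuous f.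
Proof.
by move=> d t; apply/differentiable_continuous/derivable1_diffP/ex_derive.
Qed.

Lemma mvt_bound f df (a b B : R) : a <= b ->
  (forall t : R, is_derive t 1 f (df t)) -> (forall t, a <= t <= b -> `|df t| <= B) ->
  `|f b - f a| <= B * (b - a).
Proof.
move=> ab d dB; have [|c cab ->] := @MVT_segment R f df a b ab.
  by apply: continuous_subspaceT; exact: is_derive_cont d.
by rewrite normrM (@ger0_norm _ (b - a)) ?subr_ge0// ler_wpM2r ?subr_ge0// dB.
Qed.

Lemma periodicZ (T : Type) (f : R -> T) : periodic f ->
  forall (k : int) t, f (t + (pi *+ 2) * k%:~R) = f t.
Proof.
move=> pf; case=> n t.
  rewrite -pmulrn; elim: n => [|n IH]; first by rewrite mulr0 addr0.
  by rewrite -natr1 mulrDr mulr1 addrA pf.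
rewrite NegzE mulrNz mulrN -pmulrn; elim: n.+1 => [|m IH]; first by rewrite mulr0 subr0.
by rewrite -natr1 mulrDr mulr1 opprD addrA -pf subrK.
Qed.

(** The codomain is arbitrary so that several functions, packed in a tuple, can be moved to the same
    point of a period at once. *)
Lemma periodic_reduce (T : Type) (f : R -> T) (a x : R) : periodic f ->
  exists2 y, a <= y <= a + pi *+ 2 & f y = f x.
Proof.
move=> pf; set k := Num.floor ((x - a) / (pi *+ 2)).
have P := pi2_gt0 R.
exists (x + (pi *+ 2) * (- k)%:~R); last exact: periodicZ.
have /andP[k1 k2] : (k%:~R <= (x - a) / (pi *+ 2) < (k + 1)%:~R)%R.
  by rewrite floor_le_tmp floorD1_gt.
rewrite ler_pdivlMr // in k1; rewrite ltr_pdivrMr // in k2.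
rewrite intrD mulrDl in k2.
rewrite mulrNz mulrN; apply/andP; split; lra.
Qed.

Lemma is_deriveMf f g (t df dg : R) : is_derive t 1 f df -> is_derive t 1 g dg ->
  is_derive t 1 (fun s => f s * g s) (df * g t + f t * dg).
Proof.
move=> d1 d2; have := @is_deriveM _ _ f g t 1 df dg d1 d2.
by rewrite /GRing.scale /= addrC [g t * df]mulrC.
Qed.

Lemma is_deriveDf f g (t df dg : R) : is_derive t 1 f df -> is_derive t 1 g dg ->
  is_derive t 1 (fun s => f s + g s) (df + dg).
Proof. by move=> d1 d2; exact: is_deriveD. Qed.

Lemma is_deriveBf f g (t df dg : R) : is_derive t 1 f df -> is_derive t 1 g dg ->
  is_derive t 1 (fun s => f s - g s) (df - dg).
Proof. by move=> d1 d2; exact: is_deriveB. Qed.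

Lemma is_deriveCf c f (t df : R) : is_derive t 1 f df ->
  is_derive t 1 (fun s => c * f s) (c * df).
Proof. by move=> d1; exact: (@is_deriveZ _ _ _ f c t 1 df d1). Qed.

Lemma is_derive_shf f (t c df : R) : is_derive (t + c) 1 f df ->
  is_derive t 1 (fun s => f (s + c)) df.
Proof.
move=> d; have := @is_derive1_comp _ f (fun s => s + c) t _ _ d (is_derive_shift t 1 c).
by rewrite mulr1.
Qed.

Lemma is_derive_sumf (I : Type) (r : seq I) (F : I -> R -> R) (dF : I -> R) (t : R) :
  (forall i, is_derive t 1 (F i) (dF i)) ->
  is_derive t 1 (fun s => \sum_(i <- r) F i s) (\sum_(i <- r) dF i).
Proof.
move=> d; elim: r => [|i r IH].
  rewrite big_nil (_ : (fun s => _) = cst 0); first exact: is_derive_cst.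
  by apply/funext => s; rewrite big_nil.
rewrite big_cons (_ : (fun s => _) = (fun s => F i s + \sum_(j <- r) F j s)).
  exact: is_deriveDf.
by apply/funext => s; rewrite big_cons.
Qed.

(* exp (2 pi (al + i be)) <> 1, i.e. al + i be is not a resonant Floquet exponent. *)
Definition nonres (al be : R) : Prop := al != 0 \/ cos (pi *+ 2 * be) != 1.

(** Periodic solutions of z' = (al + i be) z + h, written for z = x + i y and h = h1 + i h2. *)
Definition cplx_ode (al be : R) (x y h1 h2 : R -> R) : Prop :=
  [/\ periodic x, periodic y,
      forall t : R, is_derive t 1 x (al * x t - be * y t + h1 t)
    & forall t : R, is_derive t 1 y (be * x t + al * y t + h2 t)].

Lemma cplx_ode_shift al be x y h1 h2 c : cplx_ode al be x y h1 h2 ->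
  cplx_ode al be (fun t => x (t + c)) (fun t => y (t + c)) (fun t => h1 (t + c))
   (fun t => h2 (t + c)).
Proof.
case=> px py dx dy; split=> t.
- by rewrite addrAC px.
- by rewrite addrAC py.
- exact: is_derive_shf.
- exact: is_derive_shf.
Qed.

(** The quantity is the squared modulus of exp (-2 pi (al + i be)) - 1, the determinant of the
    system that fixes the initial value of a periodic solution. *)
Lemma det_nonres al be : nonres al be ->
  let E := expR (- al * (pi *+ 2)) in
  let c := cos (pi *+ 2 * be) in let s := sin (pi *+ 2 * be) in
  0 < (E * c - 1) ^+ 2 + (E * s) ^+ 2.
Proof.
move=> nr /=; set E := expR _; set c := cos _; set s := sin _.
rewrite lt_def addr_ge0 ?sqr_ge0// andbT.
apply/negP; rewrite paddr_eq0 ?sqr_ge0// !sqrf_eq0 => /andP[].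
rewrite subr_eq0 => /eqP Ec; rewrite mulf_eq0 [E == 0]gt_eqF ?expR_gt0//= => /eqP s0.
have E0 : 0 < E by exact: expR_gt0.
have c2 : c ^+ 2 = 1 by rewrite -(cos2Dsin2 (pi *+ 2 * be)) -/c -/s s0 expr0n addr0.
have c0 : 0 < c by rewrite -(pmulr_rgt0 _ E0) Ec.
have c1 : c = 1.
  move: c2 => /eqP; rewrite sqrf_eq1 => /orP[/eqP//|/eqP c1].
  by move: c0; rewrite c1 ltr0N1.
case: nr => [a0|]; last by rewrite -/c c1 eqxx.
move: Ec; rewrite c1 mulr1 /E -[RHS]expR0 => /expR_inj /eqP.
by rewrite mulf_eq0 oppr_eq0 (negbTE a0) gt_eqF// pi2_gt0.
Qed.

(** Over one period the solution times the integrating factor changes by at most the integral of the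
    forcing; with periodicity this gives two linear inequalities for the initial value. In K the
    factor 2 counts the two forcing terms, the exponential bounds the integrating factor and the
    last factor is the length of the period. *)
Lemma cplx_ode_bound0 al be x y h1 h2 B : cplx_ode al be x y h1 h2 ->
    (forall t, `|h1 t| <= B) -> (forall t, `|h2 t| <= B) ->
  let E := expR (- al * (pi *+ 2)) in
  let c := cos (pi *+ 2 * be) in let s := sin (pi *+ 2 * be) in
  let K := 2 * expR (`|al| * (pi *+ 2)) * (pi *+ 2) in
  `|(E * c - 1) * x 0 + E * s * y 0| <= K * B /\
  `|- (E * s) * x 0 + (E * c - 1) * y 0| <= K * B.
Proof.
move=> [px py dx dy] hB1 hB2 E c s K.
have P := pi2_gt0 R.
have B0 : 0 <= B by exact: le_trans (hB1 0).
(* X + i Y = exp (-(al + i be) t) (x + i y), whose derivative contains the forcing only. *)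
pose X t := expR (- al * t) * (cos (be * t) * x t + sin (be * t) * y t).
pose Y t := expR (- al * t) * (cos (be * t) * y t - sin (be * t) * x t).
have dX (t : R) : is_derive t 1 X (expR (- al * t) * (cos (be * t) * h1 t + sin (be * t) * h2 t)).
  by apply: is_derive_eq; rewrite /GRing.scale /=; ring.
have dY (t : R) : is_derive t 1 Y (expR (- al * t) * (cos (be * t) * h2 t - sin (be * t) * h1 t)).
  by apply: is_derive_eq; rewrite /GRing.scale /=; ring.
have bnd (t u v : R) : 0 <= t <= pi *+ 2 -> `|u| <= B -> `|v| <= B ->
    `|expR (- al * t) * (cos (be * t) * u + sin (be * t) * v)| <=
    2 * expR (`|al| * (pi *+ 2)) * B.
  move=> /andP[t0 t1] uB vB; rewrite normrM ger0_norm ?expR_ge0//.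
  rewrite [2 * _]mulrC -mulrA; apply: ler_pM; rewrite ?expR_ge0//.
    rewrite ler_expR; apply: le_trans (ler_norm _) _.
    by rewrite normrM normrN ler_wpM2l// ger0_norm.
  rewrite mulr_natl mulr2n (le_trans (ler_normD _ _))// !normrM.
  apply: lerD; rewrite -[leRHS]mul1r ler_pM//.
    by rewrite ler_norml cos_geN1 cos_le1.
  by rewrite ler_norml sin_geN1 sin_le1.
have c2 : cos (be * (pi *+ 2)) = c by rewrite mulrC.
have s2 : sin (be * (pi *+ 2)) = s by rewrite mulrC.
have x2 : x (pi *+ 2) = x 0 by rewrite -[X in x X]add0r px.
have y2 : y (pi *+ 2) = y 0 by rewrite -[X in y X]add0r py.
split.
- have := @mvt_bound X _ 0 (pi *+ 2) (2 * expR (`|al| * (pi *+ 2)) * B) (ltW P) dX.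
  rewrite /X c2 s2 x2 y2 !mulr0 expR0 cos0 sin0 -/E subr0.
  have -> : (E * (c * x 0 + s * y 0) - 1 * (1 * x 0 + 0 * y 0)) =
            ((E * c - 1) * x 0 + E * s * y 0) by ring.
  by rewrite /K [_ * _ * (pi *+ 2)]mulrAC; apply => t /bnd; apply.
- have := @mvt_bound Y _ 0 (pi *+ 2) (2 * expR (`|al| * (pi *+ 2)) * B) (ltW P) dY.
  rewrite /Y c2 s2 x2 y2 !mulr0 expR0 cos0 sin0 -/E subr0.
  have -> : (E * (c * y 0 - s * x 0) - 1 * (1 * y 0 - 0 * x 0)) =
            (- (E * s) * x 0 + (E * c - 1) * y 0) by ring.
  rewrite /K [_ * _ * (pi *+ 2)]mulrAC; apply => t tP.
  by rewrite -mulrN; apply: bnd => //; rewrite normrN.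
Qed.

(** Translating time makes any t the initial time, so the bound on initial values holds everywhere.
    The constant depends on al and be alone, not on the solution. *)
Lemma cplx_ode_bound al be : nonres al be ->
  exists2 C, 0 <= C & forall x y h1 h2 B, cplx_ode al be x y h1 h2 ->
    (forall t, `|h1 t| <= B) -> (forall t, `|h2 t| <= B) ->
    forall t, `|x t| <= C * B /\ `|y t| <= C * B.
Proof.
move=> nr; have /= := det_nonres nr.
set E := expR _; set c := cos _; set s := sin _; set D := _ + _ => D0.
pose K := 2 * expR (`|al| * (pi *+ 2)) * (pi *+ 2).
have P := pi2_gt0 R.
have K0 : 0 <= K by rewrite !mulr_ge0// ?expR_ge0// ltW.
exists ((`|E * c - 1| + `|E * s|) * K / D).
  apply: divr_ge0; [apply: mulr_ge0 => //; exact: addr_ge0|exact: ltW].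
move=> x y h1 h2 B ode hB1 hB2 t.
have /= := @cplx_ode_bound0 _ _ _ _ _ _ B (cplx_ode_shift t ode) (fun=> hB1 _) (fun=> hB2 _).
rewrite add0r -/E -/c -/s -/K; set d1 := _ + _; set d2 := _ + _ => -[b1 b2].
have Dn : D != 0 by rewrite gt_eqF.
have key u v : `|u| <= `|E * c - 1| -> `|v| <= `|E * s| -> forall d d', `|d| <= K * B -> `|d'| <= K * B ->
   `|(u * d + v * d') / D| <= (`|E * c - 1| + `|E * s|) * K / D * B.
  move=> uE vE d d' dB dB'; rewrite normrM normfV (ger0_norm (ltW D0)) mulrAC ler_wpM2r//.
    by rewrite invr_ge0 ltW.
  rewrite -mulrA mulrDl (le_trans (ler_normD _ _))// (normrM u) (normrM v).
  by apply: lerD; apply: ler_pM.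
(* Cramer's rule for the system with rows (E c - 1, E s) and (- E s, E c - 1), of determinant D. *)
have -> : x t = ((E * c - 1) * d1 + - (E * s) * d2) / D.
  apply: (mulIf Dn); rewrite mulfVK// /d1 /d2 /D; ring.
have -> : y t = ((E * c - 1) * d2 + (E * s) * d1) / D.
  apply: (mulIf Dn); rewrite mulfVK// /d1 /d2 /D; ring.
by split; apply: key; rewrite ?normrN.
Qed.

(** By Rolle the derivative vanishes somewhere, and there c = - h. This is how periodicity bounds
    the secular terms. *)
Lemma periodic_slope f (c B : R) h : periodic f ->
  (forall t : R, is_derive t 1 f (c + h t)) -> (forall t, `|h t| <= B) -> `|c| <= B.
Proof.
move=> pf df hB; have [||||x _ dx] := @Rolle R f 0 (pi *+ 2).
- exact: pi2_gt0.
- by move=> x _; exact: ex_derive.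
- by apply: continuous_subspaceT; exact: is_derive_cont df.
- by rewrite -[X in _ = f X]add0r pf.
have := df x => dfx; have := @derive_val _ _ _ _ _ _ _ dx.
rewrite derive_val => /eqP; rewrite addr_eq0 => /eqP ->.
by rewrite normrN.
Qed.

(** With zero mean, f t is the average of f t - f s over s, and two values of f differ by at most
    the period times the bound on the derivative. *)
Lemma mean_zero_bound f df (B : R) : periodic f -> avg f = 0 ->
  (forall t : R, is_derive t 1 f (df t)) -> (forall t, `|df t| <= B) ->
  forall t, `|f t| <= pi *+ 2 * B.
Proof.
move=> pf f0 dfd dB t; have cf := is_derive_cont dfd.
have -> : f t = avg (fun s => f t - f s).
  by rewrite avgB ?avg_cst ?f0 ?subr0//; exact: cont_cst.
apply: avg_bound; first by apply: contD; [exact: cont_cst|exact: contN].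
move=> s; have [y /andP[y1 y2] <-] := periodic_reduce t s pf.
rewrite distrC (le_trans (mvt_bound y1 dfd (fun u _ => dB u)))//.
by rewrite mulrC ler_wpM2r ?lerBlDl//; exact: le_trans (dB 0).
Qed.

(** 1 - cos (2 pi b) = 2 sin (pi b)^2, and the sine is positive on the open half period. *)
Lemma cos2pi_neq1 (b : R) : 0 < `|b| < 1 -> cos (pi *+ 2 * b) != 1.
Proof.
move=> /andP[b0 b1].
have -> : cos (pi *+ 2 * b) = cos (pi *+ 2 * `|b|).
  by case: (ger0P b) => // _; rewrite mulrN cosN.
have -> : pi *+ 2 * `|b| = (pi * `|b|) *+ 2 by rewrite mulrnAl.
have p0 := pi_gt0 R.
have : 0 < sin (pi * `|b|) by rewrite sin_gt0_pi// ?mulr_gt0// gtr_pMr.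
rewrite cos_mulr2n => /(exprn_gt0 2) s0; apply/eqP => c1.
have := cos2Dsin2 (pi * `|b|); lra.
Qed.

(** The frequencies 3 omega and 4 omega may exceed 1 when omega < 1/2; they are brought back by one
    period. *)
Lemma cos2pi_neq1' (b : R) : 1 < b < 2 -> cos (pi *+ 2 * b) != 1.
Proof.
move=> /andP[b1 b2]; rewrite -[b](subrK 1) mulrDr mulr1 cosD2pi.
by apply: cos2pi_neq1; rewrite ger0_norm; lra.
Qed.

End ODE.

(** * The block systems of a Fourier mode *)

Section Modes.
Variable R : realType.

(** System of the cosine and sine coefficients of one phi-mode, g being m omega*. In complex form it
    reads (a - i b)' = (M - i g) (a - i b) + (fa - i fb). *)
Definition msys (m : nat) (M : 'M[R]_m) (g : R) (a b fa fb : R -> 'cV[R]_m) : Prop :=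
  [/\ periodic a, periodic b,
    forall (t : R) i, is_derive t 1 (fun s => a s i 0)
       ((M *m a t) i 0 - g * b t i 0 + fa t i 0)
  & forall (t : R) i, is_derive t 1 (fun s => b s i 0)
       ((M *m b t) i 0 + g * a t i 0 + fb t i 0)].

Lemma rotmxE (x y : R) (u : 'cV[R]_2) :
  ((rotmx x y *m u) 0 0 = x * u 0 0 - y * u 1 0) *
  ((rotmx x y *m u) 1 0 = y * u 0 0 + x * u 1 0).
Proof.
have l1 : lift ord0 ord0 = 1 :> 'I_2 by exact/val_inj.
by rewrite !mxE !big_ord_recl !big_ord0 !mxE /= l1 !addr0 mulNr.
Qed.

Lemma cv2E (x y : R) : (cv2 x y 0 0 = x) * (cv2 x y 1 0 = y).
Proof. by rewrite !mxE. Qed.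

Lemma ord2P (i : 'I_2) : i = 0 \/ i = 1.
Proof. by case: i => [[|[|//]]] H; [left|right]; apply/val_inj. Qed.

Lemma periodic_cmp (T U : Type) (h : T -> U) (f : R -> T) : periodic f ->
  periodic (fun t => h (f t)).
Proof. by move=> pf t; rewrite pf. Qed.

Lemma ler_norm2 (x y B C : R) : `|x| <= B -> `|y| <= C -> `|x + y| <= B + C.
Proof. by move=> xB yB; rewrite (le_trans (ler_normD _ _))// lerD. Qed.

Lemma ler_norm2B (x y B C : R) : `|x| <= B -> `|y| <= C -> `|x - y| <= B + C.
Proof. by move=> xB yB; rewrite (le_trans (ler_normB _ _))// lerD. Qed.

Lemma half_sum (x y X Y C : R) : X = x + y -> Y = x - y ->
  `|X| <= C -> `|Y| <= C -> `|x| <= C /\ `|y| <= C.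
Proof. move=> -> ->; rewrite !ler_norml => /andP[? ?] /andP[? ?]; split; lra. Qed.

(* In the variables a_0 +- b_1, a_1 -+ b_0 the system splits into two rotations
   with frequencies w - g and w + g. *)
Lemma hat_bound (w g : R) : nonres 0 (w - g) -> nonres 0 (w + g) ->
  exists2 C, 0 <= C & forall a b fa fb B, msys (rotmx 0 w) g a b fa fb ->
    (forall t i, `|fa t i 0| <= B) -> (forall t i, `|fb t i 0| <= B) ->
    forall t i, `|a t i 0| <= C * B /\ `|b t i 0| <= C * B.
Proof.
move=> /cplx_ode_bound[C1 C10 H1] /cplx_ode_bound[C2 C20 H2].
exists (2 * C1 + 2 * C2) => [|a b fa fb B [pa pb da db] faB fbB t i].
  by apply: addr_ge0; apply: mulr_ge0.
have B0 : 0 <= B := le_trans (normr_ge0 _) (faB 0 0).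
have [|u|u|u1 u2] := H1 (fun t => a t 0 0 + b t 1 0) (fun t => a t 1 0 - b t 0 0)
  (fun t => fa t 0 0 + fb t 1 0) (fun t => fa t 1 0 - fb t 0 0) (2 * B) _ _ _ t.
- split.
  + by move=> s; rewrite pa pb.
  + by move=> s; rewrite pa pb.
  + move=> s; have d1 := da s 0; have d2 := db s 1; apply: is_derive_eq.
    by rewrite !rotmxE; ring.
  + move=> s; have d1 := da s 1; have d2 := db s 0; apply: is_derive_eq.
    by rewrite !rotmxE; ring.
- by rewrite mulr2n mulrDl mul1r ler_norm2.
- by rewrite mulr2n mulrDl mul1r ler_norm2B.
have [|u|u|v1 v2] := H2 (fun t => a t 0 0 - b t 1 0) (fun t => a t 1 0 + b t 0 0)
  (fun t => fa t 0 0 - fb t 1 0) (fun t => fa t 1 0 + fb t 0 0) (2 * B) _ _ _ t.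
- split.
  + by move=> s; rewrite pa pb.
  + by move=> s; rewrite pa pb.
  + move=> s; have d1 := da s 0; have d2 := db s 1; apply: is_derive_eq.
    by rewrite !rotmxE; ring.
  + move=> s; have d1 := da s 1; have d2 := db s 0; apply: is_derive_eq.
    by rewrite !rotmxE; ring.
- by rewrite mulr2n mulrDl mul1r ler_norm2B.
- by rewrite mulr2n mulrDl mul1r ler_norm2.
have e1 : C1 * (2 * B) <= (2 * C1 + 2 * C2) * B.
  by have := mulr_ge0 C20 B0; lra.
have e2 : C2 * (2 * B) <= (2 * C1 + 2 * C2) * B.
  by have := mulr_ge0 C10 B0; lra.
move: (le_trans u1 e1) (le_trans u2 e1) (le_trans v1 e2) (le_trans v2 e2) => {}u1 {}u2 {}v1 {}v2.
have [A0 B1] := half_sum erefl erefl u1 v1.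
have [A1 B0'] := half_sum erefl erefl v2 u2.
by case: (ord2P i) => ->.
Qed.

(* At g = w one of the two rotations is trivial: periodicity determines the
   secular terms m1 and m2, and the two means determine the solution. *)
Lemma hat_res_bound (w : R) : nonres 0 (w + w) ->
  exists2 C, 0 <= C & forall a b fa fb m1 m2 B,
    msys (rotmx 0 w) w a b (fun t => cv2 m1 m2 + fa t) (fun t => cv2 (- m2) m1 + fb t) ->
    avg (fun t => a t 0 0 + b t 1 0) = 0 -> avg (fun t => a t 1 0 - b t 0 0) = 0 ->
    (forall t i, `|fa t i 0| <= B) -> (forall t i, `|fb t i 0| <= B) ->
    [/\ `|m1| <= C * B, `|m2| <= C * B &
    forall t i, `|a t i 0| <= C * B /\ `|b t i 0| <= C * B].
Proof.
move=> /cplx_ode_bound[C2 C20 H2].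
have P := pi2_gt0 R.
exists (1 + 4 * (pi *+ 2) + 2 * C2) => [|a b fa fb m1 m2 B [pa pb da db] av1 av2 faB fbB].
  by have := mulr_ge0 (ler0n R 2) C20; lra.
have B0 : 0 <= B := le_trans (normr_ge0 _) (faB 0 0).
have PB := mulr_ge0 (ltW P) B0.
have CB := mulr_ge0 C20 B0.
pose x t := a t 0 0 + b t 1 0; pose y t := a t 1 0 - b t 0 0.
pose hx t := fa t 0 0 + fb t 1 0; pose hy t := fa t 1 0 - fb t 0 0.
have px : periodic x by move=> s; rewrite /x pa pb.
have py : periodic y by move=> s; rewrite /y pa pb.
have hxB s : `|hx s| <= 2 * B by rewrite mulr2n mulrDl mul1r ler_norm2.
have hyB s : `|hy s| <= 2 * B by rewrite mulr2n mulrDl mul1r ler_norm2B.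
have dx (s : R) : is_derive s 1 x (2 * m1 + hx s).
  have d1 := da s 0; have d2 := db s 1; apply: is_derive_eq.
  by rewrite !rotmxE !mxE /= /hx; ring.
have dy (s : R) : is_derive s 1 y (2 * m2 + hy s).
  have d1 := da s 1; have d2 := db s 0; apply: is_derive_eq.
  by rewrite !rotmxE !mxE /= /hy; ring.
have s1 := periodic_slope px dx hxB; have s2 := periodic_slope py dy hyB.
have bx s : `|x s| <= pi *+ 2 * (2 * B + 2 * B).
  by apply: mean_zero_bound px av1 dx _ s => u; apply: ler_norm2.
have by_ s : `|y s| <= pi *+ 2 * (2 * B + 2 * B).
  by apply: mean_zero_bound py av2 dy _ s => u; apply: ler_norm2.
have m1B : `|m1| <= B by move: s1; rewrite normrM ger0_norm//; lra.
have m2B : `|m2| <= B by move: s2; rewrite normrM ger0_norm//; lra.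
split; [by apply: le_trans m1B _; lra|by apply: le_trans m2B _; lra|move=> t i].
have [|u|u|v1 v2] := H2 (fun t => a t 0 0 - b t 1 0) (fun t => a t 1 0 + b t 0 0)
  (fun t => fa t 0 0 - fb t 1 0) (fun t => fa t 1 0 + fb t 0 0) (2 * B) _ _ _ t.
- split.
  + by move=> s; rewrite pa pb.
  + by move=> s; rewrite pa pb.
  + move=> s; have d1 := da s 0; have d2 := db s 1; apply: is_derive_eq.
    by rewrite !rotmxE !mxE /=; ring.
  + move=> s; have d1 := da s 1; have d2 := db s 0; apply: is_derive_eq.
    by rewrite !rotmxE !mxE /=; ring.
- by rewrite mulr2n mulrDl mul1r ler_norm2B.
- by rewrite mulr2n mulrDl mul1r ler_norm2.
set C := 1 + _ + _.
have e1 : pi *+ 2 * (2 * B + 2 * B) <= C * B by rewrite /C; lra.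
have e2 : C2 * (2 * B) <= C * B by rewrite /C; lra.
move: (le_trans (bx t) e1) (le_trans (by_ t) e1) (le_trans v1 e2) (le_trans v2 e2).
move=> u1 u2 {}v1 {}v2.
have [A0 B1] := half_sum erefl erefl u1 v1.
have [A1 B0'] := half_sum erefl erefl v2 u2.
by case: (ord2P i) => ->.
Qed.

Lemma ring_mean_bound (a f : R -> R) (eta B : R) : periodic a -> avg a = 0 ->
  (forall t : R, is_derive t 1 a (- eta + f t)) -> (forall t, `|f t| <= B) ->
  `|eta| <= B /\ forall t, `|a t| <= pi *+ 2 * (2 * B).
Proof.
move=> pa a0 da fB; have := periodic_slope pa da fB; rewrite normrN => eB.
split=> // t; apply: mean_zero_bound pa a0 da _ t => t.
by rewrite mulr2n mulrDl mul1r ler_norm2// normrN.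
Qed.

Section Tilde.
Variables (k : nat) (A : 'M[R]_k) (g : R).

(* Real and imaginary parts of l (a - i b). *)
Definition rfun (l : 'rV[R[i]]_k) (a b : 'cV[R]_k) : R :=
  \sum_j (complex.Re (l 0 j) * a j 0 + complex.Im (l 0 j) * b j 0).
Definition ifun (l : 'rV[R[i]]_k) (a b : 'cV[R]_k) : R :=
  \sum_j (complex.Im (l 0 j) * a j 0 - complex.Re (l 0 j) * b j 0).

Lemma rfun_bound l : exists2 C, 0 <= C & forall (a b : 'cV[R]_k) B,
  (forall i, `|a i 0| <= B) -> (forall i, `|b i 0| <= B) ->
  `|rfun l a b| <= C * B /\ `|ifun l a b| <= C * B.
Proof.
exists (\sum_j (`|complex.Re (l 0 j)| + `|complex.Im (l 0 j)|)).
  by apply: sumr_ge0 => j _; apply: addr_ge0.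
move=> a b B aB bB; split.
- rewrite mulr_suml; apply: le_trans (ler_norm_sum _ _ _) _; apply: ler_sum => j _.
  by rewrite mulrDl; apply: ler_norm2; rewrite normrM ler_wpM2l.
- rewrite mulr_suml; apply: le_trans (ler_norm_sum _ _ _) _; apply: ler_sum => j _.
  by rewrite mulrDl addrC; apply: ler_norm2; rewrite ?normrN normrM ler_wpM2l.
Qed.

Lemma sumRe (I : finType) (F : I -> R[i]) :
  (complex.Re (\sum_i F i) = \sum_i complex.Re (F i)) *
  (complex.Im (\sum_i F i) = \sum_i complex.Im (F i)).
Proof.
split; elim/big_rec2: _ => // i x y _ <-; by case: (F i) => ? ?; case: y.
Qed.

Lemma complexM_real (z : R[i]) (x : R) :
  (complex.Re (z * real_complex R x) = complex.Re z * x) *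
  (complex.Im (z * real_complex R x) = complex.Im z * x).
Proof. by case: z => u v /=; rewrite !mulr0 subr0 add0r. Qed.

Lemma rfun_mul l (a b : 'cV[R]_k) :
  (rfun (l *m map_mx (real_complex R) A) a b = rfun l (A *m a) (A *m b)) *
  (ifun (l *m map_mx (real_complex R) A) a b = ifun l (A *m a) (A *m b)).
Proof.
have E (f : R[i] -> R) (u : 'cV[R]_k) : (forall z x, f (z * real_complex R x) = f z * x) ->
  (forall F : 'I_k -> R[i], f (\sum_i F i) = \sum_i f (F i)) ->
   \sum_j f ((l *m map_mx (real_complex R) A) 0 j) * u j 0 =
   \sum_j f (l 0 j) * (A *m u) j 0.
  move=> fM fS; under eq_bigr do rewrite mxE fS mulr_suml.
  rewrite exchange_big /=; apply: eq_bigr => j _.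
  rewrite mxE mulr_sumr; apply: eq_bigr => i _.
  by rewrite mxE fM mulrA.
have Er u := @E (@complex.Re R) u (fun z x => (complexM_real z x).1) (fun F => (sumRe F).1).
have Ei u := @E (@complex.Im R) u (fun z x => (complexM_real z x).2) (fun F => (sumRe F).2).
by rewrite /rfun /ifun !sumrB !big_split /= !Er !Ei.
Qed.

Lemma rfunB l l' (a b : 'cV[R]_k) :
  (rfun (l - l') a b = rfun l a b - rfun l' a b) *
  (ifun (l - l') a b = ifun l a b - ifun l' a b).
Proof.
split; rewrite -sumrB; apply: eq_bigr => j _; rewrite !mxE.
  by case: (l 0 j) => ? ?; case: (l' 0 j) => ? ? /=; ring.
by case: (l 0 j) => ? ?; case: (l' 0 j) => ? ? /=; ring.
Qed.

Lemma rfunZ (c : R[i]) l (a b : 'cV[R]_k) :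
  (rfun (c *: l) a b = complex.Re c * rfun l a b - complex.Im c * ifun l a b) *
  (ifun (c *: l) a b = complex.Im c * rfun l a b + complex.Re c * ifun l a b).
Proof.
split; rewrite !mulr_sumr -?sumrB -?big_split; apply: eq_bigr => j _; rewrite !mxE.
  by case: (l 0 j) => ? ?; case: c => ? ? /=; ring.
by case: (l 0 j) => ? ?; case: c => ? ? /=; ring.
Qed.

Lemma rfunD l (a b a' b' : 'cV[R]_k) :
  (rfun l (a + a') (b + b') = rfun l a b + rfun l a' b') *
  (ifun l (a + a') (b + b') = ifun l a b + ifun l a' b').
Proof.
by split; rewrite -big_split; apply: eq_bigr => j _; rewrite !mxE /=; ring.
Qed.

Lemma rfun_rot l (a b : 'cV[R]_k) (c : R) :
  (rfun l (- (c *: b)) (c *: a) = c * ifun l a b) *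
  (ifun l (- (c *: b)) (c *: a) = - c * rfun l a b).
Proof.
by split; rewrite mulr_sumr; apply: eq_bigr => j _; rewrite !mxE; ring.
Qed.

(** For the first factor z put l' = l A - z l. The scalar l (a - i b) then solves an equation with
    exponent z - i g, forced by l' (a - i b) and by the given forcing; l' is handled by induction
    and the last row is 0. Since Re z is nonzero the exponent is nonresonant for every frequency
    g. *)
Lemma row_bound (s : seq R[i]) (l : 'rV[R[i]]_k) :
  (forall z, z \in s -> complex.Re z != 0) ->
  foldl (fun l' z => l' *m map_mx (real_complex R) A - z *: l') l s = 0 ->
  exists2 C, 0 <= C & forall a b fa fb B, msys A g a b fa fb ->
    (forall t i, `|fa t i 0| <= B) -> (forall t i, `|fb t i 0| <= B) ->
    forall t, `|rfun l (a t) (b t)| <= C * B /\ `|ifun l (a t) (b t)| <= C * B.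
Proof.
elim: s l => [|z s IH] l zs /= l0.
  exists 0 => // a b fa fb B _ _ _ t; rewrite l0.
  have -> : rfun 0 (a t) (b t) = 0.
    by apply: big1 => j _; rewrite !mxE /= !mul0r addr0.
  have -> : ifun 0 (a t) (b t) = 0.
    by apply: big1 => j _; rewrite !mxE /= !mul0r subr0.
  by rewrite normr0 mul0r.
set l' := _ - _ in l0; have [|C1 C10 H1] := IH l' _ l0.
  by move=> y ys; apply: zs; rewrite inE ys orbT.
have nr : nonres (complex.Re z) (complex.Im z - g).
  by left; apply: zs; rewrite inE eqxx.
have [C2 C20 H2] := cplx_ode_bound nr; have [C3 C30 H3] := rfun_bound l.
exists (C2 * (C1 + C3)) => [|a b fa fb B ms faB fbB t].
  by apply: mulr_ge0 => //; apply: addr_ge0.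
have H1' := H1 _ _ _ _ _ ms faB fbB.
rewrite -mulrA; apply: (H2 (fun t => rfun l (a t) (b t)) (fun t => ifun l (a t) (b t))
   (fun t => rfun l' (a t) (b t) + rfun l (fa t) (fb t))
   (fun t => ifun l' (a t) (b t) + ifun l (fa t) (fb t))).
- case: ms => pa pb da db; split.
  + by move=> u; rewrite pa pb.
  + by move=> u; rewrite pa pb.
  + move=> u; rewrite [X in is_derive _ _ _ X](_ : _ = rfun l (A *m a u + (- (g *: b u) + fa u))
       (A *m b u + (g *: a u + fb u))); last first.
      by rewrite !rfunD rfun_rot -rfun_mul /l' rfunB rfunZ; ring.
    apply: is_derive_sumf => j; apply: is_deriveDf; apply: is_deriveCf.
        by have := da u j; rewrite !mxE !addrA.
      by have := db u j; rewrite !mxE !addrA.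
  + move=> u; rewrite [X in is_derive _ _ _ X](_ : _ = ifun l (A *m a u + (- (g *: b u) + fa u))
       (A *m b u + (g *: a u + fb u))); last first.
      by rewrite !rfunD rfun_rot -rfun_mul /l' rfunB rfunZ; ring.
    apply: is_derive_sumf => j; apply: is_deriveBf; apply: is_deriveCf.
        by have := da u j; rewrite !mxE !addrA.
      by have := db u j; rewrite !mxE !addrA.
- move=> u; rewrite mulrDl; apply: ler_norm2; first by case: (H1' u).
  by case: (H3 (fa u) (fb u) B).
- move=> u; rewrite mulrDl; apply: ler_norm2; first by case: (H1' u).
  by case: (H3 (fa u) (fb u) B).
Qed.

Hypothesis hyp : forall w : R,
  ~~ eigenvalue (map_mx (real_complex R) A) (Complex 0 w).

(* Cayley-Hamilton: the factors X - z over the eigenvalues z kill every row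
   vector, which reduces the tilde block to scalar equations. *)
Lemma hyp_annihilator : exists2 s : seq R[i], (forall z, z \in s -> complex.Re z != 0)
  & forall l : 'rV[R[i]]_k, foldl (fun l' z => l' *m map_mx (real_complex R) A - z *: l') l s = 0.
Proof.
case: k A hyp => [|k'] M hM.
  by exists [::] => // l; rewrite thinmx0.
set N := map_mx _ M in hM *.
have [s es] := closed_field_poly_normal (char_poly N).
exists s => [z zs|l].
  apply/negP => /eqP z0; have := hM (complex.Im z).
  rewrite eigenvalue_root_char es => /negP; apply.
  rewrite (monicP (char_poly_monic N)) scale1r root_prod_XsubC.
  suff -> : Complex 0 (complex.Im z) = z by [].
  by move: z0; case: (z) => x y /= ->.
have := Cayley_Hamilton N; rewrite es (monicP (char_poly_monic N)) scale1r => CH.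
have -> : foldl (fun l' z => l' *m N - z *: l') l s = l *m horner_mx N (\prod_(z <- s) ('X - z%:P)).
  elim: s l {es CH} => [|z s IH] l /=.
    by rewrite big_nil rmorph1 mulmx1.
  rewrite IH big_cons rmorphM /= mulmxA; congr (_ *m _).
  by rewrite rmorphB /= horner_mx_X horner_mx_C mulmxBr mul_mx_scalar.
by rewrite CH mulmx0.
Qed.

(** Applied to the unit rows, for which [rfun] and [ifun] are a_j and - b_j. *)
Lemma til_bound : exists2 C, 0 <= C & forall a b fa fb B, msys A g a b fa fb ->
    (forall t i, `|fa t i 0| <= B) -> (forall t i, `|fb t i 0| <= B) ->
    forall t i, `|a t i 0| <= C * B /\ `|b t i 0| <= C * B.
Proof.
have [s zs ls] := hyp_annihilator.
have H (j : 'I_k) : {C | 0 <= C & forall a b fa fb B, msys A g a b fa fb ->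
    (forall t i, `|fa t i 0| <= B) -> (forall t i, `|fb t i 0| <= B) ->
    forall t, `|a t j 0| <= C * B /\ `|b t j 0| <= C * B}.
  have [C C0 HC] := cid2 (row_bound zs (ls (delta_mx 0 j))).
  exists C => // a b fa fb B ms faB fbB t; have := HC _ _ _ _ _ ms faB fbB t.
  have -> : rfun (delta_mx 0 j) (a t) (b t) = a t j 0.
    rewrite /rfun (bigD1 j)//= !mxE !eqxx /= mul1r mul0r addr0 big1 ?addr0// => i ij.
    by rewrite !mxE (negbTE ij) andbF /= !mul0r addr0.
  have -> : ifun (delta_mx 0 j) (a t) (b t) = - b t j 0.
    rewrite /ifun (bigD1 j)//= !mxE !eqxx /= mul1r mul0r sub0r big1 ?addr0// => i ij.
    by rewrite !mxE (negbTE ij) andbF /= !mul0r subr0.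
  by rewrite normrN.
exists (\sum_j s2val (H j)); first by apply: sumr_ge0 => j _; exact: (s2valP (H j)).
move=> a b fa fb B ms faB fbB t i.
have [] := s2valP' (H i) _ _ _ _ _ ms faB fbB t.
have : s2val (H i) * B <= (\sum_j s2val (H j)) * B.
  rewrite ler_wpM2r ?(le_trans _ (faB 0 i))// (bigD1 i)//= lerDl.
  by apply: sumr_ge0 => j _; exact: (s2valP (H j)).
by move=> h h1 h2; split; apply: le_trans h.
Qed.

End Tilde.

End Modes.

(** * Directional derivatives and Taylor expansion *)

Section LineDerivative.
Variables (R : realType) (V : normedModType R).
Implicit Types (f g : V -> R) (x u w : V).

Lemma is_derive_lineP f x u (d : R) :
  is_derive x u f d <-> is_derive (0 : R) (1 : R) (fun h : R => f (h *: u + x)) d.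
Proof.
have E : (fun h : R => h^-1 *: (((fun h : R => f (h *: u + x)) \o shift (0 : R)) (h *: (1 : R)) - f (0 *: u + x)))
  = (fun h : R => h^-1 *: ((f \o shift x) (h *: u) - f x)).
  by apply/funext => h /=; rewrite scale0r add0r addr0 [h *: 1]mulr1.
split=> -[d1 d2]; split.
- by rewrite /derivable E.
- by rewrite /derive E.
- by move: d1; rewrite /derivable E.
- by move: d2; rewrite /derive E.
Qed.

Lemma is_derive_line f x u (s d : R) : is_derive (x + s *: u) u f d ->
  is_derive s (1 : R) (fun h : R => f (x + h *: u)) d.
Proof.
move/is_derive_lineP => D; have := @is_derive_shf R _ s (- s) d.
rewrite subrr => /(_ _ D); congr (is_derive _ _ _ _); apply/funext => h.
by congr f; rewrite addrCA -scalerDl subrK.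
Qed.

Lemma is_deriveZdir f x u (c d : R) : is_derive x u f d ->
  is_derive x (c *: u) f (c * d).
Proof.
move/is_derive_lineP => D; apply/is_derive_lineP.
have d1 : is_derive (0 : R) (1 : R) (fun h => c * h) c.
  by have := is_deriveCf c (is_derive_id (0 : R) (1 : R)); rewrite mulr1.
have := @is_derive1_comp _ (fun h : R => f (h *: u + x)) (fun h => c * h) (0 : R) d c.
rewrite mulr0 => /(_ D d1); rewrite mulrC; congr (is_derive _ _ _ _).
by apply/funext => h /=; rewrite scalerA mulrC.
Qed.

Lemma mvt_segment_line f x u (df : V -> R) :
  (forall s : R, 0 <= s <= 1 -> is_derive (x + s *: u) u f (df (x + s *: u))) ->
  exists2 s : R, 0 <= s <= 1 & f (x + u) - f x = df (x + s *: u).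
Proof.
move=> D; pose ph (s : R) := f (x + s *: u).
have dph (s : R) : 0 <= s <= 1 -> is_derive s 1 ph (df (x + s *: u)).
  by move=> s01; apply: is_derive_line; exact: D.
have [s| |c] := @MVT_segment R ph (fun s => df (x + s *: u)) 0 1 ler01.
- by rewrite in_itv /= => /andP[s0 s1]; apply: dph; rewrite !ltW.
- apply: derivable_within_continuous => s; rewrite in_itv /= => s01.
  by have := dph s s01 => H; exact: ex_derive.
rewrite in_itv /= => c01; rewrite /ph scale1r scale0r addr0 subr0 mulr1 => E.
by exists c.
Qed.

Lemma mvt_line f x u (df : V -> R) : (forall y, is_derive y u f (df y)) ->
  exists2 s : R, 0 <= s <= 1 & f (x + u) - f x = df (x + s *: u).
Proof. by move=> D; apply: mvt_segment_line => s _. Qed.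

(** The increment along u + w is split into a leg along u from x and a leg along w from the
    displaced point. Continuity of the second directional derivative makes the displacement
    harmless, so linearity in the direction follows from [class_C] without Frechet derivatives. *)
Lemma is_deriveDdir f x u w (df dg : V -> R) :
  (forall y, is_derive y u f (df y)) -> (forall y, is_derive y w f (dg y)) ->
  {for x, continuous dg} -> is_derive x (u + w) f (df x + dg x).
Proof.
move=> Du Dw cw.
suff H : h^-1 *: ((f \o shift x) (h *: (u + w)) - f x) @[h --> (0 : R)^'] --> df x + dg x.
  by split; [exact: cvgP H|exact: cvg_lim H].
have Hu : h^-1 *: ((f \o shift x) (h *: u) - f x) @[h --> (0 : R)^'] --> df x.
  by rewrite -(@derive_val _ _ _ _ _ _ _ (Du x)); exact: (@ex_derive _ _ _ _ _ _ _ (Du x)).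
apply: (@cvg_trans _ ((fun h => h^-1 *: ((f \o shift x) (h *: u) - f x) +
     h^-1 *: (f (h *: u + x + h *: w) - f (h *: u + x))) @ (0 : R)^')).
  apply: near_eq_cvg; near=> h => /=.
  by rewrite -scalerDr [X in _ *: X]addrC addrA subrK [h *: (u + w)]scalerDr [h *: u + x + _]addrAC.
apply: cvgD => //; apply/cvgrPdist_le => /= e e0.
have /cvgrPdist_le/(_ _ e0) := cw; rewrite -nbhs_nearE => /nbhs_ballP[d /= d0 Hd].
near=> h.
have h0 : h != 0 by near: h; exact: nbhs_dnbhs_neq.
(* The second leg is a value of dg at a point within |h| (|u| + |w|) of x, where continuity
   applies. *)
have [s /andP[s0 s1] ->] := mvt_line (h *: u + x) (fun y => is_deriveZdir h (Dw y)).
rewrite -[_ *: _]/(_ * _) mulrA mulVf// mul1r.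
apply: Hd; rewrite -ball_normE /ball_ /= opprD addrA [_ + x]addrC opprD addrA subrr sub0r -opprD normrN.
rewrite scalerA mulrC -scalerA -scalerDr normrZ.
apply: (@le_lt_trans _ _ (`|h| * (`|u| + `|w|))).
  rewrite ler_wpM2l// (le_trans (ler_normD _ _))// lerD2l normrZ ger0_norm//.
  by rewrite ler_piMl.
apply: (@le_lt_trans _ _ (`|h| * (`|u| + `|w| + 1))).
  by rewrite ler_wpM2l// lerDl.
rewrite -ltr_pdivlMr; last by rewrite ltr_wpDl// addr_ge0.
near: h; apply: dnbhs0_lt; rewrite divr_gt0// ltr_wpDl// addr_ge0//.
Unshelve. all: by end_near. Qed.

End LineDerivative.

Section Taylor.
Variable R : realType.

(** Induction on N: the derivative of the remainder of ph is the remainder of its derivative, one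
    order lower, and both start at 0. The factor 1/N! is given away. *)
Lemma taylor1 (N : nat) (ph : nat -> R -> R) (C : R) :
  (forall j (s : R), is_derive s 1 (ph j) (ph j.+1 s)) ->
  (forall s, 0 <= s <= 1 -> `|ph N s| <= C) ->
  forall s, 0 <= s <= 1 -> `|ph 0%N s - \sum_(j < N) ph j 0 * s ^+ j / j`!%:R| <= C.
Proof.
elim: N ph => [|N IH] ph D B s s01; first by rewrite big_ord0 subr0 B.
have /andP[s0 s1] := s01.
have {IH} := IH (fun j => ph j.+1) (fun j => D j.+1) B => IH.
pose q s := ph 0%N s - \sum_(j < N.+1) ph j 0 * s ^+ j / j`!%:R.
have dq (t : R) : is_derive t 1 q (ph 1%N t - \sum_(j < N) ph j.+1 0 * t ^+ j / j`!%:R).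
  apply: (@is_deriveBf _ (ph 0%N)).
  have -> : (fun s0 => \sum_(j < N.+1) ph j 0 * s0 ^+ j / j`!%:R) =
      (fun s0 => ph 0%N 0 + \sum_(j < N) (ph j.+1 0 / j.+1`!%:R) * s0 ^+ j.+1).
    apply/funext => u; rewrite big_ord_recl /= expr0 fact0 mulr1 divr1; congr (_ + _).
    by apply: eq_bigr => j _; rewrite mulrAC.
  rewrite -[X in is_derive _ _ _ X]add0r; apply: is_deriveDf.
  apply: is_derive_sumf => j.
  rewrite [X in is_derive _ _ _ X](_ : _ = (ph j.+1 0 / j.+1`!%:R) * (j.+1%:R * t ^+ j)).
    apply: is_deriveCf; split; first exact: exprn_derivable.
    by rewrite exp_derive [LHS]mulr1.
  rewrite factS natrM; field.
  by rewrite addrC natr1 !pnatr_eq0 -lt0n fact_gt0.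
have q0 : q 0 = 0.
  rewrite /q big_ord_recl /= expr0 fact0 mulr1 divr1 big1 ?addr0 ?subrr// => j _.
  by rewrite expr0n mulr0 mul0r.
have C0 : 0 <= C by apply: le_trans (B 0 _); rewrite ?lexx ?ler01.
have := @mvt_bound _ q _ 0 s C s0 dq; rewrite q0 !subr0 => H.
apply: le_trans (H _) _; last by rewrite ler_piMr.
move=> t /andP[t0 ts]; apply: IH; rewrite t0 /=; exact: le_trans s1.
Qed.

End Taylor.

(** * Iterated directional derivatives of smooth functions *)

Section Smooth.
Variables (R : realType) (V : normedModType R).
Implicit Types (f g : V -> R) (x u w : V).

Definition smoothT f := smooth_on setT f.

Lemma smoothT_cont f : smoothT f -> continuous f.
Proof. by move=> sf x; case: (sf 0%N) => + _; apply. Qed.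

Lemma smoothT_derivable f : smoothT f -> forall x u, is_derive x u f ('D_u f x).
Proof. by move=> sf x u; apply: derivableP; case: (sf 1%N) => _ /(_ u)[+ _]; apply. Qed.

Lemma smoothT_derive f u : smoothT f -> smoothT ('D_u f).
Proof. by move=> sf m; case: (sf m.+1) => _ /(_ u)[_]. Qed.

Lemma smoothT_deriveD f x u w : smoothT f -> 'D_(u + w) f x = 'D_u f x + 'D_w f x.
Proof.
move=> sf; apply: derive_val; apply: (@is_deriveDdir _ _ f x u w ('D_u f) ('D_w f)) => [y|y|].
- exact: smoothT_derivable.
- exact: smoothT_derivable.
- by apply: smoothT_cont; exact: smoothT_derive.
Qed.

Lemma smoothT_deriveZ f x u (c : R) : smoothT f -> 'D_(c *: u) f x = c * 'D_u f x.
Proof. by move=> sf; apply: derive_val; apply: is_deriveZdir; exact: smoothT_derivable. Qed.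

Lemma smoothT_derive_sum (I : Type) (r : seq I) f x (e : I -> V) : smoothT f ->
  'D_(\sum_(i <- r) e i) f x = \sum_(i <- r) 'D_(e i) f x.
Proof.
move=> sf; elim: r => [|i r IH]; first by rewrite !big_nil derive0.
by rewrite !big_cons smoothT_deriveD// IH.
Qed.

(** The head of the list is the direction differentiated first. *)
Fixpoint Dlist (us : seq V) f : V -> R :=
  if us is u :: us' then Dlist us' ('D_u f) else f.

Lemma Dlist_smooth us f : smoothT f -> smoothT (Dlist us f).
Proof. by elim: us f => //= u us IH f sf; apply: IH; exact: smoothT_derive. Qed.

Lemma Dlist_rcons us u f : Dlist (rcons us u) f = 'D_u (Dlist us f).
Proof. by elim: us f => //= w us IH f; rewrite IH. Qed.

Lemma Dlist_lin (I : Type) (r : seq I) us (F : I -> V -> R) (c : I -> R) :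
  (forall i, smoothT (F i)) ->
  Dlist us (fun x => \sum_(i <- r) c i * F i x) =
  (fun x => \sum_(i <- r) c i * Dlist us (F i) x).
Proof.
elim: us F => //= u us IH F sF.
rewrite (_ : 'D_u _ = fun x => \sum_(i <- r) c i * 'D_u (F i) x).
  by rewrite IH// => i; exact: smoothT_derive.
apply/funext => x; apply: derive_val.
have sD i : is_derive x u (F i) ('D_u (F i) x) by exact: smoothT_derivable.
elim: r {IH} => [|i r IHr].
  rewrite big_nil (_ : (fun y => _) = cst 0); first exact: is_derive_cst.
  by apply/funext => y; rewrite big_nil.
rewrite big_cons (_ : (fun y => _) = (c i *: F i) + (fun y => \sum_(j <- r) c j * F j y)).
  exact: is_deriveD.
by apply/funext => y; rewrite big_cons.
Qed.

Section Basis.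
Variables (B : finType) (e : B -> V) (co : B -> V -> R).
Hypothesis eco : forall u, u = \sum_b co b u *: e b.
Hypothesis coB : forall b u, `|co b u| <= `|u|.

Lemma Dlist_cons_basis u us f x : smoothT f ->
  Dlist (u :: us) f x = \sum_b co b u * Dlist us ('D_(e b) f) x.
Proof.
move=> sf /=; rewrite (_ : 'D_u f = fun x => \sum_b co b u * 'D_(e b) f x).
  by rewrite Dlist_lin// => b; exact: smoothT_derive.
apply/funext => y; rewrite {1}[u]eco smoothT_derive_sum//.
by apply: eq_bigr => b _; rewrite smoothT_deriveZ.
Qed.

Variable K : set V.
Hypothesis Kbnd : forall f, continuous f -> exists C : R, forall x, K x -> `|f x| <= C.

(** Expanding each direction in the finite basis leaves finitely many continuous functions to bound
    on K. *)
Lemma Dlist_bound (j : nat) f : smoothT f ->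
  exists2 C : R, 0 <= C & forall us x, size us = j -> K x ->
    `|Dlist us f x| <= C * \prod_(u <- us) `|u|.
Proof.
elim: j f => [|j IH] f sf.
  have [C HC] := Kbnd (smoothT_cont sf).
  exists `|C| => // us x /size0nil -> Kx; rewrite big_nil mulr1 /=.
  exact: le_trans (HC _ Kx) (ler_norm _).
have H b : {C : R | 0 <= C & forall us x, size us = j -> K x ->
    `|Dlist us ('D_(e b) f) x| <= C * \prod_(u <- us) `|u|}.
  by apply: cid2; apply: IH; exact: smoothT_derive.
exists (\sum_b s2val (H b)); first by apply: sumr_ge0 => b _; exact: (s2valP (H b)).
case=> [//|u us] x [sus] Kx; rewrite Dlist_cons_basis// big_cons.
rewrite mulr_suml; apply: le_trans (ler_norm_sum _ _ _) _; apply: ler_sum => b _.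
rewrite normrM mulrCA; apply: ler_pM => //.
by apply: (s2valP' (H b)).
Qed.

Lemma smooth_lip f : smoothT f -> (forall x y (s : R), K x -> K y -> 0 <= s <= 1 -> K (x + s *: (y - x))) ->
  exists2 C : R, 0 <= C & forall x y, K x -> K y -> `|f y - f x| <= C * `|y - x|.
Proof.
move=> sf Kcv; have [C C0 HC] := Dlist_bound 1 sf; exists C => // x y Kx Ky.
have [s s01] := mvt_line x (fun z => smoothT_derivable sf z (y - x)).
have -> : x + (y - x) = y by rewrite addrC subrK.
move=> ->.
by have := HC [:: y - x] (x + s *: (y - x)) erefl (Kcv _ _ _ Kx Ky s01); rewrite big_seq1.
Qed.

(** One-variable Taylor along the segment from x to x + u, each derivative along it being a [Dlist]
    with all directions equal to u. *)
Lemma smooth_taylor (N : nat) f : smoothT f ->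
  exists2 C : R, 0 <= C & forall x u, (forall s : R, 0 <= s <= 1 -> K (x + s *: u)) ->
   `|f (x + u) - \sum_(j < N) Dlist (nseq j u) f x / j`!%:R| <= C * `|u| ^+ N.
Proof.
move=> sf; have [C C0 HC] := Dlist_bound N sf; exists C => // x u Kxu.
pose ph j (s : R) := Dlist (nseq j u) f (x + s *: u).
have := @taylor1 R N ph (C * `|u| ^+ N) _ _ 1; rewrite ler01 lexx /ph => H.
have {}H := H _ _ isT; move: H; rewrite scale1r scale0r addr0.
rewrite (eq_bigr (fun j : 'I_N => Dlist (nseq j u) f x / j`!%:R)); last first.
  by move=> j _; rewrite expr1n mulr1.
apply=> [j s|s s01].
  apply: is_derive_line; rewrite (_ : nseq j.+1 u = rcons (nseq j u) u); last by elim: (j) => //= i <-.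
  rewrite Dlist_rcons.
  by apply: smoothT_derivable; exact: Dlist_smooth.
have := HC (nseq N u) (x + s *: u); rewrite size_nseq => /(_ erefl (Kxu _ s01)).
suff -> : \prod_(w <- nseq N u) `|w| = `|u| ^+ N by [].
by elim: (N) => [|M IH]; rewrite ?big_nil ?expr0//= big_cons IH exprS.
Qed.

End Basis.

End Smooth.

(** * Norms of matrices and Lipschitz dependence on lambda *)

Section MxNorm.
Variable R : realType.

Lemma mxnorm_le (m n : nat) (x : 'M[R]_(m, n)) (C : R) : 0 <= C ->
  (forall i j, `|x i j| <= C) -> `|x| <= C.
Proof.
by move=> C0 xC; rewrite [leLHS]/Num.Def.normr/= mx_normrE bigmax_le// => -[i j] _; exact: xC.
Qed.

Lemma mxnorm_ge (m n : nat) (x : 'M[R]_(m, n)) i j : `|x i j| <= `|x|.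
Proof.
rewrite [leRHS]/Num.Def.normr/= mx_normrE.
exact: (@le_bigmax _ _ _ _ (fun ij : 'I_m * 'I_n => `|x ij.1 ij.2|) (i, j)).
Qed.

Lemma mxnormM (m n p : nat) (A : 'M[R]_(m, n)) (B : 'M[R]_(n, p)) :
  `|A *m B| <= n%:R * `|A| * `|B|.
Proof.
apply: mxnorm_le => [|i j]; first by rewrite !mulr_ge0.
rewrite mxE (le_trans (ler_norm_sum _ _ _))//.
have -> : n%:R * `|A| * `|B| = \sum_(k < n) `|A| * `|B|.
  by rewrite sumr_const card_ord -mulrA mulr_natl.
by apply: ler_sum => k _; rewrite normrM ler_pM// mxnorm_ge.
Qed.

Lemma trmx_norm (m n : nat) (A : 'M[R]_(m, n)) : `|A^T| = `|A|.
Proof.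
apply/le_anti/andP; split; apply: mxnorm_le => // i j; rewrite ?mxE ?mxnorm_ge//.
by have := mxnorm_ge A^T j i; rewrite mxE.
Qed.

(** The ball is the image under transposition, an isometry, of a ball of row vectors, where bounded
    closed sets are compact. *)
Lemma compact_cV_ball (n : nat) (rho : R) : compact [set x : 'cV[R]_n | `|x| <= rho].
Proof.
have -> : [set x : 'cV[R]_n | `|x| <= rho] =
    (trmx : 'rV[R]_n -> 'cV[R]_n) @` [set x : 'rV[R]_n | `|x| <= rho].
  apply/seteqP; split => [x /= xr|_ /= [y yr <-]]; last by rewrite trmx_norm.
  by exists x^T; rewrite ?trmx_norm ?trmxK.
have ct : continuous (trmx : 'rV[R]_n -> 'cV[R]_n).
  move=> x; apply/(@cvgrPdist_le _ _ _ (nbhs x)) => e e0.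
  near=> y; rewrite -linearB /= trmx_norm.
  by near: y; apply: cvgr_dist_le => //; exact: cvg_id.
apply: continuous_compact; first exact: continuous_subspaceT ct.
apply: bounded_closed_compact.
  exists rho; split; first exact: num_real.
  by move=> M rM x /= xr; rewrite (le_trans xr)// ltW.
apply: (@closed_comp _ _ (fun x : 'rV[R]_n => `|x|) [set y | y <= rho]).
  by move=> x _; exact: norm_continuous.
exact: closed_le.
Unshelve. all: by end_near. Qed.

End MxNorm.

Section ClassC.
Variables (R : realType) (V : normedModType R).

Lemma class_C_ext (W : normedModType R) (m : nat) (A : set V) (f g : V -> W) :
  open A -> (forall x, A x -> f x = g x) -> class_C m A f -> class_C m A g.
Proof.
move=> oA; elim: m f g => [|m IH] f g fg [cf Df].
  split=> // x Ax; have nfg : {near x, f =1 g}.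
    by near=> y; apply: fg; near: y; exact: open_nbhs_nbhs.
  change (g y @[y --> x] --> g x); rewrite -(fg _ Ax); apply: cvg_trans (cf x Ax).
  exact: near_eq_cvg nfg.
split=> [x Ax|u].
  have nfg : {near x, f =1 g}.
    by near=> y; apply: fg; near: y; exact: open_nbhs_nbhs.
  change (g y @[y --> x] --> g x); rewrite -(fg _ Ax); apply: cvg_trans (cf x Ax).
  exact: near_eq_cvg nfg.
have [df cDf] := Df u.
have nfg x : A x -> {near x, f =1 g}.
  by move=> Ax; near=> y; apply: fg; near: y; exact: open_nbhs_nbhs.
split=> [x Ax|]; first by apply: (near_eq_derivable (nfg x Ax)); exact: df.
by apply: IH cDf => x Ax; apply: near_eq_derive; exact: nfg.
Unshelve. all: by end_near. Qed.

(** Derivatives of matrix functions are entrywise, but only at the points of A, whence the recourse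
    to [class_C_ext]. *)
Lemma class_C_entry (p q : nat) (m : nat) (A : set V) (f : V -> 'M[R]_(p, q)) i j :
  open A -> class_C m A f -> class_C m A (fun x => f x i j).
Proof.
move=> oA; elim: m f => [|m IH] f [cf Df].
  split=> // x Ax.
  exact: (continuous_comp (cf x Ax) (@coord_continuous _ _ _ i j (f x))).
split=> [x Ax|u].
  exact: (continuous_comp (cf x Ax) (@coord_continuous _ _ _ i j (f x))).
have [df cDf] := Df u; split=> [x Ax|].
  by have /derivable_mxP := df x Ax; apply.
apply: class_C_ext oA _ (IH _ cDf) => x Ax.
by rewrite derive_mx ?mxE//; exact: df.
Qed.

End ClassC.

(** * Functions of theta and lambda that are bounded and Lipschitz at lambda* *)

Section BLclosure.
Variables (R : realType) (ls r0 : R).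
Hypothesis r00 : 0 < r0.

(* Bounded near ls, and Lipschitz at ls, uniformly in the first variable. *)
Definition BL (c : R -> R -> R) : Prop :=
  exists2 C : R, 0 <= C & forall t l, `|l - ls| <= r0 ->
    `|c t l| <= C /\ `|c t l - c t ls| <= C * `|l - ls|.

Lemma BL_cst (c : R) : BL (fun _ _ => c).
Proof.
by exists `|c| => // t l _; rewrite subrr normr0 mulr_ge0.
Qed.

Lemma BL_add c d : BL c -> BL d -> BL (fun t l => c t l + d t l).
Proof.
move=> [C C0 HC] [D D0 HD]; exists (C + D) => [|t l lr]; first exact: addr_ge0.
have [c1 c2] := HC t l lr; have [d1 d2] := HD t l lr; split; first exact: ler_norm2.
rewrite mulrDl opprD addrACA; exact: ler_norm2.
Qed.

Lemma BL_mul c d : BL c -> BL d -> BL (fun t l => c t l * d t l).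
Proof.
move=> [C C0 HC] [D D0 HD]; exists (C * D + C * D) => [|t l lr].
  by rewrite addr_ge0// mulr_ge0.
have [c1 c2] := HC t l lr; have [d1 d2] := HD t l lr.
have [|c3 _] := HC t ls; first by rewrite subrr normr0 ltW.
split.
  rewrite normrM (le_trans (ler_pM _ _ c1 d1))// lerDl mulr_ge0//.
have -> : c t l * d t l - c t ls * d t ls =
   (c t l - c t ls) * d t l + c t ls * (d t l - d t ls) by ring.
rewrite [leRHS]mulrDl; apply: ler_norm2; rewrite normrM.
  by rewrite mulrAC ler_pM.
by rewrite -mulrA ler_pM.
Qed.

Lemma BL_opp c : BL c -> BL (fun t l => - c t l).
Proof.
move=> /(BL_mul (BL_cst (-1))); congr BL; apply/funext => t; apply/funext => l.
by rewrite mulN1r.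
Qed.

Lemma BL_sum (I : Type) (r : seq I) (F : I -> R -> R -> R) :
  (forall i, BL (F i)) -> BL (fun t l => \sum_(i <- r) F i t l).
Proof.
move=> H; elim: r => [|i r IH].
  rewrite (_ : (fun t l => _) = (fun _ _ => 0)); first exact: BL_cst.
  by apply/funext => t; apply/funext => l; rewrite big_nil.
rewrite (_ : (fun t l => _) = (fun t l => F i t l + \sum_(i <- r) F i t l)).
  exact: BL_add.
by apply/funext => t; apply/funext => l; rewrite big_cons.
Qed.

Lemma BL_prod (I : Type) (r : seq I) (F : I -> R -> R -> R) :
  (forall i, BL (F i)) -> BL (fun t l => \prod_(i <- r) F i t l).
Proof.
move=> H; elim: r => [|i r IH].
  rewrite (_ : (fun t l => _) = (fun _ _ => 1)); first exact: BL_cst.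
  by apply/funext => t; apply/funext => l; rewrite big_nil.
rewrite (_ : (fun t l => _) = (fun t l => F i t l * \prod_(i <- r) F i t l)).
  exact: BL_mul.
by apply/funext => t; apply/funext => l; rewrite big_cons.
Qed.

Lemma BL_inv c (d : R) : BL c -> 0 < d -> (forall t l, `|l - ls| <= r0 -> d <= `|c t l|) ->
  BL (fun t l => (c t l)^-1).
Proof.
move=> [C C0 HC] d0 cd; exists (d^-1 + C * (d^-1 * d^-1)) => [|t l lr].
  by rewrite addr_ge0 ?mulr_ge0 ?invr_ge0// ltW.
have [_ c2] := HC t l lr.
have lsr : `|ls - ls| <= r0 by rewrite subrr normr0 ltW.
have i1 : `|(c t l)^-1| <= d^-1 by rewrite normfV lef_pV2 ?posrE ?cd// (lt_le_trans d0)// cd.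
have i2 : `|(c t ls)^-1| <= d^-1 by rewrite normfV lef_pV2 ?posrE ?cd// (lt_le_trans d0)// cd.
have n1 : c t l != 0 by rewrite -normr_gt0 (lt_le_trans d0)// cd.
have n2 : c t ls != 0 by rewrite -normr_gt0 (lt_le_trans d0)// cd.
have dn : 0 <= d^-1 by rewrite invr_ge0 ltW.
split; first by rewrite (le_trans i1)// lerDl !mulr_ge0.
have -> : (c t l)^-1 - (c t ls)^-1 = - (c t l - c t ls) * ((c t l)^-1 * (c t ls)^-1).
  by field; rewrite n1 n2.
rewrite normrM normrN normrM.
apply: (@le_trans _ _ ((C * `|l - ls|) * (d^-1 * d^-1))).
  by rewrite ler_pM// ?mulr_ge0// ler_pM.
by rewrite mulrAC ler_wpM2r// lerDr.
Qed.

Lemma BL_det (n : nat) (M : R -> R -> 'M[R]_n) :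
  (forall i j, BL (fun t l => M t l i j)) -> BL (fun t l => \det (M t l)).
Proof.
move=> H; rewrite /determinant; apply: BL_sum => s; apply: BL_mul; first exact: BL_cst.
by apply: BL_prod => i.
Qed.

Lemma BL_mulmx (m n p : nat) (M : R -> R -> 'M[R]_(m, n)) (N : R -> R -> 'M[R]_(n, p)) :
  (forall i j, BL (fun t l => M t l i j)) -> (forall i j, BL (fun t l => N t l i j)) ->
  forall i j, BL (fun t l => (M t l *m N t l) i j).
Proof.
move=> HM HN i j; rewrite (_ : (fun t l => _) = (fun t l => \sum_k M t l i k * N t l k j)).
  by apply: BL_sum => k; apply: BL_mul.
by apply/funext => t; apply/funext => l; rewrite mxE.
Qed.

(** Cofactor formula: entries of the inverse are polynomials in those of M divided by the
    determinant, which stays away from 0. *)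
Lemma BL_invmx (n : nat) (M : R -> R -> 'M[R]_n) (d : R) :
  (forall i j, BL (fun t l => M t l i j)) -> 0 < d ->
  (forall t l, `|l - ls| <= r0 -> d <= `|\det (M t l)|) ->
  forall i j, BL (fun t l => invmx (M t l) i j).
Proof.
move=> H d0 Hd i j.
have : BL (fun t l => (\det (M t l))^-1 * cofactor (M t l) j i).
  apply: BL_mul; first exact: BL_inv (BL_det H) d0 Hd.
  rewrite /cofactor; apply: BL_mul; first exact: BL_cst.
  apply: BL_det => a b; rewrite (_ : (fun t l => _) = (fun t l => M t l (lift j a) (lift i b))) //.
  by apply/funext => t; apply/funext => l; rewrite !mxE.
case=> C C0 HC; exists C => // t l lr; have := HC t l lr.
have unit u : `|u - ls| <= r0 -> invmx (M t u) i j = (\det (M t u))^-1 * cofactor (M t u) j i.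
  move=> ur; rewrite /invmx unitmxE unitfE -normr_gt0 (lt_le_trans d0 (Hd t u ur)).
  by rewrite !mxE.
by rewrite !unit// subrr normr0 ltW.
Qed.

Lemma BL_vec_bound (m n : nat) (M : R -> R -> 'M[R]_(m, n)) :
  (forall i j, BL (fun t l => M t l i j)) ->
  exists2 C : R, 0 <= C & forall t l, `|l - ls| <= r0 ->
    `|M t l| <= C /\ `|M t l - M t ls| <= C * `|l - ls|.
Proof.
move=> H.
have H' (ij : 'I_m * 'I_n) : {C : R | 0 <= C & forall t l, `|l - ls| <= r0 ->
    `|M t l ij.1 ij.2| <= C /\ `|M t l ij.1 ij.2 - M t ls ij.1 ij.2| <= C * `|l - ls|}.
  by apply: cid2; exact: H.
pose C := \sum_ij s2val (H' ij).
have C0 : 0 <= C by apply: sumr_ge0 => ij _; exact: (s2valP (H' ij)).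
have HC ij : s2val (H' ij) <= C.
  by rewrite /C (bigD1 ij)//= lerDl; apply: sumr_ge0 => kl _; exact: (s2valP (H' kl)).
exists C => // t l lr; split; apply: mxnorm_le; rewrite ?mulr_ge0// => i j.
  by apply: le_trans (HC (i, j)); case: (s2valP' (H' (i, j)) t l lr).
rewrite !mxE; have [_ h] := s2valP' (H' (i, j)) t l lr.
by apply: le_trans h _; rewrite ler_wpM2r.
Qed.

Lemma BL_fin_bound (I : finType) (m n : nat) (M : I -> R -> R -> 'M[R]_(m, n)) :
  (forall x i j, BL (fun t l => M x t l i j)) ->
  exists2 C : R, 0 <= C & forall x t l, `|l - ls| <= r0 ->
    `|M x t l| <= C /\ `|M x t l - M x t ls| <= C * `|l - ls|.
Proof.
move=> H.
have H' x : {C : R | 0 <= C & forall t l, `|l - ls| <= r0 ->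
    `|M x t l| <= C /\ `|M x t l - M x t ls| <= C * `|l - ls|}.
  by apply: cid2; apply: BL_vec_bound; exact: H.
pose C := \sum_x s2val (H' x).
have C0 : 0 <= C by apply: sumr_ge0 => x _; exact: (s2valP (H' x)).
have HC x : s2val (H' x) <= C.
  by rewrite /C (bigD1 x)//= lerDl; apply: sumr_ge0 => y _; exact: (s2valP (H' y)).
exists C => // x t l lr; have [h1 h2] := s2valP' (H' x) t l lr; split.
  exact: le_trans (HC x).
by apply: le_trans h2 _; rewrite ler_wpM2r.
Qed.

End BLclosure.

(** * Bounds by compactness and periodicity on a strip around lambda* *)

Section Strip.
Variables (R : realType).

Lemma compact_bound (T : topologicalType) (K : set T) (f : T -> R) : compact K ->
  (forall x, K x -> {for x, continuous f}) -> exists C : R, forall x, K x -> `|f x| <= C.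
Proof.
move=> cK cf; have [->|K0] := eqVneq K set0; first by exists 0.
have [||c _ Hc] := @compact_EVT_max T R (fun x => `|f x|) K _ cK.
- exact/set0P.
- apply: continuous_in_subspaceT => x /set_mem Kx.
  exact: (continuous_comp (cf x Kx) (@norm_continuous _ _ _)).
by exists `|f c| => x Kx; apply: Hc; exact/mem_set.
Qed.

Lemma dist_itv (l ls r1 : R) : (`|l - ls| <= r1) = (l \in `[ls - r1, ls + r1]).
Proof. by rewrite ler_distl in_itv. Qed.

Lemma itv_dist_open (ls r : R) : open [set l : R | `|l - ls| < r].
Proof.
apply: (@open_comp _ _ (fun l : R => `|l - ls|) [set y | y < r]); last exact: open_lt.
move=> l _; apply: (@continuous_comp _ _ _ (fun l => l - ls) (fun y => `|y|)).
  by apply: cvgB; [exact: cvg_id|exact: cvg_cst].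
exact: norm_continuous.
Qed.

Lemma strip_open (ls r : R) : open [set p : R * R | `|p.2 - ls| < r].
Proof.
apply: (@open_comp _ _ (fun p : R * R => p.2) [set l | `|l - ls| < r]).
  by move=> p _; exact: cvg_snd.
exact: itv_dist_open.
Qed.

Variables (ls r r1 : R).
Hypotheses (r10 : 0 < r1) (r1r : r1 < r).

Let strip := [set p : R * R | `|p.2 - ls| < r].

Lemma strip_compact_bound (f : R * R -> R) :
  (forall p, strip p -> {for p, continuous f}) ->
  exists C : R, forall t l, 0 <= t <= 0 + pi *+ 2 -> `|l - ls| <= r1 -> `|f (t, l)| <= C.
Proof.
move=> cf; have [|p [/= p1 p2]|C HC] := @compact_bound _ (`[0, 0 + pi *+ 2] `*` `[ls - r1, ls + r1]) f.
- by apply: compact_setX; exact: segment_compact.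
- by apply: cf; apply: le_lt_trans r1r; rewrite dist_itv.
by exists C => t l tt; rewrite dist_itv => lr; apply: HC; split => //=; rewrite in_itv.
Qed.

(** Periodicity brings theta into one period, where f and its lambda-derivative are bounded by
    compactness; the mean value theorem along lambda gives the Lipschitz bound. *)
Lemma strip_BL (f : R * R -> R) : class_C 1 strip f ->
  (forall l, `|l - ls| < r -> periodic (fun t => f (t, l))) ->
  BL ls r1 (fun t l => f (t, l)).
Proof.
move=> [cf Df] pf.
have [C1 H1] := strip_compact_bound cf.
have [df [cdf _]] := Df (0, 1).
have [C2 H2] := strip_compact_bound cdf.
have lsr : `|ls - ls| <= r1 by rewrite subrr normr0 ltW.
exists (`|C1| + `|C2|) => [|t l lr]; first exact: addr_ge0.
have lr' u : `|u - ls| <= r1 -> `|u - ls| < r by move=> ur; apply: le_lt_trans r1r.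
(* The values at l and at ls have to be moved to the same s, so the pair is reduced in one go. *)
have [s tt [<- <-]] : exists2 s, 0 <= s <= 0 + pi *+ 2 &
    f (s, l) = f (t, l) /\ f (s, ls) = f (t, ls).
  have pq : periodic (fun s => (f (s, l), f (s, ls))).
    by move=> u; rewrite !pf//; exact: lr'.
  by have [s s0 [e1 e2]] := periodic_reduce 0 t pq; exists s.
split.
  apply: le_trans (H1 s l tt lr) _; apply: le_trans (ler_norm _) _.
  by rewrite lerDl.
have [x x01|x x01] := @mvt_segment_line R _ f (s, ls) (0, l - ls) (fun p => (l - ls) * 'D_(0, 1) f p).
  have S : strip ((s, ls) + x *: (0, l - ls)).
    rewrite /strip /= [_ *: _]/(_ * _) addrAC subrr add0r normrM.
    rewrite (le_lt_trans _ (lr' _ lr))//.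
    rewrite ger0_norm; last by case/andP: x01.
    by case/andP: x01 => x0 x1; rewrite ler_piMl.
  rewrite [X in is_derive _ X](_ : _ = (l - ls) *: ((0, 1) : R * R)).
    by apply: is_deriveZdir; apply: derivableP; exact: df.
  by congr pair => /=; rewrite ?scaler0 ?[_ *: 1]mulr1.
have -> : (s, ls) + (0, l - ls) = (s, l) :> R * R.
  by congr pair => /=; [rewrite addr0|rewrite addrC subrK].
move=> ->; rewrite normrM mulrC ler_wpM2r//.
have -> : (s, ls) + x *: (0, l - ls) = (s, ls + x * (l - ls)) :> R * R.
  by congr pair => /=; rewrite scaler0 addr0.
apply: le_trans (H2 _ _ tt _) _; last by apply: le_trans (ler_norm _) _; rewrite lerDr.
rewrite addrAC subrr add0r normrM (le_trans _ lr)//.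
rewrite ger0_norm; last by case/andP: x01.
by case/andP: x01 => x0 x1; rewrite ler_piMl.
Qed.

(** The inverse of f is continuous and therefore bounded on the compact period strip. *)
Lemma strip_lower (f : R * R -> R) : (forall p, strip p -> {for p, continuous f}) ->
  (forall l, `|l - ls| < r -> periodic (fun t => f (t, l))) ->
  (forall p, strip p -> f p != 0) ->
  exists2 d : R, 0 < d & forall t l, `|l - ls| <= r1 -> d <= `|f (t, l)|.
Proof.
move=> cf pf f0.
have [p sp|C HC] := @strip_compact_bound (fun p => (f p)^-1).
  by apply: cvgV; [exact: f0|exact: cf].
have Q : 0 < `|C| + 1 by rewrite ltr_wpDl.
exists (`|C| + 1)^-1 => [|t l lr]; first by rewrite invr_gt0.
have lr' : `|l - ls| < r by apply: le_lt_trans r1r.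
have [s tt <-] := periodic_reduce 0 t (pf l lr').
have fn : f (s, l) != 0 by apply: f0.
rewrite -[leRHS]invrK lef_pV2 ?posrE ?invr_gt0 ?normr_gt0//.
rewrite -normfV; apply: le_trans (HC s l tt lr) _; apply: le_trans (ler_norm _) _.
by rewrite lerDl.
Qed.

Let itv := [set l : R | `|l - ls| < r].

Lemma itv_cont_bound (f : R -> R) : (forall l, itv l -> {for l, continuous f}) ->
  exists C : R, forall l, `|l - ls| <= r1 -> `|f l| <= C.
Proof.
move=> cf; have [||C HC] := @compact_bound _ `[ls - r1, ls + r1] f.
- exact: segment_compact.
- by move=> l /=; rewrite -dist_itv => lr; apply: cf; apply: le_lt_trans r1r.
by exists C => l; rewrite dist_itv => lr; apply: HC.
Qed.

Lemma itv_mvt (f : R -> R) l : (forall l, itv l -> derivable f l 1) -> `|l - ls| <= r1 ->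
  exists2 x : R, `|x - ls| <= `|l - ls| & f l - f ls = (l - ls) * 'D_1 f x.
Proof.
move=> df lr.
have H (s : R) : 0 <= s <= 1 -> `|ls + s *: (l - ls) - ls| <= `|l - ls|.
  move=> /andP[s0 s1]; rewrite addrAC subrr add0r [_ *: _]/(_ * _) normrM ger0_norm//.
  by rewrite ler_piMl.
have [x x01|x x01] := @mvt_segment_line R _ f ls (l - ls) (fun p => (l - ls) * 'D_1 f p).
  rewrite -[X in is_derive _ X]mulr1 -[_ * 1]/(_ *: 1).
  apply: is_deriveZdir; apply: derivableP; apply: df => /=.
  by apply: le_lt_trans r1r; apply: le_trans lr; exact: H.
have -> : ls + (l - ls) = l by rewrite addrC subrK.
move=> ->; exists (ls + x *: (l - ls)) => //; exact: H.
Qed.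

Lemma itv_BL (f : R -> R) : class_C 1 itv f -> BL ls r1 (fun _ l => f l).
Proof.
move=> [cf Df]; have [df [cdf _]] := Df 1.
have [C1 H1] := itv_cont_bound cf; have [C2 H2] := itv_cont_bound cdf.
exists (`|C1| + `|C2|) => [|_ l lr]; first exact: addr_ge0.
split; first by apply: le_trans (H1 l lr) _; apply: le_trans (ler_norm _) _; rewrite lerDl.
have [x xr ->] := itv_mvt df lr.
rewrite normrM mulrC ler_wpM2r//.
apply: le_trans (H2 _ _) _; first exact: le_trans lr.
by apply: le_trans (ler_norm _) _; rewrite lerDr.
Qed.

(** Mean value theorem for f, then the Lipschitz bound for its derivative at the intermediate
    point. *)
Lemma itv_taylor2 (f : R -> R) : class_C 2 itv f ->
  exists2 C : R, 0 <= C & forall l, `|l - ls| <= r1 ->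
    `|f l - f ls - derive1 f ls * (l - ls)| <= C * `|l - ls| ^+ 2.
Proof.
move=> [cf Df]; have [df cdf] := Df 1.
have [C C0 HC] := itv_BL cdf; exists C => // l lr.
have [x xr ->] := itv_mvt df lr.
rewrite derive1E mulrC -mulrBl normrM expr2 mulrA ler_wpM2r//.
have [_ h] := HC 0 x (le_trans xr lr); apply: le_trans h _.
by rewrite ler_wpM2l.
Qed.

End Strip.

Section ContAt.
Variables (R : realType) (V : topologicalType) (x : V).

Lemma cont_at_sum (I : Type) (r : seq I) (F : I -> V -> R) :
  (forall i, {for x, continuous (F i)}) ->
  {for x, continuous (fun y => \sum_(i <- r) F i y)}.
Proof.
move=> H; elim: r => [|i r IH].
  rewrite (_ : (fun y => _) = fun=> 0); first exact: cvg_cst.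
  by apply/funext => y; rewrite big_nil.
rewrite (_ : (fun y => _) = fun y => F i y + \sum_(j <- r) F j y).
  by apply: cvgD; [exact: H|exact: IH].
by apply/funext => y; rewrite big_cons.
Qed.

Lemma cont_at_prod (I : Type) (r : seq I) (F : I -> V -> R) :
  (forall i, {for x, continuous (F i)}) ->
  {for x, continuous (fun y => \prod_(i <- r) F i y)}.
Proof.
move=> H; elim: r => [|i r IH].
  rewrite (_ : (fun y => _) = fun=> 1); first exact: cvg_cst.
  by apply/funext => y; rewrite big_nil.
rewrite (_ : (fun y => _) = fun y => F i y * \prod_(j <- r) F j y).
  by apply: cvgM; [exact: H|exact: IH].
by apply/funext => y; rewrite big_cons.
Qed.

Lemma cont_at_det (n : nat) (M : V -> 'M[R]_n) :
  (forall i j, {for x, continuous (fun y => M y i j)}) ->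
  {for x, continuous (fun y => \det (M y))}.
Proof.
move=> H; rewrite /determinant; apply: cont_at_sum => s; apply: cvgM; first exact: cvg_cst.
by apply: cont_at_prod.
Qed.

End ContAt.

(** * Smooth functions composed with maps depending on theta and lambda *)

Section ProdBasis.
Variables (R : realType) (n : nat).
Notation V := ('cV[R]_n * R)%type.

Definition pbas (b : 'I_n + unit) : V :=
  match b with inl i => (delta_mx i 0, 0) | inr _ => (0, 1) end.
Definition pco (b : 'I_n + unit) (u : V) : R :=
  match b with inl i => u.1 i 0 | inr _ => u.2 end.

Lemma pair_sum (I : Type) (r : seq I) (F : I -> V) :
  \sum_(i <- r) F i = (\sum_(i <- r) (F i).1, \sum_(i <- r) (F i).2).
Proof.
by elim: r => [|i r IH]; rewrite ?big_nil// !big_cons IH.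
Qed.

Lemma cV_sum_delta (u : 'cV[R]_n) : u = \sum_i u i 0 *: delta_mx i 0.
Proof.
apply/matrixP => i j; rewrite ord1 summxE (bigD1 i)//= !mxE !eqxx mulr1 big1 ?addr0// => k ki.
by rewrite !mxE eq_sym (negbTE ki) mulr0.
Qed.

Lemma pco_sum u : u = \sum_b pco b u *: pbas b.
Proof.
case: u => u s; rewrite big_sumType /= pair_sum.
rewrite (big_pred1 tt) => [|[]//]; congr pair => /=.
  by rewrite scaler0 addr0 [LHS]cV_sum_delta.
rewrite big1 ?add0r; last by move=> i _; rewrite [_ *: _]mulr0.
by rewrite [RHS]mulr1.
Qed.

Lemma pco_norm b u : `|pco b u| <= `|u|.
Proof.
rewrite prod_normE le_max; case: b => [i|_] /=; last by rewrite lexx orbT.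
by rewrite mxnorm_ge.
Qed.

Definition pball (rho : R) : set V := [set u | `|u| <= rho].

Lemma pball_bound rho (f : V -> R) : continuous f ->
  exists C : R, forall x, pball rho x -> `|f x| <= C.
Proof.
move=> cf; have [|x _|C HC] := @compact_bound R _ ([set x : 'cV[R]_n | `|x| <= rho] `*` `[ - rho, rho]) f.
- by apply: compact_setX; [exact: compact_cV_ball|exact: segment_compact].
- exact: cf.
exists C => -[x s]; rewrite /pball /= prod_normE ge_max /= => /andP[xr sr].
by apply: HC; split => //=; rewrite in_itv /= -ler_norml.
Qed.

Lemma pball_convex rho x y (s : R) : pball rho x -> pball rho y -> 0 <= s <= 1 ->
  pball rho (x + s *: (y - x)).
Proof.
move=> xr yr /andP[s0 s1]; rewrite /pball /=.
have -> : x + s *: (y - x) = (1 - s) *: x + s *: y.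
  by rewrite scalerBr scalerBl scale1r addrA addrAC.
apply: le_trans (ler_normD _ _) _; rewrite !normrZ !ger0_norm ?subr_ge0//.
have -> : rho = (1 - s) * rho + s * rho by ring.
by apply: lerD; apply: ler_wpM2l => //; rewrite subr_ge0.
Qed.

Variables (ls r1 : R).
Hypothesis r10 : 0 < r1.
Variable w : R -> R -> V.
Hypothesis wBL : forall b, BL ls r1 (fun t l => pco b (w t l)).

Lemma pnorm_le (u : V) (C : R) : 0 <= C -> (forall b, `|pco b u| <= C) -> `|u| <= C.
Proof.
move=> C0 H; rewrite prod_normE ge_max; apply/andP; split.
  by apply: mxnorm_le => // i j; rewrite ord1; exact: (H (inl i)).
exact: (H (inr tt)).
Qed.

Lemma pco_BL_bound (u : R -> R -> V) : (forall b, BL ls r1 (fun t l => pco b (u t l))) ->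
  exists2 C : R, 0 <= C & forall t l, `|l - ls| <= r1 ->
    `|u t l| <= C /\ `|u t l - u t ls| <= C * `|l - ls|.
Proof.
move=> H.
have H' b : {C : R | 0 <= C & forall t l, `|l - ls| <= r1 ->
    `|pco b (u t l)| <= C /\ `|pco b (u t l) - pco b (u t ls)| <= C * `|l - ls|}.
  by apply: cid2; exact: H.
pose C := \sum_b s2val (H' b).
have C0 : 0 <= C by apply: sumr_ge0 => b _; exact: (s2valP (H' b)).
have HC b : s2val (H' b) <= C.
  by rewrite /C (bigD1 b)//= lerDl; apply: sumr_ge0 => c _; exact: (s2valP (H' c)).
exists C => // t l lr; split; apply: pnorm_le; rewrite ?mulr_ge0// => b.
  by apply: le_trans (HC b); case: (s2valP' (H' b) t l lr).
have -> : pco b (u t l - u t ls) = pco b (u t l) - pco b (u t ls).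
  by case: b => //= i; rewrite !mxE.
have [_ h] := s2valP' (H' b) t l lr.
by apply: le_trans h _; rewrite ler_wpM2r.
Qed.

Lemma BL_base (f : V -> R) : smoothT f -> BL ls r1 (fun t l => f (w t l)).
Proof.
move=> sf; have [C C0 HC] := pco_BL_bound wBL.
have [C1 HC1] := pball_bound C (smoothT_cont sf).
have [C2 C20 HC2] := @smooth_lip R _ _ _ _ pco_sum pco_norm _ (@pball_bound C) f sf (@pball_convex C).
have lsr : `|ls - ls| <= r1 by rewrite subrr normr0 ltW.
exists (`|C1| + C2 * C) => [|t l lr]; first by rewrite addr_ge0// mulr_ge0.
have [w1 w2] := HC t l lr; have [w3 _] := HC t ls lsr; split.
  apply: le_trans (HC1 _ w1) _; apply: le_trans (ler_norm _) _.
  by rewrite lerDl mulr_ge0.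
apply: le_trans (HC2 _ _ w3 w1) _; rewrite mulrDl.
apply: (@le_trans _ _ (C2 * C * `|l - ls|)).
  by rewrite -mulrA ler_wpM2l.
by rewrite lerDr mulr_ge0.
Qed.

(** The directions vary with theta and lambda as well. Expanding the first one in the fixed basis
    leaves a derivative of f in a constant direction, to which induction applies. *)
Lemma BL_Dlist (us : seq (R -> R -> V)) (f : V -> R) : smoothT f ->
  (forall k b, BL ls r1 (fun t l => pco b (nth (fun _ _ => 0) us k t l))) ->
  BL ls r1 (fun t l => Dlist [seq u t l | u <- us] f (w t l)).
Proof.
elim: us f => [|u us IH] f sf H /=; first exact: BL_base.
rewrite (_ : (fun t l => _) = (fun t l => \sum_b pco b (u t l) *
   Dlist [seq u t l | u <- us] ('D_(pbas b) f) (w t l))).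
  apply: BL_sum => b; apply: (BL_mul r10); first exact: (H 0%N).
  by apply: IH => [|k c]; [exact: smoothT_derive|exact: (H k.+1)].
apply/funext => t; apply/funext => l.
exact: (@Dlist_cons_basis R _ _ _ _ pco_sum (u t l) _ f (w t l) sf).
Qed.

End ProdBasis.

(** * Jets of the rescaled vector field *)

Section Multilinear.
Variables (R : realType) (n : nat).
Implicit Types x y z u : 'cV[R]_n.

(** Multilinear maps are represented by their values on basis vectors, so that boundedness and
    Lipschitz dependence on lambda concern finitely many coefficient vectors. *)
Definition mul1 (c : 'I_n -> 'cV[R]_n) x : 'cV[R]_n := \sum_a x a 0 *: c a.
Definition mul2 (c : 'I_n -> 'I_n -> 'cV[R]_n) x y : 'cV[R]_n :=
  \sum_a x a 0 *: mul1 (c a) y.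
Definition mul3 (c : 'I_n -> 'I_n -> 'I_n -> 'cV[R]_n) x y z : 'cV[R]_n :=
  \sum_a x a 0 *: mul2 (c a) y z.
Definition mul4 (c : 'I_n -> 'I_n -> 'I_n -> 'I_n -> 'cV[R]_n) x y z u : 'cV[R]_n :=
  \sum_a x a 0 *: mul3 (c a) y z u.

Lemma mul1D c x y : mul1 c (x + y) = mul1 c x + mul1 c y.
Proof. by rewrite /mul1 -big_split; apply: eq_bigr => a _; rewrite mxE scalerDl. Qed.
Lemma mul1Z c k x : mul1 c (k *: x) = k *: mul1 c x.
Proof. by rewrite /mul1 scaler_sumr; apply: eq_bigr => a _; rewrite mxE scalerA. Qed.
Lemma mul1_mx (A : 'M[R]_n) c x : A *m mul1 c x = mul1 (fun a => A *m c a) x.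
Proof. by rewrite mulmx_sumr; apply: eq_bigr => a _; rewrite scalemxAr. Qed.
Lemma mul1_bnd c C x : (forall a, `|c a| <= C) -> `|mul1 c x| <= n%:R * C * `|x|.
Proof.
move=> cC; rewrite (le_trans (ler_norm_sum _ _ _))//.
have -> : n%:R * C * `|x| = \sum_(a < n) `|x| * C.
  by rewrite sumr_const card_ord -mulrA mulr_natl mulrC.
by apply: ler_sum => a _; rewrite normrZ ler_pM// mxnorm_ge.
Qed.
Lemma mul1B c d x : mul1 c x - mul1 d x = mul1 (fun a => c a - d a) x.
Proof. by rewrite /mul1 -sumrB; apply: eq_bigr => a _; rewrite scalerBr. Qed.

Lemma mul2Dl c x x' y : mul2 c (x + x') y = mul2 c x y + mul2 c x' y.
Proof. by rewrite /mul2 -big_split; apply: eq_bigr => a _; rewrite mxE scalerDl. Qed.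
Lemma mul2Zl c k x y : mul2 c (k *: x) y = k *: mul2 c x y.
Proof. by rewrite /mul2 scaler_sumr; apply: eq_bigr => a _; rewrite mxE scalerA. Qed.
Lemma mul2Dr c x y y' : mul2 c x (y + y') = mul2 c x y + mul2 c x y'.
Proof. by rewrite /mul2 -big_split; apply: eq_bigr => a _; rewrite mul1D scalerDr. Qed.
Lemma mul2Zr c k x y : mul2 c x (k *: y) = k *: mul2 c x y.
Proof. by rewrite /mul2 scaler_sumr; apply: eq_bigr => a _; rewrite mul1Z !scalerA mulrC. Qed.
Lemma mul2_mx (A : 'M[R]_n) c x y : A *m mul2 c x y = mul2 (fun a b => A *m c a b) x y.
Proof. by rewrite mulmx_sumr; apply: eq_bigr => a _; rewrite -scalemxAr mul1_mx. Qed.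
Lemma mul2_bnd c C x y : (forall a b, `|c a b| <= C) -> `|mul2 c x y| <= n%:R ^+ 2 * C * `|x| * `|y|.
Proof.
move=> cC; rewrite (le_trans (ler_norm_sum _ _ _))//.
have -> : n%:R ^+ 2 * C * `|x| * `|y| = \sum_(a < n) `|x| * (n%:R * C * `|y|).
  by rewrite sumr_const card_ord -mulr_natl; ring.
by apply: ler_sum => a _; rewrite normrZ ler_pM ?mxnorm_ge// mul1_bnd.
Qed.
Lemma mul2B c d x y : mul2 c x y - mul2 d x y = mul2 (fun a b => c a b - d a b) x y.
Proof. by rewrite /mul2 -sumrB; apply: eq_bigr => a _; rewrite -scalerBr mul1B. Qed.

Lemma mul3D1 c x x' y z : mul3 c (x + x') y z = mul3 c x y z + mul3 c x' y z.
Proof. by rewrite /mul3 -big_split; apply: eq_bigr => a _; rewrite mxE scalerDl. Qed.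
Lemma mul3Z1 c k x y z : mul3 c (k *: x) y z = k *: mul3 c x y z.
Proof. by rewrite /mul3 scaler_sumr; apply: eq_bigr => a _; rewrite mxE scalerA. Qed.
Lemma mul3D2 c x y y' z : mul3 c x (y + y') z = mul3 c x y z + mul3 c x y' z.
Proof. by rewrite /mul3 -big_split; apply: eq_bigr => a _; rewrite mul2Dl scalerDr. Qed.
Lemma mul3Z2 c k x y z : mul3 c x (k *: y) z = k *: mul3 c x y z.
Proof. by rewrite /mul3 scaler_sumr; apply: eq_bigr => a _; rewrite mul2Zl !scalerA mulrC. Qed.
Lemma mul3D3 c x y z z' : mul3 c x y (z + z') = mul3 c x y z + mul3 c x y z'.
Proof. by rewrite /mul3 -big_split; apply: eq_bigr => a _; rewrite mul2Dr scalerDr. Qed.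
Lemma mul3Z3 c k x y z : mul3 c x y (k *: z) = k *: mul3 c x y z.
Proof. by rewrite /mul3 scaler_sumr; apply: eq_bigr => a _; rewrite mul2Zr !scalerA mulrC. Qed.
Lemma mul3_mx (A : 'M[R]_n) c x y z : A *m mul3 c x y z = mul3 (fun a b d => A *m c a b d) x y z.
Proof. by rewrite mulmx_sumr; apply: eq_bigr => a _; rewrite -scalemxAr mul2_mx. Qed.
Lemma mul3_bnd c C x y z : (forall a b d, `|c a b d| <= C) ->
  `|mul3 c x y z| <= n%:R ^+ 3 * C * `|x| * `|y| * `|z|.
Proof.
move=> cC; rewrite (le_trans (ler_norm_sum _ _ _))//.
have -> : n%:R ^+ 3 * C * `|x| * `|y| * `|z| = \sum_(a < n) `|x| * (n%:R ^+ 2 * C * `|y| * `|z|).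
  by rewrite sumr_const card_ord -mulr_natl; ring.
by apply: ler_sum => a _; rewrite normrZ ler_pM ?mxnorm_ge// mul2_bnd.
Qed.
Lemma mul3B c d x y z : mul3 c x y z - mul3 d x y z = mul3 (fun a b e => c a b e - d a b e) x y z.
Proof. by rewrite /mul3 -sumrB; apply: eq_bigr => a _; rewrite -scalerBr mul2B. Qed.

Lemma mul4D1 c x x' y z u : mul4 c (x + x') y z u = mul4 c x y z u + mul4 c x' y z u.
Proof. by rewrite /mul4 -big_split; apply: eq_bigr => a _; rewrite mxE scalerDl. Qed.
Lemma mul4Z1 c k x y z u : mul4 c (k *: x) y z u = k *: mul4 c x y z u.
Proof. by rewrite /mul4 scaler_sumr; apply: eq_bigr => a _; rewrite mxE scalerA. Qed.
Lemma mul4D2 c x y y' z u : mul4 c x (y + y') z u = mul4 c x y z u + mul4 c x y' z u.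
Proof. by rewrite /mul4 -big_split; apply: eq_bigr => a _; rewrite mul3D1 scalerDr. Qed.
Lemma mul4Z2 c k x y z u : mul4 c x (k *: y) z u = k *: mul4 c x y z u.
Proof. by rewrite /mul4 scaler_sumr; apply: eq_bigr => a _; rewrite mul3Z1 !scalerA mulrC. Qed.
Lemma mul4D3 c x y z z' u : mul4 c x y (z + z') u = mul4 c x y z u + mul4 c x y z' u.
Proof. by rewrite /mul4 -big_split; apply: eq_bigr => a _; rewrite mul3D2 scalerDr. Qed.
Lemma mul4Z3 c k x y z u : mul4 c x y (k *: z) u = k *: mul4 c x y z u.
Proof. by rewrite /mul4 scaler_sumr; apply: eq_bigr => a _; rewrite mul3Z2 !scalerA mulrC. Qed.
Lemma mul4D4 c x y z u u' : mul4 c x y z (u + u') = mul4 c x y z u + mul4 c x y z u'.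
Proof. by rewrite /mul4 -big_split; apply: eq_bigr => a _; rewrite mul3D3 scalerDr. Qed.
Lemma mul4Z4 c k x y z u : mul4 c x y z (k *: u) = k *: mul4 c x y z u.
Proof. by rewrite /mul4 scaler_sumr; apply: eq_bigr => a _; rewrite mul3Z3 !scalerA mulrC. Qed.
Lemma mul4_mx (A : 'M[R]_n) c x y z u : A *m mul4 c x y z u = mul4 (fun a b d e => A *m c a b d e) x y z u.
Proof. by rewrite mulmx_sumr; apply: eq_bigr => a _; rewrite -scalemxAr mul3_mx. Qed.
Lemma mul4_bnd c C x y z u : (forall a b d e, `|c a b d e| <= C) ->
  `|mul4 c x y z u| <= n%:R ^+ 4 * C * `|x| * `|y| * `|z| * `|u|.
Proof.
move=> cC; rewrite (le_trans (ler_norm_sum _ _ _))//.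
have -> : n%:R ^+ 4 * C * `|x| * `|y| * `|z| * `|u| = \sum_(a < n) `|x| * (n%:R ^+ 3 * C * `|y| * `|z| * `|u|).
  by rewrite sumr_const card_ord -mulr_natl; ring.
by apply: ler_sum => a _; rewrite normrZ ler_pM ?mxnorm_ge// mul3_bnd.
Qed.

End Multilinear.

(** Equal difference quotients give equal directional derivatives, even between different spaces; it
    passes from the product space to one factor with the other frozen. *)
Lemma derive_quot (R : realType) (V V' W : normedModType R) (f : V -> W)
    (g : V' -> W) a b u v :
  (forall h : R, h^-1 *: (f (h *: u + a) - f a) = h^-1 *: (g (h *: v + b) - g b)) ->
  'D_u f a = 'D_v g b /\ (derivable f a u -> derivable g b v).
Proof.
move=> /funext E.
have E' : (fun h : R => h^-1 *: ((f \o shift a) (h *: u) - f a)) =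
  (fun h : R => h^-1 *: ((g \o shift b) (h *: v) - g b)) by exact: E.
by split; rewrite /derive /derivable E'.
Qed.

(** * Taylor expansion of G along the periodic orbit *)

Section Jets.
Variables (R : realType) (k : nat) (D : ns_data R k).
Notation n := (2 + k + 1)%N.
Notation V := ('cV[R]_n * R)%type.
Notation ls := (ns_lam D).
Hypothesis smF : smooth_on setT (fun p : V => ns_F D p.1 p.2).
Variable r : R.
Hypothesis r_gt0 : 0 < r.
Hypothesis ct : continuation D r.

(** The closed interval of half the radius is compact inside the open one where the continuation is
    smooth. *)
Let r1 := r / 2.
Let r10 : 0 < r1. Proof. by rewrite /r1 divr_gt0. Qed.
Let r1r : r1 < r. Proof. by rewrite /r1 ltr_pdivrMr// mulr_natr mulr2n ltrDl. Qed.
Let lr_lt l : `|l - ls| <= r1 -> `|l - ls| < r.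
Proof. by move=> h; apply: le_lt_trans r1r. Qed.
Let lsr : `|ls - ls| <= r1. Proof. by rewrite subrr normr0 ltW. Qed.

Definition Fcomp (i : 'I_n) (q : V) : R := ns_F D q.1 q.2 i 0.

Lemma Fcomp_smooth i : smoothT (Fcomp i).
Proof.
move=> m; have := smF m; apply: class_C_entry; exact: openT.
Qed.

Lemma BL_v i : BL ls r1 (fun t l => ns_v D t l i 0).
Proof.
apply: (@strip_BL R ls r r1 r10 r1r (fun p => ns_v D p.1 p.2 i 0)).
  apply: class_C_entry; [exact: strip_open|exact: (ct_v ct)].
by move=> l lr t /=; rewrite (ct_v_per ct lr).
Qed.

Lemma BL_P i j : BL ls r1 (fun t l => ns_P D t l i j).
Proof.
apply: (@strip_BL R ls r r1 r10 r1r (fun p => ns_P D p.1 p.2 i j)).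
  apply: class_C_entry; [exact: strip_open|exact: (ct_P ct)].
by move=> l lr t /=; rewrite (ct_P_per ct lr).
Qed.

Lemma derive1_fst (W : normedModType R) (f : R -> R -> W) t l :
  derive1 (f ^~ l) t = 'D_((1, 0) : R * R) (fun p => f p.1 p.2) (t, l).
Proof.
rewrite derive1E; apply: (derive_quot _).1 => h /=.
by rewrite scaler0 add0r.
Qed.

Lemma BL_dP i j : BL ls r1 (fun t l => ns_dP D t l i j).
Proof.
have := @strip_BL R ls r r1 r10 r1r (fun p => ('D_((1, 0) : R * R) (fun p => ns_P D p.1 p.2) p) i j).
move=> H; have -> : (fun t l => ns_dP D t l i j) =
  (fun t l => ('D_((1, 0) : R * R) (fun p => ns_P D p.1 p.2) (t, l)) i j).
  by apply/funext => t; apply/funext => l; rewrite /ns_dP derive1_fst.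
apply: H.
  apply: class_C_entry; first exact: strip_open.
  by have [_ /(_ (1, 0))[_]] := ct_P ct 2%N.
move=> l lr t; congr fun_of_matrix; rewrite -!derive1_fst !derive1E.
apply: (derive_quot _).1 => h /=.
by rewrite addrA !(ct_P_per ct lr).
Qed.

Lemma BL_T : BL ls r1 (fun _ l => ns_T D l).
Proof. exact: (itv_BL r1r (ct_T ct 1%N)). Qed.

Lemma BL_Pinv i j : BL ls r1 (fun t l => invmx (ns_P D t l) i j).
Proof.
have [||p /= pr|d d0 Hd] := @strip_lower R ls r r1 r1r (fun p => \det (ns_P D p.1 p.2)).
- move=> p pr; apply: cont_at_det => a b.
  have [H _] := ct_P ct 0%N.
  exact: (continuous_comp (H p pr) (@coord_continuous _ _ _ a b _)).
- by move=> l lr t /=; rewrite (ct_P_per ct lr).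
- by have := ct_unit ct p.1 pr; rewrite unitmxE unitfE.
by apply: (@BL_invmx R ls r1 r10 _ _ d) => //; exact: BL_P.
Qed.

Definition wpt (t l : R) : V := (ns_v D t l, l).

Lemma BL_wpt b : BL ls r1 (fun t l => pco b (wpt t l)).
Proof.
case: b => [i|[]] /=; first exact: BL_v.
exists (`|ls| + r1 + 1) => [|t l lr]; first by rewrite !addr_ge0// ltW.
split; last by rewrite ler_peMl// lerDr addr_ge0// ltW.
rewrite -[l in leLHS](subrK ls) addrC (le_trans (ler_normD _ _))// -addrA lerD2l.
by rewrite (le_trans lr)// lerDl.
Qed.

(** Columns of P as directions in the product space: the change to Floquet coordinates is carried by
    the directions of differentiation. *)
Definition Ucol (t l : R) (a : 'I_n) : V := (col a (ns_P D t l), 0).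

Lemma BL_Ucol a b : BL ls r1 (fun t l => pco b (Ucol t l a)).
Proof.
case: b => [i|[]] /=; last exact: BL_cst.
have := BL_P i a; congr BL; apply/funext => t; apply/funext => l.
by rewrite mxE.
Qed.

Definition djet2 t l a b : 'cV[R]_n :=
  \col_i Dlist [:: Ucol t l a; Ucol t l b] (Fcomp i) (wpt t l).
Definition djet3 t l a b c : 'cV[R]_n :=
  \col_i Dlist [:: Ucol t l a; Ucol t l b; Ucol t l c] (Fcomp i) (wpt t l).
Definition djet4 t l a b c d : 'cV[R]_n :=
  \col_i Dlist [:: Ucol t l a; Ucol t l b; Ucol t l c; Ucol t l d] (Fcomp i) (wpt t l).

Definition Smx (t l : R) : 'M[R]_n := ns_T D l *: invmx (ns_P D t l).

(** The [jet] tables are the coefficients of G_2, G_3, G_4; the numbers 2, 6, 24 are the factorials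
    of Taylor's formula. G_1 is minus the linear map [Bmx]. *)
Definition jet2 t l a b := Smx t l *m (2^-1 *: djet2 t l a b).
Definition jet3 t l a b c := Smx t l *m (6^-1 *: djet3 t l a b c).
Definition jet4 t l a b c d := Smx t l *m (24^-1 *: djet4 t l a b c d).
Definition Bmx (t l : R) : 'M[R]_n := invmx (ns_P D t l) *m ns_dP D t l.

Lemma BL_Smx i j : BL ls r1 (fun t l => Smx t l i j).
Proof.
have := BL_mul r10 BL_T (BL_Pinv i j); congr BL.
by apply/funext => t; apply/funext => l; rewrite mxE.
Qed.

Lemma BL_Bmx i j : BL ls r1 (fun t l => Bmx t l i j).
Proof. by apply: BL_mulmx => // *; [exact: BL_Pinv|exact: BL_dP]. Qed.

Lemma BL_djet (s : seq 'I_n) i :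
  BL ls r1 (fun t l => Dlist [seq Ucol t l a | a <- s] (Fcomp i) (wpt t l)).
Proof.
have := @BL_Dlist R n ls r1 r10 wpt BL_wpt [seq (fun t l => Ucol t l a) | a <- s] (Fcomp i).
move=> /(_ (Fcomp_smooth i)) H.
have -> : (fun t l => Dlist [seq Ucol t l a | a <- s] (Fcomp i) (wpt t l)) =
 (fun t l => Dlist [seq u t l | u <- [seq (fun t l => Ucol t l a) | a <- s]] (Fcomp i) (wpt t l)).
  by apply/funext => t; apply/funext => l; rewrite -map_comp.
apply: H => j b; case: (ltnP j (size s)) => js; last first.
  by rewrite nth_default ?size_map//; case: b => [a|[]] /=; [
    rewrite (_ : (fun t l => _) = fun _ _ => 0) ; [exact: BL_cst|
      by apply/funext => t; apply/funext => l; rewrite mxE]|exact: BL_cst].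
case: s js => [//|a0 s] js.
by rewrite (nth_map a0)//; exact: BL_Ucol.
Qed.

Lemma BL_jetaux (d : R -> R -> 'cV[R]_n) (c : R) (g : R -> R -> 'I_n -> R) :
  (forall i, BL ls r1 (fun t l => g t l i)) -> (forall t l, d t l = \col_i g t l i) ->
  forall i j, BL ls r1 (fun t l => (Smx t l *m (c *: d t l)) i j).
Proof.
move=> Hg dE; apply: BL_mulmx => // i j; first exact: BL_Smx.
have := BL_mul r10 (BL_cst ls r1 c) (Hg i); congr BL.
by apply/funext => t; apply/funext => l; rewrite dE !mxE.
Qed.

Lemma BL_jet2 a b i j : BL ls r1 (fun t l => jet2 t l a b i j).
Proof. exact: (@BL_jetaux _ _ _ (fun i => BL_djet [:: a; b] i)). Qed.
Lemma BL_jet3 a b c i j : BL ls r1 (fun t l => jet3 t l a b c i j).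
Proof. exact: (@BL_jetaux _ _ _ (fun i => BL_djet [:: a; b; c] i)). Qed.
Lemma BL_jet4 a b c d i j : BL ls r1 (fun t l => jet4 t l a b c d i j).
Proof. exact: (@BL_jetaux _ _ _ (fun i => BL_djet [:: a; b; c; d] i)). Qed.

Lemma jet2_bnd : exists2 C : R, 0 <= C & forall a b t l, `|l - ls| <= r1 ->
  `|jet2 t l a b| <= C /\ `|jet2 t l a b - jet2 t ls a b| <= C * `|l - ls|.
Proof.
have [C C0 HC] := @BL_fin_bound R ls r1 _ _ _ (fun (x : 'I_n * 'I_n) t l => jet2 t l x.1 x.2)
  (fun x => BL_jet2 x.1 x.2).
by exists C => // a b; exact: (HC (a, b)).
Qed.

Lemma jet3_bnd : exists2 C : R, 0 <= C & forall a b c t l, `|l - ls| <= r1 ->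
  `|jet3 t l a b c| <= C /\ `|jet3 t l a b c - jet3 t ls a b c| <= C * `|l - ls|.
Proof.
have [C C0 HC] := @BL_fin_bound R ls r1 _ _ _ (fun (x : 'I_n * 'I_n * 'I_n) t l => jet3 t l x.1.1 x.1.2 x.2)
  (fun x => BL_jet3 x.1.1 x.1.2 x.2).
by exists C => // a b c; exact: (HC (a, b, c)).
Qed.

Lemma jet4_bnd : exists2 C : R, 0 <= C & forall a b c d t l, `|l - ls| <= r1 ->
  `|jet4 t l a b c d| <= C /\ `|jet4 t l a b c d - jet4 t ls a b c d| <= C * `|l - ls|.
Proof.
have [C C0 HC] := @BL_fin_bound R ls r1 _ _ _
  (fun (x : 'I_n * 'I_n * 'I_n * 'I_n) t l => jet4 t l x.1.1.1 x.1.1.2 x.1.2 x.2)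
  (fun x => BL_jet4 x.1.1.1 x.1.1.2 x.1.2 x.2).
by exists C => // a b c d; exact: (HC (a, b, c, d)).
Qed.

Lemma mulPx_sum t l (x : 'cV[R]_n) :
  (ns_P D t l *m x, 0) = \sum_a x a 0 *: Ucol t l a :> V.
Proof.
rewrite pair_sum /=; congr pair; last by rewrite big1// => a _; rewrite scaler0.
apply/matrixP => i j; rewrite ord1 mxE summxE; apply: eq_bigr => a _.
by rewrite !mxE mulrC.
Qed.

Lemma Dlist_Px t l x us f q : smoothT f ->
  Dlist ((ns_P D t l *m x, 0) :: us) f q =
  \sum_a x a 0 * Dlist us ('D_(Ucol t l a) f) q.
Proof.
move=> sf /=; rewrite (_ : 'D__ f = fun q => \sum_a x a 0 * 'D_(Ucol t l a) f q).
  by rewrite Dlist_lin// => a; exact: smoothT_derive.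
apply/funext => y; rewrite mulPx_sum smoothT_derive_sum//.
by apply: eq_bigr => a _; rewrite smoothT_deriveZ.
Qed.

Lemma mul1_comp (c : 'I_n -> 'cV[R]_n) x i : mul1 c x i 0 = \sum_a x a 0 * c a i 0.
Proof. by rewrite summxE; apply: eq_bigr => a _; rewrite mxE. Qed.

(** [jac] differentiates in x with lambda frozen, [Fcomp] lives on the product space; the difference
    quotients agree along directions without lambda-component. *)
Lemma Jcomp t l x i :
  (ns_J D (ns_v D t l) l *m (ns_P D t l *m x)) i 0 =
  'D_((ns_P D t l *m x, 0) : V) (Fcomp i) (wpt t l).
Proof.
move: (ns_P D t l *m x) => y; rewrite mxE.
have -> : ((y, 0) : V) = \sum_j y j 0 *: (delta_mx j 0, 0).
  rewrite pair_sum /=; congr pair; first exact: cV_sum_delta.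
  by rewrite big1// => a _; rewrite scaler0.
rewrite smoothT_derive_sum; last exact: Fcomp_smooth.
apply: eq_bigr => j _; rewrite smoothT_deriveZ; last exact: Fcomp_smooth.
rewrite mulrC mxE; congr (_ * _).
have dF : derivable (ns_F D ^~ l) (ns_v D t l) (delta_mx j 0).
  apply/derivable_mxP => a b; rewrite ord1.
  have [+ _] := smoothT_derivable (Fcomp_smooth a) (wpt t l) (delta_mx j 0, 0).
  apply: (derive_quot _).2 => h /=.
  by rewrite /Fcomp /= scaler0 add0r.
rewrite derive_mx// mxE; apply: (derive_quot _).1 => h /=.
by rewrite /Fcomp /= scaler0 add0r.
Qed.

Definition Frem t l x : 'cV[R]_n :=
  ns_F D (ns_v D t l + ns_P D t l *m x) l - ns_F D (ns_v D t l) l -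
  (ns_J D (ns_v D t l) l *m (ns_P D t l *m x) + 2^-1 *: mul2 (djet2 t l) x x
   + 6^-1 *: mul3 (djet3 t l) x x x + 24^-1 *: mul4 (djet4 t l) x x x x).

(** The displacement P x is a combination of the columns of P, so repeated derivatives in its
    direction expand into the multilinear forms with the [djet] tables. *)
Lemma Frem_comp t l x i : let u := ((ns_P D t l *m x, 0) : V) in
  Frem t l x i 0 = Fcomp i (wpt t l + u) -
  \sum_(j < 5) Dlist (nseq j u) (Fcomp i) (wpt t l) / j`!%:R.
Proof.
move=> u; have sF := Fcomp_smooth i.
have s1 a := smoothT_derive (Ucol t l a) sF.
have s2 a b := smoothT_derive (Ucol t l b) (s1 a).
have s3 a b c := smoothT_derive (Ucol t l c) (s2 a b).
have D2 : Dlist [:: u; u] (Fcomp i) (wpt t l) = mul2 (djet2 t l) x x i 0.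
  rewrite (Dlist_Px _ _ _ _ _ sF) [RHS]summxE; apply: eq_bigr => a _.
  rewrite [RHS]mxE (Dlist_Px _ _ _ _ _ (s1 a)) mul1_comp; congr (_ * _).
  by apply: eq_bigr => b _; rewrite mxE.
have D3 : Dlist [:: u; u; u] (Fcomp i) (wpt t l) = mul3 (djet3 t l) x x x i 0.
  rewrite (Dlist_Px _ _ _ _ _ sF) [RHS]summxE; apply: eq_bigr => a _.
  rewrite [RHS]mxE (Dlist_Px _ _ _ _ _ (s1 a)) [in RHS]summxE; congr (_ * _).
  apply: eq_bigr => b _.
  rewrite [RHS]mxE (Dlist_Px _ _ _ _ _ (s2 a b)) mul1_comp; congr (_ * _).
  by apply: eq_bigr => c _; rewrite mxE.
have D4 : Dlist [:: u; u; u; u] (Fcomp i) (wpt t l) = mul4 (djet4 t l) x x x x i 0.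
  rewrite (Dlist_Px _ _ _ _ _ sF) [RHS]summxE; apply: eq_bigr => a _.
  rewrite [RHS]mxE (Dlist_Px _ _ _ _ _ (s1 a)) [in RHS]summxE; congr (_ * _).
  apply: eq_bigr => b _.
  rewrite [RHS]mxE (Dlist_Px _ _ _ _ _ (s2 a b)) [in RHS]summxE; congr (_ * _).
  apply: eq_bigr => c _.
  rewrite [RHS]mxE (Dlist_Px _ _ _ _ _ (s3 a b c)) mul1_comp; congr (_ * _).
  by apply: eq_bigr => d _; rewrite mxE.
have E5 (G : nat -> R) : \sum_(j < 5) G j = G 0%N + (G 1%N + (G 2%N + (G 3%N + G 4%N))).
  by rewrite !big_ord_recl big_ord0 addr0.
rewrite (E5 (fun j => Dlist (nseq j u) (Fcomp i) (wpt t l) / j`!%:R)).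
rewrite -[nseq 2 u]/[:: u; u] -[nseq 3 u]/[:: u; u; u] -[nseq 4 u]/[:: u; u; u; u] D2 D3 D4.
have -> : Dlist (nseq 1 u) (Fcomp i) (wpt t l) =
    (ns_J D (ns_v D t l) l *m (ns_P D t l *m x)) i 0 by rewrite Jcomp.
have -> : Dlist (nseq 0 u) (Fcomp i) (wpt t l) = ns_F D (ns_v D t l) l i 0 by [].
have -> : Fcomp i (wpt t l + u) = ns_F D (ns_v D t l + ns_P D t l *m x) l i 0.
  by rewrite /Fcomp /= addr0.
rewrite /Frem; move: (_ *m _) (mul2 _ _ _) (mul3 _ _ _ _) (mul4 _ _ _ _ _) => X1 X2 X3 X4.
move: (ns_F D _ _) (ns_F D _ _) => Y1 Y2.
rewrite !mxE !factS fact0 !muln1 /=; by field.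
Qed.

Lemma Frem_bound : exists2 C : R, 0 <= C & forall t l x, `|l - ls| <= r1 -> `|x| <= 1 ->
  `|Frem t l x| <= C * `|x| ^+ 5.
Proof.
have [Cw Cw0 Hw] := pco_BL_bound BL_wpt.
have [CP CP0 HP] := BL_vec_bound BL_P.
(* Radius of a ball that contains every segment from an orbit point to its displacement by P x with
   |x| <= 1. *)
pose rho := Cw + n%:R * CP.
have H i : {C : R | 0 <= C & forall (x u : V), (forall s : R, 0 <= s <= 1 -> pball rho (x + s *: u)) ->
   `|Fcomp i (x + u) - \sum_(j < 5) Dlist (nseq j u) (Fcomp i) x / j`!%:R| <= C * `|u| ^+ 5}.
  apply: cid2; apply: (smooth_taylor (@pco_sum R n) (@pco_norm R n)) => [f|]; first exact: pball_bound.
  exact: Fcomp_smooth.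
pose C := \sum_i s2val (H i).
have C0 : 0 <= C by apply: sumr_ge0 => i _; exact: (s2valP (H i)).
exists (C * (n%:R * CP) ^+ 5) => [|t l x lr x1].
  by rewrite mulr_ge0// exprn_ge0// mulr_ge0.
have Px : `|((ns_P D t l *m x, 0) : V)| <= n%:R * CP * `|x|.
  rewrite prod_normE ge_max /= normr0 !mulr_ge0// andbT.
  rewrite (le_trans (mxnormM _ _))// ler_wpM2r// ler_wpM2l//.
  by case: (HP t l lr).
apply: mxnorm_le => [|i j]; first by rewrite !mulr_ge0// exprn_ge0// mulr_ge0.
rewrite ord1 Frem_comp; have := s2valP' (H i) (wpt t l) (ns_P D t l *m x, 0).
move=> Hi; apply: le_trans (Hi _) _.
  move=> s /andP[s0 s1]; rewrite /pball /= (le_trans (ler_normD _ _))// lerD//.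
    by case: (Hw t l lr).
  rewrite normrZ ger0_norm// (le_trans (ler_wpM2l s0 Px))// mulrA.
  rewrite -[leRHS]mulr1 ler_pM ?mulr_ge0// -[leRHS]mul1r ler_wpM2r// mulr_ge0//.
rewrite -mulrA -exprMn; apply: ler_pM => //.
- exact: (s2valP (H i)).
- rewrite /C (bigD1 i)//= lerDl; apply: sumr_ge0 => kl _; exact: (s2valP (H kl)).
- by rewrite lerXn2r// nnegrE// !mulr_ge0.
Qed.

(** An exact identity. The Floquet equation turns T J P - dP/dtheta into P E, and what F has beyond
    its Taylor polynomial of degree four stays in [Frem]. *)
Lemma GE t l z eta e : e != 0 -> `|l - ls| <= r1 ->
  ns_G D z l eta t e = ns_E D l *m z - (e * eta) *: (Bmx t l *m z) +
    e *: mul2 (jet2 t l) z z + e ^+ 2 *: mul3 (jet3 t l) z z z +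
    e ^+ 3 *: mul4 (jet4 t l) z z z z + e^-1 *: (Smx t l *m Frem t l (e *: z)).
Proof.
move=> e0 lr; have lr' := lr_lt lr.
have -> : ns_E D l *m z = ns_T D l *: (invmx (ns_P D t l) *m (ns_J D (ns_v D t l) l *m (ns_P D t l *m z)))
    - invmx (ns_P D t l) *m (ns_dP D t l *m z).
  rewrite -[ns_E D l]mul1mx -(mulVmx (ct_unit ct t lr')) -2!mulmxA [ns_P D t l *m _]mulmxA.
  by rewrite -(ct_floquet ct t lr') mulmxBl mulmxBr -scalemxAl -scalemxAr -!mulmxA.
have -> : mul2 (jet2 t l) z z = (2^-1 * ns_T D l) *: (invmx (ns_P D t l) *m mul2 (djet2 t l) z z).
  rewrite -scalerA scalemxAl scalemxAl mul2_mx.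
  apply: eq_bigr => a _; congr (_ *: _); apply: eq_bigr => b _; congr (_ *: _).
  by rewrite /jet2 -[in RHS]scalemxAl -scalemxAr.
have -> : mul3 (jet3 t l) z z z = (6^-1 * ns_T D l) *: (invmx (ns_P D t l) *m mul3 (djet3 t l) z z z).
  rewrite -scalerA scalemxAl scalemxAl mul3_mx.
  apply: eq_bigr => a _; congr (_ *: _); apply: eq_bigr => b _; congr (_ *: _).
  by apply: eq_bigr => c _; congr (_ *: _); rewrite /jet3 -[in RHS]scalemxAl -scalemxAr.
have -> : mul4 (jet4 t l) z z z z = (24^-1 * ns_T D l) *: (invmx (ns_P D t l) *m mul4 (djet4 t l) z z z z).
  rewrite -scalerA scalemxAl scalemxAl mul4_mx.
  apply: eq_bigr => a _; congr (_ *: _); apply: eq_bigr => b _; congr (_ *: _).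
  apply: eq_bigr => c _; congr (_ *: _); apply: eq_bigr => d _; congr (_ *: _).
  by rewrite /jet4 -[in RHS]scalemxAl -scalemxAr.
rewrite /Bmx -mulmxA /Smx -scalemxAl /Frem.
rewrite !(mul2Zl, mul2Zr, mul3Z1, mul3Z2, mul3Z3, mul4Z1, mul4Z2, mul4Z3, mul4Z4) /ns_G.
rewrite -!scalemxAr !(mulmxDr, mulmxN, =^~ scalemxAr).
move: (invmx _ *m (ns_J D _ _ *m _)) => X1.
move: (invmx _ *m mul2 _ _ _) => X2.
move: (invmx _ *m mul3 _ _ _ _) => X3.
move: (invmx _ *m mul4 _ _ _ _ _) => X4.
move: (invmx _ *m ns_F D (ns_v D t l + _) l) => Y1.
move: (invmx _ *m ns_F D _ _) => Y2.
move: (invmx _ *m _) => X0.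
by apply/matrixP => i j; rewrite !mxE; field.
Qed.

(** The remainder of F is of order five in eps z, and G divides it by eps. The bound is uniform in
    theta, lambda and eta. *)
Lemma G_jet : exists2 C : R, 0 <= C & forall t l z eta e, e != 0 -> `|l - ls| <= r1 ->
  `|e| * `|z| <= 1 ->
  `|ns_G D z l eta t e - (ns_E D l *m z - (e * eta) *: (Bmx t l *m z) +
    e *: mul2 (jet2 t l) z z + e ^+ 2 *: mul3 (jet3 t l) z z z +
    e ^+ 3 *: mul4 (jet4 t l) z z z z)| <= C * `|e| ^+ 4 * `|z| ^+ 5.
Proof.
have [C C0 HC] := Frem_bound.
have [CS CS0 HS] := BL_vec_bound BL_Smx.
exists (n%:R * CS * C) => [|t l z eta e e0 lr ez]; first by rewrite !mulr_ge0.
rewrite (GE _ _ _ e0 lr) addrAC subrr add0r normrZ normfV.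
rewrite ler_pdivrMl ?normr_gt0//.
apply: le_trans (mxnormM _ _) _.
have h1 : `|Frem t l (e *: z)| <= C * `|e *: z| ^+ 5 by apply: HC => //; rewrite normrZ.
have [h2 _] := HS t l lr.
apply: (@le_trans _ _ (n%:R * CS * (C * `|e *: z| ^+ 5))).
  by rewrite ler_pM// ?mulr_ge0// ler_wpM2l.
rewrite normrZ exprMn le_eqVlt; apply/orP; left; apply/eqP; ring.
Qed.

End Jets.

(** * Uniform orders in epsilon *)

Section Order.
Variable R : realType.

(* f(eps, x) = O(eps^p) as eps -> 0, uniformly in x. *)
Definition Op (X : Type) (W : normedModType R) (p : nat) (f : R -> X -> W) : Prop :=
  exists2 C : R, 0 <= C & \forall e \near 0^', forall x, `|f e x| <= C * `|e| ^+ p.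

Section OpW.
Variables (X : Type) (W : normedModType R).
Implicit Types f g : R -> X -> W.

Lemma near_le1 : \forall e \near (0 : R)^', `|e| <= 1.
Proof. exact: dnbhs0_le. Qed.

Lemma near_ne0 : \forall e \near (0 : R)^', e != 0.
Proof. exact: nbhs_dnbhs_neq. Qed.

Lemma Op_eq p f g : (\forall e \near 0^', forall x, f e x = g e x) -> Op p f -> Op p g.
Proof.
move=> fg [C C0 HC]; exists C => //; near=> e => x.
rewrite -(_ : f e x = g e x); last by move: x; near: e.
by move: x; near: e.
Unshelve. all: by end_near. Qed.

Lemma Op_add p f g : Op p f -> Op p g -> Op p (fun e x => f e x + g e x).
Proof.
move=> [C C0 HC] [D D0 HD]; exists (C + D); first exact: addr_ge0.
near=> e => x; rewrite mulrDl (le_trans (ler_normD _ _))// lerD//; move: x; by near: e.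
Unshelve. all: by end_near. Qed.

Lemma Op_opp p f : Op p f -> Op p (fun e x => - f e x).
Proof.
by move=> [C C0 HC]; exists C => //; near=> e => x; rewrite normrN; move: x; near: e.
Unshelve. all: by end_near. Qed.

Lemma Op_sub p f g : Op p f -> Op p g -> Op p (fun e x => f e x - g e x).
Proof. by move=> Hf Hg; apply: Op_add => //; exact: Op_opp. Qed.

Lemma Op_le p q f : (q <= p)%N -> Op p f -> Op q f.
Proof.
move=> qp [C C0 HC]; exists C => //; near=> e => x.
apply: (@le_trans _ _ (C * `|e| ^+ p)); first by move: x; near: e.
rewrite ler_wpM2l// -(subnKC qp) exprD ler_piMr ?exprn_ge0//.
by rewrite exprn_ile1//; near: e; exact: near_le1.
Unshelve. all: by end_near. Qed.

Lemma Op_scale p q (c : R -> X -> R) f : Op p c -> Op q f -> Op (p + q) (fun e x => c e x *: f e x).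
Proof.
move=> [C C0 HC] [D D0 HD]; exists (C * D); first exact: mulr_ge0.
near=> e => x; rewrite normrZ exprD mulrACA ler_pM//; move: x; by near: e.
Unshelve. all: by end_near. Qed.

Lemma Op_bounded (f : R -> X -> W) (C : R) : (\forall e \near 0^', forall x, `|f e x| <= C) -> Op 0 f.
Proof.
move=> H; exists `|C| => //; near=> e => x; rewrite expr0 mulr1.
by apply: le_trans (ler_norm C); move: x; near: e.
Unshelve. all: by end_near. Qed.

(** An a priori estimate that turns every uniform bound on f e into K times that bound on g e
    preserves orders. *)
Lemma Op_dom (Y : Type) (W' : normedModType R) p f (g : R -> Y -> W') (K : R) : 0 <= K -> Op p f ->
  (\forall e \near 0^', forall B, (forall x, `|f e x| <= B) -> forall y, `|g e y| <= K * B) ->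
  Op p g.
Proof.
move=> K0 [C C0 HC] H; exists (K * C); first exact: mulr_ge0.
near=> e => y; rewrite -mulrA.
have He : forall B, (forall x, `|f e x| <= B) -> forall y, `|g e y| <= K * B by near: e.
by apply: He; near: e.
Unshelve. all: by end_near. Qed.

Lemma Op_comp (Y : Type) p (h : Y -> X) f : Op p f -> Op p (fun e y => f e (h y)).
Proof.
by move=> [C C0 HC]; exists C => //; near=> e => y; move: (h y); near: e.
Unshelve. all: by end_near. Qed.

End OpW.

Lemma Op_exp X p : Op p (fun (e : R) (_ : X) => e ^+ p).
Proof. by exists 1 => //; near=> e => x; rewrite mul1r normrX.
Unshelve. all: by end_near. Qed.

Lemma Op_id X : Op 1 (fun (e : R) (_ : X) => e).
Proof. exact: (@Op_exp X 1). Qed.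

Lemma Op_cst (X : Type) (W : normedModType R) (c : W) : Op 0 (fun (_ : R) (_ : X) => c).
Proof. by apply: (@Op_bounded _ _ _ `|c|); near=> e. Unshelve. all: by end_near. Qed.

Lemma Op_mulr X p q (f g : R -> X -> R) : Op p f -> Op q g -> Op (p + q) (fun e x => f e x * g e x).
Proof. exact: Op_scale. Qed.

Lemma Op_mulmx (X : Type) (m n l p q : nat) (A : R -> X -> 'M[R]_(m, n)) (B : R -> X -> 'M[R]_(n, l)) :
  Op p A -> Op q B -> Op (p + q) (fun e x => A e x *m B e x).
Proof.
move=> [C C0 HC] [D D0 HD]; exists (n%:R * C * D); first by rewrite !mulr_ge0.
near=> e => x; apply: le_trans (mxnormM _ _) _.
rewrite exprD (_ : n%:R * C * D * _ = n%:R * (C * `|e| ^+ p) * (D * `|e| ^+ q)); last by ring.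
rewrite ler_pM// ?mulr_ge0// ?ler_wpM2l//; move: x; by near: e.
Unshelve. all: by end_near. Qed.

Section OpMul.
Variables (X : Type) (n : nat).
Notation V := 'cV[R]_n.

Lemma Op_mul2 p q s (c : R -> X -> 'I_n -> 'I_n -> V) (x y : R -> X -> V) :
  Op p (fun e u => c e u.1.1 u.1.2 u.2) -> Op q x -> Op s y ->
  Op (p + q + s) (fun e u => mul2 (c e u) (x e u) (y e u)).
Proof.
move=> [C C0 HC] [D D0 HD] [E E0 HE]; exists (n%:R ^+ 2 * C * D * E).
  by rewrite !mulr_ge0// exprn_ge0.
near=> e => u; apply: le_trans (mul2_bnd _ _ (C := C * `|e| ^+ p) _) _.
  by move=> a b; rewrite -[c e u]/(c e (u, a, b).1.1) -[a]/((u, a, b).1.2) -[b in c _ _ _ b]/((u, a, b).2); move: (u, a, b); near: e.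
rewrite !exprD [leRHS](_ : _ = n%:R ^+ 2 * (C * `|e| ^+ p) * (D * `|e| ^+ q) * (E * `|e| ^+ s)); last by ring.
apply: ler_pM; rewrite ?mulr_ge0// ?exprn_ge0//; last by move: u; near: e.
apply: ler_pM; rewrite ?mulr_ge0// ?exprn_ge0//; by move: u; near: e.
Unshelve. all: by end_near. Qed.

Lemma Op_mul3 p q s r (c : R -> X -> 'I_n -> 'I_n -> 'I_n -> V) (x y z : R -> X -> V) :
  Op p (fun e u => c e u.1.1.1 u.1.1.2 u.1.2 u.2) -> Op q x -> Op s y -> Op r z ->
  Op (p + q + s + r) (fun e u => mul3 (c e u) (x e u) (y e u) (z e u)).
Proof.
move=> [C C0 HC] [D D0 HD] [E E0 HE] [F F0 HF]; exists (n%:R ^+ 3 * C * D * E * F).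
  by rewrite !mulr_ge0// exprn_ge0.
near=> e => u; apply: le_trans (mul3_bnd _ _ _ (C := C * `|e| ^+ p) _) _.
  move=> a b d; have H : forall u, `|c e u.1.1.1 u.1.1.2 u.1.2 u.2| <= C * `|e| ^+ p by near: e.
  exact: (H (u, a, b, d)).
rewrite !exprD [leRHS](_ : _ = n%:R ^+ 3 * (C * `|e| ^+ p) * (D * `|e| ^+ q) * (E * `|e| ^+ s) * (F * `|e| ^+ r)); last by ring.
apply: ler_pM; rewrite ?mulr_ge0// ?exprn_ge0//; last by move: u; near: e.
apply: ler_pM; rewrite ?mulr_ge0// ?exprn_ge0//; last by move: u; near: e.
apply: ler_pM; rewrite ?mulr_ge0// ?exprn_ge0//; by move: u; near: e.
Unshelve. all: by end_near. Qed.

Lemma Op_mul4 p q s r v (c : R -> X -> 'I_n -> 'I_n -> 'I_n -> 'I_n -> V) (x y z w : R -> X -> V) :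
  Op p (fun e u => c e u.1.1.1.1 u.1.1.1.2 u.1.1.2 u.1.2 u.2) -> Op q x -> Op s y -> Op r z -> Op v w ->
  Op (p + q + s + r + v) (fun e u => mul4 (c e u) (x e u) (y e u) (z e u) (w e u)).
Proof.
move=> [C C0 HC] [D D0 HD] [E E0 HE] [F F0 HF] [G G0 HG]; exists (n%:R ^+ 4 * C * D * E * F * G).
  by rewrite !mulr_ge0// exprn_ge0.
near=> e => u; apply: le_trans (mul4_bnd _ _ _ _ (C := C * `|e| ^+ p) _) _.
  move=> a b d h; have H : forall u, `|c e u.1.1.1.1 u.1.1.1.2 u.1.1.2 u.1.2 u.2| <= C * `|e| ^+ p by near: e.
  exact: (H (u, a, b, d, h)).
rewrite !exprD [leRHS](_ : _ = n%:R ^+ 4 * (C * `|e| ^+ p) * (D * `|e| ^+ q) * (E * `|e| ^+ s) * (F * `|e| ^+ r) * (G * `|e| ^+ v)); last by ring.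
apply: ler_pM; rewrite ?mulr_ge0// ?exprn_ge0//; last by move: u; near: e.
apply: ler_pM; rewrite ?mulr_ge0// ?exprn_ge0//; last by move: u; near: e.
apply: ler_pM; rewrite ?mulr_ge0// ?exprn_ge0//; last by move: u; near: e.
apply: ler_pM; rewrite ?mulr_ge0// ?exprn_ge0//; by move: u; near: e.
Unshelve. all: by end_near. Qed.

(** Telescoping, one argument changed at a time; no symmetry of the coefficients is assumed. *)
Lemma mul3_diff (c : 'I_n -> 'I_n -> 'I_n -> V) (x y : V) :
  mul3 c x x x - mul3 c y y y = mul3 c (x - y) x x + mul3 c y (x - y) x + mul3 c y y (x - y).
Proof.
have e1 : mul3 c x x x = mul3 c (x - y) x x + mul3 c y x x by rewrite -mul3D1 subrK.
have e2 : mul3 c y x x = mul3 c y (x - y) x + mul3 c y y x by rewrite -mul3D2 subrK.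
have e3 : mul3 c y y x = mul3 c y y (x - y) + mul3 c y y y by rewrite -mul3D3 subrK.
by rewrite e1 e2 e3 !addrA addrK.
Qed.

Lemma mul4_diff (c : 'I_n -> 'I_n -> 'I_n -> 'I_n -> V) (x y : V) :
  mul4 c x x x x - mul4 c y y y y = mul4 c (x - y) x x x + mul4 c y (x - y) x x
    + mul4 c y y (x - y) x + mul4 c y y y (x - y).
Proof.
have e1 : mul4 c x x x x = mul4 c (x - y) x x x + mul4 c y x x x by rewrite -mul4D1 subrK.
have e2 : mul4 c y x x x = mul4 c y (x - y) x x + mul4 c y y x x by rewrite -mul4D2 subrK.
have e3 : mul4 c y y x x = mul4 c y y (x - y) x + mul4 c y y y x by rewrite -mul4D3 subrK.
have e4 : mul4 c y y y x = mul4 c y y y (x - y) + mul4 c y y y y by rewrite -mul4D4 subrK.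
by rewrite e1 e2 e3 e4 !addrA addrK.
Qed.

End OpMul.

(** Uniqueness of asymptotic expansions: dividing by eps shows that the constant P1 is O(eps), hence
    0; dividing by eps^2 then does the same for P2. *)
Lemma Op_zero (n : nat) (P1 P2 : 'cV[R]_n) :
  Op 3 (fun e (_ : unit) => e *: P1 + e ^+ 2 *: P2) -> P1 = 0 /\ P2 = 0.
Proof.
move=> H.
have sq (W : normedModType R) (v : W) : Op 1 (fun (_ : R) (_ : unit) => v) -> v = 0.
  move=> [C C0 HC]; apply/eqP; rewrite -normr_eq0; apply/eqP/le_anti; rewrite normr_ge0 andbT.
  apply/ler_addgt0Pr => d d0; rewrite add0r.
  near (0 : R)^' => e.
  have : `|v| <= C * `|e| ^+ 1 by move: tt; near: e.
  move=> h; apply: le_trans h _; rewrite expr1.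
  have : `|e| <= d / (C + 1).
    by near: e; apply: dnbhs0_le; rewrite divr_gt0// ltr_wpDl.
  rewrite ler_pdivlMr ?ltr_wpDl// => h; rewrite mulrC.
  by apply: le_trans h; rewrite ler_wpM2l// lerDl.
have dv p q f : (q <= p)%N -> @Op unit 'cV[R]_n p (fun e x => e ^+ q *: f e x) -> Op (p - q) f.
  move=> qp [C C0 HC]; exists C => //; near=> e => x.
  have e0 : e != 0 by near: e; exact: near_ne0.
  have : `|e ^+ q *: f e x| <= C * `|e| ^+ p by move: x; near: e.
  rewrite normrZ normrX -{1}(subnKC qp) exprD mulrCA ler_pM2l//.
  by rewrite exprn_gt0// normr_gt0.
have P10 : P1 = 0.
  apply: sq; apply: (@dv 2 1 (fun _ _ => P1)) => //.
  apply: (@Op_eq _ _ _ (fun e (_ : unit) => (e *: P1 + e ^+ 2 *: P2) - e ^+ 2 *: P2)).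
    by near=> e => x; rewrite addrK.
  apply: Op_sub; first exact: Op_le H.
  exact: (Op_scale (@Op_exp _ 2) (@Op_cst _ _ P2)).
split=> //; apply: sq; apply: (@dv 3 2 (fun _ _ => P2)) => //.
apply: Op_eq H; near=> e => x; by rewrite P10 scaler0 add0r.
Unshelve. all: by end_near. Qed.

End Order.

(** * The normal form equations *)

Section Vec3.
Variables (R : realType) (k : nat).
Notation n := (2 + k + 1)%N.
Implicit Types y : 'cV[R]_n.

Definition hidx (j : 'I_2) : 'I_n := lshift 1 (lshift k j).
Definition tidx (j : 'I_k) : 'I_n := lshift 1 (rshift 2 j).
Definition ridx : 'I_n := rshift (2 + k) 0.

Lemma zhatE y j : zhat y j 0 = y (hidx j) 0.
Proof. by rewrite !mxE. Qed.
Lemma ztilE y j : ztil y j 0 = y (tidx j) 0.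
Proof. by rewrite !mxE. Qed.
Lemma zringE y : zring y = y ridx 0.
Proof. by rewrite /zring !mxE; congr (y _ _). Qed.

(** Case analysis on the three blocks of an index. *)
Lemma idxP (P : 'I_n -> Prop) : (forall j, P (hidx j)) -> (forall j, P (tidx j)) ->
  P ridx -> forall i, P i.
Proof.
move=> h t r i; case: (splitP i) => [j ij|j ij].
  have -> : i = lshift 1 j by exact/val_inj.
  case: (splitP j) => [l jl|l jl].
    have -> : j = lshift k l by exact/val_inj.
    exact: h.
  have -> : j = rshift 2 l by exact/val_inj.
  exact: t.
have -> : i = ridx by apply/val_inj; rewrite /= ij; case: j {ij} => [[]].
by [].
Qed.

Lemma vec3_eq (x y : 'cV[R]_n) : zhat x = zhat y -> ztil x = ztil y -> zring x = zring y -> x = y.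
Proof.
move=> h t r; apply/matrixP => i j; rewrite ord1; move: i; apply: idxP => [i|i|].
- by rewrite -!zhatE h.
- by rewrite -!ztilE t.
- by rewrite -!zringE.
Qed.

Lemma zhat_vec3 a b c : zhat (@vec3 R k a b c) = a.
Proof. by rewrite /zhat /vec3 !col_mxKu. Qed.
Lemma ztil_vec3 a b c : ztil (@vec3 R k a b c) = b.
Proof. by rewrite /ztil /vec3 col_mxKu col_mxKd. Qed.
Lemma zring_vec3 a b c : zring (@vec3 R k a b c) = c.
Proof. by rewrite /zring /vec3 col_mxKd mxE. Qed.

Lemma zhatD x y : zhat (x + y) = zhat x + zhat y :> 'cV[R]_2.
Proof. by apply/matrixP => i j; rewrite ord1 zhatE !mxE. Qed.
Lemma zhatZ c y : zhat (c *: y) = c *: zhat y.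
Proof. by apply/matrixP => i j; rewrite ord1 zhatE !mxE. Qed.
Lemma ztilD x y : ztil (x + y) = ztil x + ztil y :> 'cV[R]_k.
Proof. by apply/matrixP => i j; rewrite ord1 ztilE !mxE. Qed.
Lemma ztilZ c y : ztil (c *: y) = c *: ztil y.
Proof. by apply/matrixP => i j; rewrite ord1 ztilE !mxE. Qed.
Lemma zringD x y : zring (x + y) = zring x + zring y :> R.
Proof. by rewrite !zringE !mxE. Qed.
Lemma zringZ c y : zring (c *: y) = c * zring y.
Proof. by rewrite !zringE !mxE. Qed.

Definition zE := (zhat_vec3, ztil_vec3, zring_vec3, zhatD, zhatZ, ztilD, ztilZ, zringD, zringZ).

Lemma ns_E_vec3 (D : ns_data R k) l y : ns_E D l *m y =
  vec3 (rotmx (ns_aR D l) (ns_aI D l) *m zhat y) (ns_Et D l *m ztil y) 0.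
Proof.
rewrite /ns_E -{1}[y]vsubmxK -[usubmx y]vsubmxK mul_block_col !mul0mx !addr0.
rewrite mul_block_col !mul0mx add0r addr0 /vec3; congr col_mx.
Qed.

Lemma rotmxZ (x y p : R) : rotmx x y *m cv2 (cos p) (sin p) =
  x *: cv2 (cos p) (sin p) + y *: cv2 (- sin p) (cos p).
Proof.
apply/matrixP => i j; rewrite ord1; case: (ord2P i) => ->; rewrite rotmxE !mxE /=; ring.
Qed.

End Vec3.

(** * The near-identity transformation and its Jacobian *)

Section NF.
Variables (R : realType) (k : nat) (nf : nf_data R k).
Notation n := (2 + k + 1)%N.
Notation i0 := (hidx k 0).
Notation i1 := (hidx k 1).

Definition acoef m t l : 'cV[R]_n := vec3 (nf_ahat nf m t l) (nf_atil nf m t l) (nf_aring nf m t l).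
Definition bcoef m t l : 'cV[R]_n := vec3 (nf_bhat nf m t l) (nf_btil nf m t l) (nf_bring nf m t l).
(** Cubic terms occur in the hat block of the transformation only, hence the zero tilde and ring
    parts. *)
Definition hcoef m t l : 'cV[R]_n := vec3 (nf_ahat nf m t l) 0 0.
Definition kcoef m t l : 'cV[R]_n := vec3 (nf_bhat nf m t l) 0 0.

Lemma nf_mapE e l t y : nf_map nf e l t y =
  y + e *: quad_part acoef bcoef t l (zhat y) + e ^+ 2 *: cubic_part hcoef kcoef t l (zhat y).
Proof.
apply: vec3_eq; rewrite /nf_map /quad_part /cubic_part /acoef /bcoef /hcoef /kcoef !zE //.
- by rewrite !(scaler0, addr0).
- by rewrite !(mulr0, addr0).
Qed.

Section Jac.
Variables (e l t : R) (y : 'cV[R]_n).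
Let y1 := y i0 0.
Let y2 := y i1 0.
(** [jcol1] and [jcol2] are the partial derivatives of [nf_map] minus the identity in the two hat
    variables, the only ones its nonlinear terms contain. The Jacobian is therefore the identity
    plus a matrix of rank at most two. *)
Definition jcol1 : 'cV[R]_n :=
  e *: ((2 * y1) *: acoef 0 t l + (2 * y1) *: acoef 2 t l + (2 * y2) *: bcoef 2 t l)
  + e ^+ 2 *: ((3 * y1 ^+ 2 + y2 ^+ 2) *: hcoef 1 t l + (2 * y1 * y2) *: kcoef 1 t l
     + (3 * y1 ^+ 2 - 3 * y2 ^+ 2) *: hcoef 3 t l + (6 * y1 * y2) *: kcoef 3 t l).
Definition jcol2 : 'cV[R]_n :=
  e *: ((2 * y2) *: acoef 0 t l - (2 * y2) *: acoef 2 t l + (2 * y1) *: bcoef 2 t l)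
  + e ^+ 2 *: ((2 * y1 * y2) *: hcoef 1 t l + (y1 ^+ 2 + 3 * y2 ^+ 2) *: kcoef 1 t l
     - (6 * y1 * y2) *: hcoef 3 t l + (3 * y1 ^+ 2 - 3 * y2 ^+ 2) *: kcoef 3 t l).

Lemma nf_map_deriv i u : is_derive y u (fun y => nf_map nf e l t y i 0)
  (u i 0 + u i0 0 * jcol1 i 0 + u i1 0 * jcol2 i 0).
Proof.
apply/is_derive_lineP.
have -> : (fun h : R => nf_map nf e l t (h *: u + y) i 0) =
  (fun h => (h * u i 0 + y i 0) + e * (
     ((h * u i0 0 + y1) ^+ 2 + (h * u i1 0 + y2) ^+ 2) * acoef 0 t l i 0 +
     ((h * u i0 0 + y1) ^+ 2 - (h * u i1 0 + y2) ^+ 2) * acoef 2 t l i 0 +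
     2 * (h * u i0 0 + y1) * (h * u i1 0 + y2) * bcoef 2 t l i 0)
   + e ^+ 2 * (
     ((h * u i0 0 + y1) * ((h * u i0 0 + y1) ^+ 2 + (h * u i1 0 + y2) ^+ 2)) * hcoef 1 t l i 0
   + ((h * u i1 0 + y2) * ((h * u i0 0 + y1) ^+ 2 + (h * u i1 0 + y2) ^+ 2)) * kcoef 1 t l i 0
   + ((h * u i0 0 + y1) * ((h * u i0 0 + y1) ^+ 2 - 3 * (h * u i1 0 + y2) ^+ 2)) * hcoef 3 t l i 0
   + ((h * u i1 0 + y2) * (3 * (h * u i0 0 + y1) ^+ 2 - (h * u i1 0 + y2) ^+ 2)) * kcoef 3 t l i 0)).
  apply/funext => h; rewrite nf_mapE /quad_part /cubic_part !zhatE.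
  move: (acoef 0 t l) (acoef 2 t l) (bcoef 2 t l) (hcoef 1 t l) (hcoef 3 t l) (kcoef 1 t l) (kcoef 3 t l).
  by move=> *; rewrite !mxE.
rewrite /jcol1 /jcol2.
move: (acoef 0 t l) (acoef 2 t l) (bcoef 2 t l) (hcoef 1 t l) (hcoef 3 t l) (kcoef 1 t l) (kcoef 3 t l).
move=> A0 A2 B2 H1 H3 K1 K3; rewrite !mxE.
have dh (c d : R) : is_derive (0 : R) (1 : R) (fun h : R => h * c + d) c.
  have H := is_deriveDf (is_deriveMf (is_derive_id (0 : R) (1 : R)) (is_derive_cst c (0 : R) (1 : R)))
     (is_derive_cst d (0 : R) (1 : R)).
  by apply: is_derive_eq H _; rewrite /cst; ring.
have dc (c f : R) (g : R -> R) : is_derive (0 : R) (1 : R) g f ->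
    is_derive (0 : R) (1 : R) (fun h => g h * c) (f * c).
  by move=> gf; have := is_deriveCf c gf; rewrite mulrC; congr is_derive;
    apply/funext => h; rewrite mulrC.
have dX (f : R) (g : R -> R) : is_derive (0 : R) (1 : R) g f ->
    is_derive (0 : R) (1 : R) (fun h => g h ^+ 2) (2 * g 0 * f).
  move=> gf; rewrite (_ : (fun h => _) = (fun h => g h * g h)); last by apply/funext.
  by apply: is_derive_eq (is_deriveMf gf gf) _; ring.
have d0 := dh (u i0 0) y1; have d1 := dh (u i1 0) y2.
have s0 := dX _ _ d0; have s1 := dX _ _ d1.
apply: is_derive_eq.
by rewrite /GRing.scale /= !mul0r !add0r; ring.
Qed.

Lemma nf_jacE : jac (nf_map nf e l t) y =
  1%:M + jcol1 *m delta_mx 0 i0 + jcol2 *m delta_mx 0 i1.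
Proof.
apply/matrixP => i j; rewrite mxE.
have dF : derivable (nf_map nf e l t) y (delta_mx j 0).
  by apply/derivable_mxP => a b; rewrite ord1; have [] := nf_map_deriv a (delta_mx j 0).
rewrite derive_mx// mxE (@derive_val _ _ _ _ _ _ _ (nf_map_deriv i (delta_mx j 0))).
move: jcol1 jcol2 => J1 J2; rewrite !mxE !big_ord1 !mxE !eqxx /= !andbT.
by rewrite ![_ == j]eq_sym [j == i]eq_sym; ring.
Qed.

Lemma nf_jacM w : jac (nf_map nf e l t) y *m w =
  w + w i0 0 *: jcol1 + w i1 0 *: jcol2.
Proof.
rewrite nf_jacE; move: jcol1 jcol2 => J1 J2; rewrite !mulmxDl mul1mx -!mulmxA.
have dw (i : 'I_n) : delta_mx 0 i *m w = (w i 0)%:M :> 'M[R]_1.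
  apply/matrixP => a b; rewrite !ord1 !mxE (bigD1 i)//= big1 ?addr0 => [|j ji].
    by rewrite !mxE !eqxx mul1r.
  by rewrite !mxE (negbTE ji) andbF mul0r.
by rewrite !dw !mul_mx_scalar.
Qed.

End Jac.

(** A nonzero row v with v A = 0 would satisfy |v| = |v (A - 1)| < |v|; the factor m comes from the
    max norm of a product. *)
Lemma near_id_unit (m : nat) (A : 'M[R]_m) : m%:R * `|A - 1%:M| < 1 -> A \in unitmx.
Proof.
move=> h; rewrite -row_free_unit -kermx_eq0; apply/negPn/negP => /rowV0Pn[v /sub_kermxP vA v0].
have : `|v| <= m%:R * `|v| * `|A - 1%:M|.
  have E : v *m (A - 1%:M) = - v by rewrite mulmxBr vA mulmx1 sub0r.
  by rewrite -[leLHS]normrN -E; exact: mxnormM.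
rewrite mulrAC -subr_ge0 -[X in _ - X]mul1r -mulrBl => H.
have : (m%:R * `|A - 1%:M| - 1) * `|v| < 0 by rewrite nmulr_rlt0 ?normr_gt0// subr_lt0.
by rewrite ltNge H.
Qed.

End NF.

(** * The identities of order eps and eps^2 contained in the normal form *)

Section NFexpansion.
Variables (R : realType) (k : nat) (D : ns_data R k) (nf : nf_data R k).
Notation n := (2 + k + 1)%N.
Notation i0 := (hidx k 0).
Notation i1 := (hidx k 1).
Notation V := ('cV[R]_n * R)%type.
Notation ls := (ns_lam D).
Hypothesis smF : smooth_on setT (fun p : V => ns_F D p.1 p.2).
Variable r : R.
Hypothesis r_gt0 : 0 < r.
Hypothesis ct : continuation D r.
Hypothesis aR0 : ns_aR D ls = 0.
Hypothesis aI0 : ns_aI D ls = ns_om D.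
Hypothesis nfls : normal_form_at D nf ls.

(** On the circle a* the transformation becomes a trigonometric polynomial: [zq], with modes 0 and
    2, is its coefficient of eps, and [zc], with modes 1 and 3, that of eps^2. The prefix [d] marks
    phi-derivatives, the prefix [t] theta-derivatives, all at lambda*. *)
Definition zq t p : 'cV[R]_n := acoef nf 0 t ls + cos (2 * p) *: acoef nf 2 t ls + sin (2 * p) *: bcoef nf 2 t ls.
Definition dzq t p : 'cV[R]_n := (- (2 * sin (2 * p))) *: acoef nf 2 t ls + (2 * cos (2 * p)) *: bcoef nf 2 t ls.
Definition zc t p : 'cV[R]_n := cos p *: hcoef nf 1 t ls + sin p *: kcoef nf 1 t ls
  + cos (3 * p) *: hcoef nf 3 t ls + sin (3 * p) *: kcoef nf 3 t ls.
Definition dzc t p : 'cV[R]_n := (- sin p) *: hcoef nf 1 t ls + cos p *: kcoef nf 1 t ls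
  + (- (3 * sin (3 * p))) *: hcoef nf 3 t ls + (3 * cos (3 * p)) *: kcoef nf 3 t ls.
Definition d1v (f : R -> R -> 'cV[R]_n) t : 'cV[R]_n := derive1 (f ^~ ls) t.
Definition tzq t p : 'cV[R]_n := d1v (acoef nf 0) t + cos (2 * p) *: d1v (acoef nf 2) t + sin (2 * p) *: d1v (bcoef nf 2) t.
Definition tzc t p : 'cV[R]_n := cos p *: d1v (hcoef nf 1) t + sin p *: d1v (kcoef nf 1) t
  + cos (3 * p) *: d1v (hcoef nf 3) t + sin (3 * p) *: d1v (kcoef nf 3) t.

Lemma cos2E (p : R) : cos (2 * p) = cos p ^+ 2 - sin p ^+ 2.
Proof. by rewrite mulr_natl mulr2n cosD -!expr2. Qed.
Lemma sin2E (p : R) : sin (2 * p) = 2 * cos p * sin p.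
Proof. by rewrite mulr_natl mulr2n sinD; ring. Qed.
Lemma cos3E (p : R) : cos (3 * p) = cos p * (cos p ^+ 2 - 3 * sin p ^+ 2).
Proof.
rewrite (_ : 3 * p = 2 * p + p) ?cosD ?cos2E ?sin2E; ring.
Qed.
Lemma sin3E (p : R) : sin (3 * p) = sin p * (3 * cos p ^+ 2 - sin p ^+ 2).
Proof.
rewrite (_ : 3 * p = 2 * p + p) ?sinD ?cos2E ?sin2E; ring.
Qed.

Lemma astar_idx (p : R) : (astar k p i0 0 = cos p) * (astar k p i1 0 = sin p).
Proof. by rewrite -!zhatE /astar zhat_vec3 !cv2E. Qed.
Lemma dastar_idx (p : R) : (dastar k p i0 0 = - sin p) * (dastar k p i1 0 = cos p).
Proof. by rewrite -!zhatE /dastar zhat_vec3 !cv2E. Qed.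

Lemma sin_sq (p : R) : sin p ^+ 2 = 1 - cos p ^+ 2.
Proof. by rewrite -(cos2Dsin2 p) addrAC subrr add0r. Qed.

Lemma nf_map_astar e t p : nf_map nf e ls t (astar k p) = astar k p + e *: zq t p + e ^+ 2 *: zc t p.
Proof.
rewrite nf_mapE /quad_part /cubic_part /zq /zc !zhatE !astar_idx cos2Dsin2 !mulr1 scale1r.
by rewrite cos2E sin2E cos3E sin3E.
Qed.

(** Chain rule: [dastar] is the phi-derivative of [astar], so the product is the phi-derivative of
    the transformed circle. *)
Lemma nf_jac_dastar e t p : jac (nf_map nf e ls t) (astar k p) *m dastar k p =
  dastar k p + e *: dzq t p + e ^+ 2 *: dzc t p.
Proof.
rewrite nf_jacM /jcol1 /jcol2 !astar_idx !dastar_idx /dzq /dzc.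
rewrite cos2E sin2E cos3E sin3E.
move: (acoef nf 0 ls t) => *; apply/matrixP => i j; rewrite !mxE !sin_sq.
have S3 : sin p * sin p ^+ 2 = sin p * (1 - cos p ^+ 2) by rewrite sin_sq.
move: (acoef nf 0 t ls i j) (acoef nf 2 t ls i j) (bcoef nf 2 t ls i j) (hcoef nf 1 t ls i j) (hcoef nf 3 t ls i j) (kcoef nf 1 t ls i j) (kcoef nf 3 t ls i j).
move: (sin_sq p) (dastar k p i j); move: (cos p) (sin p) S3 => c s S3 S2 d A0 A2 B2 H1 H3 K1 K3.
have S2' : s * s = 1 - c * c by rewrite -!expr2.
ring: S2'.
Qed.

Lemma vec3_derivable (f : nat -> R -> R -> 'cV[R]_2) (g : nat -> R -> R -> 'cV[R]_k) (h : nat -> R -> R -> R) m t :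
  per_derivable (f m ^~ ls) -> per_derivable (g m ^~ ls) -> per_derivable (h m ^~ ls) ->
  derivable (fun s => vec3 (f m s ls) (g m s ls) (h m s ls) : 'cV[R]_n) t 1.
Proof.
move=> [_ df] [_ dg] [_ dh]; apply/derivable_mxP => i j; rewrite ord1.
move: i; apply: idxP => [i|i|].
- rewrite (_ : (fun s => _) = (fun s => f m s ls i 0)).
    by move: (df t) => /derivable_mxP; apply.
  by apply/funext => s; rewrite -zhatE zhat_vec3.
- rewrite (_ : (fun s => _) = (fun s => g m s ls i 0)).
    by move: (dg t) => /derivable_mxP; apply.
  by apply/funext => s; rewrite -ztilE ztil_vec3.
- rewrite (_ : (fun s => _) = (fun s => h m s ls)); first exact: dh.
  by apply/funext => s; rewrite -zringE zring_vec3.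
Qed.

Lemma cst_per (W : normedModType R) (c : W) : per_derivable (fun _ : R => c).
Proof. by split=> // t; exact: derivable_cst. Qed.

Lemma acoef_derivable m t : derivable (acoef nf m ^~ ls) t 1.
Proof. exact: (@vec3_derivable (nf_ahat nf) (nf_atil nf) (nf_aring nf) m t (nfa_ahat nfls m) (nfa_atil nfls m) (nfa_aring nfls m)). Qed.
Lemma bcoef_derivable m t : derivable (bcoef nf m ^~ ls) t 1.
Proof. exact: (@vec3_derivable (nf_bhat nf) (nf_btil nf) (nf_bring nf) m t (nfa_bhat nfls m) (nfa_btil nfls m) (nfa_bring nfls m)). Qed.
Lemma hcoef_derivable m t : derivable (hcoef nf m ^~ ls) t 1.
Proof.
exact: (@vec3_derivable (nf_ahat nf) (fun _ _ _ => 0) (fun _ _ _ => 0) _ _ (nfa_ahat nfls m) (cst_per _) (cst_per _)).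
Qed.
Lemma kcoef_derivable m t : derivable (kcoef nf m ^~ ls) t 1.
Proof.
exact: (@vec3_derivable (nf_bhat nf) (fun _ _ _ => 0) (fun _ _ _ => 0) _ _ (nfa_bhat nfls m) (cst_per _) (cst_per _)).
Qed.

Lemma nf_map_dt e t p : derive1 (fun s => nf_map nf e ls s (astar k p)) t =
  e *: tzq t p + e ^+ 2 *: tzc t p.
Proof.
have DA m := derivableP (@acoef_derivable m t).
have DB m := derivableP (@bcoef_derivable m t).
have DH m := derivableP (@hcoef_derivable m t).
have DK m := derivableP (@kcoef_derivable m t).
rewrite derive1E; apply: derive_val.
rewrite (_ : (fun s => _) = (cst (astar k p) + e *: ((acoef nf 0 ^~ ls) + cos (2 * p) *: (acoef nf 2 ^~ ls) + sin (2 * p) *: (bcoef nf 2 ^~ ls)))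
   + e ^+ 2 *: (cos p *: (hcoef nf 1 ^~ ls) + sin p *: (kcoef nf 1 ^~ ls) + cos (3 * p) *: (hcoef nf 3 ^~ ls) + sin (3 * p) *: (kcoef nf 3 ^~ ls))); last first.
  by apply/funext => s; rewrite nf_map_astar.
rewrite /tzq /tzc /d1v !derive1E.
have H1 := is_deriveD (is_deriveD (DA 0%N) (is_deriveZ (cos (2 * p)) (DA 2%N))) (is_deriveZ (sin (2 * p)) (DB 2%N)).
have H2 := is_deriveD (is_deriveD (is_deriveD (is_deriveZ (cos p) (DH 1%N)) (is_deriveZ (sin p) (DK 1%N)))
  (is_deriveZ (cos (3 * p)) (DH 3%N))) (is_deriveZ (sin (3 * p)) (DK 3%N)).
have H := is_deriveD (is_deriveD (is_derive_cst (astar k p) t 1) (is_deriveZ e H1)) (is_deriveZ (e ^+ 2) H2).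
by rewrite add0r in H.
Qed.

Lemma E_astar (p : R) : ns_E D ls *m astar k p = ns_om D *: dastar k p.
Proof.
rewrite ns_E_vec3 /astar zhat_vec3 ztil_vec3 mulmx0 rotmxZ aR0 aI0 scale0r add0r /dastar.
by apply: vec3_eq; rewrite !zE ?scaler0 ?mulr0.
Qed.

Variables (t p : R) (Gp Kp : nat -> R -> 'cV[R]_n -> 'cV[R]_n).
Hypothesis expn : nf_expansion D nf ls Gp Kp.
Hypothesis cond : forall t x,
      [/\ ztil (Gp 2%N t (only_hat k x)) = 0,
          zring (Gp 2%N t (only_hat k x)) =
            nf_kappa nf ls * (x 0 0 ^+ 2 + x 1 0 ^+ 2),
          zhat (Gp 2%N t (only_hat k x)) = 0
        & zhat (Gp 3%N t (only_hat k x)) =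
            (x 0 0 ^+ 2 + x 1 0 ^+ 2) *:
              (rotmx (nf_betaR nf ls) (nf_betaI nf ls) *m x)].

Local Notation a := (astar k p).
Local Notation kap := (nf_kappa nf ls).
Local Notation om := (ns_om D).
Local Notation q2 := (mul2 (jet2 D t ls)).
Local Notation q3 := (mul3 (jet3 D t ls)).
Local Notation Y e := (nf_map nf e ls t (astar k p)).

Lemma Gp2_astar : Gp 2%N t a = kap *: e_n R k.
Proof.
have [h1 h2 h3 _] := cond t (cv2 (cos p) (sin p)).
apply: vec3_eq; rewrite /e_n !zE ?scaler0.
- exact: h3.
- exact: h1.
- by rewrite [LHS]h2 !cv2E cos2Dsin2 mulr1.
Qed.

Lemma Gp3_astar : zhat (Gp 3%N t a) = rotmx (nf_betaR nf ls) (nf_betaI nf ls) *m cv2 (cos p) (sin p).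
Proof.
have [_ _ _ h] := cond t (cv2 (cos p) (sin p)).
by rewrite [LHS]h !cv2E cos2Dsin2 scale1r.
Qed.

(* Coefficients of eps and eps^2 of the normal form identity at y = a*(phi). *)
Definition NF1 : 'cV[R]_n := ns_E D ls *m zq t p + q2 a a - kap *: e_n R k - tzq t p - om *: dzq t p.
Definition NF2 : 'cV[R]_n := ns_E D ls *m zc t p - kap *: (Bmx D t ls *m a) + q2 a (zq t p) + q2 (zq t p) a
  + q3 a a a - tzc t p - om *: dzc t p - Gp 3%N t a.

Lemma Op_of_bigO (f : R -> 'cV[R]_n) N : f =O_ (0^') (fun e : R => e ^+ N) ->
  Op N (fun e (_ : unit) => f e).
Proof.
move=> /eqOP[C [_ HC]]; exists (`|C| + 1); first exact: addr_ge0.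
have := HC (`|C| + 1); rewrite (le_lt_trans (ler_norm C)) ?ltrDl// => /(_ isT) H.
by near=> e => _; rewrite -normrX; near: e.
Unshelve. all: by end_near. Qed.

(** The points of a* satisfy |hat y|^2 = 1, where the expansion is imposed. With zeta = 0 the K
    terms vanish, and the conditions on [Gp 2] leave kappa e_n at order eps. *)
Lemma Gdag_expand : Op 3 (fun e (_ : unit) => nf_Gdag D nf a ls 0 t e -
   (om *: dastar k p + e *: (kap *: e_n R k) + e ^+ 2 *: Gp 3%N t a)).
Proof.
case: expn => _ _ /(_ 3%N a 0 t) H.
have Ha : zhat a 0 0 ^+ 2 + zhat a 1 0 ^+ 2 = 1.
  by rewrite /astar zhat_vec3 !cv2E cos2Dsin2.
have /Op_of_bigO := H Ha; apply: Op_eq; near=> e => _.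
by rewrite scale0r addr0 big_ltn// big_nat1 Gp2_astar E_astar addrA.
Unshelve. all: by end_near. Qed.

Let r1 := r / 2.
Let lsr : `|ls - ls| <= r1. Proof. by rewrite subrr normr0 /r1 ltW// divr_gt0. Qed.

Lemma Op_c2 : Op 0 (fun (_ : R) (u : unit * 'I_n * 'I_n) => jet2 D t ls u.1.2 u.2).
Proof.
have [C C0 HC] := jet2_bnd smF r_gt0 ct.
by apply: (@Op_bounded _ _ _ _ C); near=> e => u; case: (HC u.1.2 u.2 t ls lsr).
Unshelve. all: by end_near. Qed.
Lemma Op_c3 : Op 0 (fun (_ : R) (u : unit * 'I_n * 'I_n * 'I_n) => jet3 D t ls u.1.1.2 u.1.2 u.2).
Proof.
have [C C0 HC] := jet3_bnd smF r_gt0 ct.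
by apply: (@Op_bounded _ _ _ _ C); near=> e => u; case: (HC u.1.1.2 u.1.2 u.2 t ls lsr).
Unshelve. all: by end_near. Qed.
Lemma Op_c4 : Op 0 (fun (_ : R) (u : unit * 'I_n * 'I_n * 'I_n * 'I_n) => jet4 D t ls u.1.1.1.2 u.1.1.2 u.1.2 u.2).
Proof.
have [C C0 HC] := jet4_bnd smF r_gt0 ct.
by apply: (@Op_bounded _ _ _ _ C); near=> e => u; case: (HC u.1.1.1.2 u.1.1.2 u.1.2 u.2 t ls lsr).
Unshelve. all: by end_near. Qed.

Let Ocst (v : 'cV[R]_n) : Op 0 (fun (_ : R) (_ : unit) => v) := Op_cst _ v.
Let Oe q (f : R -> unit -> 'cV[R]_n) m : Op q f -> Op (m + q) (fun e u => e ^+ m *: f e u).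
Proof. by move=> H; apply: (Op_scale (@Op_exp _ _ m) H). Qed.
Let Oec m (v : 'cV[R]_n) : Op m (fun e (_ : unit) => e ^+ m *: v).
Proof. by rewrite -[X in Op X]addn0; exact: Oe (Ocst v). Qed.

Lemma Op_Y : Op 0 (fun e (_ : unit) => Y e).
Proof.
apply: (@Op_eq _ _ _ _ (fun e (_ : unit) => a + e ^+ 1 *: zq t p + e ^+ 2 *: zc t p)).
  by near=> e => _; rewrite nf_map_astar expr1.
apply: Op_add; last exact: Op_le (Oec 2 _).
by apply: Op_add; [exact: Ocst|exact: Op_le (Oec 1 _)].
Unshelve. all: by end_near. Qed.

Lemma Op_Ya : Op 1 (fun e (_ : unit) => Y e - a).
Proof.
apply: (@Op_eq _ _ _ _ (fun e (_ : unit) => e ^+ 1 *: zq t p + e ^+ 2 *: zc t p)).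
  by near=> e => _; rewrite nf_map_astar expr1 -(addrA a) (addrC a) addrK.
by apply: Op_add; [exact: Oec|exact: Op_le (Oec 2 _)].
Unshelve. all: by end_near. Qed.

Lemma Op_jcols : Op 1 (fun e (_ : unit) => jcol1 nf e ls t a) /\
  Op 1 (fun e (_ : unit) => jcol2 nf e ls t a).
Proof.
by split; rewrite /jcol1 /jcol2; apply: Op_add; [exact: (Oec 1)|exact: Op_le (Oec 2 _)|
  exact: (Oec 1)|exact: Op_le (Oec 2 _)].
Qed.

Lemma Op_coord q (f : R -> unit -> 'cV[R]_n) i : Op q f -> Op q (fun e u => f e u i 0).
Proof.
move=> [C C0 HC]; exists C => //; near=> e => u.
by apply: le_trans (mxnorm_ge _ i 0) _; move: u; near: e.
Unshelve. all: by end_near. Qed.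

Lemma jac_unit : \forall e \near (0 : R)^', jac (nf_map nf e ls t) a \in unitmx.
Proof.
have [[C1 C10 H1] [C2 C20 H2]] := Op_jcols.
have H : Op 1 (fun e (_ : unit) => jac (nf_map nf e ls t) a - 1%:M).
  apply: (@Op_eq _ _ _ _ (fun e (_ : unit) => jcol1 nf e ls t a *m delta_mx 0 i0 + jcol2 nf e ls t a *m delta_mx 0 i1)).
    by near=> e => _; rewrite nf_jacE -(addrA 1%:M) (addrC 1%:M) addrK.
  by case: Op_jcols => h1 h2; apply: Op_add;
   [exact: (Op_mulmx (p := 1) (q := 0) h1 (Op_cst _ _))|exact: (Op_mulmx (p := 1) (q := 0) h2 (Op_cst _ _))].
have [C C0 HC] := H; near=> e; apply: near_id_unit.
have h : `|jac (nf_map nf e ls t) a - 1%:M| <= C * `|e| ^+ 1 by move: tt; near: e.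
apply: (@le_lt_trans _ _ (n%:R * (C * `|e|))); first by rewrite ler_wpM2l.
have : `|e| < (n%:R * C + 1)^-1.
  by near: e; apply: dnbhs0_lt; rewrite invr_gt0 ltr_wpDl// mulr_ge0.
rewrite -[X in _ < X]mul1r ltr_pdivlMr; last by rewrite ltr_wpDl// mulr_ge0.
by move=> h'; apply: le_lt_trans h'; rewrite mulrDr mulr1 mulrA mulrC lerDl.
Unshelve. all: by end_near. Qed.

(** The definition of G^dagger, multiplied by the Jacobian, equates two expansions in eps at y = a*,
    zeta = 0. Their difference eps NF1 + eps^2 NF2 is O(eps^3), so both coefficients vanish. *)
Lemma NF_main : NF1 = 0 /\ NF2 = 0.
Proof.
apply: Op_zero.
have [jc1 jc2] := Op_jcols.
(* w is G^dagger - eta e_n at eta = eps kappa; the Jacobian times w is free of the inverse matrix in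
   [nf_Gdag]. *)
pose w e := nf_Gdag D nf a ls 0 t e - (e * kap) *: e_n R k.
pose rho e := nf_Gdag D nf a ls 0 t e - (om *: dastar k p + e *: (kap *: e_n R k) + e ^+ 2 *: Gp 3%N t a).
have rhoO : Op 3 (fun e (_ : unit) => rho e) by exact: Gdag_expand.
pose J e := jac (nf_map nf e ls t) a.
pose c4 e := mul4 (jet4 D t ls) (Y e) (Y e) (Y e) (Y e).
pose R1 e := ns_G D (Y e) ls (e * kap) t e - (ns_E D ls *m Y e - (e * (e * kap)) *: (Bmx D t ls *m Y e) +
    e *: q2 (Y e) (Y e) + e ^+ 2 *: q3 (Y e) (Y e) (Y e) + e ^+ 3 *: c4 e).
have R1O : Op 4 (fun e (_ : unit) => R1 e).
  have [C C0 HC] := G_jet smF r_gt0 ct; have [CY CY0 HY] := Op_Y.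
  exists (C * CY ^+ 5); first by rewrite mulr_ge0// exprn_ge0.
  near=> e => _.
  have e0 : e != 0 by near: e; exact: near_ne0.
  have hY : `|Y e| <= CY.
    by rewrite -[leRHS]mulr1 -[X in _ * X](expr0 `|e|); move: tt; near: e.
  have eY : `|e| * `|Y e| <= 1.
    apply: (@le_trans _ _ (`|e| * (CY + 1))); first by rewrite ler_wpM2l// (le_trans hY)// lerDl.
    rewrite -ler_pdivlMr ?ltr_wpDl//; near: e; apply: dnbhs0_le.
    by rewrite divr_gt0// ltr_wpDl.
  apply: le_trans (HC t ls (Y e) (e * kap) e e0 lsr eY) _.
  by rewrite [leRHS]mulrAC; apply: ler_wpM2l; rewrite ?mulr_ge0 ?exprn_ge0// lerXn2r// nnegrE.
(* What the quadratic form at Y contains beyond its terms of order 1 and eps. *)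
pose R4 e := q2 (Y e) (Y e) - q2 a a - e *: (q2 a (zq t p) + q2 (zq t p) a).
have R4O : Op 2 (fun e (_ : unit) => R4 e).
  apply: (@Op_eq _ _ _ _ (fun e (_ : unit) => q2 (Y e - a) (Y e - a) + e ^+ 2 *: (q2 (zc t p) a + q2 a (zc t p)))).
    near=> e => _; rewrite /R4.
    have -> : Y e - a = e *: zq t p + e ^+ 2 *: zc t p by rewrite nf_map_astar -(addrA a) (addrC a) addrK.
    rewrite nf_map_astar; move: (zq t p) (zc t p) => Zq Zc.
    rewrite !(mul2Dl, mul2Dr, mul2Zl, mul2Zr).
    move: (q2 a a) (q2 a Zq) (q2 Zq a) (q2 a Zc) (q2 Zc a) (q2 Zq Zq) (q2 Zc Zq) (q2 Zq Zc) (q2 Zc Zc) => *.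
    by apply/matrixP => i j; rewrite !mxE; ring.
  apply: Op_add; last exact: Oec.
  exact: (Op_mul2 (p := 0) (q := 1) (s := 1) Op_c2 Op_Ya Op_Ya).
pose R5 e := q3 (Y e) (Y e) (Y e) - q3 a a a.
have R5O : Op 1 (fun e (_ : unit) => R5 e).
  rewrite /R5; under [fun e => _]funext => e do rewrite mul3_diff.
  apply: Op_add; [apply: Op_add|].
  - exact: (Op_mul3 (p := 0) (q := 1) (s := 0) (r := 0) Op_c3 Op_Ya Op_Y Op_Y).
  - exact: (Op_mul3 (p := 0) (q := 0) (s := 1) (r := 0) Op_c3 (Ocst _) Op_Ya Op_Y).
  - exact: (Op_mul3 (p := 0) (q := 0) (s := 0) (r := 1) Op_c3 (Ocst _) (Ocst _) Op_Ya).
have c4O : Op 0 (fun e (_ : unit) => c4 e).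
  exact: (Op_mul4 (p := 0) (q := 0) (s := 0) (r := 0) (v := 0) Op_c4 Op_Y Op_Y Op_Y Op_Y).
(* On om dastar the Jacobian is known exactly; in front of eps^2 [Gp 3] it may be replaced by the
   identity, from which it differs by O(eps). *)
pose R7 e := J e *m w e - om *: (dastar k p + e *: dzq t p + e ^+ 2 *: dzc t p) - e ^+ 2 *: Gp 3%N t a.
have R7O : Op 3 (fun e (_ : unit) => R7 e).
  apply: (@Op_eq _ _ _ _ (fun e (_ : unit) => e ^+ 2 *: ((Gp 3%N t a i0 0) *: jcol1 nf e ls t a + (Gp 3%N t a i1 0) *: jcol2 nf e ls t a)
     + (rho e + rho e i0 0 *: jcol1 nf e ls t a + rho e i1 0 *: jcol2 nf e ls t a))).
    near=> e => _; rewrite /R7.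
    have -> : w e = om *: dastar k p + e ^+ 2 *: Gp 3%N t a + rho e.
      rewrite /rho /w; move: (nf_Gdag _ _ _ _ _ _ _) (Gp 3%N t a) (dastar k p) (e_n R k) => *.
      by apply/matrixP => i j; rewrite !mxE; ring.
    move: (rho e) => rh; rewrite /J !mulmxDr -!scalemxAr nf_jac_dastar !nf_jacM.
    move: (Gp 3%N t a) (jcol1 _ _ _ _ _) (jcol2 _ _ _ _ _) (dastar k p) (dzq t p) (dzc t p) => *.
    by apply/matrixP => i j; rewrite !mxE; ring.
  apply: Op_add.
    apply: (Oe (q := 1)); apply: Op_add.
      exact: (Op_scale (p := 0) (q := 1) (Op_cst _ _) jc1).
    exact: (Op_scale (p := 0) (q := 1) (Op_cst _ _) jc2).
  apply: Op_add; first apply: Op_add => //.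
    exact: Op_le (Op_scale (Op_coord _ rhoO) jc1).
  exact: Op_le (Op_scale (Op_coord _ rhoO) jc2).
(* For small eps this combination of remainders equals eps NF1 + eps^2 NF2, and each summand is
   O(eps^3). *)
apply: (@Op_eq _ _ _ _ (fun e (_ : unit) => - R1 e - e ^+ 3 *: c4 e
  + e ^+ 2 *: (kap *: (Bmx D t ls *m (Y e - a))) - e ^+ 1 *: R4 e - e ^+ 2 *: R5 e
  + e ^+ 3 *: (kap *: (tzq t p + e *: tzc t p)) + R7 e)).
  near=> e => _.
  have uJ : J e \in unitmx by near: e; exact: jac_unit.
  have X0 : J e *m w e = ns_G D (Y e) ls (e * kap) t e - (e * kap) *: e_n R k
     - (1 + e * (e * kap)) *: (e *: tzq t p + e ^+ 2 *: tzc t p).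
    by rewrite /w /nf_Gdag add0r addrK mulKVmx// nf_map_dt.
  have EY : ns_E D ls *m Y e = om *: dastar k p + e *: (ns_E D ls *m zq t p) + e ^+ 2 *: (ns_E D ls *m zc t p).
    by rewrite nf_map_astar; move: (zq t p) (zc t p) => ? ?; rewrite !mulmxDr -!scalemxAr E_astar.
  rewrite /NF1 /NF2 /R7 X0 /R1 EY /R4 /R5 mulmxBr.
  move: (ns_G _ _ _ _ _ _) (c4 e) (q2 (Y e) (Y e)) (q3 (Y e) (Y e) (Y e)) (Bmx D t ls *m Y e) (Bmx D t ls *m a)
   (ns_E D ls *m zq t p) (ns_E D ls *m zc t p) (q2 a a) (q2 a (zq t p)) (q2 (zq t p) a) (q3 a a a) (e_n R k)
   (tzq t p) (tzc t p) (dzq t p) (dzc t p) (dastar k p) (Gp 3%N t a) => *.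
  by apply/matrixP => i j; rewrite !mxE; ring.
apply: Op_add => //; apply: Op_add; last first.
  apply: (Oe (q := 0)); apply: (Op_scale (p := 0) (q := 0) (Op_cst _ _)).
  by apply: Op_add; [exact: Ocst|exact: Op_le (Oec 1 _)].
apply: Op_sub; last exact: (Oe (q := 1)).
apply: Op_sub; last exact: (Oe (q := 2)).
apply: Op_add; last first.
  apply: (Oe (q := 1)); apply: (Op_scale (p := 0) (q := 1) (Op_cst _ _)).
  exact: (Op_mulmx (p := 0) (q := 1) (Op_cst _ _) Op_Ya).
apply: Op_sub; last exact: (Oe (q := 0)).
by apply: Op_opp; exact: Op_le R1O.
Unshelve. all: by end_near. Qed.

End NFexpansion.

(** * Mode equations of a truncated solution *)

Section TrigVec.
Variables (R : realType).

Lemma trigD (a b a' b' : nat -> R) p :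
  trig a b p + trig a' b' p = trig (fun m => a m + a' m) (fun m => b m + b' m) p.
Proof.
rewrite /trig addrACA -big_split; congr (_ + _); apply: eq_bigr => m _ /=; ring.
Qed.

Lemma trigZ (c : R) (a b : nat -> R) p :
  c * trig a b p = trig (fun m => c * a m) (fun m => c * b m) p.
Proof.
rewrite /trig mulrDr mulr_sumr; congr (_ + _); apply: eq_bigr => m _ /=; ring.
Qed.

Lemma trig_cst (c : R) p : trig (fun m => if m == 0%N then c else 0) (fun _ => 0) p = c.
Proof.
by rewrite /trig /index_iota /= !big_cons big_nil /= !mulr0 !addr0.
Qed.

Lemma trig_sum (I : Type) (r : seq I) (a b : I -> nat -> R) p :
  \sum_(j <- r) trig (a j) (b j) p = trig (fun m => \sum_(j <- r) a j m) (fun m => \sum_(j <- r) b j m) p.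
Proof.
elim: r => [|j r IH].
  rewrite big_nil (_ : (fun m => _) = (fun m => if m == 0%N then 0 else 0)); last first.
    by apply/funext => m; rewrite big_nil if_same.
  rewrite (_ : (fun m => \sum_(j <- [::]) b j m) = (fun _ => 0)) ?trig_cst//.
  by apply/funext => m; rewrite big_nil.
rewrite big_cons IH trigD; congr (trig _ _ _); apply/funext => m; by rewrite big_cons.
Qed.

Lemma periodic_trig (a b : nat -> R) : periodic (trig a b).
Proof.
by move=> p; rewrite /trig; congr (_ + _); apply: eq_bigr => m _; rewrite cosM_periodic sinM_periodic.
Qed.

Lemma trig_dp (a b : nat -> R) (p : R) :
  is_derive p 1 (trig a b) (trig (fun m => m%:R * b m) (fun m => - (m%:R * a m)) p).
Proof.
rewrite /trig mul0r; apply: is_deriveDf; apply: is_derive_sumf => m.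
rewrite [X in is_derive _ _ _ X](_ : _ = (- m%:R * sin (m%:R * p)) * a m + (m%:R * cos (m%:R * p)) * b m); last by ring.
apply: is_deriveDf.
  rewrite mulrC; have := is_deriveCf (a m) (is_derive_cosM m%:R p).
  by congr (is_derive _ _ _ _); apply/funext => s; rewrite mulrC.
rewrite mulrC; have := is_deriveCf (b m) (is_derive_sinM m%:R p).
by congr (is_derive _ _ _ _); apply/funext => s; rewrite mulrC.
Qed.

Lemma trig_dt (a b : nat -> R -> R) (da db : nat -> R) (p t : R) :
  (forall m, is_derive t 1 (a m) (da m)) -> (forall m, is_derive t 1 (b m) (db m)) ->
  is_derive t 1 (fun s => trig (a ^~ s) (b ^~ s) p) (trig da db p).
Proof.
move=> Da Db; rewrite /trig; apply: is_deriveDf.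
apply: is_derive_sumf => m; apply: is_deriveDf; exact: is_deriveCf.
Qed.

Lemma derive1_entry (m n : nat) (f : R -> 'M[R]_(m, n)) (t : R) (df : 'M[R]_(m, n)) :
  (forall i j, is_derive t 1 (fun s => f s i j) (df i j)) -> derive1 f t = df.
Proof.
move=> H; have D : derivable f t 1.
  by apply/derivable_mxP => i j; have := H i j => h; exact: ex_derive.
rewrite derive1E derive_mx//; apply/matrixP => i j; rewrite mxE.
exact: derive_val.
Qed.

Lemma cont_entries (T : topologicalType) (m n : nat) (f : T -> 'M[R]_(m, n)) :
  (forall i j, continuous (fun x => f x i j)) -> continuous f.
Proof.
move=> H x; apply/(@cvgrPdist_le _ _ _ (f @ x)) => e e0.
have K : \forall y \near x, forall ij : 'I_m * 'I_n, `|f x ij.1 ij.2 - f y ij.1 ij.2| <= e.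
  apply: filter_forall => ij.
  by have /cvgrPdist_le/(_ _ e0) := H ij.1 ij.2 x.
apply: filterS K => y Hy.
apply: mxnorm_le; first exact: ltW.
by move=> i j; rewrite !mxE; exact: (Hy (i, j)).
Qed.

Lemma avg_trig (a b : nat -> R -> R) (m : nat) : (m < 4)%N ->
  (forall m, continuous (a m)) -> (forall m, continuous (b m)) ->
  (forall p, avg (fun t => trig (a ^~ t) (b ^~ t) p) = trig (fun m => avg (a m)) (fun m => avg (b m)) p).
Proof.
move=> m4 ca cb p; rewrite /trig avgD; last 2 first.
- exact: ca.
- by apply: cont_sum => j; apply: contD; apply: contM => //; exact: cont_cst.
congr (_ + _); rewrite avg_sum.
  by apply: eq_bigr => j _; rewrite avgD ?avgZ//; apply: contM => //; exact: cont_cst.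
by move=> j; apply: contD; apply: contM => //; exact: cont_cst.
Qed.

Variable k : nat.
Notation n := (2 + k + 1)%N.

Lemma phi_poly_trig (a b : nat -> R -> 'cV[R]_n) t p i :
  phi_poly 3 a b t p i 0 = trig (fun m => a m t i 0) (fun m => b m t i 0) p.
Proof.
rewrite /phi_poly /trig mxE summxE; congr (_ + _).
by apply: eq_bigr => m _; rewrite !mxE.
Qed.

Lemma phi_trunc_trig (w : R -> R -> 'cV[R]_n) t p i :
  phi_trunc 3 w t p i 0 = trig (fun m => (if m == 0%N then 1 else 2) * pc m (fun p => w t p i 0))
    (fun m => 2 * ps m (fun p => w t p i 0)) p.
Proof.
rewrite /phi_trunc phi_poly_trig; congr (trig _ _ _); apply/funext => m; rewrite !mxE.
  by congr (_ * avg _); apply/funext => s; rewrite mxE.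
by congr (_ * avg _); apply/funext => s; rewrite mxE.
Qed.

(* The mode coefficients of a*. *)
Definition acst (m : nat) : 'cV[R]_n := if m == 1%N then vec3 (ehat1 R) 0 0 else 0.
Definition bcst (m : nat) : 'cV[R]_n := if m == 1%N then vec3 (ehat2 R) 0 0 else 0.

Lemma astar_trig p i : astar k p i 0 = trig (fun m => acst m i 0) (fun m => bcst m i 0) p.
Proof.
rewrite /trig /index_iota /= !big_cons big_nil /acst /bcst /= mul1r.
have -> : astar k p = cos p *: vec3 (ehat1 R) 0 0 + sin p *: vec3 (ehat2 R) 0 0.
  apply: vec3_eq; rewrite !zE ?scaler0 ?mulr0 ?addr0//.
  by apply/matrixP => a b; rewrite !mxE; case: (a == 0); ring.
move: (vec3 (ehat1 R) 0 0) (vec3 (ehat2 R) 0 0) => X Y; rewrite !mxE; ring.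
Qed.

End TrigVec.

Section ModeEq.
Variables (R : realType) (k : nat) (D : ns_data R k).
Notation n := (2 + k + 1)%N.
Notation V := ('cV[R]_n * R)%type.
Hypothesis smF : smooth_on setT (fun p : V => ns_F D p.1 p.2).
Variables (e l om eta : R) (a b : nat -> R -> 'cV[R]_n).
Let z t p := astar k p + phi_poly 3 a b t p.
Hypothesis fs : fourier_sol D 3 e l om eta z.

Definition az m t := a m t + acst R k m.
Definition bz m t := b m t + bcst R k m.
(** G without its leading linear part; the term in eta, linear in z, is still included. *)
Definition Nres t p : 'cV[R]_n := ns_G D (z t p) l eta t e - ns_E D l *m z t p.

Lemma z_trig t p i : z t p i 0 = trig (fun m => az m t i 0) (fun m => bz m t i 0) p.
Proof.
rewrite /z mxE astar_trig phi_poly_trig trigD; congr (trig _ _ _); apply/funext => m.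
  by rewrite /az mxE addrC.
by rewrite /bz mxE addrC.
Qed.

(** [phi_band] provides differentiable periodic coefficients of z; since Fourier coefficients up to
    mode 3 are unique, they are those of a* plus the given a and b. *)
Lemma az_per : (forall m, (m < 4)%N -> per_derivable (az m)) /\
  (forall m, (0 < m < 4)%N -> per_derivable (bz m)).
Proof.
have [a' [b' [pa pb zE']]] := fs_band fs.
have H t i : (forall m, (m < 4)%N -> az m t i 0 = a' m t i 0) /\
    (forall m, (0 < m < 4)%N -> bz m t i 0 = b' m t i 0).
  by apply: trig_inj => p; rewrite -z_trig zE' phi_poly_trig.
split=> m m4.
  have -> : az m = a' m.
    apply/funext => t; apply/matrixP => i j; rewrite ord1.
    by have [+ _] := H t i; apply.
  exact: pa.
have -> : bz m = b' m.
  apply/funext => t; apply/matrixP => i j; rewrite ord1.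
  by have [_] := H t i; apply.
exact: pb.
Qed.

Definition da m t : 'cV[R]_n := derive1 (a m) t.
Definition db m t : 'cV[R]_n := derive1 (b m) t.

Lemma a_per m : (m < 4)%N -> periodic (a m) /\
  forall (t : R) i, is_derive t 1 (fun s => a m s i 0) (da m t i 0).
Proof.
move=> m4; have [+ _] := az_per => /(_ m m4)[pa dera].
have E : a m = fun t => az m t - acst R k m by apply/funext => t; rewrite addrK.
split; first by move=> t; rewrite E pa.
move=> t i; have dm : derivable (a m) t 1.
  by rewrite E; apply: derivableB => //; exact: derivable_cst.
rewrite /da derive1E derive_mx// mxE; apply: derivableP.
by move/derivable_mxP: dm; apply.
Qed.

Lemma b_per m : (0 < m < 4)%N -> periodic (b m) /\
  forall (t : R) i, is_derive t 1 (fun s => b m s i 0) (db m t i 0).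
Proof.
move=> m4; have [_ /(_ m m4)[pa dera]] := az_per.
have E : b m = fun t => bz m t - bcst R k m by apply/funext => t; rewrite addrK.
split; first by move=> t; rewrite E pa.
move=> t i; have dm : derivable (b m) t 1.
  by rewrite E; apply: derivableB => //; exact: derivable_cst.
rewrite /db derive1E derive_mx// mxE; apply: derivableP.
by move/derivable_mxP: dm; apply.
Qed.

Lemma z_cont t i : continuous (fun p => z t p i 0).
Proof.
rewrite (_ : (fun p => _) = trig (fun m => az m t i 0) (fun m => bz m t i 0)).
  exact: cont_trig.
by apply/funext => p; rewrite z_trig.
Qed.

Lemma z_periodic t : periodic (z t).
Proof.
by move=> p; apply/matrixP => i j; rewrite ord1 !z_trig periodic_trig.
Qed.

Lemma cont_mulmx_entry (m : nat) (A : 'M[R]_(m, n)) (w : R -> 'cV[R]_n) i j :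
  (forall i, continuous (fun p => w p i 0)) -> continuous (fun p => (A *m w p) i j).
Proof.
move=> cw; rewrite (_ : (fun p => _) = fun p => \sum_h A i h * w p h 0).
  by apply: cont_sum => h; apply: contM => //; exact: cont_cst.
by apply/funext => p; rewrite mxE ord1.
Qed.

Lemma G_cont t i : continuous (fun p => ns_G D (z t p) l eta t e i 0).
Proof.
rewrite /ns_G (_ : (fun p => _) = fun p => e^-1 * (invmx (ns_P D t l) *m
    (ns_T D l *: ns_F D (ns_v D t l + e *: (ns_P D t l *m z t p)) l
     - ns_T D l *: ns_F D (ns_v D t l) l
     - (e * (1 + e * eta)) *: (ns_dP D t l *m z t p))) i 0); last first.
  by apply/funext => p; rewrite mxE.
apply: contM; first exact: cont_cst.
apply: cont_mulmx_entry => {}i.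
rewrite (_ : (fun p => _) = fun p => ns_T D l * Fcomp D i (ns_v D t l + e *: (ns_P D t l *m z t p), l)
     - ns_T D l * ns_F D (ns_v D t l) l i 0
     - (e * (1 + e * eta)) * (ns_dP D t l *m z t p) i 0); last first.
  apply/funext => p; move: (ns_dP D t l *m z t p) => X; rewrite !mxE; congr (_ * _ - _ - _).
apply: contD; last first.
  apply: contN; apply: contM; first exact: cont_cst.
  by apply: cont_mulmx_entry => j; exact: z_cont.
apply: contD; last exact: cont_cst.
apply: contM; first exact: cont_cst.
move=> p; apply: (@continuous_comp _ _ _ (fun p => (ns_v D t l + e *: (ns_P D t l *m z t p), l) : V) (Fcomp D i)).
  suff h : continuous (fun p => ns_v D t l + e *: (ns_P D t l *m z t p)).
    change ((ns_v D t l + e *: (ns_P D t l *m z t q), l) @[q --> p] -->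
      (ns_v D t l + e *: (ns_P D t l *m z t p), l)).
    apply/(@cvgrPdist_le _ V) => d d0; have /cvgrPdist_le/(_ d d0) := h p.
    apply: filterS => q Hq; rewrite prod_normE /= subrr normr0 ge_max Hq; exact: ltW.
  apply: cont_entries => a' b'.
  rewrite (_ : (fun p => _) = fun p => ns_v D t l a' b' + e * (ns_P D t l *m z t p) a' b').
    apply: contD; first exact: cont_cst.
    apply: contM; first exact: cont_cst.
    by apply: cont_mulmx_entry => j; exact: z_cont.
  by apply/funext => q; rewrite ord1; move: (ns_P D t l *m z t q) => X; rewrite !mxE.
by apply: smoothT_cont; exact: Fcomp_smooth.
Qed.

Lemma N_cont t i : continuous (fun p => Nres t p i 0).
Proof.
rewrite (_ : (fun p => _) = fun p => ns_G D (z t p) l eta t e i 0 - (ns_E D l *m z t p) i 0).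
  apply: contD; first exact: G_cont.
  by apply: contN; apply: cont_mulmx_entry => j; exact: z_cont.
by apply/funext => p; rewrite /Nres; move: (ns_E D l *m z t p) => X; rewrite !mxE.
Qed.

Lemma N_periodic t : periodic (Nres t).
Proof. by move=> p; rewrite /Nres z_periodic. Qed.

Definition vpc m (f : R -> 'cV[R]_n) : 'cV[R]_n := \col_i pc m (fun p => f p i 0).
Definition vps m (f : R -> 'cV[R]_n) : 'cV[R]_n := \col_i ps m (fun p => f p i 0).

(** Normalization of the cosine coefficients in [phi_trunc]. *)
Definition cm (m : nat) : R := if m == 0%N then 1 else 2.

Lemma Ez_trig t p i : (ns_E D l *m z t p) i 0 =
  trig (fun m => (ns_E D l *m az m t) i 0) (fun m => (ns_E D l *m bz m t) i 0) p.
Proof.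
rewrite mxE; under eq_bigr do rewrite z_trig trigZ.
by rewrite trig_sum; congr (trig _ _ _); apply/funext => m; rewrite mxE.
Qed.

Lemma dz_t t p i : derive1 (z ^~ p) t i 0 =
  trig (fun m => if (m < 4)%N then da m t i 0 else 0) (fun m => if (0 < m < 4)%N then db m t i 0 else 0) p.
Proof.
(* Coefficients outside the band may fail to be differentiable; they do not enter [trig] and are
   replaced by 0. *)
have E i' : (fun s => z s p i' 0) = (fun s => trig (fun m => if (m < 4)%N then az m s i' 0 else 0)
   (fun m => if (0 < m < 4)%N then bz m s i' 0 else 0) p).
  apply/funext => s; rewrite z_trig /trig; congr (_ + _).
  apply: eq_big_nat => m /andP[m1 m2]; by rewrite m2 m1.
pose df : 'cV[R]_n := \col_i trig (fun m => if (m < 4)%N then da m t i 0 else 0) (fun m => if (0 < m < 4)%N then db m t i 0 else 0) p.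
have -> : derive1 (z ^~ p) t = df.
  apply: derive1_entry => i' j; rewrite ord1 mxE E; apply: (@trig_dt R (fun m s => if (m < 4)%N then az m s i' 0 else 0)
     (fun m s => if (0 < m < 4)%N then bz m s i' 0 else 0)) => m.
    case: ifP => m4; last exact: is_derive_cst.
    have [_ /(_ t i')] := a_per m4 => dA.
    rewrite (_ : (fun s => _) = (fun s => a m s i' 0 + acst R k m i' 0)); last by apply/funext => s; rewrite mxE.
    rewrite -[X in is_derive _ _ _ X]addr0; apply: is_deriveDf.
  case: ifP => m4; last exact: is_derive_cst.
  have [_ /(_ t i')] := b_per m4 => dA.
  rewrite (_ : (fun s => _) = (fun s => b m s i' 0 + bcst R k m i' 0)); last by apply/funext => s; rewrite mxE.
  rewrite -[X in is_derive _ _ _ X]addr0; apply: is_deriveDf.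
by rewrite mxE.
Qed.

Lemma dz_p t p i : derive1 (z t) p i 0 =
  trig (fun m => m%:R * bz m t i 0) (fun m => - (m%:R * az m t i 0)) p.
Proof.
pose df : 'cV[R]_n := \col_i trig (fun m => m%:R * bz m t i 0) (fun m => - (m%:R * az m t i 0)) p.
have -> : derive1 (z t) p = df.
  apply: derive1_entry => i' j; rewrite ord1 mxE.
  rewrite (_ : (fun s => _) = trig (fun m => az m t i' 0) (fun m => bz m t i' 0)); first exact: trig_dp.
  by apply/funext => s; rewrite z_trig.
by rewrite mxE.
Qed.

(** All terms of the truncated equation are trigonometric polynomials with modes 0 to 3, so
    uniqueness of coefficients yields one equation per mode. *)
Lemma mode_eq_raw t i :
  (forall m, (m < 4)%N -> cm m * pc m (fun p => ns_G D (z t p) l eta t e i 0)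
    - (if m == 0%N then eta * e_n R k i 0 else 0)
    - ((1 + e * eta) * da m t i 0 + om * (m%:R * bz m t i 0)) = 0) /\
  (forall m, (0 < m < 4)%N -> 2 * ps m (fun p => ns_G D (z t p) l eta t e i 0)
    - ((1 + e * eta) * db m t i 0 - om * (m%:R * az m t i 0)) = 0).
Proof.
have E p : trig (fun m => cm m * pc m (fun p => ns_G D (z t p) l eta t e i 0)
    + (-1) * (if m == 0%N then eta * e_n R k i 0 else 0)
    + (-1) * ((1 + e * eta) * (if (m < 4)%N then da m t i 0 else 0) + om * (m%:R * bz m t i 0)))
   (fun m => 2 * ps m (fun p => ns_G D (z t p) l eta t e i 0) + (-1) * 0
    + (-1) * ((1 + e * eta) * (if (0 < m < 4)%N then db m t i 0 else 0) + om * - (m%:R * az m t i 0))) p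
   = trig (fun _ => 0) (fun _ => 0) p.
  have := fs_eq fs t p => /matrixP/(_ i 0).
  rewrite -!trigD -!trigZ -!trigD -!trigZ -dz_t -dz_p trig_cst -(phi_trunc_trig (fun t p => ns_G D (z t p) l eta t e)).
  move: (phi_trunc _ _ _ _) (derive1 _ t) (derive1 _ p) => X Y Z; rewrite !mxE => H.
  rewrite (_ : trig (fun _ => 0) (fun _ => 0) p = 0); last first.
    have := @trig_cst R 0 p; rewrite (_ : (fun m => _) = (fun _ => 0))//.
    by apply/funext => m; rewrite if_same.
  by rewrite -H; ring.
have [Ea Eb] := trig_inj E; split=> m m4.
  by have := Ea m m4; rewrite m4 => H; rewrite -[RHS]H; ring.
by have := Eb m m4; rewrite m4 => H; rewrite -[RHS]H; ring.
Qed.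

(** The truncation acts trivially on E z, which has modes 0 to 3 only; what remains projected is
    [Nres]. *)
Lemma mode_eq_a t m : (m < 4)%N -> (1 + e * eta) *: da m t =
  ns_E D l *m az m t - (m%:R * om) *: bz m t + cm m *: vpc m (Nres t)
  - (if m == 0%N then eta *: e_n R k else 0).
Proof.
move=> m4; apply/matrixP => i j; rewrite ord1.
have [/(_ m m4) H _] := mode_eq_raw t i.
have Gs : (fun p => ns_G D (z t p) l eta t e i 0) = (fun p => Nres t p i 0 + (ns_E D l *m z t p) i 0).
  by apply/funext => p; rewrite /Nres; move: (ns_E D l *m z t p) => X; rewrite !mxE subrK.
have : pc m (fun p => ns_G D (z t p) l eta t e i 0) = pc m (fun p => Nres t p i 0) +
   (if m == 0%N then 1 else 2^-1) * (ns_E D l *m az m t) i 0.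
  rewrite Gs pcD; [|exact: N_cont|by apply: cont_mulmx_entry => h; exact: z_cont].
  congr (_ + _); rewrite -(pc_trig (fun m => (ns_E D l *m az m t) i 0) (fun m => (ns_E D l *m bz m t) i 0) m4).
  by congr (pc _ _); apply/funext => p; rewrite Ez_trig.
move: H => /[swap] ->; move: (ns_E D l *m az m t) (da m t) (bz m t) => X Y Z.
have E1 : (cm m *: vpc m (Nres t)) i 0 = cm m * pc m (fun p => Nres t p i 0).
  by rewrite mxE; congr (_ * _); rewrite mxE.
move: (cm m *: _) (pc m _) E1 => W P EW.
have E2 : (if m == 0%N then eta *: e_n R k else 0) i 0 = if m == 0%N then eta * e_n R k i 0 else 0.
  by case: ifP => _; move: (e_n R k) => U; rewrite !mxE.
move: (if m == 0%N then eta *: e_n R k else 0) E2 => U EU H; rewrite !mxE EW EU.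
move: H; rewrite /cm; case: ifP => _ H; apply/eqP; rewrite -subr_eq0 -oppr_eq0; apply/eqP; rewrite -[RHS]H; by field.
Qed.

Lemma mode_eq_b t m : (0 < m < 4)%N -> (1 + e * eta) *: db m t =
  ns_E D l *m bz m t + (m%:R * om) *: az m t + 2 *: vps m (Nres t).
Proof.
move=> m4; apply/matrixP => i j; rewrite ord1.
have [_ /(_ m m4) H] := mode_eq_raw t i.
have Gs : (fun p => ns_G D (z t p) l eta t e i 0) = (fun p => Nres t p i 0 + (ns_E D l *m z t p) i 0).
  by apply/funext => p; rewrite /Nres; move: (ns_E D l *m z t p) => X; rewrite !mxE subrK.
have : ps m (fun p => ns_G D (z t p) l eta t e i 0) = ps m (fun p => Nres t p i 0) +
   2^-1 * (ns_E D l *m bz m t) i 0.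
  rewrite Gs psD; [|exact: N_cont|by apply: cont_mulmx_entry => h; exact: z_cont].
  congr (_ + _); rewrite -(ps_trig (fun m => (ns_E D l *m az m t) i 0) (fun m => (ns_E D l *m bz m t) i 0) m4).
  by congr (ps _ _); apply/funext => p; rewrite Ez_trig.
move: H => /[swap] ->; move: (ns_E D l *m bz m t) (db m t) (az m t) => X Y Z.
have E1 : (2 *: vps m (Nres t)) i 0 = 2 * ps m (fun p => Nres t p i 0).
  by rewrite mxE; congr (_ * _); rewrite mxE.
move: (2 *: _) (ps m _) E1 => W P EW.
move=> H; rewrite !mxE EW; apply/eqP; rewrite -subr_eq0 -oppr_eq0; apply/eqP; rewrite -[RHS]H; by field.
Qed.

End ModeEq.

(** * Estimates for the linearized mode equations *)

Section Linear.
Variables (R : realType) (k : nat) (D : ns_data R k).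
Notation n := (2 + k + 1)%N.
Notation om := (ns_om D).
Notation ls := (ns_lam D).
Hypothesis aR0 : ns_aR D ls = 0.
Hypothesis aI0 : ns_aI D ls = om.
Hypothesis hyp : forall w : R,
    ~~ eigenvalue (map_mx (real_complex R) (ns_Et D ls)) (Complex 0 w).

Lemma E_entry (y : 'cV[R]_n) :
  [/\ forall j, (ns_E D ls *m y) (hidx k j) 0 = (rotmx 0 om *m zhat y) j 0,
      forall j, (ns_E D ls *m y) (tidx j) 0 = (ns_Et D ls *m ztil y) j 0
    & (ns_E D ls *m y) (ridx k) 0 = 0].
Proof.
rewrite ns_E_vec3 aR0 aI0; split=> [j|j|].
- by rewrite -zhatE zhat_vec3.
- by rewrite -ztilE ztil_vec3.
by rewrite -zringE zring_vec3.
Qed.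

Section Blocks.
Variables (g : R) (A B fA fB : R -> 'cV[R]_n).
Hypothesis mAB : msys (ns_E D ls) g A B fA fB.

Lemma msys_hat : msys (rotmx 0 om) g (fun t => zhat (A t)) (fun t => zhat (B t))
  (fun t => zhat (fA t)) (fun t => zhat (fB t)).
Proof.
have [pA pB dA dB] := mAB; split; [exact: periodic_cmp|exact: periodic_cmp| |] => t i.
  rewrite (_ : (fun s => _) = (fun s => A s (hidx k i) 0)); last by apply/funext => s; rewrite zhatE.
  have := dA t (hidx k i); have [-> _ _] := E_entry (A t); by rewrite -!zhatE.
rewrite (_ : (fun s => _) = (fun s => B s (hidx k i) 0)); last by apply/funext => s; rewrite zhatE.
have := dB t (hidx k i); have [-> _ _] := E_entry (B t); by rewrite -!zhatE.
Qed.

Lemma msys_til : msys (ns_Et D ls) g (fun t => ztil (A t)) (fun t => ztil (B t))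
  (fun t => ztil (fA t)) (fun t => ztil (fB t)).
Proof.
have [pA pB dA dB] := mAB; split; [exact: periodic_cmp|exact: periodic_cmp| |] => t i.
  rewrite (_ : (fun s => _) = (fun s => A s (tidx i) 0)); last by apply/funext => s; rewrite ztilE.
  have := dA t (tidx i); have [_ -> _] := E_entry (A t); by rewrite -!ztilE.
rewrite (_ : (fun s => _) = (fun s => B s (tidx i) 0)); last by apply/funext => s; rewrite ztilE.
have := dB t (tidx i); have [_ -> _] := E_entry (B t); by rewrite -!ztilE.
Qed.

Lemma msys_ring : cplx_ode 0 g (fun t => zring (A t)) (fun t => zring (B t))
  (fun t => zring (fA t)) (fun t => zring (fB t)).
Proof.
have [pA pB dA dB] := mAB; split; [exact: periodic_cmp|exact: periodic_cmp| |] => t.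
  rewrite (_ : (fun s => _) = (fun s => A s (ridx k) 0)); last by apply/funext => s; rewrite zringE.
  have := dA t (ridx k); have [_ _ ->] := E_entry (A t); by rewrite -!zringE add0r mul0r add0r.
rewrite (_ : (fun s => _) = (fun s => B s (ridx k) 0)); last by apply/funext => s; rewrite zringE.
have := dB t (ridx k); have [_ _ ->] := E_entry (B t).
by rewrite -!zringE add0r mul0r addr0.
Qed.

End Blocks.

Lemma norm_blocks (y : 'cV[R]_n) (C : R) : 0 <= C -> (forall j, `|zhat y j 0| <= C) ->
  (forall j, `|ztil y j 0| <= C) -> `|zring y| <= C -> `|y| <= C.
Proof.
move=> C0 h t r; apply: mxnorm_le => // i j; rewrite ord1; move: i; apply: idxP => [i|i|].
- by rewrite -zhatE.
- by rewrite -ztilE.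
by rewrite -zringE.
Qed.

Lemma blocks_norm (y : 'cV[R]_n) (C : R) : `|y| <= C ->
  [/\ forall j, `|zhat y j 0| <= C, forall j, `|ztil y j 0| <= C & `|zring y| <= C].
Proof.
move=> yC; split=> [j|j|].
- by rewrite zhatE (le_trans (mxnorm_ge _ _ _)).
- by rewrite ztilE (le_trans (mxnorm_ge _ _ _)).
by rewrite zringE (le_trans (mxnorm_ge _ _ _)).
Qed.

(** E at lambda* is block diagonal: the hat block requires om - g and om + g nonresonant, the ring
    block requires g, and the tilde block is hyperbolic. *)
Lemma lin_nonres (g : R) : nonres 0 (om - g) -> nonres 0 (om + g) -> nonres 0 g ->
  exists2 C, 0 <= C & forall A B fA fB Bd, msys (ns_E D ls) g A B fA fB ->
    (forall t, `|fA t| <= Bd) -> (forall t, `|fB t| <= Bd) ->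
    forall t, `|A t| <= C * Bd /\ `|B t| <= C * Bd.
Proof.
move=> n1 n2 n3.
have [C1 C10 H1] := hat_bound n1 n2.
have [C2 C20 H2] := til_bound g hyp.
have [C3 C30 H3] := cplx_ode_bound n3.
exists (C1 + C2 + C3) => [|A B fA fB Bd M bA bB t]; first by rewrite !addr_ge0.
have B0 : 0 <= Bd := le_trans (normr_ge0 _) (bA 0).
have a1 t' i : `|zhat (fA t') i 0| <= Bd by have [+ _ _] := blocks_norm (bA t'); apply.
have b1 t' i : `|zhat (fB t') i 0| <= Bd by have [+ _ _] := blocks_norm (bB t'); apply.
have a2 t' i : `|ztil (fA t') i 0| <= Bd by have [_ + _] := blocks_norm (bA t'); apply.
have b2 t' i : `|ztil (fB t') i 0| <= Bd by have [_ + _] := blocks_norm (bB t'); apply.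
have a3 t' : `|zring (fA t')| <= Bd by have [_ _ +] := blocks_norm (bA t'); apply.
have b3 t' : `|zring (fB t')| <= Bd by have [_ _ +] := blocks_norm (bB t'); apply.
have {a1 b1}h := H1 _ _ _ _ _ (msys_hat M) a1 b1 t.
have {a2 b2}l := H2 _ _ _ _ _ (msys_til M) a2 b2 t.
have {a3 b3}[r1 r2] := H3 _ _ _ _ _ (msys_ring M) a3 b3 t.
have := mulr_ge0 C10 B0; have := mulr_ge0 C20 B0; have := mulr_ge0 C30 B0 => k1 k2 k3.
split; apply: norm_blocks.
- by rewrite mulr_ge0// !addr_ge0.
- by move=> j; have [+ _] := h j; lra.
- by move=> j; have [+ _] := l j; lra.
- lra.
- by rewrite mulr_ge0// !addr_ge0.
- by move=> j; have [_] := h j; lra.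
- by move=> j; have [_] := l j; lra.
- lra.
Qed.

(** Mode 1, where g = om makes one rotation of the hat block trivial. The secular pair m1, m2 is
    then bounded together with the solution, the two zero means removing the kernel; the other
    blocks remain nonresonant. *)
Lemma lin_res : nonres 0 om -> nonres 0 (om + om) ->
  exists2 C, 0 <= C & forall A B fA fB m1 m2 Bd,
    msys (ns_E D ls) om A B (fun t => vec3 (cv2 m1 m2) 0 0 + fA t)
      (fun t => vec3 (cv2 (- m2) m1) 0 0 + fB t) ->
    avg (fun t => zhat (A t) 0 0 + zhat (B t) 1 0) = 0 ->
    avg (fun t => zhat (A t) 1 0 - zhat (B t) 0 0) = 0 ->
    (forall t, `|fA t| <= Bd) -> (forall t, `|fB t| <= Bd) ->
    [/\ `|m1| <= C * Bd, `|m2| <= C * Bd & forall t, `|A t| <= C * Bd /\ `|B t| <= C * Bd].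
Proof.
move=> n3 n1.
have [C1 C10 H1] := hat_res_bound n1.
have [C2 C20 H2] := til_bound om hyp.
have [C3 C30 H3] := cplx_ode_bound n3.
exists (C1 + C2 + C3) => [|A B fA fB m1 m2 Bd M av1 av2 bA bB]; first by rewrite !addr_ge0.
have B0 : 0 <= Bd := le_trans (normr_ge0 _) (bA 0).
have a1 t' i : `|zhat (fA t') i 0| <= Bd by have [+ _ _] := blocks_norm (bA t'); apply.
have b1 t' i : `|zhat (fB t') i 0| <= Bd by have [+ _ _] := blocks_norm (bB t'); apply.
have a2 t' i : `|ztil (fA t') i 0| <= Bd by have [_ + _] := blocks_norm (bA t'); apply.
have b2 t' i : `|ztil (fB t') i 0| <= Bd by have [_ + _] := blocks_norm (bB t'); apply.
have a3 t' : `|zring (fA t')| <= Bd by have [_ _ +] := blocks_norm (bA t'); apply.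
have b3 t' : `|zring (fB t')| <= Bd by have [_ _ +] := blocks_norm (bB t'); apply.
have {a1 b1}[h1 h2 h] : [/\ `|m1| <= C1 * Bd, `|m2| <= C1 * Bd & forall t i,
    `|zhat (A t) i 0| <= C1 * Bd /\ `|zhat (B t) i 0| <= C1 * Bd].
  apply: H1 av1 av2 a1 b1.
  have := msys_hat M; congr (msys _ _ _ _ _ _); apply/funext => t; by rewrite zhatD zhat_vec3.
have {a2 b2}l : forall t i, `|ztil (A t) i 0| <= C2 * Bd /\ `|ztil (B t) i 0| <= C2 * Bd.
  apply: H2 a2 b2; have := msys_til M.
  congr (msys _ _ _ _ _ _); apply/funext => t; by rewrite ztilD ztil_vec3 add0r.
have {a3 b3}r : forall t, `|zring (A t)| <= C3 * Bd /\ `|zring (B t)| <= C3 * Bd.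
  apply: H3 a3 b3; have := msys_ring M.
  congr (cplx_ode _ _ _ _ _ _); apply/funext => t; by rewrite zringD zring_vec3 add0r.
have := mulr_ge0 C10 B0; have := mulr_ge0 C20 B0; have := mulr_ge0 C30 B0 => k1 k2 k3.
split; [lra|lra|] => t; have [r1 r2] := r t; split; apply: norm_blocks.
- by rewrite mulr_ge0// !addr_ge0.
- by move=> j; have [+ _] := h t j; lra.
- by move=> j; have [+ _] := l t j; lra.
- lra.
- by rewrite mulr_ge0// !addr_ge0.
- by move=> j; have [_] := h t j; lra.
- by move=> j; have [_] := l t j; lra.
- lra.
Qed.

(** Mode 0, where the ring block has exponent 0: periodicity determines eta and the zero mean
    removes the constants. *)
Lemma lin_mean : nonres 0 om ->
  exists2 C, 0 <= C & forall A fA eta Bd,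
    msys (ns_E D ls) 0 A (fun _ => 0) (fun t => fA t - eta *: e_n R k) (fun _ => 0) ->
    avg (fun t => zring (A t)) = 0 ->
    (forall t, `|fA t| <= Bd) ->
    `|eta| <= C * Bd /\ forall t, `|A t| <= C * Bd.
Proof.
move=> n3.
have nm : nonres 0 (om - 0) by rewrite subr0.
have np : nonres 0 (om + 0) by rewrite addr0.
have [C1 C10 H1] := hat_bound nm np.
have [C2 C20 H2] := til_bound 0 hyp.
have P := pi2_gt0 R.
exists (C1 + C2 + (1 + pi *+ 2 * 2)) => [|A fA eta Bd M av bA].
  by rewrite !addr_ge0// mulr_ge0// ltW.
have B0 : 0 <= Bd := le_trans (normr_ge0 _) (bA 0).
have a1 t' i : `|zhat (fA t') i 0| <= Bd by have [+ _ _] := blocks_norm (bA t'); apply.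
have a2 t' i : `|ztil (fA t') i 0| <= Bd by have [_ + _] := blocks_norm (bA t'); apply.
have a3 t' : `|zring (fA t')| <= Bd by have [_ _ +] := blocks_norm (bA t'); apply.
have hN y : zhat (y - eta *: e_n R k) = zhat y.
  by rewrite -scaleNr zhatD zhatZ /e_n zhat_vec3 scaler0 addr0.
have tN y : ztil (y - eta *: e_n R k) = ztil y.
  by rewrite -scaleNr ztilD ztilZ /e_n ztil_vec3 scaler0 addr0.
have {a1}h : forall t i, `|zhat (A t) i 0| <= C1 * Bd /\ `|zhat (0 : 'cV[R]_n) i 0| <= C1 * Bd.
  apply: (H1 _ _ (fun t => zhat (fA t)) (fun t => zhat 0)) => //; last first.
    by move=> t i; rewrite zhatE mxE normr0.
  have := msys_hat M; congr (msys _ _ _ _ _ _); apply/funext => t; by rewrite hN.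
have {a2}l : forall t i, `|ztil (A t) i 0| <= C2 * Bd /\ `|ztil (0 : 'cV[R]_n) i 0| <= C2 * Bd.
  apply: (H2 _ _ (fun t => ztil (fA t)) (fun t => ztil 0)) => //; last first.
    by move=> t i; rewrite ztilE mxE normr0.
  have := msys_til M; congr (msys _ _ _ _ _ _); apply/funext => t; by rewrite tN.
have {a3}[r1 r2] : `|eta| <= Bd /\ forall t, `|zring (A t)| <= pi *+ 2 * (2 * Bd).
  have [pA _ dA _] := msys_ring M.
  have dA' : forall t : R, is_derive t 1 (fun t => zring (A t)) (- eta + zring (fA t)).
    move=> t; have := dA t; rewrite !mul0r subrr add0r -scaleNr zringD zringZ /e_n zring_vec3 mulr1 addrC.
    exact.
  exact: (ring_mean_bound pA av dA' a3).
have k1 := mulr_ge0 C10 B0; have k2 := mulr_ge0 C20 B0; have k3 := mulr_ge0 (ltW P) B0.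
split; first by lra.
move=> t; apply: norm_blocks.
- by rewrite mulr_ge0// !addr_ge0// mulr_ge0// ltW.
- by move=> j; have [+ _] := h t j; lra.
- by move=> j; have [+ _] := l t j; lra.
- by have := r2 t; lra.
Qed.

Lemma nonres_frac (b : R) : (0 < `|b| < 1) \/ (1 < b < 2) -> nonres 0 b.
Proof. by case=> h; right; [exact: cos2pi_neq1|exact: cos2pi_neq1']. Qed.

Lemma Op_nonres (g : R) (p : nat) (A B fA fB : R -> R -> 'cV[R]_n) :
  nonres 0 (om - g) -> nonres 0 (om + g) -> nonres 0 g ->
  (\forall e \near 0^', msys (ns_E D ls) g (A e) (B e) (fA e) (fB e)) ->
  Op p fA -> Op p fB -> Op p A /\ Op p B.
Proof.
move=> n1 n2 n3 H [C1 C10 H1] [C2 C20 H2].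
have [C C0 HC] := lin_nonres n1 n2 n3.
suff K : \forall e \near 0^', forall t, `|A e t| <= C * (C1 + C2) * `|e| ^+ p /\ `|B e t| <= C * (C1 + C2) * `|e| ^+ p.
  split; exists (C * (C1 + C2)); rewrite ?mulr_ge0 ?addr_ge0//; near=> e => t;
    by have []: `|A e t| <= C * (C1 + C2) * `|e| ^+ p /\ `|B e t| <= C * (C1 + C2) * `|e| ^+ p
      by move: t; near: e.
near=> e => t; rewrite -mulrA.
have M : msys (ns_E D ls) g (A e) (B e) (fA e) (fB e) by near: e.
have c1 : C1 * `|e| ^+ p <= (C1 + C2) * `|e| ^+ p by rewrite ler_wpM2r ?exprn_ge0// lerDl.
have c2 : C2 * `|e| ^+ p <= (C1 + C2) * `|e| ^+ p by rewrite ler_wpM2r ?exprn_ge0// lerDr.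
apply: HC M _ _ _ => {}t.
  by apply: le_trans c1; move: t; near: e.
by apply: le_trans c2; move: t; near: e.
Unshelve. all: by end_near. Qed.

Lemma Op_res (p : nat) (A B fA fB : R -> R -> 'cV[R]_n) (m1 m2 : R -> R) :
  nonres 0 om -> nonres 0 (om + om) ->
  (\forall e \near 0^', [/\ msys (ns_E D ls) om (A e) (B e)
      (fun t => vec3 (cv2 (m1 e) (m2 e)) 0 0 + fA e t)
      (fun t => vec3 (cv2 (- m2 e) (m1 e)) 0 0 + fB e t),
    avg (fun t => zhat (A e t) 0 0 + zhat (B e t) 1 0) = 0 &
    avg (fun t => zhat (A e t) 1 0 - zhat (B e t) 0 0) = 0]) ->
  Op p fA -> Op p fB ->
  [/\ Op p A, Op p B, Op p (fun e (_ : unit) => m1 e) & Op p (fun e (_ : unit) => m2 e)].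
Proof.
move=> n1 n2 H [C1 C10 H1] [C2 C20 H2].
have [C C0 HC] := lin_res n1 n2.
pose K := C * (C1 + C2).
have K0 : 0 <= K by rewrite mulr_ge0// addr_ge0.
suff N : \forall e \near 0^', [/\ `|m1 e| <= K * `|e| ^+ p, `|m2 e| <= K * `|e| ^+ p
   & forall t, `|A e t| <= K * `|e| ^+ p /\ `|B e t| <= K * `|e| ^+ p].
  split; exists K => //; near=> e => t;
    have [u1 u2 u3] : [/\ `|m1 e| <= K * `|e| ^+ p, `|m2 e| <= K * `|e| ^+ p
     & forall t, `|A e t| <= K * `|e| ^+ p /\ `|B e t| <= K * `|e| ^+ p] by near: e.
  - by have [] := u3 t.
  - by have [] := u3 t.
  - exact: u1.
  - exact: u2.
near=> e.
have [M a1 a2] : [/\ msys (ns_E D ls) om (A e) (B e)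
      (fun t => vec3 (cv2 (m1 e) (m2 e)) 0 0 + fA e t)
      (fun t => vec3 (cv2 (- m2 e) (m1 e)) 0 0 + fB e t),
    avg (fun t => zhat (A e t) 0 0 + zhat (B e t) 1 0) = 0 &
    avg (fun t => zhat (A e t) 1 0 - zhat (B e t) 0 0) = 0] by near: e.
have c1 : C1 * `|e| ^+ p <= (C1 + C2) * `|e| ^+ p by rewrite ler_wpM2r ?exprn_ge0// lerDl.
have c2 : C2 * `|e| ^+ p <= (C1 + C2) * `|e| ^+ p by rewrite ler_wpM2r ?exprn_ge0// lerDr.
rewrite /K -!mulrA.
apply: HC M a1 a2 _ _ => t.
  by apply: le_trans c1; move: t; near: e.
by apply: le_trans c2; move: t; near: e.
Unshelve. all: by end_near. Qed.

Lemma Op_mean (p : nat) (A fA : R -> R -> 'cV[R]_n) (eta : R -> R) :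
  nonres 0 om ->
  (\forall e \near 0^', msys (ns_E D ls) 0 (A e) (fun _ => 0)
      (fun t => fA e t - eta e *: e_n R k) (fun _ => 0) /\
    avg (fun t => zring (A e t)) = 0) ->
  Op p fA -> Op p A /\ Op p (fun e (_ : unit) => eta e).
Proof.
move=> n1 H [C1 C10 H1].
have [C C0 HC] := lin_mean n1.
suff N : \forall e \near 0^', `|eta e| <= C * C1 * `|e| ^+ p /\
   forall t, `|A e t| <= C * C1 * `|e| ^+ p.
  split; exists (C * C1); rewrite ?mulr_ge0//; near=> e => t;
    have [u1 u2] : `|eta e| <= C * C1 * `|e| ^+ p /\
     forall t, `|A e t| <= C * C1 * `|e| ^+ p by near: e.
  - exact: u2.
  - exact: u1.
near=> e.
have [M a1] : msys (ns_E D ls) 0 (A e) (fun _ => 0)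
      (fun t => fA e t - eta e *: e_n R k) (fun _ => 0) /\
    avg (fun t => zring (A e t)) = 0 by near: e.
rewrite -!mulrA; apply: HC M a1 _ => t; move: t; near: e; exact: H1.
Unshelve. all: by end_near. Qed.

End Linear.

(** * The phase and mean conditions *)

Section Means.
Variables (R : realType) (k : nat) (D : ns_data R k).
Notation n := (2 + k + 1)%N.
Notation V := ('cV[R]_n * R)%type.

Lemma dotv_vec3 (u : 'cV[R]_n) x y c :
  dotv u (vec3 x y c) = \sum_j zhat u j 0 * x j 0 + \sum_j ztil u j 0 * y j 0 + zring u * c.
Proof.
rewrite /dotv big_split_ord big_split_ord /= big_ord1.
congr (_ + _ + _).
- by apply: eq_bigr => j _; rewrite zhatE -(zhatE (vec3 x y c)) zhat_vec3.
- by apply: eq_bigr => j _; rewrite ztilE -(ztilE (vec3 x y c)) ztil_vec3.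
by rewrite -[X in _ = _ * X](zring_vec3 x y c) !zringE.
Qed.

Lemma dotv_hat (u : 'cV[R]_n) x y :
  dotv u (vec3 (cv2 x y) 0 0) = u (hidx k 0) 0 * x + u (hidx k 1) 0 * y.
Proof.
rewrite dotv_vec3 big_ord_recl big_ord1 !zhatE !cv2E mulr0 addr0 big1 ?addr0; last first.
  by move=> j _; rewrite [(0 : 'cV_k) _ _]mxE mulr0.
by rewrite (_ : lift ord0 ord0 = 1 :> 'I_2) ?cv2E//; exact/val_inj.
Qed.

Lemma dotv_ring (u : 'cV[R]_n) : dotv u (e_n R k) = u (ridx k) 0.
Proof.
rewrite /e_n dotv_vec3 big1 ?add0r; last by move=> j _; rewrite [(0 : 'cV_2) _ _]mxE mulr0.
rewrite big1 ?add0r; last by move=> j _; rewrite [(0 : 'cV_k) _ _]mxE mulr0.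
by rewrite mulr1 zringE.
Qed.

Variables (e l om eta : R) (a b : nat -> R -> 'cV[R]_n).
Let z t p := astar k p + phi_poly 3 a b t p.
Hypothesis fs : fourier_sol D 3 e l om eta z.

(** Cut off outside the band, so that the coefficient of every index is continuous. *)
Let A m i t := if (m < 4)%N then az a m t i 0 else 0.
Let B m i t := if (0 < m < 4)%N then bz b m t i 0 else 0.

Lemma z_trig_trunc t p i : z t p i 0 = trig (A ^~ i ^~ t) (B ^~ i ^~ t) p.
Proof.
rewrite z_trig /trig; congr (_ + _).
by apply: eq_big_nat => m /andP[m1 m2]; rewrite /A /B m2 m1.
Qed.

Lemma A_cont m i : continuous (A m i).
Proof.
case m4 : (m < 4)%N; rewrite /A m4; last exact: cont_cst.
have [+ _] := az_per fs => /(_ m m4)[_ d] t.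
apply: differentiable_continuous; apply/derivable1_diffP.
by move/derivable_mxP: (d t); apply.
Qed.

Lemma B_cont m i : continuous (B m i).
Proof.
case m4 : (0 < m < 4)%N; rewrite /B m4; last exact: cont_cst.
have [_ /(_ m m4)[_ d]] := az_per fs => t.
apply: differentiable_continuous; apply/derivable1_diffP.
by move/derivable_mxP: (d t); apply.
Qed.

Lemma avg_z p i : avg (fun t => z t p i 0) = trig (fun m => avg (A m i)) (fun m => avg (B m i)) p.
Proof.
rewrite -(@avg_trig R (A ^~ i) (B ^~ i) 0)//; last 2 first.
- by move=> m; exact: A_cont.
- by move=> m; exact: B_cont.
by congr avg; apply/funext => t; rewrite z_trig_trunc.
Qed.

Lemma avg_z_hat p x y : avg (fun t => dotv (z t p) (vec3 (cv2 x y) 0 0)) =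
  x * trig (fun m => avg (A m (hidx k 0))) (fun m => avg (B m (hidx k 0))) p
  + y * trig (fun m => avg (A m (hidx k 1))) (fun m => avg (B m (hidx k 1))) p.
Proof.
have c i : continuous (fun t => z t p i 0).
  rewrite (_ : (fun t => _) = fun t => A 0%N i t + \sum_(1 <= m < 4) (cos (m%:R * p) * A m i t + sin (m%:R * p) * B m i t)).
    apply: contD; first exact: A_cont.
    apply: cont_sum => m; apply: contD; (apply: contM; first exact: cont_cst); [exact: A_cont|exact: B_cont].
  by apply/funext => t; rewrite z_trig_trunc.
rewrite -!avg_z -!avgZ// -avgD; last 2 first.
- by apply: contM => //; exact: cont_cst.
- by apply: contM => //; exact: cont_cst.
by congr avg; apply/funext => t; rewrite dotv_hat; ring.
Qed.

(** Only finitely many phi-modes occur, so the double averages reduce to theta-means of single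
    coefficients. The circle a* itself meets the phase and mean conditions, which leaves homogeneous
    conditions on the corrections. *)
Lemma gamma_means :
  [/\ avg (fun t => zhat (a 1%N t) 0 0 + zhat (b 1%N t) 1 0) = 0,
      avg (fun t => zhat (a 1%N t) 1 0 - zhat (b 1%N t) 0 0) = 0
    & avg (fun t => zring (a 0%N t)) = 0].
Proof.
have aE i : (fun t => a 1%N t i 0) = fun t => A 1 i t - acst R k 1 i 0.
  by apply/funext => t; rewrite /A /= mxE addrK.
have bE i : (fun t => b 1%N t i 0) = fun t => B 1 i t - bcst R k 1 i 0.
  by apply/funext => t; rewrite /B /= mxE addrK.
have ac i : continuous (fun t => a 1%N t i 0).
  by rewrite aE; apply: contD; [exact: A_cont|exact: cont_cst].
have bc i : continuous (fun t => b 1%N t i 0).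
  by rewrite bE; apply: contD; [exact: B_cont|exact: cont_cst].
have aA i : avg (fun t => a 1%N t i 0) = avg (A 1 i) - acst R k 1 i 0.
  by rewrite aE avgB ?avg_cst//; [exact: A_cont|exact: cont_cst].
have bA i : avg (fun t => b 1%N t i 0) = avg (B 1 i) - bcst R k 1 i 0.
  by rewrite bE avgB ?avg_cst//; [exact: B_cont|exact: cont_cst].
have tc (i : 'I_n) : continuous (trig (fun m => avg (A m i)) (fun m => avg (B m i))) by exact: cont_trig.
have cc : continuous (@cos R) by exact: continuous_cos.
have cs : continuous (@sin R) by exact: continuous_sin.
have pc1E f : avg (fun p : R => cos p * f p) = pc 1 f by congr avg; apply/funext => p; rewrite mul1r.
have ps1E f : avg (fun p : R => sin p * f p) = ps 1 f by congr avg; apply/funext => p; rewrite mul1r.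
have g := fs_gamma1 fs.
have g1 : inner2 z (fun _ => astar k) = 1.
  by move/matrixP: g => /(_ 0 0); rewrite /gamma1 /ehat1 !cv2E.
have g2 : inner2 z (fun _ => dastar k) = 0.
  by move/matrixP: g => /(_ 1 0); rewrite /gamma1 /ehat1 !cv2E.
have g3 := fs_gamma2 fs.
split.
- rewrite (_ : (fun t => _) = fun t => a 1%N t (hidx k 0) 0 + b 1%N t (hidx k 1) 0); last first.
    by apply/funext => t; rewrite !zhatE.
  rewrite avgD// aA bA /acst /bcst /= -!zhatE !zhat_vec3 /ehat1 /ehat2 !cv2E.
  move: g1; rewrite /inner2 /astar; under eq_fun do rewrite avg_z_hat.
  rewrite avgD; [|exact: contM|exact: contM].
  rewrite pc1E ps1E pc_trig// ps_trig//= => H.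
  lra.
- rewrite (_ : (fun t => _) = fun t => a 1%N t (hidx k 1) 0 - b 1%N t (hidx k 0) 0); last first.
    by apply/funext => t; rewrite !zhatE.
  rewrite avgB// aA bA /acst /bcst /= -!zhatE !zhat_vec3 /ehat1 /ehat2 !cv2E.
  move: g2; rewrite /inner2 /dastar; under eq_fun do rewrite avg_z_hat.
  under eq_fun do rewrite addrC mulNr.
  rewrite avgB; [|exact: contM|exact: contM].
  rewrite pc1E ps1E pc_trig// ps_trig//= => H.
  lra.
rewrite (_ : (fun t => _) = A 0%N (ridx k)); last first.
  apply/funext => t; rewrite /A /= zringE mxE /acst /=.
  by rewrite [X in _ + X]mxE addr0.
move: g3; rewrite /gamma2 /inner2.
rewrite (_ : (fun p => _) = fun p => cos (0%:R * p) * trig (fun m => avg (A m (ridx k))) (fun m => avg (B m (ridx k))) p); last first.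
  apply/funext => p; rewrite mul0r cos0 mul1r -avg_z; congr avg; apply/funext => t.
  by rewrite dotv_ring.
by rewrite -/(pc 0 _) pc_trig//= mul1r.
Qed.

End Means.

(** * Odd and even parts of the nonlinearity *)

Section Parity.
Variables (R : realType) (X : Type) (n : nat).
Notation V := 'cV[R]_n.

Lemma OpZ_le (W : normedModType R) p q s (c : R -> X -> R) (f : R -> X -> W) :
  Op p c -> Op q f -> (s <= p + q)%N -> Op s (fun e u => c e u *: f e u).
Proof. by move=> Hc Hf le; apply: (Op_le le); exact: Op_scale. Qed.

Lemma Op_exp_le (W : normedModType R) p q s (f : R -> X -> W) :
  Op q f -> (s <= p + q)%N -> Op s (fun e u => e ^+ p *: f e u).
Proof. by move=> Hf le; exact: (OpZ_le (Op_exp R X p) Hf le). Qed.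

Lemma Op_cstZ (W : normedModType R) (a : R) q (f : R -> X -> W) :
  Op q f -> Op q (fun e u => a *: f e u).
Proof. by move=> Hf; exact: (OpZ_le (Op_cst X a) Hf). Qed.

Variables (B : R -> X -> 'M[R]_n) (c2 : R -> X -> 'I_n -> 'I_n -> V)
  (c3 : R -> X -> 'I_n -> 'I_n -> 'I_n -> V) (c4 : R -> X -> 'I_n -> 'I_n -> 'I_n -> 'I_n -> V)
  (eta : R -> X -> R) (zo we : R -> X -> V).

Definition Jet e u x : V := - ((e * eta e u) *: (B e u *m x)) + e *: mul2 (c2 e u) x x
  + e ^+ 2 *: mul3 (c3 e u) x x x + e ^+ 3 *: mul4 (c4 e u) x x x x.

(** The part of [Jet] odd in zo, up to O(eps^4) when [we] and [eta] are O(eps): the omitted cubic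
    terms contain [we] twice, and the omitted quartic ones at least once. *)
Definition Jodd e u : V := - ((e * eta e u) *: (B e u *m zo e u))
  + e *: (mul2 (c2 e u) (zo e u) (we e u) + mul2 (c2 e u) (we e u) (zo e u))
  + e ^+ 2 *: mul3 (c3 e u) (zo e u) (zo e u) (zo e u).

Hypothesis oB : Op 0 B.
Hypothesis o2 : Op 0 (fun e u => c2 e u.1.1 u.1.2 u.2).
Hypothesis o3 : Op 0 (fun e u => c3 e u.1.1.1 u.1.1.2 u.1.2 u.2).
Hypothesis o4 : Op 0 (fun e u => c4 e u.1.1.1.1 u.1.1.1.2 u.1.1.2 u.1.2 u.2).
Hypothesis oz : Op 0 zo.

Section Gen.
Variables (Np Nm : R -> X -> V).
Hypothesis HNp : Op 4 (fun e u => Np e u - Jet e u (zo e u + we e u)).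
Hypothesis HNm : Op 4 (fun e u => Nm e u - Jet e u (we e u - zo e u)).
Hypothesis oe : Op 1 eta.
Hypothesis ow : Op 1 we.

Let ow0 : Op 0 we. Proof. exact: Op_le ow. Qed.
Let om2 p q x y : Op p x -> Op q y -> Op (p + q) (fun e u => mul2 (c2 e u) (x e u) (y e u)).
Proof. by move=> hx hy; exact: (Op_mul2 o2 hx hy). Qed.
Let om3 p q r x y z : Op p x -> Op q y -> Op r z ->
  Op (p + q + r) (fun e u => mul3 (c3 e u) (x e u) (y e u) (z e u)).
Proof. by move=> hx hy hz; exact: (Op_mul3 o3 hx hy hz). Qed.
Let om4 p q r s x y z w : Op p x -> Op q y -> Op r z -> Op s w ->
  Op (p + q + r + s) (fun e u => mul4 (c4 e u) (x e u) (y e u) (z e u) (w e u)).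
Proof. by move=> hx hy hz hw; exact: (Op_mul4 o4 hx hy hz hw). Qed.

(** [Np] and [Nm] stand for the forcing at phi and phi + pi, where zo changes sign and [we] does
    not. The difference cancels everything even in zo. *)
Lemma odd_part : Op 4 (fun e u => 2^-1 *: (Np e u - Nm e u) - Jodd e u).
Proof.
pose rem e u := 2^-1 *: (Np e u - Jet e u (zo e u + we e u)) - 2^-1 *: (Nm e u - Jet e u (we e u - zo e u)).
pose t3 e u := mul3 (c3 e u) (zo e u) (we e u) (we e u) + mul3 (c3 e u) (we e u) (zo e u) (we e u)
   + mul3 (c3 e u) (we e u) (we e u) (zo e u).
pose xp e u := zo e u + we e u. pose xm e u := zo e u - we e u. pose dd e u := xp e u - xm e u.
pose t4 e u := mul4 (c4 e u) (dd e u) (xp e u) (xp e u) (xp e u) + mul4 (c4 e u) (xm e u) (dd e u) (xp e u) (xp e u)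
    + mul4 (c4 e u) (xm e u) (xm e u) (dd e u) (xp e u) + mul4 (c4 e u) (xm e u) (xm e u) (xm e u) (dd e u).
have oxp : Op 0 xp by exact: Op_add.
have oxm : Op 0 xm by exact: Op_sub.
have od : Op 1 dd.
  apply: (@Op_eq _ _ _ _ (fun e u => 2 *: we e u)); last exact: Op_cstZ.
  near=> e => u; rewrite /dd /xp /xm opprD opprK addrACA subrr add0r.
  by rewrite scaler_nat mulr2n.
apply: (@Op_eq _ _ _ _ (fun e u => rem e u + e ^+ 2 *: t3 e u + e ^+ 3 *: (2^-1 *: t4 e u))).
  near=> e => u; rewrite /rem /t3 /t4 -mul4_diff /xp /xm /Jodd /Jet.
  (* The quartic form is even, so its argument may be negated to match [xm]. *)
  have -> : mul4 (c4 e u) (we e u - zo e u) (we e u - zo e u) (we e u - zo e u) (we e u - zo e u) =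
    mul4 (c4 e u) (zo e u - we e u) (zo e u - we e u) (zo e u - we e u) (zo e u - we e u).
    rewrite -(opprB (zo e u)) -scaleN1r mul4Z1 mul4Z2 mul4Z3 mul4Z4 !scalerA.
    by rewrite (_ : -1 * -1 * -1 * -1 = 1 :> R) ?scale1r//; ring.
  move: (zo e u) (we e u) => x y.
  rewrite -(scaleN1r x) !mulmxDr !mul2Dl !mul2Dr !mul3D1 !mul3D2 !mul3D3.
  rewrite -!scalemxAr !mul2Zl !mul2Zr !mul3Z1 !mul3Z2 !mul3Z3 !scalerA.
  move: (B e u *m x) (B e u *m y) (mul2 (c2 e u)) (mul3 (c3 e u)) (mul4 (c4 e u)) => b1 b2 q2 q3 q4.
  move: (q2 x x) (q2 x y) (q2 y x) (q2 y y) => q2a q2b q2c q2d.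
  move: (q3 x x x) (q3 x x y) (q3 x y x) (q3 x y y) (q3 y x x) (q3 y x y) (q3 y y x) (q3 y y y) => a1 a2 a3 a4 a5 a6 a7 a8.
  move: (q4 _ _ _ _) (q4 _ _ _ _) (Np e u) (Nm e u) => w1 w2 n1 n2.
  by apply/matrixP => i j; rewrite !mxE; field.
apply: Op_add; first apply: Op_add.
- by apply: Op_sub; apply: Op_cstZ.
- apply: (@Op_exp_le _ _ 2) => //; apply: Op_add; first apply: Op_add.
  + exact: (om3 oz ow ow).
  + exact: (om3 ow oz ow).
  + exact: (om3 ow ow oz).
- apply: (@Op_exp_le _ _ 1) => //; apply: Op_cstZ; apply: Op_add; first apply: Op_add; first apply: Op_add.
  + exact: (om4 od oxp oxp oxp).
  + exact: (om4 oxm od oxp oxp).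
  + exact: (om4 oxm oxm od oxp).
  + exact: (om4 oxm oxm oxm od).
Unshelve. all: by end_near. Qed.

(** Besides eps q2(zo, zo), every even term has a further eps: eps eta B we and eps q2(we, we) have
    two small factors, the even cubic terms contain [we], and the quartic ones come with eps^3. *)
Lemma even_part : Op 3 (fun e u => 2^-1 *: (Np e u + Nm e u) - e *: mul2 (c2 e u) (zo e u) (zo e u)).
Proof.
pose rem e u := 2^-1 *: (Np e u - Jet e u (zo e u + we e u)) + 2^-1 *: (Nm e u - Jet e u (we e u - zo e u)).
pose t1 e u := eta e u *: (B e u *m we e u).
pose t2 e u := mul2 (c2 e u) (we e u) (we e u).
pose t3 e u := mul3 (c3 e u) (we e u) (zo e u) (zo e u) + mul3 (c3 e u) (zo e u) (we e u) (zo e u)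
   + mul3 (c3 e u) (zo e u) (zo e u) (we e u) + mul3 (c3 e u) (we e u) (we e u) (we e u).
pose xp e u := zo e u + we e u. pose xm e u := we e u - zo e u.
pose t4 e u := mul4 (c4 e u) (xp e u) (xp e u) (xp e u) (xp e u)
    + mul4 (c4 e u) (xm e u) (xm e u) (xm e u) (xm e u).
have oxp : Op 0 xp by exact: Op_add.
have oxm : Op 0 xm by exact: Op_sub.
apply: (@Op_eq _ _ _ _ (fun e u => rem e u - e ^+ 1 *: t1 e u + e ^+ 1 *: t2 e u + e ^+ 2 *: t3 e u + e ^+ 3 *: (2^-1 *: t4 e u))).
  near=> e => u; rewrite /rem /t1 /t2 /t3 /t4 /xp /xm /Jet expr1.
  move: (zo e u) (we e u) => x y.
  rewrite -(scaleN1r x) !mulmxDr !mul2Dl !mul2Dr !mul3D1 !mul3D2 !mul3D3.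
  rewrite -!scalemxAr !mul2Zl !mul2Zr !mul3Z1 !mul3Z2 !mul3Z3 !scalerA.
  move: (B e u *m x) (B e u *m y) (mul2 (c2 e u)) (mul3 (c3 e u)) (mul4 (c4 e u)) => b1 b2 q2 q3 q4.
  move: (q2 x x) (q2 x y) (q2 y x) (q2 y y) => q2a q2b q2c q2d.
  move: (q3 x x x) (q3 x x y) (q3 x y x) (q3 x y y) (q3 y x x) (q3 y x y) (q3 y y x) (q3 y y y) => a1 a2 a3 a4 a5 a6 a7 a8.
  move: (q4 _ _ _ _) (q4 _ _ _ _) (Np e u) (Nm e u) => w1 w2 n1 n2.
  by apply/matrixP => i j; rewrite !mxE; field.
have obw : Op 1 (fun e u => B e u *m we e u) by exact: (Op_mulmx oB ow).
apply: Op_add; first apply: Op_add; first apply: Op_add; first apply: Op_add.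
- by apply: (@Op_le _ _ _ 4) => //; apply: Op_add; apply: Op_cstZ.
- by apply: Op_opp; apply: (@Op_exp_le _ _ 2) => //; exact: (OpZ_le oe obw).
- by apply: (@Op_exp_le _ _ 2) => //; exact: (om2 ow ow).
- apply: (@Op_exp_le _ _ 1) => //; apply: Op_add; first apply: Op_add; first apply: Op_add.
  + exact: (om3 ow oz oz).
  + exact: (om3 oz ow oz).
  + exact: (om3 oz oz ow).
  + by apply: (@Op_le _ _ _ 3) => //; exact: (om3 ow ow ow).
- apply: (@Op_exp_le _ _ 0) => //; apply: Op_cstZ; apply: Op_add.
  + exact: (om4 oxp oxp oxp oxp).
  + exact: (om4 oxm oxm oxm oxm).
Unshelve. all: by end_near. Qed.

Lemma Jodd_Op2 : Op 2 Jodd.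
Proof.
have obz : Op 0 (fun e u => B e u *m zo e u) by exact: (Op_mulmx oB oz).
apply: Op_add; first apply: Op_add.
- apply: Op_opp; apply: (@OpZ_le _ 2 0) => //.
  exact: (@Op_mulr _ _ 1 1 _ _ (Op_id R X) oe).
- apply: (OpZ_le (Op_id R X)); last exact: (leqnn 2).
  by apply: Op_add; [exact: (om2 oz ow)|exact: (om2 ow oz)].
by apply: (@Op_exp_le _ _ 0) => //; exact: (om3 oz oz oz).
Qed.

End Gen.

Variables (Bs : R -> X -> 'M[R]_n) (c2s : R -> X -> 'I_n -> 'I_n -> V)
  (c3s : R -> X -> 'I_n -> 'I_n -> 'I_n -> V) (ka : R) (zs zq : R -> X -> V).
Hypothesis oBs : Op 0 Bs.
Hypothesis o2s : Op 0 (fun e u => c2s e u.1.1 u.1.2 u.2).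
Hypothesis o3s : Op 0 (fun e u => c3s e u.1.1.1 u.1.1.2 u.1.2 u.2).
Hypothesis ozs : Op 0 zs.
Hypothesis ozz : Op 2 (fun e u => zo e u - zs e u).
Hypothesis o22 : Op 2 (fun e u => c2 e u.1.1 u.1.2 u.2 - c2s e u.1.1 u.1.2 u.2).

(** Telescoping over the coefficients, the first and the second argument; the three inequalities are
    the orders of the three differences. *)
Lemma Op_mul2_lim p q p' s v r (x x' y y' : R -> X -> V) :
  Op p x -> Op q y -> Op p' x' ->
  Op s (fun e u => x e u - x' e u) -> Op v (fun e u => y e u - y' e u) ->
  (r <= 2 + p + q)%N -> (r <= s + q)%N -> (r <= p' + v)%N ->
  Op r (fun e u => mul2 (c2 e u) (x e u) (y e u) - mul2 (c2s e u) (x' e u) (y' e u)).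
Proof.
move=> ox oy ox' od1 od2 le1 le2 le3.
apply: (@Op_eq _ _ _ _ (fun e u => mul2 (fun a b => c2 e u a b - c2s e u a b) (x e u) (y e u)
  + mul2 (c2s e u) (x e u - x' e u) (y e u) + mul2 (c2s e u) (x' e u) (y e u - y' e u))).
  near=> e => u; rewrite -mul2B -(scaleN1r (x' e u)) -(scaleN1r (y' e u)) !mul2Dl !mul2Dr !mul2Zl !mul2Zr.
  move: (mul2 _ _ _) (mul2 _ _ _) (mul2 _ _ _) (mul2 _ _ _) => a b c d.
  apply/matrixP => i j; rewrite !mxE; ring.
apply: Op_add; first apply: Op_add.
- by apply: (Op_le le1); exact: (@Op_mul2 _ _ _ 2 p q (fun e u a b => c2 e u a b - c2s e u a b)).
- by apply: (Op_le le2); exact: (Op_mul2 o2s od1 oy).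
- by apply: (Op_le le3); exact: (Op_mul2 o2s ox' od2).
Unshelve. all: by end_near. Qed.

Lemma even_lim : Op 2 (fun e u => mul2 (c2 e u) (zo e u) (zo e u) - mul2 (c2s e u) (zs e u) (zs e u)).
Proof. exact: (Op_mul2_lim oz oz ozs ozz ozz). Qed.

Hypothesis o33 : Op 2 (fun e u => c3 e u.1.1.1 u.1.1.2 u.1.2 u.2 - c3s e u.1.1.1 u.1.1.2 u.1.2 u.2).
Hypothesis oBB : Op 2 (fun e u => B e u - Bs e u).
Hypothesis oe : Op 1 eta.
Hypothesis ow : Op 1 we.
Hypothesis oq : Op 0 zq.
Hypothesis owq : Op 3 (fun e u => we e u - e *: zq e u).
Hypothesis oek : Op 3 (fun e u => eta e u - e * ka).

(** Coefficient of eps^2 in [Jodd]. With zs = a* and zq the quadratic part of the transformation it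
    is the forcing in [NF2]. *)
Definition Jlim e u : V := - (ka *: (Bs e u *m zs e u)) + mul2 (c2s e u) (zs e u) (zq e u)
  + mul2 (c2s e u) (zq e u) (zs e u) + mul3 (c3s e u) (zs e u) (zs e u) (zs e u).

(** [we] and [eta] enter with a prefactor eps, so their errors O(eps^3) suffice; the coefficients
    and zo converge at rate eps^2 inside terms that are already O(eps^2). *)
Lemma Jodd_lim : Op 4 (fun e u => Jodd e u - e ^+ 2 *: Jlim e u).
Proof.
have oeq : Op 1 (fun e u => e *: zq e u) by exact: (OpZ_le (Op_id R X) oq).
pose d1 e u := mul2 (c2 e u) (zo e u) (we e u) - mul2 (c2s e u) (zs e u) (e *: zq e u).
pose d2 e u := mul2 (c2 e u) (we e u) (zo e u) - mul2 (c2s e u) (e *: zq e u) (zs e u).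
pose d3 e u := mul3 (fun a b d => c3 e u a b d - c3s e u a b d) (zo e u) (zo e u) (zo e u)
  + (mul3 (c3s e u) (zo e u - zs e u) (zo e u) (zo e u) + mul3 (c3s e u) (zs e u) (zo e u - zs e u) (zo e u)
     + mul3 (c3s e u) (zs e u) (zs e u) (zo e u - zs e u)).
pose d4 e u := (eta e u - e * ka) *: (B e u *m zo e u).
pose d5 e u := (B e u - Bs e u) *m zo e u + Bs e u *m (zo e u - zs e u).
apply: (@Op_eq _ _ _ _ (fun e u => e ^+ 1 *: d1 e u + e ^+ 1 *: d2 e u + e ^+ 2 *: d3 e u
  - e ^+ 1 *: d4 e u - e ^+ 2 *: (ka *: d5 e u))).
  near=> e => u; rewrite /d1 /d2 /d3 /d4 /d5 -mul3_diff -mul3B mulmxBl mulmxBr /Jodd /Jlim expr1 !mul2Zl !mul2Zr.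
  move: (mul2 _ _ _) (mul2 _ _ _) (mul2 _ _ _) (mul2 _ _ _) => q1 q2 q3 q4.
  move: (mul3 _ _ _ _) (mul3 _ _ _ _) (mul3 _ _ _ _) (_ *m _) (_ *m _) (_ *m _) => r1 r2 r3 b1 b2 b3.
  by apply/matrixP => i j; rewrite !mxE; ring.
have o33' := @Op_mul3 _ _ _ 2 0 0 0 (fun e u a b d => c3 e u a b d - c3s e u a b d) _ _ _ o33 oz oz oz.
apply: Op_add; first apply: Op_add; first apply: Op_add; first apply: Op_add.
- apply: (@Op_exp_le _ _ 3) => //; exact: (Op_mul2_lim oz ow ozs ozz owq).
- apply: (@Op_exp_le _ _ 3) => //; exact: (Op_mul2_lim ow oz oeq owq ozz).
- apply: (@Op_exp_le _ _ 2) => //; apply: Op_add => //; apply: Op_add; first apply: Op_add.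
  + exact: (Op_mul3 o3s ozz oz oz).
  + exact: (Op_mul3 o3s ozs ozz oz).
  + exact: (Op_mul3 o3s ozs ozs ozz).
- apply: Op_opp; apply: (@Op_exp_le _ _ 3) => //; apply: (OpZ_le oek (Op_mulmx oB oz)) => //.
- apply: Op_opp; apply: (@Op_exp_le _ _ 2) => //; apply: Op_cstZ; apply: Op_add.
  + exact: (Op_mulmx oBB oz).
  + exact: (Op_mulmx oBs ozz).
Unshelve. all: by end_near. Qed.

End Parity.

(** * Projection onto Fourier modes *)

Section Proj.
Variables (R : realType) (k : nat).
Notation n := (2 + k + 1)%N.
Implicit Types (f g : R -> 'cV[R]_n) (m : nat).

Definition vcont f := forall i, continuous (fun p => f p i 0).

Lemma vcontD f g : vcont f -> vcont g -> vcont (fun p => f p + g p).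
Proof.
move=> cf cg i; rewrite (_ : (fun p => _) = fun p => f p i 0 + g p i 0); first exact: contD.
by apply/funext => p; rewrite mxE.
Qed.

Lemma vcontZ (c : R) f : vcont f -> vcont (fun p => c *: f p).
Proof.
move=> cf i; rewrite (_ : (fun p => _) = fun p => c * f p i 0).
  by apply: contM; [exact: cont_cst|exact: cf].
by apply/funext => p; rewrite mxE.
Qed.

Lemma vcontN f : vcont f -> vcont (fun p => - f p).
Proof. by move=> cf; under eq_fun do rewrite -scaleN1r; exact: vcontZ. Qed.

Lemma vcontB f g : vcont f -> vcont g -> vcont (fun p => f p - g p).
Proof. by move=> cf cg; apply: vcontD => //; exact: vcontN. Qed.

Lemma vcont_shift f (c : R) : vcont f -> vcont (fun p => f (p + c)).
Proof. by move=> cf i; apply: (@cont_shift R (fun p => f p i 0) c); exact: cf. Qed.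

Lemma vcont_mulmx (A : 'M[R]_n) f : vcont f -> vcont (fun p => A *m f p).
Proof. by move=> cf i; apply: cont_mulmx_entry => j; exact: cf. Qed.

Lemma vcont_cZ (c : R -> R) (v : 'cV[R]_n) : continuous c -> vcont (fun p => c p *: v).
Proof.
move=> cc i; rewrite (_ : (fun p => _) = fun p => c p * v i 0).
  by apply: contM => //; exact: cont_cst.
by apply/funext => p; rewrite mxE.
Qed.

Lemma vcont_sum (I : Type) (s : seq I) (F : I -> R -> 'cV[R]_n) :
  (forall i, vcont (F i)) -> vcont (fun p => \sum_(i <- s) F i p).
Proof.
move=> cF i; rewrite (_ : (fun p => _) = fun p => \sum_(j <- s) F j p i 0).
  by apply: cont_sum => j; exact: cF.
by apply/funext => p; rewrite summxE.
Qed.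

Lemma vcont_scale (c : R -> R) f : continuous c -> vcont f -> vcont (fun p => c p *: f p).
Proof.
move=> cc cf i; rewrite (_ : (fun p => _) = fun p => c p * f p i 0).
  by apply: contM => //; exact: cf.
by apply/funext => p; rewrite mxE.
Qed.

Lemma vcont_mul1 (c : 'I_n -> 'cV[R]_n) f : vcont f -> vcont (fun p => mul1 c (f p)).
Proof. by move=> cf; apply: vcont_sum => a; apply: vcont_cZ; exact: cf. Qed.

Lemma vcont_mul2 (c : 'I_n -> 'I_n -> 'cV[R]_n) f g : vcont f -> vcont g ->
  vcont (fun p => mul2 c (f p) (g p)).
Proof.
move=> cf cg; apply: vcont_sum => a; apply: vcont_scale; first exact: cf.
exact: vcont_mul1.
Qed.

Lemma vcont_mul3 (c : 'I_n -> 'I_n -> 'I_n -> 'cV[R]_n) f g h : vcont f -> vcont g -> vcont h ->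
  vcont (fun p => mul3 c (f p) (g p) (h p)).
Proof.
move=> cf cg ch; apply: vcont_sum => a; apply: vcont_scale; first exact: cf.
exact: vcont_mul2.
Qed.

Lemma vpcD m f g : vcont f -> vcont g ->
  (vpc m (fun p => f p + g p) = vpc m f + vpc m g) * (vps m (fun p => f p + g p) = vps m f + vps m g).
Proof.
move=> cf cg; split; apply/matrixP => i j; rewrite !mxE.
  by rewrite -pcD; [congr (pc _ _); apply/funext => p; rewrite mxE|exact: cf|exact: cg].
by rewrite -psD; [congr (ps _ _); apply/funext => p; rewrite mxE|exact: cf|exact: cg].
Qed.

Lemma vpcZ m (c : R) f : vcont f ->
  (vpc m (fun p => c *: f p) = c *: vpc m f) * (vps m (fun p => c *: f p) = c *: vps m f).
Proof.
move=> cf; split; apply/matrixP => i j; rewrite !mxE.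
  by rewrite -pcZ; [congr (pc _ _); apply/funext => p; rewrite mxE|exact: cf].
by rewrite -psZ; [congr (ps _ _); apply/funext => p; rewrite mxE|exact: cf].
Qed.

Lemma vpcB m f g : vcont f -> vcont g ->
  (vpc m (fun p => f p - g p) = vpc m f - vpc m g) * (vps m (fun p => f p - g p) = vps m f - vps m g).
Proof.
move=> cf cg; have cg' := vcontN cg.
rewrite !(vpcD m cf cg') -!(scaleN1r (vpc m g), scaleN1r (vps m g)) -!(vpcZ m _ cg).
by split; congr (_ + _); [congr vpc|congr vps]; apply/funext => p; rewrite scaleN1r.
Qed.

Lemma vpc_bound m f (B : R) : vcont f -> (forall p, `|f p| <= B) -> `|vpc m f| <= B /\ `|vps m f| <= B.
Proof.
move=> cf fB; have B0 : 0 <= B := le_trans (normr_ge0 _) (fB 0).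
have fB' i p : `|f p i 0| <= B by exact: le_trans (mxnorm_ge _ _ _) (fB p).
by split; apply: mxnorm_le => // i j; rewrite mxE;
  [apply: pc_bound|apply: ps_bound] => //; exact: cf.
Qed.

Lemma Op_vpc m q (f : R -> R * R -> 'cV[R]_n) :
  (\forall e \near 0^', forall t, vcont (fun p => f e (t, p))) -> Op q f ->
  Op q (fun e t => vpc m (fun p => f e (t, p))) /\ Op q (fun e t => vps m (fun p => f e (t, p))).
Proof.
move=> cf [C C0 HC]; split; exists C => //; near=> e => t.
  apply: (proj1 (@vpc_bound m _ _ _ _)) => [|p]; first by move: t; near: e.
  by have H : forall u, `|f e u| <= C * `|e| ^+ q by near: e; exact: HC.
apply: (proj2 (@vpc_bound m _ _ _ _)) => [|p]; first by move: t; near: e.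
by have H : forall u, `|f e u| <= C * `|e| ^+ q by near: e; exact: HC.
Unshelve. all: by end_near. Qed.

Lemma vpc_par m f : vcont f -> periodic f ->
  (vpc m f = vpc m (fun p => 2^-1 *: (f p + (-1) ^+ m *: f (p + pi)))) *
  (vps m f = vps m (fun p => 2^-1 *: (f p + (-1) ^+ m *: f (p + pi)))).
Proof.
move=> cf pf; split; apply/matrixP => i j; rewrite !mxE.
  rewrite pc_par; [|exact: cf|by move=> p; rewrite pf].
  by congr (pc _ _); apply/funext => p; rewrite !mxE.
rewrite ps_par; [|exact: cf|by move=> p; rewrite pf].
by congr (ps _ _); apply/funext => p; rewrite !mxE.
Qed.

Lemma vpc_trig m (f : R -> 'cV[R]_n) (a b : nat -> 'cV[R]_n) :
  (forall p i, f p i 0 = trig (fun m => a m i 0) (fun m => b m i 0) p) ->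
  ((m < 4)%N -> cm R m *: vpc m f = a m) /\ ((0 < m < 4)%N -> 2 *: vps m f = b m).
Proof.
move=> fE; split=> m4; apply/matrixP => i j; rewrite ord1.
  have -> : (cm R m *: vpc m f) i 0 = cm R m * pc m (fun p => f p i 0).
    by rewrite mxE; congr (_ * _); rewrite mxE.
  under eq_fun do rewrite fE.
  by rewrite (@pc_trig R m (fun m => a m i 0) (fun m => b m i 0))// mulrA /cm; case: ifP; rewrite ?mul1r// divff// mul1r.
have -> : (2 *: vps m f) i 0 = 2 * ps m (fun p => f p i 0).
  by rewrite mxE; congr (_ * _); rewrite mxE.
under eq_fun do rewrite fE.
by rewrite (@ps_trig R m (fun m => a m i 0) (fun m => b m i 0))// mulrA divff// mul1r.
Qed.

(** Coefficients are averages against functions bounded by 1, normalized by 1 or 2. *)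
Lemma phi_poly_coef (a b : nat -> R -> 'cV[R]_n) t (B : R) :
  (forall p, `|phi_poly 3 a b t p| <= B) ->
  (forall m, (m < 4)%N -> `|a m t| <= 2 * B) /\ (forall m, (0 < m < 4)%N -> `|b m t| <= 2 * B).
Proof.
move=> H; have cf : vcont (phi_poly 3 a b t).
  move=> i; under eq_fun do rewrite phi_poly_trig; exact: cont_trig.
have B0 : 0 <= B := le_trans (normr_ge0 _) (H 0).
split=> m m4.
  have [/(_ m4) <- _] := @vpc_trig m (phi_poly 3 a b t) (a ^~ t) (b ^~ t) (phi_poly_trig a b t).
  rewrite normrZ ler_pM//; last by have [] := vpc_bound m cf H.
  by rewrite /cm; case: ifP => _; rewrite ger0_norm// ler1n.
have [_ /(_ m4) <-] := @vpc_trig m (phi_poly 3 a b t) (a ^~ t) (b ^~ t) (phi_poly_trig a b t).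
rewrite normrZ ler_pM//; last by have [] := vpc_bound m cf H.
by rewrite ger0_norm.
Qed.

(** The factor 7 counts the coefficients, four of cosines and three of sines. *)
Lemma phi_poly_norm (a b : nat -> R -> 'cV[R]_n) t p (B : R) :
  (forall m, (m < 4)%N -> `|a m t| <= B) -> (forall m, (0 < m < 4)%N -> `|b m t| <= B) ->
  `|phi_poly 3 a b t p| <= 7 * B.
Proof.
move=> ha hb; rewrite /phi_poly /index_iota /= !big_cons big_nil addr0.
have c1 (x : R) (v : 'cV[R]_n) : `|v| <= B -> `|cos x *: v| <= B.
  by move=> vB; rewrite normrZ -[leRHS]mul1r ler_pM//; rewrite ler_norml cos_geN1 cos_le1.
have s1 (x : R) (v : 'cV[R]_n) : `|v| <= B -> `|sin x *: v| <= B.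
  by move=> vB; rewrite normrZ -[leRHS]mul1r ler_pM//; rewrite ler_norml sin_geN1 sin_le1.
have -> : 7 * B = B + (B + B + (B + B + (B + B))) by ring.
apply: le_trans (ler_normD _ _) _; apply: lerD; first exact: ha.
apply: le_trans (ler_normD _ _) _; apply: lerD.
  by apply: le_trans (ler_normD _ _) _; apply: lerD; [apply: c1; exact: ha|apply: s1; exact: hb].
apply: le_trans (ler_normD _ _) _; apply: lerD.
  by apply: le_trans (ler_normD _ _) _; apply: lerD; [apply: c1; exact: ha|apply: s1; exact: hb].
by apply: le_trans (ler_normD _ _) _; apply: lerD; [apply: c1; exact: ha|apply: s1; exact: hb].
Qed.

End Proj.

(** * Expansion of the Fourier branch *)

Section Waves.
Variables (R : realType) (k : nat) (aF bF : nat -> R -> R -> 'cV[R]_(2 + k + 1)).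

(** Modes are grouped by their behaviour under phi -> phi + pi; a*, being of mode 1, joins the odd
    part in [z_odd]. *)
Definition w_even e (u : R * R) := aF 0%N u.1 e + cos (2 * u.2) *: aF 2%N u.1 e + sin (2 * u.2) *: bF 2%N u.1 e.
Definition w_odd e (u : R * R) := cos u.2 *: aF 1%N u.1 e + sin u.2 *: bF 1%N u.1 e
  + cos (3 * u.2) *: aF 3%N u.1 e + sin (3 * u.2) *: bF 3%N u.1 e.
Definition z_odd e (u : R * R) := astar k u.2 + w_odd e u.

Lemma phi_poly_split e t p : astar k p + phi_poly 3 (fun m s => aF m s e) (fun m s => bF m s e) t p
  = z_odd e (t, p) + w_even e (t, p).
Proof.
rewrite /z_odd /w_even /w_odd /phi_poly /index_iota /= !big_cons big_nil addr0 mul1r.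
move: (astar k p) => a; apply/matrixP => i j; rewrite !mxE; ring.
Qed.

Lemma we_shift e t p : w_even e (t, p + pi) = w_even e (t, p).
Proof. by rewrite /w_even /= (cosM_pi 2) (sinM_pi 2) sqrrN expr1n !mul1r. Qed.

Lemma wo_shift e t p : w_odd e (t, p + pi) = - w_odd e (t, p).
Proof.
have h1 := @cosM_pi R 1 p; have h2 := @sinM_pi R 1 p; rewrite !mul1r expr1 !mulN1r in h1 h2.
rewrite /w_odd /= h1 h2 (cosM_pi 3) (sinM_pi 3) (_ : (-1) ^+ 3 = -1); last by rewrite exprS sqrrN expr1n mulr1.
by rewrite !mulN1r !scaleNr !opprD.
Qed.

Lemma astar_shift (p : R) : astar k (p + pi) = - astar k p.
Proof.
have h1 := @cosM_pi R 1 p; have h2 := @sinM_pi R 1 p; rewrite !mul1r expr1 !mulN1r in h1 h2.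
rewrite -scaleN1r; apply: vec3_eq; rewrite /astar !zE ?scaler0 ?mulr0//.
by apply/matrixP => i j; rewrite !mxE h1 h2; case: ifP; rewrite mulN1r.
Qed.

Lemma zo_shift e t p : z_odd e (t, p + pi) = - z_odd e (t, p).
Proof. by rewrite /z_odd wo_shift -[RHS]/(- (astar k p + w_odd e (t, p))) [RHS]opprD -astar_shift. Qed.

Lemma Op_cosZ q (c : R) (f : R -> R -> 'cV[R]_(2 + k + 1)) : Op q f ->
  Op q (fun e (u : R * R) => cos (c * u.2) *: f e u.1) /\ Op q (fun e (u : R * R) => sin (c * u.2) *: f e u.1).
Proof.
move=> H; have H' := Op_comp (fun u : R * R => u.1) H.
have o1 : Op 0 (fun (_ : R) (u : R * R) => cos (c * u.2)).
  by apply: (@Op_bounded _ _ _ _ 1); near=> e => u; rewrite ler_norml cos_geN1 cos_le1.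
have o2 : Op 0 (fun (_ : R) (u : R * R) => sin (c * u.2)).
  by apply: (@Op_bounded _ _ _ _ 1); near=> e => u; rewrite ler_norml sin_geN1 sin_le1.
by split; [exact: (OpZ_le o1 H')|exact: (OpZ_le o2 H')].
Unshelve. all: by end_near. Qed.

Lemma Op_we q : Op q (fun e t => aF 0%N t e) -> Op q (fun e t => aF 2%N t e) ->
  Op q (fun e t => bF 2%N t e) -> Op q w_even.
Proof.
move=> h0 h1 h2; apply: Op_add; first apply: Op_add.
- exact: (Op_comp (fun u : R * R => u.1) h0).
- exact: (proj1 (Op_cosZ 2 h1)).
- exact: (proj2 (Op_cosZ 2 h2)).
Qed.

Lemma Op_wo q : Op q (fun e t => aF 1%N t e) -> Op q (fun e t => bF 1%N t e) ->
  Op q (fun e t => aF 3%N t e) -> Op q (fun e t => bF 3%N t e) -> Op q w_odd.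
Proof.
move=> h0 h1 h2 h3.
have k1 := proj1 (Op_cosZ 1 h0); have k2 := proj2 (Op_cosZ 1 h1).
apply: Op_add; first apply: Op_add; first apply: Op_add.
- by move: k1; apply: Op_eq; near=> e => u; rewrite mul1r.
- by move: k2; apply: Op_eq; near=> e => u; rewrite mul1r.
- exact: (proj1 (Op_cosZ 3 h2)).
- exact: (proj2 (Op_cosZ 3 h3)).
Unshelve. all: by end_near. Qed.

Lemma Op_astar : Op 0 (fun (_ : R) (u : R * R) => astar k u.2).
Proof.
apply: (@Op_bounded _ _ _ _ 1); near=> e => u; apply: mxnorm_le => // i j; rewrite ord1.
move: i; apply: idxP => [i|i|].
- rewrite -zhatE /astar zhat_vec3 mxE; case: ifP => _.
    by rewrite ler_norml cos_geN1 cos_le1.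
  by rewrite ler_norml sin_geN1 sin_le1.
- by rewrite -ztilE /astar ztil_vec3 mxE normr0.
- by rewrite -zringE /astar zring_vec3 normr0.
Unshelve. all: by end_near. Qed.

End Waves.

Section Aux.
Variable R : realType.

(** At S = sup f the hypothesis gives sup f <= sup f / 2 + c; the crude bound M guarantees that the
    supremum is finite. *)
Lemma absorb_sup (Y : Type) (f : Y -> R) (c M : R) : (forall y, f y <= M) ->
  (forall S, (forall y, f y <= S) -> forall y, f y <= S / 2 + c) -> forall y, f y <= 2 * c.
Proof.
move=> fM H y; have hs : has_sup (range f) by split; [exists (f y); exists y|exists M => _ [z _ <-]].
have ub z : f z <= sup (range f) by apply: (ub_le_sup (proj2 hs)); exists z.
have : sup (range f) <= sup (range f) / 2 + c.
  by apply: ge_sup; [exact: (proj1 hs)|move=> _ [z _ <-]; exact: H].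
by have := ub y; lra.
Qed.

Lemma arith_small (Q c c' d d' x y b1 b2 b3 b4 : R) : 0 <= Q -> 0 <= c -> 0 <= d ->
  c <= c' -> d <= d' -> 0 <= x -> 0 <= y -> b1 <= Q * x -> b2 <= 6 * x ->
  b3 <= 2 * (c * y) -> b4 <= d * y -> b1 + b2 + b3 + b4 <= (Q + 6 + 2 * c' + d') * (x + y).
Proof.
move=> Q0 c0 d0 cc dd x0 y0 h1 h2 h3 h4.
have k1 : c * y <= c' * y by rewrite ler_wpM2r.
have k2 : d * y <= d' * y by rewrite ler_wpM2r.
have := mulr_ge0 Q0 y0; have := mulr_ge0 (le_trans c0 cc) x0; have := mulr_ge0 (le_trans d0 dd) x0.
lra.
Qed.

End Aux.

Section Branch.
Variables (R : realType) (k : nat) (D : ns_data R k).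
Notation n := (2 + k + 1)%N.
Notation V := ('cV[R]_n * R)%type.
Notation X := (R * R)%type.
Notation om := (ns_om D).
Notation ls := (ns_lam D).
Hypothesis smF : smooth_on setT (fun p : V => ns_F D p.1 p.2).
Variable r : R.
Hypothesis r_gt0 : 0 < r.
Hypothesis ct : continuation D r.
Hypothesis aR0 : ns_aR D ls = 0.
Hypothesis aI0 : ns_aI D ls = om.
Hypothesis hyp : forall w : R,
    ~~ eigenvalue (map_mx (real_complex R) (ns_Et D ls)) (Complex 0 w).
Hypothesis om01 : 0 < om < 1 / 2.
Hypothesis res3 : om != 1 / 3.
Hypothesis res4 : om != 1 / 4.
Hypothesis trans : derive1 (ns_aR D) ls != 0.
Variables (lF omF etaF : R -> R) (aF bF : nat -> R -> R -> 'cV[R]_n).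
Hypothesis HF : \forall e \near 0^', fourier_sol D 3 e (lF e) (omF e) (etaF e)
  (fun t p => astar k p + phi_poly 3 (fun m s => aF m s e) (fun m s => bF m s e) t p).
Hypothesis Hnear : forall d, 0 < d -> \forall e \near 0^', near_base D d (lF e) (omF e) (etaF e)
  (fun t p => astar k p + phi_poly 3 (fun m s => aF m s e) (fun m s => bF m s e) t p).

(** * Nonresonance, transversality and the mode equations of the branch *)

Lemma r2_gt0 : 0 < r / 2. Proof. exact: divr_gt0. Qed.
Lemma r2_lt : r / 2 < r. Proof. by rewrite ltr_pdivrMr// mulr2n mulrDr mulr1 ltrDl. Qed.

Lemma nonres_om : nonres 0 om /\ nonres 0 (om + om).
Proof.
have /andP[w1 w2] := om01; split; apply: nonres_frac; left; rewrite ger0_norm; [|lra| |lra];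
  apply/andP; split; lra.
Qed.

(** The critical frequencies are 3 om (modes 2 and 3) and 4 om (mode 3): they lie below 2 and the
    exclusion of 1/3 and 1/4 keeps them off 1. All others lie strictly between 0 and 1 in
    modulus. *)
Lemma nonres_m m : (1 < m < 4)%N ->
  [/\ nonres 0 (om - m%:R * om), nonres 0 (om + m%:R * om) & nonres 0 (m%:R * om)].
Proof.
have /andP[w1 w2] := om01.
have h3 : om < 1 / 3 \/ 1 / 3 < om.
  by have := res3; rewrite neq_lt => /orP[]; [left|right].
have h4 : om < 1 / 4 \/ 1 / 4 < om.
  by have := res4; rewrite neq_lt => /orP[]; [left|right].
case: m => [|[|[|[|//]]]]// _; split; apply: nonres_frac.
- left; rewrite ler0_norm; [apply/andP; split|]; lra.
- by case: h3 => h; [left; rewrite ger0_norm; [apply/andP; split|]|right; apply/andP; split]; lra.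
- left; rewrite ger0_norm; [apply/andP; split|]; lra.
- left; rewrite ler0_norm; [apply/andP; split|]; lra.
- by case: h4 => h; [left; rewrite ger0_norm; [apply/andP; split|]|right; apply/andP; split]; lra.
- by case: h3 => h; [left; rewrite ger0_norm; [apply/andP; split|]|right; apply/andP; split]; lra.
Qed.

Lemma itv_open : open [set l : R | `|l - ls| < r].
Proof. exact: itv_dist_open. Qed.

Lemma E_BL : exists2 K, 0 <= K & forall l, `|l - ls| <= r / 2 ->
  `|ns_E D l| <= K /\ `|ns_E D l - ns_E D ls| <= K * `|l - ls|.
Proof.
suff H i j : BL ls (r / 2) (fun _ l => ns_E D l i j).
  have [K K0 HK] := @BL_vec_bound R ls (r / 2) _ _ (fun _ l => ns_E D l) H.
  by exists K => // l; exact: (HK 0 l).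
have BaR := itv_BL r2_lt (ct_aR ct 1%N); have BaI := itv_BL r2_lt (ct_aI ct 1%N).
have BEt i' j' := itv_BL r2_lt (class_C_entry i' j' itv_open (ct_Et ct 1%N)).
have B0 : BL ls (r / 2) (fun _ _ => 0) := BL_cst _ _ _.
have B0e (p q : nat) (i' : 'I_p) (j' : 'I_q) : BL ls (r / 2) (fun _ _ => (0 : 'M[R]_(p, q)) i' j') := BL_cst _ _ _.
have ext f g : (forall t l, f t l = g t l) -> BL ls (r / 2) f -> BL ls (r / 2) g.
  by move=> fg; congr BL; apply/funext => t; apply/funext => l.
move: i; apply: idxP => [i|i|]; move: j; apply: idxP => [j|j|].
- have e (t l : R) : (if i == j then ns_aR D l else if i == 0 then - ns_aI D l else ns_aI D l) = ns_E D l (hidx k i) (hidx k j).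
    by rewrite /ns_E /hidx block_mxEul block_mxEul mxE.
  by apply: (ext _ _ e); case: (i == j) => //; case: (i == 0) => //; exact: (BL_opp r2_gt0 BaI).
- by apply: (ext _ _ _ (B0e _ _ i j)) => t l; rewrite /ns_E /hidx /tidx block_mxEul block_mxEur.
- by apply: (ext _ _ _ (B0e _ _ (lshift k i) (0 : 'I_1))) => t l; rewrite /ns_E /hidx /ridx block_mxEur.
- by apply: (ext _ _ _ (B0e _ _ i j)) => t l; rewrite /ns_E /hidx /tidx block_mxEul block_mxEdl.
- by apply: (ext _ _ _ (BEt i j)) => t l; rewrite /ns_E /tidx block_mxEul block_mxEdr.
- by apply: (ext _ _ _ (B0e _ _ (rshift 2 i) (0 : 'I_1))) => t l; rewrite /ns_E /tidx /ridx block_mxEur.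
- by apply: (ext _ _ _ (B0e _ _ (0 : 'I_1) (lshift k j))) => t l; rewrite /ns_E /hidx /ridx block_mxEdl.
- by apply: (ext _ _ _ (B0e _ _ (0 : 'I_1) (rshift 2 j))) => t l; rewrite /ns_E /tidx /ridx block_mxEdl.
- by apply: (ext _ _ _ (B0e _ _ (0 : 'I_1) (0 : 'I_1))) => t l; rewrite /ns_E /ridx block_mxEdr.
Qed.

Lemma near_lam_le d : 0 < d -> \forall e \near 0^', `|lF e - ls| <= d.
Proof. by move=> /Hnear; apply: filterS => e [/ltW]. Qed.

Lemma aR_taylor : exists2 C, 0 <= C & forall l, `|l - ls| <= r / 2 ->
  `|ns_aR D l - derive1 (ns_aR D) ls * (l - ls)| <= C * `|l - ls| ^+ 2.
Proof.
have [C C0 HC] := itv_taylor2 r2_lt (ct_aR ct 2%N).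
by exists C => // l lr; have := HC l lr; rewrite aR0 subr0.
Qed.

Lemma aI_taylor : exists2 C, 0 <= C & forall l, `|l - ls| <= r / 2 ->
  `|ns_aI D l - om - derive1 (ns_aI D) ls * (l - ls)| <= C * `|l - ls| ^+ 2.
Proof.
have [C C0 HC] := itv_taylor2 r2_lt (ct_aI ct 2%N).
by exists C => // l lr; have := HC l lr; rewrite aI0.
Qed.

(** With c the nonzero derivative of alpha_R and x = lambda - lambda*, Taylor gives |c| |x| <=
    |alpha_R| + C x^2, and the square is absorbed as soon as C |x| <= |c| / 2. *)
Lemma lam_Op p (Y : Type) : Op p (fun e (_ : unit) => ns_aR D (lF e)) ->
  Op p (fun e (_ : Y) => lF e - ls).
Proof.
move=> [A A0 HA]; have [C C0 HC] := aR_taylor.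
have c0 : 0 < `|derive1 (ns_aR D) ls| by rewrite normr_gt0.
set c := derive1 (ns_aR D) ls in c0 HC.
exists (2 / `|c| * A); first by rewrite !mulr_ge0// invr_ge0.
near=> e => y.
have lr : `|lF e - ls| <= r / 2 by near: e; exact: near_lam_le r2_gt0.
have ld : `|lF e - ls| <= `|c| / 2 / (C + 1).
  by near: e; apply: near_lam_le; rewrite !divr_gt0// ltr_wpDl.
have Ha : `|ns_aR D (lF e)| <= A * `|e| ^+ p by apply: (_ : unit -> _) tt; near: e; exact: HA.
have := HC _ lr; move: lr ld Ha; set a := ns_aR D _; set x := lF e - ls => _ ld Ha Hb.
have h1 : `|c| * `|x| <= `|a| + C * `|x| ^+ 2.
  rewrite -normrM -[X in `|X| <= _](subrK a) (le_trans (ler_normD _ _))// addrC lerD//.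
  by rewrite distrC.
have h2 : C * `|x| ^+ 2 <= `|c| / 2 * `|x|.
  rewrite expr2 mulrA ler_wpM2r//; apply: le_trans (ler_wpM2l C0 ld) _.
  rewrite mulrCA ler_piMr ?divr_ge0// ler_pdivrMr ?mul1r; lra.
have h3 : `|c| / 2 * `|x| <= A * `|e| ^+ p by lra.
rewrite -(ler_pM2l c0) [leRHS](_ : _ = 2 * (A * `|e| ^+ p)); first by lra.
by field; exact: lt0r_neq0.
Unshelve. all: by end_near. Qed.

Definition NF e (u : X) := Nres D e (lF e) (etaF e) (fun m s => aF m s e) (fun m s => bF m s e) u.1 u.2.
Definition dA m e t : 'cV[R]_n := da (fun m s => aF m s e) m t.
Definition dB m e t : 'cV[R]_n := db (fun m s => bF m s e) m t.
Definition residA m e t : 'cV[R]_n := (ns_E D (lF e) - ns_E D ls) *m aF m t e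
  - (m%:R * (omF e - om)) *: bF m t e + cm R m *: vpc m (fun p => NF e (t, p)) - (e * etaF e) *: dA m e t.
Definition residB m e t : 'cV[R]_n := (ns_E D (lF e) - ns_E D ls) *m bF m t e
  + (m%:R * (omF e - om)) *: aF m t e + 2 *: vps m (fun p => NF e (t, p)) - (e * etaF e) *: dB m e t.
(* The secular terms of mode 1; [growth] vanishes at lambda* and determines
   lambda - lambda* by transversality. *)
Definition growth e := ns_aR D (lF e).
Definition detuning e := ns_aI D (lF e) - omF e.
(** Modes of the defect of a* in the linear equation, growth a* + detuning da*/dphi, together with -
    eta e_n in mode 0. *)
Definition forceA m e : 'cV[R]_n := if m == 0%N then - (etaF e *: e_n R k)
  else if m == 1%N then vec3 (cv2 (growth e) (detuning e)) 0 0 else 0.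
Definition forceB m e : 'cV[R]_n := if m == 1%N then vec3 (cv2 (- detuning e) (growth e)) 0 0 else 0.

Lemma E_acst m e : ns_E D (lF e) *m acst R k m - (m%:R * omF e) *: bcst R k m =
  if m == 1%N then vec3 (cv2 (growth e) (detuning e)) 0 0 else 0.
Proof.
rewrite /acst /bcst; case: ifP => [/eqP ->|_]; last by rewrite mulmx0 scaler0 subr0.
rewrite mul1r ns_E_vec3 -scaleNr; apply: vec3_eq; rewrite !zE ?mulmx0 ?mulr0 ?scaler0 ?addr0//.
apply/matrixP => i j; rewrite ord1 mxE; case: (ord2P i) => ->.
  by rewrite rotmxE [X in _ + X]mxE !cv2E /growth; ring.
by rewrite rotmxE [X in _ + X]mxE !cv2E /detuning; ring.
Qed.

Lemma E_bcst m e : ns_E D (lF e) *m bcst R k m + (m%:R * omF e) *: acst R k m = forceB m e.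
Proof.
rewrite /forceB /acst /bcst; case: ifP => [/eqP ->|_]; last by rewrite mulmx0 scaler0 addr0.
rewrite mul1r ns_E_vec3; apply: vec3_eq; rewrite !zE ?mulmx0 ?mulr0 ?scaler0 ?addr0//.
apply/matrixP => i j; rewrite ord1 mxE; case: (ord2P i) => ->.
  by rewrite rotmxE [X in _ + X]mxE !cv2E /detuning; ring.
by rewrite rotmxE [X in _ + X]mxE !cv2E /growth; ring.
Qed.

(** The contribution of a* is split off by [E_acst]; the remaining linear terms are compared with
    their values at lambda*. *)
Lemma mode_id_a m : (m < 4)%N -> \forall e \near 0^', forall t,
  dA m e t = ns_E D ls *m aF m t e - (m%:R * om) *: bF m t e + (forceA m e + residA m e t).
Proof.
move=> m4; near=> e => t.
have fs : fourier_sol D 3 e (lF e) (omF e) (etaF e)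
  (fun t p => astar k p + phi_poly 3 (fun m s => aF m s e) (fun m s => bF m s e) t p) by near: e.
have := mode_eq_a smF fs t m4.
rewrite -/(dA m e t) /az /bz.
have <- : vpc m (fun p => NF e (t, p)) = vpc m (Nres D e (lF e) (etaF e) (fun m s => aF m s e) (fun m s => bF m s e) t) by [].
have := E_acst m e.
rewrite /residA /forceA mulmxDr scalerDr mulmxBl.
have i0 j : (if j == 0%N then - (etaF e *: e_n R k) else if j == 1%N then vec3 (cv2 (growth e) (detuning e)) 0 0 else 0)
  = (if j == 1%N then vec3 (cv2 (growth e) (detuning e)) 0 0 else 0) - (if j == 0%N then etaF e *: e_n R k else 0).
  by case: j => [|[|j]] /=; rewrite ?sub0r ?subr0 ?oppr0.
rewrite i0 => <-.
move: (if _ then _ else _) (_ *m _) (_ *m _) (_ *m _) (dA m e t) (cm R m *: _) => c x1 x2 x3 d v.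
move: (acst R k m) (bcst R k m) => ca cb.
rewrite scalerDl scale1r => H.
rewrite -[LHS](addrK ((e * etaF e) *: d)) H.
move: (aF m t e) (bF m t e) => a b; apply/matrixP => i j; rewrite !mxE; ring.
Unshelve. all: by end_near. Qed.

Lemma mode_id_b m : (0 < m < 4)%N -> \forall e \near 0^', forall t,
  dB m e t = ns_E D ls *m bF m t e + (m%:R * om) *: aF m t e + (forceB m e + residB m e t).
Proof.
move=> m4; near=> e => t.
have fs : fourier_sol D 3 e (lF e) (omF e) (etaF e)
  (fun t p => astar k p + phi_poly 3 (fun m s => aF m s e) (fun m s => bF m s e) t p) by near: e.
have := mode_eq_b smF fs t m4.
rewrite -/(dB m e t) /az /bz.
have <- : vps m (fun p => NF e (t, p)) = vps m (Nres D e (lF e) (etaF e) (fun m s => aF m s e) (fun m s => bF m s e) t) by [].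
rewrite -E_bcst /residB mulmxDr scalerDr mulmxBl.
move: (_ *m _) (_ *m _) (_ *m _) (dB m e t) (2 *: _) => x1 x2 x3 d v.
move: (acst R k m) (bcst R k m) => ca cb.
rewrite scalerDl scale1r => H.
rewrite -[LHS](addrK ((e * etaF e) *: d)) H.
move: (aF m t e) (bF m t e) => a b; apply/matrixP => i j; rewrite !mxE; ring.
Unshelve. all: by end_near. Qed.

Lemma branch_msys m : (0 < m < 4)%N -> \forall e \near 0^',
  msys (ns_E D ls) (m%:R * om) (aF m ^~ e) (bF m ^~ e)
    (fun t => forceA m e + residA m e t) (fun t => forceB m e + residB m e t).
Proof.
move=> m4; have m4' : (m < 4)%N by case/andP: m4.
move: HF (mode_id_a m4') (mode_id_b m4); apply: filterS3 => e fs ida idb.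
have [pa dera] := a_per fs m4'; have [pb derb] := b_per fs m4.
split=> // t i.
  have := dera t i; rewrite -/(dA m e t).
  rewrite ida.
  by move: (_ *m _) (forceA m e + residA m e t) => x y; rewrite !mxE.
have := derb t i; rewrite -/(dB m e t).
rewrite idb.
by move: (_ *m _) (forceB m e + residB m e t) => x y; rewrite !mxE.
Qed.

Lemma branch_msys0 : \forall e \near 0^',
  msys (ns_E D ls) 0 (aF 0%N ^~ e) (fun _ => 0) (fun t => residA 0 e t - etaF e *: e_n R k) (fun _ => 0) /\
  avg (fun t => zring (aF 0%N t e)) = 0.
Proof.
move: HF (mode_id_a (isT : (0 < 4)%N)); apply: filterS2 => e fs ida.
have [pa dera] := a_per fs (isT : (0 < 4)%N).
split; last by have [] := gamma_means fs.
split=> // t i; last first.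
  rewrite mulmx0 [(0 : 'cV_n) i 0]mxE mul0r !addr0; exact: is_derive_cst.
have := dera t i; rewrite -/(dA 0 e t).
rewrite ida !mul0r scale0r subr0 subr0 /forceA /= [- _ + _]addrC.
by move: (_ *m _) (residA 0 e t - etaF e *: e_n R k) => x y; rewrite !mxE.
Qed.

(** * Crude bounds, without a rate, from closeness to the base point *)

Lemma near_small d : 0 < d -> \forall e \near 0^', [/\ `|lF e - ls| <= d, `|omF e - om| <= d,
  `|etaF e| <= d & forall t, (forall m, (m < 4)%N -> `|aF m t e| <= 2 * d) /\
     (forall m, (0 < m < 4)%N -> `|bF m t e| <= 2 * d)].
Proof.
move=> d0; have := Hnear d0; apply: filterS => e [h1 h2 h3 h4]; split; try exact: ltW.
move=> t; apply: (@phi_poly_coef R k (fun m s => aF m s e) (fun m s => bF m s e) t) => p.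
by have := ltW (h4 t p); rewrite addrC addKr.
Qed.

Lemma Op0_A m : (m < 4)%N -> Op 0 (fun e t => aF m t e).
Proof.
move=> m4; apply: (@Op_bounded _ _ _ _ (2 * 1)).
by have := near_small ltr01; apply: filterS => e [_ _ _ h] t; have [+ _] := h t; exact.
Qed.

Lemma Op0_B m : (0 < m < 4)%N -> Op 0 (fun e t => bF m t e).
Proof.
move=> m4; apply: (@Op_bounded _ _ _ _ (2 * 1)).
by have := near_small ltr01; apply: filterS => e [_ _ _ h] t; have [_ +] := h t; exact.
Qed.

Lemma Op0_eta (Y : Type) : Op 0 (fun e (_ : Y) => etaF e).
Proof.
apply: (@Op_bounded _ _ _ _ 1).
by have := near_small ltr01; apply: filterS => e [_ _ h _].
Qed.

Lemma Op0_lam (Y : Type) : Op 0 (fun e (_ : Y) => lF e - ls).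
Proof.
apply: (@Op_bounded _ _ _ _ 1).
by have := near_small ltr01; apply: filterS => e [h _ _ _].
Qed.

Lemma Op0_nu (Y : Type) : Op 0 (fun e (_ : Y) => omF e - om).
Proof.
apply: (@Op_bounded _ _ _ _ 1).
by have := near_small ltr01; apply: filterS => e [_ h _ _].
Qed.

Lemma Op_E q (Y : Type) : Op q (fun e (_ : Y) => lF e - ls) ->
  Op q (fun e (_ : Y) => ns_E D (lF e) - ns_E D ls).
Proof.
have [K K0 HK] := E_BL; move=> [C C0 HC]; exists (K * C); first exact: mulr_ge0.
have := near_lam_le r2_gt0; move: HC; apply: filterS2 => e HC lr y.
by apply: (le_trans (proj2 (HK _ lr))); rewrite -mulrA ler_wpM2l//; exact: HC.
Qed.

Lemma Op0_E (Y : Type) : Op 0 (fun e (_ : Y) => ns_E D (lF e)).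
Proof.
have [K K0 HK] := E_BL; apply: (@Op_bounded _ _ _ _ K).
by have := near_lam_le r2_gt0; apply: filterS => e lr y; exact: (proj1 (HK _ lr)).
Qed.

(** * The forcing along the branch and its dependence on lambda *)

Definition BmxF e (u : X) := Bmx D u.1 (lF e).
Definition jetF2 e (u : X) := jet2 D u.1 (lF e).
Definition jetF3 e (u : X) := jet3 D u.1 (lF e).
Definition jetF4 e (u : X) := jet4 D u.1 (lF e).
Definition BmxS (e : R) (u : X) := Bmx D u.1 ls.
Definition jetS2 (e : R) (u : X) := jet2 D u.1 ls.
Definition jetS3 (e : R) (u : X) := jet3 D u.1 ls.

Lemma Bmx_bnd : exists2 C, 0 <= C & forall t l, `|l - ls| <= r / 2 ->
  `|Bmx D t l| <= C /\ `|Bmx D t l - Bmx D t ls| <= C * `|l - ls|.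
Proof. by apply: BL_vec_bound => i j; exact: (BL_Bmx r_gt0 ct). Qed.

Lemma ls_in : `|ls - ls| <= r / 2.
Proof. by rewrite subrr normr0 ltW// r2_gt0. Qed.

Lemma Op0_coef (W : normedModType R) (Y : Type) (f : Y -> R -> W) (C : R) :
  (forall y l, `|l - ls| <= r / 2 -> `|f y l| <= C) ->
  Op 0 (fun e y => f y (lF e)) /\ Op 0 (fun (_ : R) y => f y ls).
Proof.
move=> H; split; apply: (@Op_bounded _ _ _ _ C).
  by have := near_lam_le r2_gt0; apply: filterS => e lr y; exact: H.
by near=> e => y; apply: H; exact: ls_in.
Unshelve. all: by end_near. Qed.

Lemma Op_coefB q (W : normedModType R) (Y : Type) (f : Y -> R -> W) (C : R) : 0 <= C ->
  (forall y l, `|l - ls| <= r / 2 -> `|f y l - f y ls| <= C * `|l - ls|) ->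
  Op q (fun e (_ : unit) => lF e - ls) ->
  Op q (fun e y => f y (lF e) - f y ls).
Proof.
move=> C0 H [K K0 HK]; exists (C * K); first exact: mulr_ge0.
have := near_lam_le r2_gt0; move: HK; apply: filterS2 => e HK lr y.
by apply: (le_trans (H _ _ lr)); rewrite -mulrA ler_wpM2l//; exact: (HK tt).
Qed.

Lemma Op_Bmx : [/\ Op 0 BmxF, Op 0 BmxS & forall q, Op q (fun e (_ : unit) => lF e - ls) ->
   Op q (fun e u => BmxF e u - BmxS e u)].
Proof.
have [C C0 HC] := Bmx_bnd; have [h1 h2] : Op 0 BmxF /\ Op 0 BmxS.
  by apply: (@Op0_coef _ _ (fun (u : X) l => Bmx D u.1 l) C) => u l /(HC u.1)[].
by split=> // q Hq; apply: (@Op_coefB q _ _ (fun (u : X) l => Bmx D u.1 l) C C0) => // u l /(HC u.1)[].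
Qed.

Lemma Op_jet2 : [/\ Op 0 (fun e u => jetF2 e u.1.1 u.1.2 u.2), Op 0 (fun e u => jetS2 e u.1.1 u.1.2 u.2) &
   forall q, Op q (fun e (_ : unit) => lF e - ls) ->
   Op q (fun e u => jetF2 e u.1.1 u.1.2 u.2 - jetS2 e u.1.1 u.1.2 u.2)].
Proof.
have [C C0 HC] := jet2_bnd smF r_gt0 ct.
have [h1 h2] := @Op0_coef _ _ (fun (u : X * 'I_n * 'I_n) l => jet2 D u.1.1.1 l u.1.2 u.2) C
   (fun u l lr => proj1 (HC u.1.2 u.2 u.1.1.1 l lr)).
split; [exact: h1|exact: h2|move=> q Hq].
exact: (@Op_coefB q _ _ (fun (u : X * 'I_n * 'I_n) l => jet2 D u.1.1.1 l u.1.2 u.2) C C0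
   (fun u l lr => proj2 (HC u.1.2 u.2 u.1.1.1 l lr))).
Qed.

Lemma Op_jet3 : [/\ Op 0 (fun e u => jetF3 e u.1.1.1 u.1.1.2 u.1.2 u.2), Op 0 (fun e u => jetS3 e u.1.1.1 u.1.1.2 u.1.2 u.2) &
   forall q, Op q (fun e (_ : unit) => lF e - ls) ->
   Op q (fun e u => jetF3 e u.1.1.1 u.1.1.2 u.1.2 u.2 - jetS3 e u.1.1.1 u.1.1.2 u.1.2 u.2)].
Proof.
have [C C0 HC] := jet3_bnd smF r_gt0 ct.
have [h1 h2] := @Op0_coef _ _ (fun (u : X * 'I_n * 'I_n * 'I_n) l => jet3 D u.1.1.1.1 l u.1.1.2 u.1.2 u.2) C
   (fun u l lr => proj1 (HC u.1.1.2 u.1.2 u.2 u.1.1.1.1 l lr)).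
split; [exact: h1|exact: h2|move=> q Hq].
exact: (@Op_coefB q _ _ (fun (u : X * 'I_n * 'I_n * 'I_n) l => jet3 D u.1.1.1.1 l u.1.1.2 u.1.2 u.2) C C0
   (fun u l lr => proj2 (HC u.1.1.2 u.1.2 u.2 u.1.1.1.1 l lr))).
Qed.

Lemma Op_jet4 : Op 0 (fun e u => jetF4 e u.1.1.1.1 u.1.1.1.2 u.1.1.2 u.1.2 u.2).
Proof.
have [C C0 HC] := jet4_bnd smF r_gt0 ct.
have [h _] := @Op0_coef _ _ (fun (u : X * 'I_n * 'I_n * 'I_n * 'I_n) l => jet4 D u.1.1.1.1.1 l u.1.1.1.2 u.1.1.2 u.1.2 u.2) C
   (fun u l lr => proj1 (HC u.1.1.1.2 u.1.1.2 u.1.2 u.2 u.1.1.1.1.1 l lr)).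
exact: h.
Qed.

Lemma Op0_zo : Op 0 (z_odd aF bF).
Proof. by apply: Op_add; [exact: Op_astar|apply: Op_wo; solve [exact: Op0_A|exact: Op0_B]]. Qed.

Lemma Op0_we : Op 0 (w_even aF bF).
Proof. by apply: Op_we; solve [exact: Op0_A|exact: Op0_B]. Qed.

Notation etaX := (fun e (_ : X) => etaF e).

Lemma NF_jet : Op 4 (fun e u => NF e u - Jet BmxF jetF2 jetF3 jetF4 etaX e u (z_odd aF bF e u + w_even aF bF e u)).
Proof.
have [C C0 HC] := G_jet smF r_gt0 ct.
have [Z Z0 HZ] := Op_add Op0_zo Op0_we.
exists (C * Z ^+ 5); first by rewrite mulr_ge0// exprn_ge0.
near=> e => u.
have ez : `|z_odd aF bF e u + w_even aF bF e u| <= Z.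
  have H : forall u, `|z_odd aF bF e u + w_even aF bF e u| <= Z * `|e| ^+ 0 by near: e; exact: HZ.
  by have := H u; rewrite expr0 mulr1.
have e0 : e != 0 by near: e; exact: near_ne0.
have lr : `|lF e - ls| <= r / 2 by near: e; exact: near_lam_le r2_gt0.
have eZ : `|e| <= (Z + 1)^-1 by near: e; apply: dnbhs0_le; rewrite invr_gt0 ltr_wpDl.
have e1 : `|e| * `|z_odd aF bF e u + w_even aF bF e u| <= 1.
  apply: le_trans (ler_pM _ _ eZ ez) _ => //; rewrite mulrC ler_pdivrMr ?mul1r ?lerDl//.
  exact: ltr_wpDl.
have := HC u.1 (lF e) _ (etaF e) e e0 lr e1.
rewrite /NF /Nres phi_poly_split -!surjective_pairing /Jet /BmxF /jetF2 /jetF3 /jetF4.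
move: (z_odd aF bF e u + w_even aF bF e u) ez => z ez.
move: (ns_G _ _ _ _ _ _) (_ *m z) (_ *m z) => G y x H.
rewrite (_ : G - x - _ = G - (x - (e * etaF e) *: y + e *: mul2 (jet2 D u.1 (lF e)) z z +
   e ^+ 2 *: mul3 (jet3 D u.1 (lF e)) z z z + e ^+ 3 *: mul4 (jet4 D u.1 (lF e)) z z z z)); last first.
  move: (mul2 _ _ _) (mul3 _ _ _ _) (mul4 _ _ _ _ _) => q2 q3 q4.
  by apply/matrixP => i j; rewrite !mxE; ring.
apply: le_trans H _; rewrite mulrAC ler_wpM2r ?exprn_ge0// ler_wpM2l//.
by rewrite lerXn2r// nnegrE.
Unshelve. all: by end_near. Qed.

(** At phi + pi the odd part of z changes sign, the even part does not, and the coefficient tables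
    depend on theta only. *)
Lemma NF_jet_shift : Op 4 (fun e u => NF e (u.1, u.2 + pi)
  - Jet BmxF jetF2 jetF3 jetF4 etaX e u (w_even aF bF e u - z_odd aF bF e u)).
Proof.
have := Op_comp (fun u : X => (u.1, u.2 + pi)) NF_jet; apply: Op_eq.
near=> e => u; rewrite we_shift zo_shift -surjective_pairing /Jet /BmxF /jetF2 /jetF3 /jetF4 /=.
by rewrite [- _ + w_even _ _ _ _]addrC.
Unshelve. all: by end_near. Qed.

Lemma NF_cont e t : vcont (fun p => NF e (t, p)).
Proof. by move=> i; exact: (N_cont smF). Qed.

Lemma NF_periodic e t : periodic (fun p => NF e (t, p)).
Proof. by move=> p; exact: N_periodic. Qed.

Lemma NF_Op1 : Op 1 NF.
Proof.
have o0z := Op_add Op0_zo Op0_we; have [oB _ _] := Op_Bmx; have [oc2 _ _] := Op_jet2.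
have [oc3 _ _] := Op_jet3; have oc4 := Op_jet4.
suff J : Op 1 (fun e u => Jet BmxF jetF2 jetF3 jetF4 etaX e u (z_odd aF bF e u + w_even aF bF e u)).
  have := Op_add (Op_le (isT : (1 <= 4)%N) NF_jet) J; apply: Op_eq; near=> e => u.
  by rewrite subrK.
apply: Op_add; first apply: Op_add; first apply: Op_add.
- apply: Op_opp; apply: OpZ_le (Op_mulr (Op_id R X) (Op0_eta X)) (Op_mulmx oB o0z) _ => //.
- apply: OpZ_le (Op_id R X) (Op_mul2 oc2 o0z o0z) _ => //.
- by apply: Op_exp_le (Op_mul3 oc3 o0z o0z o0z) _.
- by apply: Op_exp_le (Op_mul4 oc4 o0z o0z o0z o0z) _.
Unshelve. all: by end_near. Qed.

Lemma Op_vN m q (f : R -> X -> 'cV[R]_n) : (forall e t, vcont (fun p => f e (t, p))) -> Op q f ->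
  Op q (fun e t => vpc m (fun p => f e (t, p))) /\ Op q (fun e t => vps m (fun p => f e (t, p))).
Proof. by move=> cf; apply: Op_vpc; near=> e. Unshelve. all: by end_near. Qed.

(** [residA] without eps eta d_theta, hence free of the derivative that is to be estimated. *)
Definition restA m e t : 'cV[R]_n := (ns_E D (lF e) - ns_E D ls) *m aF m t e
  - (m%:R * (omF e - om)) *: bF m t e + cm R m *: vpc m (fun p => NF e (t, p)).
Definition restB m e t : 'cV[R]_n := (ns_E D (lF e) - ns_E D ls) *m bF m t e
  + (m%:R * (omF e - om)) *: aF m t e + 2 *: vps m (fun p => NF e (t, p)).

Lemma Op_sA m q s q' : (0 < m)%N -> (q <= s + q')%N ->
  Op s (fun e (_ : unit) => lF e - ls) -> Op s (fun e (_ : unit) => omF e - om) ->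
  Op q' (fun e t => aF m t e) -> Op q' (fun e t => bF m t e) ->
  Op q (fun e t => vpc m (fun p => NF e (t, p))) -> Op q (fun e t => vps m (fun p => NF e (t, p))) ->
  Op q (restA m) /\ Op q (restB m).
Proof.
move=> m0 qs ol on oa ob ov os.
have ol' := Op_E (Op_comp (fun _ : R => tt) ol).
have on' := Op_comp (fun _ : R => tt) on.
have om' : Op s (fun e (_ : R) => m%:R * (omF e - om)) by exact: Op_cstZ.
split; apply: Op_add; [apply: Op_add|exact: Op_cstZ|apply: Op_add|exact: Op_cstZ].
- exact: Op_le qs (Op_mulmx ol' oa).
- by apply: Op_opp; exact: OpZ_le om' ob qs.
- exact: Op_le qs (Op_mulmx ol' ob).
- exact: OpZ_le om' oa qs.
Qed.

Lemma Op_sA0 q s q' : (q <= s + q')%N ->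
  Op s (fun e (_ : unit) => lF e - ls) -> Op q' (fun e t => aF 0%N t e) ->
  Op q (fun e t => vpc 0 (fun p => NF e (t, p))) -> Op q (restA 0).
Proof.
move=> qs ol oa ov.
have ol' := Op_E (Op_comp (fun _ : R => tt) ol).
apply: Op_add; last exact: Op_cstZ.
have := Op_le qs (Op_mulmx ol' oa); apply: Op_eq; near=> e => t.
by rewrite mul0r scale0r subr0.
Unshelve. all: by end_near. Qed.

(* The term - eps eta d on the right is absorbed by the left-hand side. *)
Lemma Op_solve q (d Q : R -> R -> 'cV[R]_n) : Op q Q ->
  (\forall e \near 0^', forall t, d e t = Q e t - (e * etaF e) *: d e t) -> Op q d.
Proof.
move=> oQ H; apply: (Op_dom (ler0n R 2) oQ).
have h : \forall e \near 0^', `|e * etaF e| <= 1 / 2.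
  have s1 := near_small ltr01.
  have s2 : \forall e \near (0 : R)^', `|e| <= 1 / 2 by apply: dnbhs0_le.
  move: s1 s2; apply: filterS2 => e [_ _ h _] h2.
  by rewrite normrM -[leRHS]mulr1 ler_pM.
move: H h; apply: filterS2 => e He h B QB t.
have : `|d e t| <= B + 1 / 2 * `|d e t|.
  rewrite {1}He (le_trans (ler_normB _ _))// lerD//.
  by rewrite normrZ ler_wpM2r.
lra.
Qed.

(** The derivative is read off the mode equation, in which it recurs on the right with the small
    factor eps eta. *)
Lemma Op_dA m q : (m < 4)%N -> Op q (fun e t => aF m t e) ->
  ((0 < m)%N -> Op q (fun e t => bF m t e)) -> Op q (fun e (_ : unit) => forceA m e) -> Op q (restA m) ->
  Op q (dA m).
Proof.
move=> m4 oa ob of_ os.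
have om' : Op q (fun e t => (m%:R * om) *: bF m t e).
  case: m {m4 oa of_ os} ob => [_|m ob]; last exact: Op_cstZ (ob isT).
  apply: (@Op_eq _ _ _ _ (fun _ _ => 0)); first by near=> e => t; rewrite mul0r scale0r.
  by exists 0 => //; near=> e => t; rewrite normr0 mul0r.
apply: (@Op_solve q _ (fun e t => ns_E D ls *m aF m t e - (m%:R * om) *: bF m t e + (forceA m e + restA m e t))).
  apply: Op_add; first apply: Op_sub => //.
    exact: (Op_mulmx (Op_cst R (ns_E D ls)) oa).
  by apply: Op_add => //; exact: (Op_comp (fun _ : R => tt) of_).
apply: filterS (mode_id_a m4) => e He t; rewrite {1}He /residA -/(restA m e t).
by rewrite !addrA.
Unshelve. all: by end_near. Qed.

Lemma Op_dB m q : (0 < m < 4)%N -> Op q (fun e t => aF m t e) ->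
  Op q (fun e t => bF m t e) -> Op q (fun e (_ : unit) => forceB m e) -> Op q (restB m) ->
  Op q (dB m).
Proof.
move=> m4 oa ob of_ os.
apply: (@Op_solve q _ (fun e t => ns_E D ls *m bF m t e + (m%:R * om) *: aF m t e + (forceB m e + restB m e t))).
  apply: Op_add; first apply: Op_add => //.
  - exact: (Op_mulmx (Op_cst R (ns_E D ls)) ob).
  - exact: Op_cstZ.
  - by apply: Op_add => //; exact: (Op_comp (fun _ : R => tt) of_).
apply: filterS (mode_id_b m4) => e He t; rewrite {1}He /residB -/(restB m e t).
by rewrite !addrA.
Qed.

Lemma Op_fA q m : Op q (fun e (_ : unit) => growth e) -> Op q (fun e (_ : unit) => detuning e) ->
  (m == 0%N -> Op q (fun e (_ : unit) => etaF e)) ->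
  Op q (fun e (_ : unit) => forceA m e) /\ Op q (fun e (_ : unit) => forceB m e).
Proof.
move=> o1 o2 oe.
have z0 : Op q (fun (e : R) (_ : unit) => 0 : 'cV[R]_n).
  by exists 0 => //; near=> e => t; rewrite normr0 mul0r.
have vv (x y : R -> R) : Op q (fun e (_ : unit) => x e) -> Op q (fun e (_ : unit) => y e) ->
    Op q (fun e (_ : unit) => vec3 (cv2 (x e) (y e)) 0 0 : 'cV[R]_n).
  move=> ox oy; have s1 := OpZ_le ox (Op_cst unit (vec3 (ehat1 R) 0 0 : 'cV[R]_n)) (leq_addr 0 q).
  have s2 := OpZ_le oy (Op_cst unit (vec3 (ehat2 R) 0 0 : 'cV[R]_n)) (leq_addr 0 q).
  move: (Op_add s1 s2); apply: Op_eq; near=> e => _.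
  apply: vec3_eq; rewrite !zE ?scaler0 ?mulr0 ?addr0//.
  by apply/matrixP => i j; rewrite !mxE; case: ifP => _; ring.
split; rewrite /forceA /forceB.
  case m0 : (m == 0%N).
    by apply: Op_opp; exact: (OpZ_le (oe m0) (Op_cst unit (e_n R k)) (leq_addr 0 q)).
  by case: (m == 1%N) => //; exact: vv.
by case: (m == 1%N) => //; apply: vv => //; exact: Op_opp.
Unshelve. all: by end_near. Qed.

Lemma Op0_m : Op 0 (fun e (_ : unit) => growth e) /\ Op 0 (fun e (_ : unit) => detuning e).
Proof.
have aI := Op0_E unit.
have ent (i j : 'I_n) : Op 0 (fun e (_ : unit) => ns_E D (lF e) i j).
  case: aI => C C0 HC; exists C => //; apply: filterS HC => e HC u.
  exact: le_trans (mxnorm_ge _ _ _) (HC u).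
have E00 e : ns_E D (lF e) (hidx k 0) (hidx k 0) = ns_aR D (lF e).
  by rewrite /ns_E /hidx block_mxEul block_mxEul mxE eqxx.
have E10 e : ns_E D (lF e) (hidx k 1) (hidx k 0) = ns_aI D (lF e).
  by rewrite /ns_E /hidx block_mxEul block_mxEul mxE.
split.
  by have := ent (hidx k 0) (hidx k 0); apply: Op_eq; near=> e => _; rewrite E00.
have h : Op 0 (fun e (_ : unit) => ns_aI D (lF e)).
  by have := ent (hidx k 1) (hidx k 0); apply: Op_eq; near=> e => _; rewrite E10.
have := Op_sub h (Op_add (Op0_nu unit) (Op_cst unit om)); apply: Op_eq; near=> e => _.
by rewrite subrK.
Unshelve. all: by end_near. Qed.

Lemma Op0_dA m : (m < 4)%N -> Op 0 (dA m).
Proof.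
move=> m4; have [h1 h2] := Op0_m; have [hfa hfb] := @Op_fA 0 m h1 h2 (fun _ => Op0_eta unit).
have [v1 v2] := Op_vN m (fun e t => @NF_cont e t) (Op_le (leq0n 1) NF_Op1).
apply: Op_dA => // [|m0|]; [exact: Op0_A|by apply: Op0_B; rewrite m0|].
case: m m4 hfa hfb v1 v2 => [|m] m4 hfa hfb v1 v2.
  exact: (Op_sA0 (isT : (0 <= 0 + 0)%N) (Op0_lam unit) (Op0_A m4) v1).
by have [] := Op_sA (isT : (0 < m.+1)%N) (isT : (0 <= 0 + 0)%N) (Op0_lam unit) (Op0_nu unit) (Op0_A m4) (@Op0_B m.+1 m4) v1 v2.
Qed.

Lemma Op0_dB m : (0 < m < 4)%N -> Op 0 (dB m).
Proof.
move=> m4; have /andP[m0 m4'] := m4.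
have [h1 h2] := Op0_m; have [hfa hfb] := @Op_fA 0 m h1 h2 (fun _ => Op0_eta unit).
have [v1 v2] := Op_vN m (fun e t => @NF_cont e t) (Op_le (leq0n 1) NF_Op1).
apply: Op_dB => //; [exact: Op0_A|exact: Op0_B|].
by have [] := Op_sA m0 (isT : (0 <= 0 + 0)%N) (Op0_lam unit) (Op0_nu unit) (Op0_A m4') (Op0_B m4) v1 v2.
Qed.

(** * Bootstrap to order eps *)

Notation Phi e := (phi_poly 3 (fun m s => aF m s e) (fun m s => bF m s e)).

(** Terms linear in the branch carry lambda - lambda* or omega - omega*, hence the factor d; the
    nonlinearity and the derivative term are O(eps) by the crude bounds alone. *)
Lemma rAB_small m : (m < 4)%N -> exists2 K, 0 <= K & forall d, 0 < d -> \forall e \near 0^',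
  forall S, (forall t p, `|Phi e t p| <= S) -> forall t, `|residA m e t| <= K * (d * S + `|e|) /\
    ((0 < m)%N -> `|residB m e t| <= K * (d * S + `|e|)).
Proof.
move=> m4; have [KE KE0 HE] := E_BL.
have [[C1 C10 H1] [C2 C20 H2]] := Op_vN m (fun e t => @NF_cont e t) NF_Op1.
have [C3 C30 H3] := Op0_dA m4.
have [C4 C40 H4] : exists2 C, 0 <= C & \forall e \near 0^', (0 < m)%N -> forall t, `|dB m e t| <= C.
  case: m {H1 H2 H3} m4 => [|m] m4; first by exists 0 => //; near=> e.
  have [C C0 HC] := @Op0_dB m.+1 m4; exists C => //; apply: filterS HC => e HC _ t.
  by rewrite -[C]mulr1 -(expr0 `|e|).
(* One summand per term of the residual: change of E, change of frequency (6 from m <= 3 and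
   coefficients at most 2 S), nonlinearity with [cm] at most 2, derivative. *)
exists (n%:R * KE * 2 + 6 + 2 * (C1 + C2) + (C3 + C4)) => [|d d0].
  by rewrite !addr_ge0// !mulr_ge0// addr_ge0.
near=> e => S HS t.
have [lr nu _ _] : [/\ `|lF e - ls| <= d, `|omF e - om| <= d,
  `|etaF e| <= d & forall t, (forall m, (m < 4)%N -> `|aF m t e| <= 2 * d) /\
     (forall m, (0 < m < 4)%N -> `|bF m t e| <= 2 * d)] by near: e; exact: near_small.
have et : `|etaF e| <= 1.
  have [] : [/\ `|lF e - ls| <= 1, `|omF e - om| <= 1,
  `|etaF e| <= 1 & forall t, (forall m, (m < 4)%N -> `|aF m t e| <= 2 * 1) /\
     (forall m, (0 < m < 4)%N -> `|bF m t e| <= 2 * 1)] by near: e; exact: near_small.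
  by [].
have lr2 : `|lF e - ls| <= r / 2 by near: e; exact: near_lam_le r2_gt0.
have [cA cB'] := phi_poly_coef (HS t).
have S0 : 0 <= S := le_trans (normr_ge0 _) (HS 0 0).
have EE : `|ns_E D (lF e) - ns_E D ls| <= KE * d.
  by apply: le_trans (proj2 (HE _ lr2)) _; rewrite ler_wpM2l.
have eE (v : 'cV[R]_n) : `|v| <= 2 * S -> `|(ns_E D (lF e) - ns_E D ls) *m v| <= n%:R * KE * 2 * (d * S).
  move=> vS; apply: le_trans (mxnormM _ _) _.
  rewrite (_ : n%:R * KE * 2 * (d * S) = n%:R * (KE * d) * (2 * S)); last by ring.
  by rewrite ler_pM// ?mulr_ge0// ler_wpM2l.
have m3 : m%:R <= 3 :> R by rewrite ler_nat -ltnS.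
have eN (v : 'cV[R]_n) : `|v| <= 2 * S -> `|(m%:R * (omF e - om)) *: v| <= 6 * (d * S).
  move=> vS; rewrite normrZ normrM normr_nat (_ : 6 * (d * S) = 3 * d * (2 * S)); last by ring.
  by rewrite ler_pM// ?mulr_ge0// ler_pM.
have cm2 : `|cm R m| <= 2 by rewrite /cm; case: (m == 0%N); rewrite ger0_norm// ler1n.
have v1 : `|vpc m (fun p => NF e (t, p))| <= C1 * `|e|.
  rewrite -[X in _ * X]expr1; have H : forall t, `|vpc m (fun p => NF e (t, p))| <= C1 * `|e| ^+ 1 by near: e; exact: H1.
  exact: H.
have v2 : `|vps m (fun p => NF e (t, p))| <= C2 * `|e|.
  rewrite -[X in _ * X]expr1; have H : forall t, `|vps m (fun p => NF e (t, p))| <= C2 * `|e| ^+ 1 by near: e; exact: H2.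
  exact: H.
have d1 : `|dA m e t| <= C3.
  rewrite -[C3]mulr1 -(expr0 `|e|); have H : forall t, `|dA m e t| <= C3 * `|e| ^+ 0 by near: e; exact: H3.
  exact: H.
have d2 : (0 < m)%N -> `|dB m e t| <= C4.
  move=> m0; have H : (0 < m)%N -> forall t, `|dB m e t| <= C4 by near: e; exact: H4.
  exact: H.
have ed (C : R) (v : 'cV[R]_n) : `|v| <= C -> `|(e * etaF e) *: v| <= C * `|e|.
  move=> vC; rewrite normrZ normrM mulrC ler_pM// ?mulr_ge0//.
  by rewrite -[leRHS]mulr1 ler_wpM2l.
have e0 := normr_ge0 e; have dS : 0 <= d * S by rewrite mulr_ge0// ltW.
have Q0 : 0 <= n%:R * KE * 2 by rewrite !mulr_ge0.
split.
  have b1 : `|(ns_E D (lF e) - ns_E D ls) *m aF m t e| <= n%:R * KE * 2 * (d * S) by apply: eE; exact: cA.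
  have b2 : `|(m%:R * (omF e - om)) *: bF m t e| <= 6 * (d * S).
    have [m0|m0] := posnP m; last by apply: eN; apply: cB'; rewrite m0.
    by rewrite m0 mul0r scale0r normr0 mulr_ge0.
  have b3 : `|cm R m *: vpc m (fun p => NF e (t, p))| <= 2 * (C1 * `|e|) by rewrite normrZ ler_pM.
  have b4 := ed _ _ d1.
  apply: le_trans (ler_normB _ _) _; apply: le_trans (lerD (ler_normD _ _) b4) _.
  apply: le_trans (lerD (lerD (ler_normB _ _) b3) (lexx _)) _.
  by apply: (arith_small Q0 C10 C30 _ _ dS e0 b1 b2 (lexx _)) => //; rewrite lerDl.
move=> m0; have b1 : `|(ns_E D (lF e) - ns_E D ls) *m bF m t e| <= n%:R * KE * 2 * (d * S).
  by apply: eE; apply: cB'; rewrite m0.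
have b2 : `|(m%:R * (omF e - om)) *: aF m t e| <= 6 * (d * S) by apply: eN; exact: cA.
have b3 : `|2%:R *: vps m (fun p => NF e (t, p))| <= 2 * (C2 * `|e|) by rewrite normrZ normr_nat ler_wpM2l.
have b4 := ed _ _ (d2 m0).
apply: le_trans (ler_normB _ _) _; apply: le_trans (lerD (ler_normD _ _) b4) _.
apply: le_trans (lerD (lerD (ler_normD _ _) b3) (lexx _)) _.
by apply: (arith_small Q0 C20 C40 _ _ dS e0 b1 b2 (lexx _)) => //; rewrite lerDr.
Unshelve. all: by end_near. Qed.

(* The linear theory turns a bound S on w into the bound K (d S + eps), with d
   arbitrarily small; the bootstrap of [Phi_Op1] takes the supremum. *)
Lemma AB_small m : (m < 4)%N -> exists2 K, 0 <= K & forall d, 0 < d -> \forall e \near 0^',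
  forall S, (forall t p, `|Phi e t p| <= S) -> forall t, `|aF m t e| <= K * (d * S + `|e|) /\
    ((0 < m)%N -> `|bF m t e| <= K * (d * S + `|e|)).
Proof.
move=> m4; have [K K0 HK] := rAB_small m4.
have [no n2o] := nonres_om.
case: m m4 HK => [|[|m]] m4 HK.
- have [C C0 HC] := lin_mean aR0 aI0 hyp no.
  exists (C * K) => [|d d0]; first exact: mulr_ge0.
  move: (HK d d0) branch_msys0; apply: filterS2 => e Hr [M av] S HS t; split => //.
  have [_ /(_ t)] := HC _ _ _ (K * (d * S + `|e|)) M av (fun t => proj1 (Hr S HS t)).
  by rewrite mulrA.
- have [C C0 HC] := lin_res aR0 aI0 hyp no n2o.
  exists (C * K) => [|d d0]; first exact: mulr_ge0.
  move: (HK d d0) (@branch_msys 1 isT) HF; apply: filterS3 => e Hr M fs S HS t.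
  have [g1 g2 _] := gamma_means fs.
  rewrite mul1r in M.
  have [_ _ /(_ t)] := HC _ _ _ _ _ _ (K * (d * S + `|e|)) M g1 g2 (fun t => proj1 (Hr S HS t))
    (fun t => proj2 (Hr S HS t) isT).
  by rewrite mulrA => -[? ?]; split.
have [n1 n2 n3] := @nonres_m m.+2 m4.
have [C C0 HC] := lin_nonres aR0 aI0 hyp n1 n2 n3.
exists (C * K) => [|d d0]; first exact: mulr_ge0.
move: (HK d d0) (@branch_msys m.+2 m4); apply: filterS2 => e Hr M S HS t.
have := HC _ _ _ _ (K * (d * S + `|e|)) M _ _ t.
rewrite mulrA => -[t'|t'|? ?]; last by split.
  by rewrite add0r; have [] := Hr S HS t'.
by rewrite add0r; have [_] := Hr S HS t'; exact.
Qed.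

Lemma Phi_Op1 : Op 1 (fun e (u : X) => Phi e u.1 u.2).
Proof.
have [K0 K00 H0] := @AB_small 0 isT; have [K1 K10 H1] := @AB_small 1 isT.
have [K2 K20 H2] := @AB_small 2 isT; have [K3 K30 H3] := @AB_small 3 isT.
pose K := K0 + K1 + K2 + K3.
have Kp : 0 <= K by rewrite !addr_ge0.
(* Chosen so that 7 K d <= 1/2, which lets [absorb_sup] apply. *)
pose d := 2^-1 / (7 * K + 1).
have d0 : 0 < d by rewrite divr_gt0// ltr_wpDl// mulr_ge0.
exists (2 * (7 * K)); first by rewrite !mulr_ge0.
have FF : Filter (nbhs (0 : R)^') by exact: _.
have N01 := @filterI R _ FF _ _ (H0 d d0) (H1 d d0); have N23 := @filterI R _ FF _ _ (H2 d d0) (H3 d d0).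
move: (near_small ltr01) N01 N23; apply: filterS3 => e s1 [A0 A1] [A2 A3] u.
rewrite expr1 -mulrA.
(* The a priori bound with d = 1 makes the supremum finite. *)
apply: (@absorb_sup R X (fun u => `|Phi e u.1 u.2|) (7 * K * `|e|) (7 * (2 * 1))) => [y|S HS y].
  by case: s1 => _ _ _ /(_ y.1)[h1 h2]; exact: phi_poly_norm.
have HS' t p : `|Phi e t p| <= S by exact: (HS (t, p)).
have S0 : 0 <= S := le_trans (normr_ge0 _) (HS' 0 0).
have dS : 0 <= d * S + `|e| by rewrite addr_ge0// mulr_ge0// ltW.
have all m : (m < 4)%N -> forall t, `|aF m t e| <= K * (d * S + `|e|) /\
    ((0 < m)%N -> `|bF m t e| <= K * (d * S + `|e|)).
  have wk x Km : Km <= K -> x <= Km * (d * S + `|e|) -> x <= K * (d * S + `|e|).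
    by move=> KmK xK; apply: le_trans xK _; rewrite ler_wpM2r.
  have kk : [/\ K0 <= K, K1 <= K, K2 <= K & K3 <= K] by rewrite /K; split; lra.
  case: kk => kk0 kk1 kk2 kk3.
  case: m => [|[|[|[|//]]]] _ t.
  - by have [? _] := A0 S HS' t; split=> //; exact: wk kk0 _.
  - by have [? /(_ isT) ?] := A1 S HS' t; split=> [|_]; exact: wk kk1 _.
  - by have [? /(_ isT) ?] := A2 S HS' t; split=> [|_]; exact: wk kk2 _.
  - by have [? /(_ isT) ?] := A3 S HS' t; split=> [|_]; exact: wk kk3 _.
have P : `|Phi e y.1 y.2| <= 7 * (K * (d * S + `|e|)).
  apply: phi_poly_norm => m m4; first by have [] := all m m4 y.1.
  have /andP[m0 m4'] := m4; have [_] := all m m4' y.1; exact.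
apply: le_trans P _; rewrite !mulrA mulrDr lerD// mulrA.
rewrite mulrC ler_wpM2l// /d mulrCA ler_piMr// ler_pdivrMr ?mul1r ?lerDl//.
by rewrite ltr_wpDl// mulr_ge0.
Qed.

Lemma Op1_A m : (m < 4)%N -> Op 1 (fun e t => aF m t e).
Proof.
move=> m4; have [C C0 HC] := Phi_Op1; exists (2 * C); first exact: mulr_ge0.
apply: filterS HC => e HC t; rewrite -mulrA.
have [+ _] := phi_poly_coef (fun p => HC (t, p)); exact.
Qed.

Lemma Op1_B m : (0 < m < 4)%N -> Op 1 (fun e t => bF m t e).
Proof.
move=> m4; have [C C0 HC] := Phi_Op1; exists (2 * C); first exact: mulr_ge0.
apply: filterS HC => e HC t; rewrite -mulrA.
have [_ +] := phi_poly_coef (fun p => HC (t, p)); exact.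
Qed.

Lemma Op_rAB m q q1 q2 : (q <= 1 + q1 + q2)%N -> Op q1 (fun e (_ : unit) => etaF e) ->
  (Op q (restA m) -> Op q2 (dA m) -> Op q (residA m)) /\ (Op q (restB m) -> Op q2 (dB m) -> Op q (residB m)).
Proof.
move=> le oe; have oe' := Op_mulr (Op_id R R) (Op_comp (fun _ : R => tt) oe).
split=> os od; apply: Op_sub => //; exact: OpZ_le oe' od le.
Qed.

Lemma Op_block0 q : Op q (residA 0) -> Op q (fun e t => aF 0%N t e) /\ Op q (fun e (_ : unit) => etaF e).
Proof. by move=> h; have := Op_mean aR0 aI0 hyp (proj1 nonres_om) branch_msys0 h. Qed.

Lemma Op_block1 q : Op q (residA 1) -> Op q (residB 1) ->
  [/\ Op q (fun e t => aF 1%N t e), Op q (fun e t => bF 1%N t e),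
    Op q (fun e (_ : unit) => growth e) & Op q (fun e (_ : unit) => detuning e)].
Proof.
move=> ha hb; have [n1 n2] := nonres_om.
apply: (@Op_res R k D aR0 aI0 hyp q (fun e t => aF 1%N t e) (fun e t => bF 1%N t e) _ _ growth detuning n1 n2 _ ha hb).
move: (@branch_msys 1 isT) HF; apply: filterS2 => e M fs.
have [g1 g2 _] := gamma_means fs.
by rewrite mul1r in M; split.
Qed.

Lemma Op_block23 m q : (1 < m < 4)%N -> Op q (residA m) -> Op q (residB m) ->
  Op q (fun e t => aF m t e) /\ Op q (fun e t => bF m t e).
Proof.
move=> m4 ha hb; have [n1 n2 n3] := nonres_m m4.
have m1' : (m == 1%N) = false by apply/negbTE; rewrite neq_ltn; case/andP: m4 => ->; rewrite orbT.
have m0' : (m == 0%N) = false by case: m m4 {ha hb n1 n2 n3 m1'}.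
have m4' : (0 < m < 4)%N by case/andP: m4 => /ltnW -> ->.
apply: (Op_nonres aR0 aI0 hyp n1 n2 n3 _ ha hb).
apply: filterS (branch_msys m4') => e.
rewrite /forceA /forceB m1' m0'; congr (msys _ _ _ _ _ _); apply/funext => t; exact: add0r.
Qed.

(** alpha_R at lambda controls lambda - lambda* by transversality; then omega - omega* is alpha_I -
    omega* minus the detuning. *)
Lemma Op_nu q : Op q (fun e (_ : unit) => growth e) -> Op q (fun e (_ : unit) => detuning e) ->
  Op q (fun e (_ : unit) => lF e - ls) /\ Op q (fun e (_ : unit) => omF e - om).
Proof.
move=> h1 h2; have hl : Op q (fun e (_ : unit) => lF e - ls) by exact: lam_Op.
split=> //; have := Op_E hl => -[C C0 HC].
have hI : Op q (fun e (_ : unit) => ns_aI D (lF e) - om).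
  exists C => //; apply: filterS HC => e HC u; apply: le_trans (HC u).
  have := mxnorm_ge (ns_E D (lF e) - ns_E D ls) (hidx k 1) (hidx k 0).
  have EE l : ns_E D l (hidx k 1) (hidx k 0) = ns_aI D l.
    by rewrite /ns_E /hidx block_mxEul block_mxEul mxE.
  by rewrite mxE [(- ns_E _ _) _ _]mxE !EE aI0.
have := Op_sub hI h2; apply: Op_eq; near=> e => _; rewrite /detuning; ring.
Unshelve. all: by end_near. Qed.

(** * Order eps for all unknowns, then order eps^2 for odd modes, lambda and omega *)

Lemma vN1 m : Op 1 (fun e t => vpc m (fun p => NF e (t, p))) /\ Op 1 (fun e t => vps m (fun p => NF e (t, p))).
Proof. exact: (Op_vN m (fun e t => @NF_cont e t) NF_Op1). Qed.

Lemma sA1 m : (0 < m < 4)%N -> Op 1 (restA m) /\ Op 1 (restB m).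
Proof.
move=> m4; have /andP[m0 m4'] := m4; have [v1 v2] := vN1 m.
exact: (Op_sA m0 (isT : (1 <= 0 + 1)%N) (Op0_lam unit) (Op0_nu unit) (Op1_A m4') (Op1_B m4) v1 v2).
Qed.

Lemma sA01 : Op 1 (restA 0).
Proof.
exact: (Op_sA0 (isT : (1 <= 0 + 1)%N) (Op0_lam unit) (Op1_A (isT : (0 < 4)%N)) (proj1 (vN1 0))).
Qed.

Lemma Op1_eta : Op 1 (fun e (_ : unit) => etaF e).
Proof.
have [h _] := @Op_rAB 0 1 0 0 isT (Op0_eta unit).
by have [] := Op_block0 (h sA01 (Op0_dA (isT : (0 < 4)%N))).
Qed.

Lemma Op1_m : Op 1 (fun e (_ : unit) => growth e) /\ Op 1 (fun e (_ : unit) => detuning e).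
Proof.
have [h1 h2] := @Op_rAB 1 1 0 0 isT (Op0_eta unit); have [s1 s2] := @sA1 1 isT.
by have [] := Op_block1 (h1 s1 (Op0_dA (isT : (1 < 4)%N))) (h2 s2 (@Op0_dB 1 isT)).
Qed.

Lemma Op1_dA m : (m < 4)%N -> Op 1 (dA m).
Proof.
move=> m4; have [h1 h2] := Op1_m; have [hfa hfb] := @Op_fA 1 m h1 h2 (fun _ => Op1_eta).
apply: Op_dA => // [|m0|]; [exact: Op1_A|by apply: Op1_B; rewrite m0|].
case: m m4 {hfa hfb} => [|m] m4; first exact: sA01.
by have [] := @sA1 m.+1 m4.
Qed.

Lemma Op1_dB m : (0 < m < 4)%N -> Op 1 (dB m).
Proof.
move=> m4; have /andP[m0 m4'] := m4.
have [h1 h2] := Op1_m; have [hfa hfb] := @Op_fA 1 m h1 h2 (fun _ => Op1_eta).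
by apply: Op_dB => //; [exact: Op1_A|exact: Op1_B|have [] := sA1 m4].
Qed.

Lemma Op1_we : Op 1 (w_even aF bF).
Proof. by apply: Op_we; [exact: Op1_A|exact: Op1_A|exact: Op1_B]. Qed.

(* Parity is taken with respect to the shift of phi by pi. *)
Definition Fodd e (u : X) : 'cV[R]_n := 2^-1 *: (NF e u - NF e (u.1, u.2 + pi)).
Definition Feven e (u : X) : 'cV[R]_n := 2^-1 *: (NF e u + NF e (u.1, u.2 + pi)).

Lemma Fodd_cont e t : vcont (fun p => Fodd e (t, p)).
Proof.
apply: vcontZ; apply: vcontB; first exact: NF_cont.
exact: (@vcont_shift R k (fun p => NF e (t, p)) pi (@NF_cont e t)).
Qed.

Lemma Feven_cont e t : vcont (fun p => Feven e (t, p)).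
Proof.
apply: vcontZ; apply: vcontD; first exact: NF_cont.
exact: (@vcont_shift R k (fun p => NF e (t, p)) pi (@NF_cont e t)).
Qed.

Lemma vN_odd m e t : odd m -> (vpc m (fun p => NF e (t, p)) = vpc m (fun p => Fodd e (t, p))) *
  (vps m (fun p => NF e (t, p)) = vps m (fun p => Fodd e (t, p))).
Proof.
move=> om_; rewrite !(vpc_par m (@NF_cont e t) (@NF_periodic e t)).
by rewrite -signr_odd om_ expr1; split; [congr vpc|congr vps]; apply/funext => p; rewrite scaleN1r.
Qed.

Lemma vN_even m e t : ~~ odd m -> (vpc m (fun p => NF e (t, p)) = vpc m (fun p => Feven e (t, p))) *
  (vps m (fun p => NF e (t, p)) = vps m (fun p => Feven e (t, p))).
Proof.
move=> om_; rewrite !(vpc_par m (@NF_cont e t) (@NF_periodic e t)).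
by rewrite -signr_odd (negbTE om_) expr0; split; [congr vpc|congr vps]; apply/funext => p; rewrite scale1r.
Qed.

Lemma Fodd_jet : Op 4 (fun e u => Fodd e u - Jodd BmxF jetF2 jetF3 etaX (z_odd aF bF) (w_even aF bF) e u).
Proof.
have [oc3 _ _] := Op_jet3.
exact: (odd_part oc3 Op_jet4 Op0_zo NF_jet NF_jet_shift Op1_we).
Qed.

Lemma Fodd_Op2 : Op 2 Fodd.
Proof.
have [oB _ _] := Op_Bmx; have [oc2 _ _] := Op_jet2; have [oc3 _ _] := Op_jet3.
have J := Jodd_Op2 oB oc2 oc3 Op0_zo (Op_comp (fun _ : X => tt) Op1_eta) Op1_we.
have := Op_add (Op_le (isT : (2 <= 4)%N) Fodd_jet) J; apply: Op_eq; near=> e => u.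
by rewrite subrK.
Unshelve. all: by end_near. Qed.

Lemma vN2 m : odd m -> Op 2 (fun e t => vpc m (fun p => NF e (t, p))) /\ Op 2 (fun e t => vps m (fun p => NF e (t, p))).
Proof.
move=> om_; have [h1 h2] := Op_vN m (fun e t => @Fodd_cont e t) Fodd_Op2.
by split; [move: h1|move: h2]; apply: Op_eq; near=> e => t; rewrite !(vN_odd _ _ om_).
Unshelve. all: by end_near. Qed.

(** The odd part of the forcing is O(eps^2), and the linear terms are products of two quantities
    already known to be O(eps). *)
Lemma sA2 m : odd m -> (m < 4)%N -> Op 2 (restA m) /\ Op 2 (restB m).
Proof.
move=> om_ m4; have m0 : (0 < m)%N by case: m om_ {m4}.
have m04 : (0 < m < 4)%N by rewrite m0.
have [v1 v2] := vN2 om_; have [h1 h2] := Op1_m; have [hl hn] := Op_nu h1 h2.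
exact: (Op_sA m0 (isT : (2 <= 1 + 1)%N) hl hn (Op1_A m4) (Op1_B m04) v1 v2).
Qed.

(** In the derivative term eps and eta each supply one power, so boundedness of the derivative is
    enough here. *)
Lemma Op2_block1 : [/\ Op 2 (fun e t => aF 1%N t e), Op 2 (fun e t => bF 1%N t e),
    Op 2 (fun e (_ : unit) => growth e) & Op 2 (fun e (_ : unit) => detuning e)].
Proof.
have [h1 h2] := @Op_rAB 1 2 1 0 isT Op1_eta; have [s1 s2] := @sA2 1 isT isT.
exact: (Op_block1 (h1 s1 (Op0_dA (isT : (1 < 4)%N))) (h2 s2 (@Op0_dB 1 isT))).
Qed.

Lemma Op2_block3 : Op 2 (fun e t => aF 3%N t e) /\ Op 2 (fun e t => bF 3%N t e).
Proof.
have [h1 h2] := @Op_rAB 3 2 1 0 isT Op1_eta; have [s1 s2] := @sA2 3 isT isT.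
exact: (@Op_block23 3 2 isT (h1 s1 (Op0_dA (isT : (3 < 4)%N))) (h2 s2 (@Op0_dB 3 isT))).
Qed.

Lemma Op2_lam : Op 2 (fun e (_ : unit) => lF e - ls) /\ Op 2 (fun e (_ : unit) => omF e - om).
Proof. by have [_ _ h1 h2] := Op2_block1; exact: Op_nu. Qed.

Lemma Op2_wo : Op 2 (w_odd aF bF).
Proof. by have [? ? _ _] := Op2_block1; have [? ?] := Op2_block3; exact: Op_wo. Qed.

Lemma Op2_d m : odd m -> (m < 4)%N -> Op 2 (dA m) /\ Op 2 (dB m).
Proof.
move=> om_ m4; have [s1 s2] := sA2 om_ m4; have [a1 b1 h1 h2] := Op2_block1; have [a3 b3] := Op2_block3.
case: m om_ m4 s1 s2 => [|[|[|[|//]]]] // _ m4 s1 s2.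
  have [hfa hfb] := @Op_fA 2 1 h1 h2 (fun h => ltac:(discriminate h)).
  by split; [apply: Op_dA|apply: Op_dB].
have [hfa hfb] := @Op_fA 2 3 h1 h2 (fun h => ltac:(discriminate h)).
by split; [apply: Op_dA|apply: Op_dB].
Qed.

(** * Mode equations of the normal form coefficients *)

Variable nf : nf_data R k.
Hypothesis nfls : normal_form_at D nf ls.
Notation ka := (nf_kappa nf ls).
Notation bR := (nf_betaR nf ls).
Notation bI := (nf_betaI nf ls).

(** Projection to the hat block, the only block in which the normal form prescribes the cubic
    terms. *)
Definition Pi (v : 'cV[R]_n) : 'cV[R]_n := vec3 (zhat v) 0 0.

Lemma PiD u v : Pi (u + v) = Pi u + Pi v.
Proof. by apply: vec3_eq; rewrite /Pi !zE ?addr0. Qed.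
Lemma PiZ c v : Pi (c *: v) = c *: Pi v.
Proof. by apply: vec3_eq; rewrite /Pi !zE ?scaler0 ?mulr0. Qed.
Lemma PiN v : Pi (- v) = - Pi v.
Proof. by rewrite -scaleN1r PiZ scaleN1r. Qed.
Lemma Pi_vec3 x : Pi (vec3 x 0 0) = vec3 x 0 0.
Proof. by rewrite /Pi zhat_vec3. Qed.
Lemma PiE v : Pi (ns_E D ls *m v) = ns_E D ls *m Pi v.
Proof. by rewrite !ns_E_vec3 /Pi !zE mulmx0. Qed.
Lemma Pi_h m t l : Pi (hcoef nf m t l) = hcoef nf m t l.
Proof. exact: Pi_vec3. Qed.
Lemma Pi_k m t l : Pi (kcoef nf m t l) = kcoef nf m t l.
Proof. exact: Pi_vec3. Qed.

(* The cubic-order forcing, whose odd modes drive the normal form of order eps^2. *)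
Definition NJ t p : 'cV[R]_n := Jlim BmxS jetS2 jetS3 ka (fun _ u => astar k u.2) (fun _ u => zq D nf u.1 u.2) 0 (t, p).
Definition N2 t p : 'cV[R]_n := mul2 (jet2 D t ls) (astar k p) (astar k p).

(** The identity of order eps, solved for the quadratic forcing. *)
Lemma NF_N2 t p : N2 t p = ka *: e_n R k + tzq D nf t p + om *: dzq D nf t p - ns_E D ls *m zq D nf t p.
Proof.
have [Gp [Kp [expn cond]]] := nfa_conditions nfls.
have [+ _] := NF_main smF r_gt0 ct aR0 aI0 nfls t p expn cond.
rewrite /NF1 -/(N2 t p); move: (N2 t p) (_ *m _) (tzq _ _ _ _) (dzq _ _ _ _) => a b c d.
move: (e_n R k) => v /matrixP H; apply/matrixP => i j; have := H i j; rewrite !mxE => H'.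
by apply/eqP; rewrite -subr_eq0 -[X in _ == X]H'; apply/eqP; ring.
Qed.

(** The identity of order eps^2 in the hat block; the condition on the cubic terms is what brings in
    the Lyapunov coefficients. *)
Lemma NF_NJ t p : Pi (NJ t p) = Pi (tzc D nf t p) + om *: Pi (dzc D nf t p) - ns_E D ls *m Pi (zc D nf t p)
  + vec3 (rotmx bR bI *m cv2 (cos p) (sin p)) 0 0.
Proof.
have [Gp [Kp [expn cond]]] := nfa_conditions nfls.
have [_ +] := NF_main smF r_gt0 ct aR0 aI0 nfls t p expn cond.
have <- : Pi (Gp 3%N t (astar k p)) = vec3 (rotmx bR bI *m cv2 (cos p) (sin p)) 0 0.
  by rewrite /Pi (Gp3_astar t p cond).
rewrite -PiE -PiZ -!PiN -!PiD => H; congr Pi.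
apply/eqP; rewrite -subr_eq0; apply/eqP; rewrite -[RHS]H /NF2 /NJ /Jlim /= /BmxS /jetS2 /jetS3 /=.
move: (Bmx _ _ _ *m _) (mul2 _ _ _) (mul2 _ _ _) (mul3 _ _ _ _) (ns_E _ _ *m _) (tzc _ _ _ _) (dzc _ _ _ _) (Gp _ _ _) => a b c d e f g h.
by apply/matrixP => i j; rewrite !mxE; ring.
Qed.

Definition dac m t := d1v D (acoef nf m) t.
Definition dbc m t := d1v D (bcoef nf m) t.
Definition dhc m t := d1v D (hcoef nf m) t.
Definition dkc m t := d1v D (kcoef nf m) t.
Notation ac m t := (acoef nf m t ls).
Notation bc m t := (bcoef nf m t ls).
Notation hc m t := (hcoef nf m t ls).
Notation kc m t := (kcoef nf m t ls).

(** Modes of the quadratic forcing as given by the normal form identity. Equated with its averages,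
    they become differential equations for the coefficients of the transformation. *)
Definition N2_cos t m : 'cV[R]_n := if m == 0%N then ka *: e_n R k + dac 0 t - ns_E D ls *m ac 0 t
  else if m == 2%N then dac 2 t + (2 * om) *: bc 2 t - ns_E D ls *m ac 2 t else 0.
Definition N2_sin t m : 'cV[R]_n := if m == 2%N then dbc 2 t - (2 * om) *: ac 2 t - ns_E D ls *m bc 2 t else 0.

Lemma N2_trig t p i : N2 t p i 0 = trig (fun m => N2_cos t m i 0) (fun m => N2_sin t m i 0) p.
Proof.
rewrite NF_N2 /tzq /dzq /zq /trig /index_iota /= !big_cons big_nil /N2_cos /N2_sin /= -!/(dac _ _) -!/(dbc _ _).
rewrite !mulmxDr -!scalemxAr.
move: (ns_E D ls *m ac 0 t) (ns_E D ls *m ac 2 t) (ns_E D ls *m bc 2 t) (dac 0 t) (dac 2 t) (dbc 2 t) (ac 2 t) (bc 2 t) (e_n R k) => x1 x2 x3 x4 x5 x6 x7 x8 x9.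
by rewrite !mxE; ring.
Qed.

Lemma N2_modes t : [/\ cm R 0 *: vpc 0 (N2 t) = ka *: e_n R k + dac 0 t - ns_E D ls *m ac 0 t,
  2 *: vpc 2 (N2 t) = dac 2 t + (2 * om) *: bc 2 t - ns_E D ls *m ac 2 t &
  2 *: vps 2 (N2 t) = dbc 2 t - (2 * om) *: ac 2 t - ns_E D ls *m bc 2 t].
Proof.
have H m := @vpc_trig R k m (N2 t) (N2_cos t) (N2_sin t) (N2_trig t).
split.
- by have [/(_ isT) -> _] := H 0%N.
- by have [/(_ isT) h _] := H 2%N.
- by have [_ /(_ isT) h] := H 2%N.
Qed.

Definition NJ_cos t m : 'cV[R]_n :=
  if m == 1%N then dhc 1 t + om *: kc 1 t - ns_E D ls *m hc 1 t + vec3 (cv2 bR bI) 0 0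
  else if m == 3%N then dhc 3 t + (3 * om) *: kc 3 t - ns_E D ls *m hc 3 t else 0.
Definition NJ_sin t m : 'cV[R]_n :=
  if m == 1%N then dkc 1 t - om *: hc 1 t - ns_E D ls *m kc 1 t + vec3 (cv2 (- bI) bR) 0 0
  else if m == 3%N then dkc 3 t - (3 * om) *: hc 3 t - ns_E D ls *m kc 3 t else 0.

Lemma d1v_entry (f : R -> R -> 'cV[R]_n) (t : R) i : derivable (f ^~ ls) t 1 ->
  is_derive t 1 (fun s => f s ls i 0) (d1v D f t i 0).
Proof.
move=> df; rewrite /d1v derive1E derive_mx// mxE; apply: derivableP.
by move/derivable_mxP: df; apply.
Qed.

Lemma d1v_Pi (f : R -> R -> 'cV[R]_n) (t : R) : derivable (f ^~ ls) t 1 ->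
  (forall s, Pi (f s ls) = f s ls) -> Pi (d1v D f t) = d1v D f t.
Proof.
move=> df fP.
have z i : (forall s, f s ls i 0 = 0) -> d1v D f t i 0 = 0.
  move=> h; have := d1v_entry i df; rewrite (_ : (fun s => _) = cst 0); last by apply/funext => s; rewrite h.
  by move=> H; rewrite -(@derive_val _ _ _ _ _ _ _ H) (@derive_val _ _ _ _ _ _ _ (is_derive_cst _ _ _)).
apply: vec3_eq; rewrite /Pi !zE//.
  apply/matrixP => i j; rewrite ord1 ztilE z ?mxE// => s.
  by rewrite -ztilE -fP /Pi ztil_vec3 mxE.
by rewrite zringE z// => s; rewrite -zringE -fP /Pi zring_vec3.
Qed.

Lemma Pi_dh m t : Pi (dhc m t) = dhc m t.
Proof. by apply: d1v_Pi => [|s]; [exact: hcoef_derivable|exact: Pi_h]. Qed.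
Lemma Pi_dk m t : Pi (dkc m t) = dkc m t.
Proof. by apply: d1v_Pi => [|s]; [exact: kcoef_derivable|exact: Pi_k]. Qed.

Lemma NJ_trig t p i : Pi (NJ t p) i 0 = trig (fun m => NJ_cos t m i 0) (fun m => NJ_sin t m i 0) p.
Proof.
have e1 : Pi (tzc D nf t p) = cos p *: dhc 1 t + sin p *: dkc 1 t + cos (3 * p) *: dhc 3 t + sin (3 * p) *: dkc 3 t.
  by rewrite -(Pi_dh 1) -(Pi_dk 1) -(Pi_dh 3) -(Pi_dk 3) -!PiZ -!PiD.
have e2 : Pi (dzc D nf t p) = - sin p *: hc 1 t + cos p *: kc 1 t + - (3 * sin (3 * p)) *: hc 3 t + (3 * cos (3 * p)) *: kc 3 t.
  by rewrite -(Pi_h 1) -(Pi_k 1) -(Pi_h 3) -(Pi_k 3) -!PiZ -!PiD.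
have e3 : Pi (zc D nf t p) = cos p *: hc 1 t + sin p *: kc 1 t + cos (3 * p) *: hc 3 t + sin (3 * p) *: kc 3 t.
  by rewrite -(Pi_h 1) -(Pi_k 1) -(Pi_h 3) -(Pi_k 3) -!PiZ -!PiD.
rewrite NF_NJ e1 e2 e3 /trig /index_iota /= !big_cons big_nil /NJ_cos /NJ_sin /=.
have -> : vec3 (rotmx bR bI *m cv2 (cos p) (sin p)) 0 0 =
   cos p *: vec3 (cv2 bR bI) 0 0 + sin p *: vec3 (cv2 (- bI) bR) 0 0 :> 'cV[R]_n.
  rewrite rotmxZ; apply: vec3_eq; rewrite !zE ?scaler0 ?mulr0 ?addr0//.
  by apply/matrixP => a b; rewrite !mxE; case: ifP => _; ring.
rewrite !mulmxDr -!scalemxAr.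
move: (vec3 (cv2 bR bI) 0 0) (vec3 (cv2 (- bI) bR) 0 0) => v1 v2.
move: (ns_E D ls *m hc 1 t) (ns_E D ls *m kc 1 t) (ns_E D ls *m hc 3 t) (ns_E D ls *m kc 3 t) (dhc 1 t) (dkc 1 t)  (dhc 3 t) (dkc 3 t) (hc 1 t) (kc 1 t) (hc 3 t) (kc 3 t) => x1 x2 x3 x4 x5 x6 x7 x8 x9 x10 x11 x12.
by rewrite !mul1r !mxE; ring.
Qed.

Lemma vpc_Pi m (f : R -> 'cV[R]_n) : (vpc m (fun p => Pi (f p)) = Pi (vpc m f)) * (vps m (fun p => Pi (f p)) = Pi (vps m f)).
Proof.
have z (j : 'I_k) : (fun p => Pi (f p) (tidx j) 0) = fun _ => 0.
  by apply/funext => p; rewrite -ztilE /Pi ztil_vec3 mxE.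
have z' : (fun p => Pi (f p) (ridx k) 0) = fun _ => 0.
  by apply/funext => p; rewrite -zringE /Pi zring_vec3.
have h j : (fun p => Pi (f p) (hidx k j) 0) = fun p => f p (hidx k j) 0.
  by apply/funext => p; rewrite -!zhatE /Pi zhat_vec3.
have pc0 : pc m (fun _ : R => 0) = 0 :> R.
  by rewrite /pc (_ : (fun p => _) = fun _ => 0) ?avg_cst//; apply/funext => p; rewrite mulr0.
have ps0 : ps m (fun _ : R => 0) = 0 :> R.
  by rewrite /ps (_ : (fun p => _) = fun _ => 0) ?avg_cst//; apply/funext => p; rewrite mulr0.
split; apply: vec3_eq; rewrite /Pi !zE.
- by apply/matrixP => i j; rewrite ord1 !zhatE !mxE h.
- by apply/matrixP => i j; rewrite ord1 !ztilE !mxE z.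
- by rewrite zringE mxE z'.
- by apply/matrixP => i j; rewrite ord1 !zhatE !mxE h.
- by apply/matrixP => i j; rewrite ord1 !ztilE !mxE z.
- by rewrite zringE mxE z'.
Qed.

Lemma NJ_modes t :
  [/\ Pi (2 *: vpc 1 (NJ t)) = dhc 1 t + om *: kc 1 t - ns_E D ls *m hc 1 t + vec3 (cv2 bR bI) 0 0,
   Pi (2 *: vps 1 (NJ t)) = dkc 1 t - om *: hc 1 t - ns_E D ls *m kc 1 t + vec3 (cv2 (- bI) bR) 0 0,
   Pi (2 *: vpc 3 (NJ t)) = dhc 3 t + (3 * om) *: kc 3 t - ns_E D ls *m hc 3 t &
   Pi (2 *: vps 3 (NJ t)) = dkc 3 t - (3 * om) *: hc 3 t - ns_E D ls *m kc 3 t].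
Proof.
have H m := @vpc_trig R k m (fun p => Pi (NJ t p)) (NJ_cos t) (NJ_sin t) (NJ_trig t).
rewrite !PiZ -!vpc_Pi; split.
- by have [/(_ isT) h _] := H 1%N.
- by have [_ /(_ isT) h] := H 1%N.
- by have [/(_ isT) h _] := H 3%N.
- by have [_ /(_ isT) h] := H 3%N.
Qed.

(** Linearity, used with c = eps or eps^2 to subtract the normal form system from the system of the
    branch. *)
Lemma msys_diff (M : 'M[R]_n) (g c : R) (a b fa fb a' b' fa' fb' : R -> 'cV[R]_n) :
  msys M g a b fa fb -> msys M g a' b' fa' fb' ->
  msys M g (fun t => a t - c *: a' t) (fun t => b t - c *: b' t)
    (fun t => fa t - c *: fa' t) (fun t => fb t - c *: fb' t).
Proof.
move=> [pa pb da db] [pa' pb' da' db']; split.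
- by move=> t; rewrite pa pa'.
- by move=> t; rewrite pb pb'.
- move=> t i; rewrite (_ : (fun s => _) = fun s => a s i 0 - c * a' s i 0); last first.
    by apply/funext => s; rewrite !mxE.
  have := is_deriveBf (da t i) (is_deriveCf c (da' t i)); congr (is_derive _ _ _ _).
  rewrite mulmxBr -scalemxAr; move: (_ *m _) (_ *m _) => x y; rewrite !mxE; ring.
move=> t i; rewrite (_ : (fun s => _) = fun s => b s i 0 - c * b' s i 0); last first.
  by apply/funext => s; rewrite !mxE.
have := is_deriveBf (db t i) (is_deriveCf c (db' t i)); congr (is_derive _ _ _ _).
rewrite mulmxBr -scalemxAr; move: (_ *m _) (_ *m _) => x y; rewrite !mxE; ring.
Qed.

Lemma msys_mk (g : R) (a b fa fb da db : R -> 'cV[R]_n) : periodic a -> periodic b ->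
  (forall (t : R) i, is_derive t 1 (fun s => a s i 0) (da t i 0)) ->
  (forall (t : R) i, is_derive t 1 (fun s => b s i 0) (db t i 0)) ->
  (forall t, da t = ns_E D ls *m a t - g *: b t + fa t) ->
  (forall t, db t = ns_E D ls *m b t + g *: a t + fb t) ->
  msys (ns_E D ls) g a b fa fb.
Proof.
move=> pa pb Da Db Ea Eb; split=> // t i.
  by have := Da t i; rewrite Ea; move: (_ *m _) => x; rewrite !mxE.
by have := Db t i; rewrite Eb; move: (_ *m _) => x; rewrite !mxE.
Qed.

Lemma ac_per m : periodic (acoef nf m ^~ ls).
Proof.
move=> t; have [p1 _] := nfa_ahat nfls m; have [p2 _] := nfa_atil nfls m; have [p3 _] := nfa_aring nfls m.
by rewrite /acoef /= (p1 t) (p2 t) (p3 t).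
Qed.

Lemma bc_per m : periodic (bcoef nf m ^~ ls).
Proof.
move=> t; have [p1 _] := nfa_bhat nfls m; have [p2 _] := nfa_btil nfls m; have [p3 _] := nfa_bring nfls m.
by rewrite /bcoef /= (p1 t) (p2 t) (p3 t).
Qed.

Lemma hc_per m : periodic (hcoef nf m ^~ ls).
Proof. by move=> t; have [p1 _] := nfa_ahat nfls m; rewrite /hcoef /= (p1 t). Qed.

Lemma kc_per m : periodic (kcoef nf m ^~ ls).
Proof. by move=> t; have [p1 _] := nfa_bhat nfls m; rewrite /kcoef /= (p1 t). Qed.

Lemma nf_msys2 : msys (ns_E D ls) (2 * om) (acoef nf 2 ^~ ls) (bcoef nf 2 ^~ ls)
  (fun t => 2 *: vpc 2 (N2 t)) (fun t => 2 *: vps 2 (N2 t)).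
Proof.
apply: (@msys_mk _ _ _ _ _ (dac 2) (dbc 2)); [exact: ac_per|exact: bc_per| | | |].
- by move=> t i; apply: d1v_entry; exact: acoef_derivable.
- by move=> t i; apply: d1v_entry; exact: bcoef_derivable.
- move=> t; have [_ -> _] := N2_modes t; move: (ns_E D ls *m ac 2 t) (dac 2 t) (ac 2 t) (bc 2 t) => x y z w.
  by apply/matrixP => i j; rewrite !mxE; ring.
- move=> t; have [_ _ ->] := N2_modes t; move: (ns_E D ls *m bc 2 t) (dbc 2 t) (ac 2 t) (bc 2 t) => x y z w.
  by apply/matrixP => i j; rewrite !mxE; ring.
Qed.

(** kappa takes the place that eta has for the branch: it is the secular term of the ring block. *)
Lemma nf_msys0 : msys (ns_E D ls) 0 (acoef nf 0 ^~ ls) (fun _ => 0)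
  (fun t => cm R 0 *: vpc 0 (N2 t) - ka *: e_n R k) (fun _ => 0).
Proof.
apply: (@msys_mk _ _ _ _ _ (dac 0) (fun _ => 0)); [exact: ac_per|by []| | | |].
- by move=> t i; apply: d1v_entry; exact: acoef_derivable.
- by move=> t i; rewrite mxE; exact: is_derive_cst.
- move=> t; have [-> _ _] := N2_modes t; move: (ns_E D ls *m ac 0 t) (dac 0 t) (ac 0 t) (e_n R k) => x y z w.
  by rewrite scale0r; apply/matrixP => i j; rewrite !mxE; ring.
- by move=> t; rewrite mulmx0 scale0r !addr0.
Qed.

Lemma nf_mean0 : avg (fun t => zring (acoef nf 0 t ls)) = 0.
Proof. by have := nfa_norm3 nfls; congr (_ = _); congr avg; apply/funext => t; rewrite zring_vec3. Qed.

Lemma astar_cont : vcont (astar k : R -> 'cV[R]_n).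
Proof.
move=> i; rewrite (_ : (fun p => _) = trig (fun m => acst R k m i 0) (fun m => bcst R k m i 0)).
  exact: cont_trig.
by apply/funext => p; rewrite astar_trig.
Qed.

Lemma N2_cont t : vcont (N2 t).
Proof. by apply: vcont_mul2; exact: astar_cont. Qed.

Lemma Op0_N2 : Op 0 (fun (_ : R) (u : X) => N2 u.1 u.2).
Proof. by have [_ oc2 _] := Op_jet2; exact: (Op_mul2 oc2 (Op_astar R k) (Op_astar R k)). Qed.

(* Uniform boundedness in theta comes for free from the linear theory. *)
Lemma Op0_coef2 : Op 0 (fun (_ : R) t => ac 2 t) /\ Op 0 (fun (_ : R) t => bc 2 t).
Proof.
have [n1 n2 n3] := @nonres_m 2 isT; have [v1 v2] := Op_vN 2 (fun _ t => @N2_cont t) Op0_N2.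
apply: (@Op_nonres R k D aR0 aI0 hyp _ 0 (fun _ t => ac 2 t) (fun _ t => bc 2 t) _ _ n1 n2 n3 _ (Op_cstZ 2 v1) (Op_cstZ 2 v2)).
by near=> e; exact: nf_msys2.
Unshelve. all: by end_near. Qed.

Lemma Op0_coef0 : Op 0 (fun (_ : R) t => ac 0 t).
Proof.
have [v1 _] := Op_vN 0 (fun _ t => @N2_cont t) Op0_N2.
have M : \forall e \near (0 : R)^', msys (ns_E D ls) 0 (acoef nf 0 ^~ ls) (fun _ => 0)
    (fun t => cm R 0 *: vpc 0 (N2 t) - ka *: e_n R k) (fun _ => 0) /\ avg (fun t => zring (ac 0 t)) = 0.
  by near=> e; split; [exact: nf_msys0|exact: nf_mean0].
exact: (proj1 (@Op_mean R k D aR0 aI0 hyp 0 (fun _ t => ac 0 t) _ (fun _ => ka) (proj1 nonres_om) M (Op_cstZ (cm R 0) v1))).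
Unshelve. all: by end_near. Qed.

Notation zqX := (fun (_ : R) (u : X) => zq D nf u.1 u.2).

Lemma Op0_zq : Op 0 zqX.
Proof.
have [h1 h2] := Op0_coef2.
exact: (@Op_we R k (fun m t _ => ac m t) (fun m t _ => bc m t) 0 Op0_coef0 h1 h2).
Qed.

Lemma zq_cont t : vcont (zq D nf t).
Proof.
apply: vcontD; first apply: vcontD.
- by move=> i; exact: cont_cst.
- by apply: vcont_cZ; exact: cont_cosM.
- by apply: vcont_cZ; exact: cont_sinM.
Qed.

Lemma NJ_cont t : vcont (NJ t).
Proof.
have ca := astar_cont; have cq := @zq_cont t.
apply: vcontD; first apply: vcontD; first apply: vcontD.
- exact: (vcontN (@vcontZ R k ka _ (@vcont_mulmx R k (Bmx D t ls) _ ca))).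
- exact: (@vcont_mul2 R k (jet2 D t ls) _ _ ca cq).
- exact: (@vcont_mul2 R k (jet2 D t ls) _ _ cq ca).
- exact: (@vcont_mul3 R k (jet3 D t ls) _ _ _ ca ca ca).
Qed.

(** * Comparison of the branch with the normal form *)

Lemma zo_lim : Op 2 (fun e u => z_odd aF bF e u - astar k u.2).
Proof. by have := Op2_wo; apply: Op_eq; near=> e => u; rewrite /z_odd addrC addKr. Unshelve. all: by end_near. Qed.

(** The even forcing is eps times the quadratic form at z_odd; replacing z_odd by a* and lambda by
    lambda* costs a factor eps^2. *)
Lemma Feven_N2 : Op 3 (fun e u => Feven e u - e *: N2 u.1 u.2).
Proof.
have [oB _ _] := Op_Bmx; have [oc2 oc2s dc2] := Op_jet2; have [oc3 _ _] := Op_jet3.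
have h1 := even_part oB oc2 oc3 Op_jet4 Op0_zo NF_jet NF_jet_shift (Op_comp (fun _ : X => tt) Op1_eta) Op1_we.
have h2 := even_lim Op0_zo oc2s (Op_astar R k) zo_lim (dc2 2 (proj1 Op2_lam)).
have h3 := OpZ_le (Op_id R X) h2 (isT : (3 <= 1 + 2)%N).
have := Op_add h1 h3; apply: Op_eq; near=> e => u.
by rewrite /N2 /Feven scalerBr addrA subrK.
Unshelve. all: by end_near. Qed.

Lemma vN_even_lim m : ~~ odd m ->
  Op 3 (fun e t => vpc m (fun p => NF e (t, p)) - e *: vpc m (N2 t)) /\
  Op 3 (fun e t => vps m (fun p => NF e (t, p)) - e *: vps m (N2 t)).
Proof.
move=> em; have cf e t : vcont (fun p => Feven e (t, p) - e *: N2 t p).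
  by apply: vcontB; [exact: Feven_cont|apply: vcontZ; exact: N2_cont].
have [h1 h2] := Op_vN m cf Feven_N2.
have E e t : (vpc m (fun p => Feven e (t, p) - e *: N2 t p) = vpc m (fun p => NF e (t, p)) - e *: vpc m (N2 t))
  * (vps m (fun p => Feven e (t, p) - e *: N2 t p) = vps m (fun p => NF e (t, p)) - e *: vps m (N2 t)).
  rewrite !(vN_even _ _ em) -!(vpcZ m e (@N2_cont t)).
  by rewrite !(vpcB m (@Feven_cont e t) (@vcontZ R k e _ (@N2_cont t))).
by split; [move: h1|move: h2]; apply: Op_eq; near=> e => t; rewrite E.
Unshelve. all: by end_near. Qed.

(** lambda - lambda*, omega - omega* and eps eta are all O(eps^2), so linear terms gain two orders
    over the coefficients and the derivative term two orders over the derivatives. *)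
Lemma rA_diff q m (L1 L2 : R -> R -> 'cV[R]_n) s q2 : (0 < m < 4)%N ->
  Op q (fun e t => vpc m (fun p => NF e (t, p)) - L1 e t) ->
  Op q (fun e t => vps m (fun p => NF e (t, p)) - L2 e t) ->
  Op s (fun e t => aF m t e) -> Op s (fun e t => bF m t e) -> Op q2 (dA m) -> Op q2 (dB m) ->
  (q <= 2 + s)%N -> (q <= 2 + q2)%N ->
  Op q (fun e t => residA m e t - cm R m *: L1 e t) /\ Op q (fun e t => residB m e t - 2 *: L2 e t).
Proof.
move=> m4 v1 v2 oa ob oda odb le1 le2; have [hl hn] := Op2_lam.
have hE := Op_E (Op_comp (fun _ : R => tt) hl); have hN := Op_comp (fun _ : R => tt) hn.
have hN' : Op 2 (fun e (_ : R) => m%:R * (omF e - om)) by exact: Op_cstZ.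
have he := Op_mulr (Op_id R R) (Op_comp (fun _ : R => tt) Op1_eta).
split.
  have t1 := Op_le le1 (Op_mulmx hE oa); have t2 := OpZ_le hN' ob le1.
  have t3 := Op_cstZ (cm R m) v1; have t4 := OpZ_le he oda le2.
  have := Op_sub (Op_add (Op_sub t1 t2) t3) t4; apply: Op_eq; near=> e => t.
  rewrite /residA scalerBr; move: (_ *m _) (_ *: bF m t e) (_ *: vpc _ _) (_ *: L1 _ _) (_ *: dA _ _ _) => x y z w v.
  by apply/matrixP => i j; rewrite !mxE; ring.
have t1 := Op_le le1 (Op_mulmx hE ob); have t2 := OpZ_le hN' oa le1.
have t3 := Op_cstZ 2 v2; have t4 := OpZ_le he odb le2.
have := Op_sub (Op_add (Op_add t1 t2) t3) t4; apply: Op_eq; near=> e => t.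
rewrite /residB scalerBr; move: (_ *m _) (_ *: aF m t e) (_ *: vps _ _) (_ *: L2 _ _) (_ *: dB _ _ _) => x y z w v.
by apply/matrixP => i j; rewrite !mxE; ring.
Unshelve. all: by end_near. Qed.

Lemma rA0_diff : Op 3 (fun e t => residA 0 e t - cm R 0 *: (e *: vpc 0 (N2 t))).
Proof.
have [v1 _] := @vN_even_lim 0 isT; have [hl _] := Op2_lam.
have hE := Op_E (Op_comp (fun _ : R => tt) hl).
have he := Op_mulr (Op_id R R) (Op_comp (fun _ : R => tt) Op1_eta).
have t1 := Op_mulmx hE (Op1_A (isT : (0 < 4)%N)).
have t3 := Op_cstZ (cm R 0) v1; have t4 := OpZ_le he (Op1_dA (isT : (0 < 4)%N)) (isT : (3 <= 1 + 1 + 1)%N).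
have := Op_sub (Op_add t1 t3) t4; apply: Op_eq; near=> e => t.
rewrite /residA mul0r scale0r subr0 [in LHS]scalerBr.
move: (_ *m _) (_ *: vpc _ _) (_ *: (_ *: _)) (_ *: dA _ _ _) => x y z w.
by apply/matrixP => i j; rewrite !mxE; ring.
Unshelve. all: by end_near. Qed.

Lemma step3_2 : Op 3 (fun e t => aF 2%N t e - e *: ac 2 t) /\ Op 3 (fun e t => bF 2%N t e - e *: bc 2 t).
Proof.
have [n1 n2 n3] := @nonres_m 2 isT; have [v1 v2] := @vN_even_lim 2 isT.
have [h1 h2] := @rA_diff 3 2 _ _ 1 1 isT v1 v2 (Op1_A (isT : (2 < 4)%N)) (@Op1_B 2 isT)
  (Op1_dA (isT : (2 < 4)%N)) (@Op1_dB 2 isT) isT isT.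
apply: (@Op_nonres R k D aR0 aI0 hyp _ 3 (fun e t => aF 2%N t e - e *: ac 2 t)
  (fun e t => bF 2%N t e - e *: bc 2 t) _ _ n1 n2 n3 _ h1 h2).
apply: filterS (@branch_msys 2 isT) => e M.
have := msys_diff e M nf_msys2; congr (msys _ _ _ _ _ _); apply/funext => t;
  by rewrite /forceA /forceB /= add0r; congr (_ - _); rewrite scalerA mulrC -scalerA.
Qed.

(** The difference of the two mode 0 systems has secular term eta - eps kappa and zero ring mean, so
    [Op_mean] bounds both at once. *)
Lemma step3_0 : Op 3 (fun e t => aF 0%N t e - e *: ac 0 t) /\ Op 3 (fun e (_ : unit) => etaF e - e * ka).
Proof.
apply: (@Op_mean R k D aR0 aI0 hyp 3 (fun e t => aF 0%N t e - e *: ac 0 t) _ (fun e => etaF e - e * ka)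
  (proj1 nonres_om) _ rA0_diff).
move: branch_msys0 HF; apply: filterS2 => e [M av] fs; split.
  have := msys_diff e M nf_msys0; congr (msys _ _ _ _ _ _); apply/funext => t.
  - by rewrite scaler0 subr0.
  - move: (residA 0 e t) (e_n R k) (vpc 0 (N2 t)) => x y z.
    by apply/matrixP => i j; rewrite !mxE; ring.
  - by rewrite scaler0 subr0.
have [_ dera] := a_per fs (isT : (0 < 4)%N).
have c1 : continuous (fun t => zring (aF 0%N t e)).
  move=> t; apply: is_derive_cont => {}t; rewrite (_ : (fun s => _) = fun s => aF 0%N s e (ridx k) 0).
    exact: dera.
  by apply/funext => s; rewrite zringE.
have c2' : continuous (fun t => zring (ac 0 t)).
  move=> t; apply: is_derive_cont => {}t; rewrite (_ : (fun s => _) = fun s => ac 0 s (ridx k) 0).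
    by apply: d1v_entry; exact: acoef_derivable.
  by apply/funext => s; rewrite zringE.
rewrite (_ : (fun t => _) = fun t => zring (aF 0%N t e) - e * zring (ac 0 t)); last first.
  by apply/funext => t; rewrite -scaleN1r zringD !zringZ mulN1r.
rewrite avgB ?avgZ// ?av ?nf_mean0 ?mulr0 ?subrr//.
by apply: contM => //; exact: cont_cst.
Qed.

Lemma we_lim : Op 3 (fun e u => w_even aF bF e u - e *: zq D nf u.1 u.2).
Proof.
have [h1 h2] := step3_2; have [h0 _] := step3_0.
have := @Op_we R k (fun m t e => aF m t e - e *: ac m t) (fun m t e => bF m t e - e *: bc m t) 3 h0 h1 h2.
apply: Op_eq; near=> e => u; rewrite /w_even /zq.
move: (ac 0 u.1) (ac 2 u.1) (bc 2 u.1) => x y z.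
by apply/matrixP => i j; rewrite !mxE; ring.
Unshelve. all: by end_near. Qed.

(** Here the third-order accuracy of the even modes and of eta is consumed: one factor eps in front
    of them makes the odd forcing accurate to O(eps^4). *)
Lemma Fodd_NJ : Op 4 (fun e u => Fodd e u - e ^+ 2 *: NJ u.1 u.2).
Proof.
have [oB oBs dB] := Op_Bmx; have [oc2 oc2s dc2] := Op_jet2; have [oc3 oc3s dc3] := Op_jet3.
have [hl _] := Op2_lam.
have h := Jodd_lim oB Op0_zo oBs oc2s oc3s (Op_astar R k) zo_lim (dc2 2 hl) (dc3 2 hl) (dB 2 hl)
  Op1_we Op0_zq we_lim (Op_comp (fun _ : X => tt) (proj2 step3_0)).
have := Op_add Fodd_jet h; apply: Op_eq; near=> e => u.
by rewrite addrA subrK; congr (_ - _ *: _); case: u.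
Unshelve. all: by end_near. Qed.

Lemma vN_odd_lim m : odd m ->
  Op 4 (fun e t => vpc m (fun p => NF e (t, p)) - e ^+ 2 *: vpc m (NJ t)) /\
  Op 4 (fun e t => vps m (fun p => NF e (t, p)) - e ^+ 2 *: vps m (NJ t)).
Proof.
move=> em; have cf e t : vcont (fun p => Fodd e (t, p) - e ^+ 2 *: NJ t p).
  by apply: vcontB; [exact: Fodd_cont|apply: vcontZ; exact: NJ_cont].
have [h1 h2] := Op_vN m cf Fodd_NJ.
have E e t : (vpc m (fun p => Fodd e (t, p) - e ^+ 2 *: NJ t p) = vpc m (fun p => NF e (t, p)) - e ^+ 2 *: vpc m (NJ t))
  * (vps m (fun p => Fodd e (t, p) - e ^+ 2 *: NJ t p) = vps m (fun p => NF e (t, p)) - e ^+ 2 *: vps m (NJ t)).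
  rewrite !(vN_odd _ _ em) -!(vpcZ m (e ^+ 2) (@NJ_cont t)).
  by rewrite !(vpcB m (@Fodd_cont e t) (@vcontZ R k (e ^+ 2) _ (@NJ_cont t))).
by split; [move: h1|move: h2]; apply: Op_eq; near=> e => t; rewrite E.
Unshelve. all: by end_near. Qed.

Lemma rA_odd m : odd m -> (m < 4)%N ->
  Op 4 (fun e t => residA m e t - cm R m *: (e ^+ 2 *: vpc m (NJ t))) /\
  Op 4 (fun e t => residB m e t - 2 *: (e ^+ 2 *: vps m (NJ t))).
Proof.
move=> om_ m4; have m04 : (0 < m < 4)%N by rewrite m4 andbT; case: m om_ {m4}.
have [v1 v2] := vN_odd_lim om_; have [d1 d2] := Op2_d om_ m4.
have [oa ob] : Op 2 (fun e t => aF m t e) /\ Op 2 (fun e t => bF m t e).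
  have [a1 b1 _ _] := Op2_block1; have [a3' b3'] := Op2_block3.
  by case: m om_ m4 {m04 v1 v2 d1 d2} => [|[|[|[|//]]]].
exact: (@rA_diff 4 m _ _ 2 2 m04 v1 v2 oa ob d1 d2 isT isT).
Qed.

Lemma Op_Pi q (f : R -> R -> 'cV[R]_n) : Op q f -> Op q (fun e t => Pi (f e t)).
Proof.
case=> C C0 HC; exists C => //; apply: filterS HC => e HC t.
apply: le_trans (HC t); have [h _ _] := blocks_norm (lexx `|f e t|).
apply: norm_blocks => // [j|j|]; rewrite /Pi ?zhat_vec3 ?ztil_vec3 ?zring_vec3 ?normr0//.
by rewrite mxE normr0.
Qed.

(** E at lambda* is block diagonal and so commutes with the projection. *)
Lemma msys_Pi (g : R) (a b fa fb : R -> 'cV[R]_n) : msys (ns_E D ls) g a b fa fb ->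
  msys (ns_E D ls) g (fun t => Pi (a t)) (fun t => Pi (b t)) (fun t => Pi (fa t)) (fun t => Pi (fb t)).
Proof.
move=> [pa pb da db].
have H (f df : R -> 'cV[R]_n) : (forall (t : R) i, is_derive t 1 (fun s => f s i 0) (df t i 0)) ->
    forall (t : R) i, is_derive t 1 (fun s => Pi (f s) i 0) (Pi (df t) i 0).
  move=> h t; apply: idxP => [i|i|].
  - rewrite (_ : (fun s => _) = fun s => f s (hidx k i) 0); last first.
      by apply/funext => s; rewrite -!zhatE /Pi zhat_vec3.
    by rewrite -zhatE /Pi zhat_vec3 zhatE.
  - rewrite (_ : (fun s => _) = cst 0); last first.
      by apply/funext => s; rewrite -ztilE /Pi ztil_vec3 mxE.
    by rewrite -ztilE /Pi ztil_vec3 mxE; exact: is_derive_cst.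
  rewrite (_ : (fun s => _) = cst 0); last first.
    by apply/funext => s; rewrite -zringE /Pi zring_vec3.
  by rewrite -zringE /Pi zring_vec3; exact: is_derive_cst.
have Da := H a (fun t => ns_E D ls *m a t - g *: b t + fa t).
have Db := H b (fun t => ns_E D ls *m b t + g *: a t + fb t).
apply: (@msys_mk _ _ _ _ _ _ _ _ _ (Da _) (Db _)).
- by move=> t; rewrite pa.
- by move=> t; rewrite pb.
- by move=> t i; have := da t i; move: (_ *m _) => x; rewrite !mxE.
- by move=> t i; have := db t i; move: (_ *m _) => x; rewrite !mxE.
- by move=> t; rewrite -scaleNr !PiD PiE PiZ scaleNr.
- by move=> t; rewrite !PiD PiE PiZ.
Qed.

(** The Lyapunov coefficients enter as secular terms with a minus sign, which is the origin of the
    sign in the formula for beta_R. *)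
Lemma nf_msys1 : msys (ns_E D ls) om (hcoef nf 1 ^~ ls) (kcoef nf 1 ^~ ls)
  (fun t => Pi (2 *: vpc 1 (NJ t)) - vec3 (cv2 bR bI) 0 0)
  (fun t => Pi (2 *: vps 1 (NJ t)) - vec3 (cv2 (- bI) bR) 0 0).
Proof.
apply: (@msys_mk _ _ _ _ _ (dhc 1) (dkc 1)); [exact: hc_per|exact: kc_per| | | |].
- by move=> t i; apply: d1v_entry; exact: hcoef_derivable.
- by move=> t i; apply: d1v_entry; exact: kcoef_derivable.
- move=> t; have [-> _ _ _] := NJ_modes t; rewrite addrK.
  move: (ns_E D ls *m hc 1 t) (dhc 1 t) (kc 1 t) => x y z.
  by apply/matrixP => i j; rewrite !mxE; ring.
- move=> t; have [_ -> _ _] := NJ_modes t; rewrite addrK.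
  move: (ns_E D ls *m kc 1 t) (dkc 1 t) (hc 1 t) => x y z.
  by apply/matrixP => i j; rewrite !mxE; ring.
Qed.

Lemma nf_msys3 : msys (ns_E D ls) (3 * om) (hcoef nf 3 ^~ ls) (kcoef nf 3 ^~ ls)
  (fun t => Pi (2 *: vpc 3 (NJ t))) (fun t => Pi (2 *: vps 3 (NJ t))).
Proof.
apply: (@msys_mk _ _ _ _ _ (dhc 3) (dkc 3)); [exact: hc_per|exact: kc_per| | | |].
- by move=> t i; apply: d1v_entry; exact: hcoef_derivable.
- by move=> t i; apply: d1v_entry; exact: kcoef_derivable.
- move=> t; have [_ _ -> _] := NJ_modes t.
  move: (ns_E D ls *m hc 3 t) (dhc 3 t) (kc 3 t) => x y z.
  by apply/matrixP => i j; rewrite !mxE; ring.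
- move=> t; have [_ _ _ ->] := NJ_modes t.
  move: (ns_E D ls *m kc 3 t) (dkc 3 t) (hc 3 t) => x y z.
  by apply/matrixP => i j; rewrite !mxE; ring.
Qed.

Lemma step4_3 : Op 4 (fun e t => Pi (aF 3%N t e) - e ^+ 2 *: hc 3 t) /\
  Op 4 (fun e t => Pi (bF 3%N t e) - e ^+ 2 *: kc 3 t).
Proof.
have [n1 n2 n3] := @nonres_m 3 isT; have [h1 h2] := @rA_odd 3 isT isT.
apply: (@Op_nonres R k D aR0 aI0 hyp _ 4 (fun e t => Pi (aF 3%N t e) - e ^+ 2 *: hc 3 t)
  (fun e t => Pi (bF 3%N t e) - e ^+ 2 *: kc 3 t) _ _ n1 n2 n3 _ (Op_Pi h1) (Op_Pi h2)).
apply: filterS (@branch_msys 3 isT) => e M.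
have := msys_diff (e ^+ 2) (msys_Pi M) nf_msys3; congr (msys _ _ _ _ _ _); apply/funext => t.
  rewrite /forceA /= add0r; move: (residA 3 e t) (vpc 3 (NJ t)) => x y.
  rewrite PiD PiN !PiZ; move: (Pi x) (Pi y) => {}x {}y.
  by apply/matrixP => i j; rewrite !mxE /cm /=; ring.
rewrite /forceB /= add0r; move: (residB 3 e t) (vps 3 (NJ t)) => x y.
rewrite PiD PiN !PiZ; move: (Pi x) (Pi y) => {}x {}y.
by apply/matrixP => i j; rewrite !mxE; ring.
Qed.

Lemma nf_mean1 : avg (fun t => zhat (hc 1 t) 0 0 + zhat (kc 1 t) 1 0) = 0 /\
  avg (fun t => zhat (hc 1 t) 1 0 - zhat (kc 1 t) 0 0) = 0.
Proof.
have ca i : continuous (fun t => nf_ahat nf 1 t ls i 0).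
  have [_ d] := nfa_ahat nfls 1 => t; apply: differentiable_continuous; apply/derivable1_diffP.
  by move/derivable_mxP: (d t); apply.
have cb i : continuous (fun t => nf_bhat nf 1 t ls i 0).
  have [_ d] := nfa_bhat nfls 1 => t; apply: differentiable_continuous; apply/derivable1_diffP.
  by move/derivable_mxP: (d t); apply.
have dE (u : 'cV[R]_2) x y : dotv u (cv2 x y) = u 0 0 * x + u 1 0 * y.
  rewrite /dotv big_ord_recl big_ord1 (_ : lift ord0 ord0 = 1 :> 'I_2) ?cv2E//; exact/val_inj.
have := nfa_norm1 nfls; have := nfa_norm2 nfls; rewrite /inner1 /ehat1 /ehat2.
under eq_fun do rewrite dE mulr0 mulr1 add0r.
under [in X in _ - X]eq_fun do rewrite dE mulr0 mulr1 addr0.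
move=> g2; under eq_fun do rewrite dE mulr0 mulr1 addr0.
under [in X in _ + X]eq_fun do rewrite dE mulr0 mulr1 add0r.
move=> g1; split.
  by rewrite -[RHS]g1 -avgD//; congr avg; apply/funext => t; rewrite !zhat_vec3.
by rewrite -[RHS]g2 -avgB//; congr avg; apply/funext => t; rewrite !zhat_vec3.
Qed.

Lemma mean_entry (a h : 'cV[R]_n) (c : R) i : zhat (Pi a - c *: h) i 0 = zhat a i 0 - c * zhat h i 0.
Proof.
have -> : zhat (Pi a - c *: h) = zhat a - c *: zhat h by rewrite -scaleNr zhatD zhatZ /Pi zhat_vec3 scaleNr.
by move: (zhat a) (zhat h) => x y; rewrite !mxE.
Qed.

Lemma cah m i : continuous (fun t => zhat (hc m t) i 0).
Proof.
apply: is_derive_cont => t; rewrite (_ : (fun s => _) = fun s => hc m s (hidx k i) 0).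
  by apply: d1v_entry; exact: hcoef_derivable.
by apply/funext => s; rewrite zhatE.
Qed.

Lemma ckh m i : continuous (fun t => zhat (kc m t) i 0).
Proof.
apply: is_derive_cont => t; rewrite (_ : (fun s => _) = fun s => kc m s (hidx k i) 0).
  by apply: d1v_entry; exact: kcoef_derivable.
by apply/funext => s; rewrite zhatE.
Qed.

Lemma cF e (fs : fourier_sol D 3 e (lF e) (omF e) (etaF e) (fun t p => astar k p + Phi e t p)) i :
  continuous (fun t => zhat (aF 1%N t e) i 0) /\ continuous (fun t => zhat (bF 1%N t e) i 0).
Proof.
have [_ da] := a_per fs (isT : (1 < 4)%N); have [_ db] := b_per fs (isT : (0 < 1 < 4)%N).
split; apply: is_derive_cont => t.
  by rewrite (_ : (fun s => _) = fun s => aF 1%N s e (hidx k i) 0) //; apply/funext => s; rewrite zhatE.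
by rewrite (_ : (fun s => _) = fun s => bF 1%N s e (hidx k i) 0) //; apply/funext => s; rewrite zhatE.
Qed.

(** Subtracting eps^2 times the normal form system leaves growth + eps^2 beta_R and detuning + eps^2
    beta_I as secular terms; the phase conditions and the normalization of the coefficients of index
    1 make both means vanish. *)
Lemma step4_1 : [/\ Op 4 (fun e t => Pi (aF 1%N t e) - e ^+ 2 *: hc 1 t),
  Op 4 (fun e t => Pi (bF 1%N t e) - e ^+ 2 *: kc 1 t),
  Op 4 (fun e (_ : unit) => growth e + e ^+ 2 * bR) & Op 4 (fun e (_ : unit) => detuning e + e ^+ 2 * bI)].
Proof.
have [n1 n2] := nonres_om; have [h1 h2] := @rA_odd 1 isT isT.
apply: (@Op_res R k D aR0 aI0 hyp 4 (fun e t => Pi (aF 1%N t e) - e ^+ 2 *: hc 1 t)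
  (fun e t => Pi (bF 1%N t e) - e ^+ 2 *: kc 1 t) _ _ (fun e => growth e + e ^+ 2 * bR)
  (fun e => detuning e + e ^+ 2 * bI) n1 n2 _ (Op_Pi h1) (Op_Pi h2)).
move: (@branch_msys 1 isT) HF; apply: filterS2 => e M fs; rewrite mul1r in M.
have vE (x y x' y' c : R) : vec3 (cv2 (x + c * x') (y + c * y')) 0 0 =
    vec3 (cv2 x y) 0 0 + c *: vec3 (cv2 x' y') 0 0 :> 'cV[R]_n.
  by apply: vec3_eq; rewrite !zE ?scaler0 ?mulr0 ?addr0//; apply/matrixP => i j; rewrite !mxE; case: ifP.
split.
- have := msys_diff (e ^+ 2) (msys_Pi M) nf_msys1; congr (msys _ _ _ _ _ _); apply/funext => t.
    rewrite /forceA /= vE; move: (residA 1 e t) (vpc 1 (NJ t)) => x y.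
    rewrite !PiD Pi_vec3 PiN !PiZ; move: (vec3 _ 0 0) (vec3 _ 0 0) (Pi x) (Pi y) => v w {}x {}y.
    by apply/matrixP => i j; rewrite !mxE /cm /=; ring.
  rewrite /forceB /= (opprD (detuning e)) -(mulrN (e ^+ 2)) vE; move: (residB 1 e t) (vps 1 (NJ t)) => x y.
  rewrite !PiD Pi_vec3 PiN !PiZ; move: (vec3 _ 0 0) (vec3 _ 0 0) (Pi x) (Pi y) => v w {}x {}y.
  by apply/matrixP => i j; rewrite !mxE; ring.
- have [g1 _ _] := gamma_means fs; have [g1' _] := nf_mean1.
  rewrite (_ : (fun t => _) = fun t => (zhat (aF 1%N t e) 0 0 + zhat (bF 1%N t e) 1 0) -
     e ^+ 2 * (zhat (hc 1 t) 0 0 + zhat (kc 1 t) 1 0)); last first.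
    by apply/funext => t; rewrite !mean_entry; ring.
  rewrite avgB ?avgZ// ?g1 ?g1' ?mulr0 ?subr0//.
  + by apply: contD; [exact: cah|exact: ckh].
  + by apply: contD; [exact: (proj1 (@cF e fs _))|exact: (proj2 (@cF e fs _))].
  + by apply: contM; [exact: cont_cst|apply: contD; [exact: cah|exact: ckh]].
- have [_ g1 _] := gamma_means fs; have [_ g1'] := nf_mean1.
  rewrite (_ : (fun t => _) = fun t => (zhat (aF 1%N t e) 1 0 - zhat (bF 1%N t e) 0 0) -
     e ^+ 2 * (zhat (hc 1 t) 1 0 - zhat (kc 1 t) 0 0)); last first.
    by apply/funext => t; rewrite !mean_entry; ring.
  rewrite avgB ?avgZ// ?g1 ?g1' ?mulr0 ?subr0//.
  + by apply: contD; [exact: cah|apply: contN; exact: ckh].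
  + by apply: contD; [exact: (proj1 (@cF e fs _))|apply: contN; exact: (proj2 (@cF e fs _))].
  + by apply: contM; [exact: cont_cst|apply: contD; [exact: cah|apply: contN; exact: ckh]].
Qed.

(** * Passage from uniform orders to the asserted expansions *)

Lemma Op_div (Y : Type) (W : normedModType R) p q (f : R -> Y -> W) : Op (p + q) f ->
  Op p (fun e y => (e ^+ q)^-1 *: f e y).
Proof.
move=> [C C0 HC]; exists C => //; move: HC (near_ne0 R); apply: filterS2 => e HC e0 y.
rewrite normrZ normfV normrX ler_pdivrMl ?exprn_gt0 ?normr_gt0//.
rewrite (_ : `|e| ^+ q * _ = C * `|e| ^+ (p + q)) ?HC//; rewrite exprD; ring.
Qed.

Lemma Op_bigO (f : R -> R) p : Op p (fun e (_ : unit) => f e) -> f =O_ (0^') (fun e : R => e ^+ p).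
Proof.
move=> [C C0 HC]; apply/eqO_exP; exists (C + 1); first exact: ltr_wpDl.
apply: filterS HC => e HC; apply: le_trans (HC tt) _.
by rewrite normrX ler_wpM2r ?exprn_ge0// lerDl.
Qed.

Lemma Op_unif (W : normedModType R) (f : R -> R -> W) : Op 2 (fun e t => f t e) -> unif_O2 f.
Proof.
move=> [C C0 HC]; exists C; apply: filterS HC => e HC t.
by have := HC t; rewrite real_normK// num_real.
Qed.

Lemma Op_blocks q (f : R -> R -> 'cV[R]_n) : Op q f ->
  [/\ Op q (fun e t => zhat (f e t)), Op q (fun e t => ztil (f e t)) & Op q (fun e t => zring (f e t))].
Proof.
move=> [C C0 HC]; split; exists C => //; apply: filterS HC => e HC t; apply: le_trans (HC t);
  have [h1 h2 h3] := blocks_norm (lexx `|f e t|).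
- by apply: mxnorm_le => // i j; rewrite ord1.
- by apply: mxnorm_le => // i j; rewrite ord1.
- by [].
Qed.

Lemma Op_lam2 : Op 4 (fun e (_ : unit) => (lF e - ls) ^+ 2).
Proof. by have [h _] := Op2_lam; exact: (Op_mulr h h). Qed.

Lemma Op_taylor (g : R -> R) (a C : R) : 0 <= C ->
  (forall l, `|l - ls| <= r / 2 -> `|g l - a * (l - ls)| <= C * `|l - ls| ^+ 2) ->
  Op 4 (fun e (_ : unit) => g (lF e) - a * (lF e - ls)).
Proof.
move=> C0 HC; apply: (Op_dom C0 Op_lam2).
apply: filterS (near_lam_le r2_gt0) => e lr B QB y.
by apply: le_trans (HC _ lr) _; rewrite ler_wpM2l// -normrX; exact: QB.
Qed.

(** Since lambda - lambda* is O(eps^2), its square is O(eps^4) and growth may be replaced by its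
    linear part in growth + eps^2 beta_R = O(eps^4); division by eps^2 finishes. *)
Lemma betaR_bigO : (fun e : R => bR - (- derive1 (ns_aR D) ls * ((lF e - ls) / e ^+ 2)))
  =O_ (0^') (fun e : R => e ^+ 2).
Proof.
have [C C0 HC] := aR_taylor; have h := Op_taylor C0 HC; have [_ _ h' _] := step4_1.
apply: Op_bigO; have := @Op_div _ _ 2 2 _ (Op_sub h' h).
move: (near_ne0 R) => e0; apply: Op_eq; apply: filterS e0 => e e0 _.
by rewrite /growth -[LHS]/((e ^+ 2)^-1 * _); field.
Qed.

Lemma betaI_bigO : (fun e : R => bI - ((omF e - om) / e ^+ 2
    - derive1 (ns_aI D) ls * ((lF e - ls) / e ^+ 2))) =O_ (0^') (fun e : R => e ^+ 2).
Proof.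
have [C C0 HC] := aI_taylor; have h := @Op_taylor (fun l => ns_aI D l - om) _ C C0 HC; have [_ _ _ h'] := step4_1.
apply: Op_bigO; have := @Op_div _ _ 2 2 _ (Op_sub h' h).
move: (near_ne0 R) => e0; apply: Op_eq; apply: filterS e0 => e e0 _.
by rewrite /detuning -[LHS]/((e ^+ 2)^-1 * _); field.
Qed.

Lemma kappa_bigO : (fun e : R => ka - etaF e / e) =O_ (0^') (fun e : R => e ^+ 2).
Proof.
have [_ h] := step3_0.
apply: Op_bigO; have := Op_opp (@Op_div _ _ 2 1 _ h).
move: (near_ne0 R) => e0; apply: Op_eq; apply: filterS e0 => e e0 _.
by rewrite -[LHS]/(- ((e ^+ 1)^-1 * _)) expr1; field.
Qed.

Lemma coef_unif (x y : R -> R -> 'cV[R]_n) : Op 3 (fun e t => x t e - e *: y t ls) ->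
  [/\ unif_O2 (fun t e => zhat (y t ls) - e^-1 *: zhat (x t e)),
      unif_O2 (fun t e => ztil (y t ls) - e^-1 *: ztil (x t e))
    & unif_O2 (fun t e => zring (y t ls) - e^-1 * zring (x t e))].
Proof.
move=> h; have h' : Op 2 (fun e t => y t ls - e^-1 *: x t e).
  have := Op_opp (@Op_div _ _ 2 1 _ h); move: (near_ne0 R) => e0; apply: Op_eq; apply: filterS e0 => e e0 t.
  by rewrite expr1 scalerBr scalerA mulVf// scale1r opprB.
have [h1 h2 h3] := Op_blocks h'.
split; apply: Op_unif; [move: h1|move: h2|move: h3]; apply: Op_eq; near=> e => t.
- by rewrite -scaleNr zhatD zhatZ scaleNr.
- by rewrite -scaleNr ztilD ztilZ scaleNr.
- by rewrite -scaleNr zringD zringZ mulNr.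
Unshelve. all: by end_near. Qed.

Lemma hat_unif (x : R -> R -> 'cV[R]_n) (y : R -> R -> 'cV[R]_2) :
  Op 4 (fun e t => Pi (x t e) - e ^+ 2 *: vec3 (y t ls) 0 0) ->
  unif_O2 (fun t e => y t ls - (e ^+ 2)^-1 *: zhat (x t e)).
Proof.
move=> h; have [h1 _ _] := Op_blocks h; apply: Op_unif.
have := Op_opp (@Op_div _ _ 2 2 _ h1); move: (near_ne0 R) => e0; apply: Op_eq; apply: filterS e0 => e e0 t.
have -> : zhat (Pi (x t e) - e ^+ 2 *: vec3 (y t ls) 0 0) = zhat (x t e) - e ^+ 2 *: y t ls.
  by rewrite -scaleNr zhatD zhatZ /Pi !zhat_vec3 scaleNr.
by rewrite scalerBr scalerA mulVf ?expf_neq0// scale1r opprB.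
Qed.

Lemma branch_expansion :
  [/\ [/\ (fun e : R => nf_betaR nf ls
             - (- derive1 (ns_aR D) ls * ((lF e - ls) / e ^+ 2)))
          =O_ (0^') (fun e : R => e ^+ 2),
          (fun e : R => nf_betaI nf ls
             - ((omF e - ns_om D) / e ^+ 2
                - derive1 (ns_aI D) ls * ((lF e - ls) / e ^+ 2)))
          =O_ (0^') (fun e : R => e ^+ 2)
        & (fun e : R => nf_kappa nf ls - etaF e / e)
          =O_ (0^') (fun e : R => e ^+ 2)],
      (forall m : nat, m \in [:: 0%N; 2%N] ->
        [/\ unif_O2 (fun t e => nf_ahat nf m t ls - e^-1 *: zhat (aF m t e)),
            unif_O2 (fun t e => nf_atil nf m t ls - e^-1 *: ztil (aF m t e))
          & unif_O2 (fun t e => nf_aring nf m t ls - e^-1 * zring (aF m t e))]),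
      [/\ unif_O2 (fun t e => nf_bhat nf 2 t ls - e^-1 *: zhat (bF 2%N t e)),
          unif_O2 (fun t e => nf_btil nf 2 t ls - e^-1 *: ztil (bF 2%N t e))
        & unif_O2 (fun t e => nf_bring nf 2 t ls - e^-1 * zring (bF 2%N t e))]
    & (forall m : nat, m \in [:: 1%N; 3%N] ->
        unif_O2 (fun t e => nf_ahat nf m t ls - (e ^+ 2)^-1 *: zhat (aF m t e)) /\
        unif_O2 (fun t e => nf_bhat nf m t ls - (e ^+ 2)^-1 *: zhat (bF m t e)))].
Proof.
have U (x : R -> R -> 'cV[R]_n) (y : R -> R -> 'cV[R]_2) (y' : R -> R -> 'cV[R]_k) (y'' : R -> R -> R) :
    Op 3 (fun e t => x t e - e *: vec3 (y t ls) (y' t ls) (y'' t ls)) ->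
    [/\ unif_O2 (fun t e => y t ls - e^-1 *: zhat (x t e)),
      unif_O2 (fun t e => y' t ls - e^-1 *: ztil (x t e))
    & unif_O2 (fun t e => y'' t ls - e^-1 * zring (x t e))].
  move=> h; have := @coef_unif x (fun t l => vec3 (y t l) (y' t l) (y'' t l)) h.
  under eq_fun do rewrite zhat_vec3.
  under [in X in [/\ _, X & _]]eq_fun do rewrite ztil_vec3.
  by under [in X in [/\ _, _ & X]]eq_fun do rewrite zring_vec3.
have [s3a s3b] := step3_2; have [s30 _] := step3_0; have [s1a s1b _ _] := step4_1; have [s4a s4b] := step4_3.
split; [by split; [exact: betaR_bigO|exact: betaI_bigO|exact: kappa_bigO]| | |].
- by move=> m; rewrite !inE => /orP[]/eqP->; exact: U.
- exact: (U _ (nf_bhat nf 2) (nf_btil nf 2) (nf_bring nf 2) s3b).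
by move=> m; rewrite !inE => /orP[]/eqP->; split; exact: hat_unif.
Qed.

End Branch.
Theorem theorem5p3 (R : realType) (k : nat) (D : ns_data R k)
    (nf : nf_data R k)
    (lF omF etaF : R -> R)
    (aF bF : nat -> R -> R -> 'cV[R]_(2 + k + 1)) :
  let ls := ns_lam D in
  ns_setting D ->
  (\forall l \near ls, normal_form_at D nf l) ->
  local_branch D 3 lF omF etaF
    (fun e t p => astar k p +
       phi_poly 3 (fun m s => aF m s e) (fun m s => bF m s e) t p) ->
  [/\ [/\ (fun e : R => nf_betaR nf ls
             - (- derive1 (ns_aR D) ls * ((lF e - ls) / e ^+ 2)))
          =O_ (0^') (fun e : R => e ^+ 2),
          (fun e : R => nf_betaI nf ls
             - ((omF e - ns_om D) / e ^+ 2
                - derive1 (ns_aI D) ls * ((lF e - ls) / e ^+ 2)))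
          =O_ (0^') (fun e : R => e ^+ 2)
        & (fun e : R => nf_kappa nf ls - etaF e / e)
          =O_ (0^') (fun e : R => e ^+ 2)],
      (forall m : nat, m \in [:: 0%N; 2%N] ->
        [/\ unif_O2 (fun t e => nf_ahat nf m t ls - e^-1 *: zhat (aF m t e)),
            unif_O2 (fun t e => nf_atil nf m t ls - e^-1 *: ztil (aF m t e))
          & unif_O2 (fun t e => nf_aring nf m t ls - e^-1 * zring (aF m t e))]),
      [/\ unif_O2 (fun t e => nf_bhat nf 2 t ls - e^-1 *: zhat (bF 2%N t e)),
          unif_O2 (fun t e => nf_btil nf 2 t ls - e^-1 *: ztil (bF 2%N t e))
        & unif_O2 (fun t e => nf_bring nf 2 t ls - e^-1 * zring (bF 2%N t e))]
    & (forall m : nat, m \in [:: 1%N; 3%N] ->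
        unif_O2 (fun t e => nf_ahat nf m t ls - (e ^+ 2)^-1 *: zhat (aF m t e)) /\
        unif_O2 (fun t e => nf_bhat nf m t ls - (e ^+ 2)^-1 *: zhat (bF m t e)))].
Proof.
move=> ls [smF [r r0 ct] _ aR0 aI0 om01 hyp _ tr r3 r4] /nbhs_singleton nfls [r1 r10 HB].
have Hnear d : 0 < d -> \forall e \near 0^', near_base D d (lF e) (omF e) (etaF e)
    (fun t p => astar k p + phi_poly 3 (fun m s => aF m s e) (fun m s => bF m s e) t p).
  move=> d0.
  (* The radius is capped at [r1], up to which [local_branch] describes the branch. *)
  have m0 : 0 < Num.min d r1 <= r1 by rewrite lt_min d0 r10 ge_min lexx orbT.
  apply: filterS (HB _ m0) => e [[h1 h2 h3 h4] _ _].
  have le : Num.min d r1 <= d by rewrite ge_min lexx.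
  split; [exact: lt_le_trans le|exact: lt_le_trans le|exact: lt_le_trans le|].
  by move=> t p; exact: lt_le_trans (h4 t p) le.
have HF : \forall e \near 0^', fourier_sol D 3 e (lF e) (omF e) (etaF e)
    (fun t p => astar k p + phi_poly 3 (fun m s => aF m s e) (fun m s => bF m s e) t p).
  have m0 : 0 < r1 <= r1 by rewrite r10 lexx.
  by apply: filterS (HB _ m0) => e [].
exact: (branch_expansion smF r0 ct aR0 aI0 hyp om01 r3 r4 tr HF Hnear nfls).
Qed.
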